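(* Let $M$ be a linear Fourier multiplier satisfying Assumption (M) and let $N$ be a bilinear Fourier multiplier satisfying Assumption (N) or Assumption (N* ), as written out in the context. Then for every $\mu>0$ there is a solution $u\in H^{\infty}(\mathbb{R})$, with a corresponding wave speed $\nu\in\mathbb{R}$, of the solitary-wave equation $$-\nu u+Mu-N(u,u)=0,$$ satisfying $\frac12\|u\|_{L^2}^2=\mu$. The wave speed is subcritical, $\nu<m(0)$. Moreover, for any fixed $\mu_0>0$, the estimates (i) $\|u\|_{L^\infty}\lesssim \|u\|_{H^{s/2}}\simeq \mu^{1/2}$, (ii) $m(0)-\nu\simeq \mu^{\beta}$, where $\beta=\frac{s'}{2s'-1}>\frac12$, hold uniformly for $0<\mu<\mu_0$ (the implicit constants may depend on $\mu_0$ and on $M,N$, but not on $\mu\in(0,\mu_0)$).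
   Context: Notation: $a\lesssim b$ means $a\le Cb$ for a constant $C>0$; $a\simeq b$ means $a\lesssim b\lesssim a$; $\langle\xi\rangle=(1+\xi^2)^{1/2}$. The Fourier transform is $\hat f(\xi)=(2\pi)^{-1/2}\int_{\mathbb{R}}f(x)e^{-i\xi x}\,dx$. $H^t(\mathbb{R})$ is the $L^2$-based Sobolev space with norm $\|\langle\cdot\rangle^t\hat f\|_{L^2}$, and $H^\infty(\mathbb{R})=\bigcap_{t\in\mathbb{R}}H^t(\mathbb{R})$. Functions $u$ are real-valued. The operators are $\widehat{Mu}(\xi)=m(\xi)\hat u(\xi)$ and $\widehat{N(u,v)}(\xi)=\int_{\mathbb{R}}n(\xi-\eta,\eta)\hat u(\xi-\eta)\hat v(\eta)\,d\eta$. The cyclic sum of a function $f$ of three variables is $\sum_{cyc}f(-\xi,\xi-\eta,\eta)=f(-\xi,\xi-\eta,\eta)+f(\xi-\eta,\eta,-\xi)+f(\eta,-\xi,\xi-\eta)$. Assumption (M): $m\in C^1(\mathbb{R})$ is non-negative, real-valued and even, with $m(\xi)-m(0)\simeq|\xi|^s$ for $|\xi|\ge1$, $m(\xi)-m(0)\simeq|\xi|^{s'}$ for $|\xi|<1$, and $|m'(\xi)|\lesssim\langle\xi\rangle^{s-1}$ for $\xi\in\mathbb{R}$, where $s>0$ and $s'>\frac12$. Assumption (N): $n\in C^1(\mathbb{R}^2)$ has the form $n(\xi-\eta,\eta)=\sum_{cyc}n_1(-\xi)n_2(\xi-\eta)n_3(\eta)$ and is even, i.e. invariant under $(\xi,\eta)\mapsto(-\xi,-\eta)$.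 The functions $n_i$ are real-valued with $|n_i(\xi)|\lesssim\langle\xi\rangle^{r_i}$ and $|n_i'(\xi)|\lesssim\langle\xi\rangle^{r_i-1}$ for $\xi\in\mathbb{R}$, and $n_i(0)\gtrsim1$ (i.e. $n_i(0)>0$), where each $r_i<\frac s2$, $\sum_{i=1}^3r_i<s-\frac12$, and $r_i+r_j<\frac{3s-1}{2}$ for $i\ne j$. Assumption (N* ): $n\in C^\infty(\mathbb{R}^2)$ is real-valued of the form $n(\xi-\eta,\eta)=\sum_{cyc}f(-\xi,\xi-\eta,\eta)$, where $f$ is even in $(\xi,\eta)$ and satisfies $|\partial^\alpha_{(\xi,\eta)}f(-\xi,\xi-\eta,\eta)|\lesssim\langle\xi\rangle^{r_1}\langle\xi-\eta\rangle^{r_2}\langle\eta\rangle^{r_3}$ for all $\xi,\eta\in\mathbb{R}$ and $\alpha\in\mathbb{N}_0^2$, and $f(0,0,0)\gtrsim1$ (i.e. $f(0,0,0)>0$), where each $r_i\le\frac s2-\frac14$, $\sum_{i=1}^3r_i<s-\frac54$, and $r_i+r_j<\frac{3s}{2}-1$ for $i\ne j$. *)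

(* Defs.v *)
From HB Require Import structures.
From mathcomp Require Import all_boot all_order all_algebra.
From mathcomp Require Import complex.
From mathcomp Require Import all_classical all_reals all_analysis.

Set Implicit Arguments.
Unset Strict Implicit.
Unset Printing Implicit Defensive.

Import Order.TTheory GRing.Theory Num.Theory.
Import numFieldNormedType.Exports.

Local Open Scope classical_set_scope.
Local Open Scope complex_scope.
Local Open Scope ring_scope.

Definition lesssim (R : realType) (T : Type) (D : set T) (f g : T -> R) : Prop :=
  exists2 C : R, 0 < C & forall x, D x -> f x <= C * g x.

Definition simeq (R : realType) (T : Type) (D : set T) (f g : T -> R) : Prop :=
  lesssim D f g /\ lesssim D g f.

Definition lesssime (R : realType) (T : Type) (D : set T) (f g : T -> \bar R) :
    Prop :=
  exists2 C : R, 0 < C & forall x, D x -> (f x <= C%:E * g x)%E.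

Definition simeqe (R : realType) (T : Type) (D : set T) (f g : T -> \bar R) :
    Prop :=
  lesssime D f g /\ lesssime D g f.

Definition japanese (R : realType) (xi : R) : R := Num.sqrt (1 + xi ^+ 2).

Definition C1 (R : realType) (f : R -> R) : Prop :=
  (forall x, derivable f x 1) /\ continuous (derive1 f).

Definition partial1 (R : realType) (F : R * R -> R) : R * R -> R :=
  fun p => 'D_((1, 0) : R * R) F p.

Definition partial2 (R : realType) (F : R * R -> R) : R * R -> R :=
  fun p => 'D_((0, 1) : R * R) F p.

(* C^k on the plane: all iterated partial derivatives of order at most k, in any
   order of the two variables, exist and those of order k are continuous. *)
Fixpoint Ck2 (R : realType) (k : nat) (F : R * R -> R) : Prop :=
  if k is k'.+1 then
    [/\ forall p, derivable F p (1, 0), forall p, derivable F p (0, 1),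
        Ck2 k' (partial1 F) & Ck2 k' (partial2 F)]
  else continuous F.

Definition Cinfty2 (R : realType) (F : R * R -> R) : Prop :=
  forall k, Ck2 k F.

(* On complex-valued functions the library has neither measurability nor
   integration; both are taken on real and imaginary parts. *)
Definition cintegral (R : realType) (D : set R) (f : R -> R[i]) : R[i] :=
  (\int[lebesgue_measure]_(x in D) complex.Re (f x))%R +i*
  (\int[lebesgue_measure]_(x in D) complex.Im (f x))%R.

Definition L2 (R : realType) (u : R -> R) : Prop :=
  u \in Lfun lebesgue_measure 2%:E.

Definition cL2 (R : realType) (g : R -> R[i]) : Prop :=
  L2 (fun x => complex.Re (g x)) /\ L2 (fun x => complex.Im (g x)).

Definition cis (R : realType) (t : R) : R[i] := cos t +i* sin t.

Definition truncated_fourier (R : realType) (A : R) (u : R -> R) (xi : R) :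
    R[i] :=
  ((Num.sqrt (2 * pi))^-1)%:C *
  cintegral `[- A, A] (fun x => (u x)%:C * cis (- (xi * x))).

(* Plancherel's extension of the Fourier integral: on L^2, the transform is the
   L^2-limit of the integrals over [-A, A] as A tends to infinity. *)
Definition is_fourier (R : realType) (u : R -> R) (g : R -> R[i]) : Prop :=
  cL2 g /\
  (\int[lebesgue_measure]_xi
     ((Normc.normc (g xi - truncated_fourier A u xi)) ^+ 2)%:E)%E
    @[A --> +oo%R] --> 0%E.

(* A representative, determined up to a null set when u is in L^2. *)
Definition fourier (R : realType) (u : R -> R) : R -> R[i] :=
  xget (cst 0) [set g | is_fourier u g].

Definition Hnorm (R : realType) (t : R) (u : R -> R) : \bar R :=
  ('N[lebesgue_measure]_2%:E
    [EFin \o (fun xi => japanese xi `^ t * Normc.normc (fourier u xi))%R])%E.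

(* For t < 0 this is only the part of H^t consisting of L^2 functions, which
   is all that matters for the intersection over t. *)
Definition Hs (R : realType) (t : R) (u : R -> R) : Prop :=
  L2 u /\ (Hnorm t u < +oo)%E.

Definition Hinfty (R : realType) (u : R -> R) : Prop :=
  forall t : R, Hs t u.

(* Multipliers are given as relations: "Mu is a (real-valued, L^2) function whose
   Fourier transform is m times that of u". Plancherel makes Mu unique up to a
   null set, and no default value is introduced when there is none. *)
Definition is_linear_multiplier (R : realType) (m : R -> R) (u Mu : R -> R) :
    Prop :=
  L2 Mu /\
  {ae lebesgue_measure, forall xi, fourier Mu xi = (m xi)%:C * fourier u xi}.

Definition is_bilinear_multiplier (R : realType) (n : R * R -> R)
    (u v Nuv : R -> R) : Prop :=
  L2 Nuv /\
  {ae lebesgue_measure, forall xi, fourier Nuv xi =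
     cintegral setT (fun eta =>
       (n (xi - eta, eta))%:C * fourier u (xi - eta) * fourier v eta)}.

Definition solitary_wave (R : realType) (m : R -> R) (n : R * R -> R) (nu : R)
    (u : R -> R) : Prop :=
  exists Mu Nuu : R -> R,
    [/\ is_linear_multiplier m u Mu,
        is_bilinear_multiplier n u u Nuu &
        {ae lebesgue_measure, forall x, - nu * u x + Mu x - Nuu x = 0}].

Definition cyc (R : realType) (f : R -> R -> R -> R) (a b c : R) : R :=
  f a b c + f b c a + f c a b.

Record assumptionM (R : realType) (s s' : R) (m : R -> R) : Prop := {
  M_s_gt0 : 0 < s ;
  M_s'_gt : 1 / 2 < s' ;
  M_C1 : C1 m ;
  M_ge0 : forall xi, 0 <= m xi ;
  M_even : forall xi, m (- xi) = m xi ;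
  M_high : simeq [set xi | 1 <= `|xi|]
    (fun xi => m xi - m 0) (fun xi => `|xi| `^ s) ;
  M_low : simeq [set xi | `|xi| < 1]
    (fun xi => m xi - m 0) (fun xi => `|xi| `^ s') ;
  M_deriv : lesssim setT
    (fun xi => `|derive1 m xi|) (fun xi => japanese xi `^ (s - 1)) }.

Record symbol_factor (R : realType) (r : R) (g : R -> R) : Prop := {
  factor_derivable : forall xi, derivable g xi 1 ;
  factor_bound : lesssim setT
    (fun xi => `|g xi|) (fun xi => japanese xi `^ r) ;
  factor_deriv_bound : lesssim setT
    (fun xi => `|derive1 g xi|) (fun xi => japanese xi `^ (r - 1)) ;
  factor_gt0 : 0 < g 0 }.

Definition assumptionN (R : realType) (s : R) (n : R * R -> R) : Prop :=
  exists (r1 r2 r3 : R) (n1 n2 n3 : R -> R),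
    [/\ Ck2 1 n,
        forall xi eta, n (xi - eta, eta) =
          cyc (fun a b c => n1 a * n2 b * n3 c) (- xi) (xi - eta) eta &
        forall a b, n (- a, - b) = n (a, b)] /\
    [/\ symbol_factor r1 n1, symbol_factor r2 n2 & symbol_factor r3 n3] /\
    [/\ r1 < s / 2, r2 < s / 2 & r3 < s / 2] /\
    r1 + r2 + r3 < s - 1 / 2 /\
    [/\ r1 + r2 < (3 * s - 1) / 2, r1 + r3 < (3 * s - 1) / 2 &
        r2 + r3 < (3 * s - 1) / 2].

(* (xi, eta) |-> f (- xi, xi - eta, eta) *)
Definition on_plane (R : realType) (f : R -> R -> R -> R) : R * R -> R :=
  fun p => f (- p.1) (p.1 - p.2) p.2.

Definition assumptionNstar (R : realType) (s : R) (n : R * R -> R) : Prop :=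
  exists (r1 r2 r3 : R) (f : R -> R -> R -> R),
    [/\ Cinfty2 n,
        forall xi eta, n (xi - eta, eta) = cyc f (- xi) (xi - eta) eta &
        forall xi eta, on_plane f (- xi, - eta) = on_plane f (xi, eta)] /\
    [/\ Cinfty2 (on_plane f),
        forall a b : nat, lesssim setT
          (fun p => `|iter a (@partial1 R) (iter b (@partial2 R) (on_plane f)) p|)
          (fun p => japanese p.1 `^ r1 * japanese (p.1 - p.2) `^ r2 *
                    japanese p.2 `^ r3) &
        0 < f 0 0 0] /\
    [/\ r1 <= s / 2 - 1 / 4, r2 <= s / 2 - 1 / 4 & r3 <= s / 2 - 1 / 4] /\
    r1 + r2 + r3 < s - 5 / 4 /\
    [/\ r1 + r2 < 3 * s / 2 - 1, r1 + r3 < 3 * s / 2 - 1 &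
        r2 + r3 < 3 * s / 2 - 1].

(* Main.v *)
Require Import Defs.
From HB Require Import structures.
From mathcomp Require Import all_boot all_order all_algebra.
From mathcomp Require Import complex ring lra.
From mathcomp Require Import all_classical all_reals all_analysis.
From mathcomp Require Import measurable_realfun ess_sup_inf.
Set Implicit Arguments.
Unset Strict Implicit.
Unset Printing Implicit Defensive.
Import Order.TTheory GRing.Theory Num.Theory.
Import numFieldNormedType.Exports.
Local Open Scope classical_set_scope.
Local Open Scope ring_scope.

(** The equation is solved on the Fourier side. A real function u is encoded by
    its Hartley transform h, a real function with hat u = ev h + i od h, called
    its profile here. With mt = m - m(0), profiles carry the mass, the integral
    of h^2, the dispersion Q, the integral of mt h^2, and the cubic form T, the
    integral of u N(u, u). The wave is a minimizer of the energy Q / 2 - T / 3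
    among profiles of mass 2 mu. Its Euler-Lagrange equation
    mt h + kappa h = (bilinear term), with kappa times the mass equal to T - Q,
    is the solitary-wave equation with nu = m(0) - kappa.

    Both sets of assumptions enter through the same few facts [symbols]: m - m(0)
    grows like |x|^s and starts like |x|^s', n is continuous, even, invariant
    under cyclic permutation of its three frequencies a + b + c = 0, positive at
    the origin, and bounded by products of powers whose exponents are smaller
    than s / 2 and add up to less than s - 1 / 2. A product of decreasing
    functions of |a|, |b|, |c| is largest at the smallest of the three, so n is
    dominated by a product of weights (t + mt)^(1/2) times one square-integrable
    function of a single frequency [symbol_energy_dominated]. This bounds T by
    the energy norm, with a power of t that makes the energy coercive at fixed
    mass [cubic_growth], and it leaves room for a small power of the frequency,
    which makes high frequencies negligible [cubic_truncation].

    A minimizer exists [minimizer_exists] for the following reason. The least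
    energy is negative, because spreading little mass over low frequencies costs
    little dispersion, and so T stays away from 0 along a minimizing sequence.
    If every translate of a profile were nearly orthogonal to finitely many test
    profiles, then T would be small: on a bounded set of frequencies n is
    approximated by step functions, and a convolution is bounded on L2 by the
    supremum of the transform of its kernel, by Plancherel
    [profile_nonvanishing]. So suitable translates have a nonzero weak limit.
    The quadratic forms split along the limit and the remainder, and so does T
    because it is weakly continuous as soon as one of its arguments is fixed
    [profile_compact]. Scaling shows that the least energy is strictly
    subadditive in the mass: quadratic terms scale by the square and T by the
    cube. Hence no mass is lost and the limit is a minimizer.

    For the estimates, concentrating the mass M on |x| <= d with d of order
    M^(1/(2 s' - 1)) gives energy at most - c M^(1 + beta) [negative_energy].
    Conversely Q < T and the low-frequency bound on T force Q / M, and then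
    T / M, to be at most of order M^beta; together this is the size of kappa
    [kappa_bounds]. Regularity follows by testing the equation with weighted
    copies of h, each step gaining a fixed power of the frequency because of the
    room left in the domination of n [profile_regularity]. It makes every
    weighted norm of h, in particular the integral of |h|, at most a multiple of
    the energy norm, which bounds u uniformly.

    Finally the variational equation holds pointwise [profile_spectral], and the
    Plancherel identity [plancherel], proved by exponential damping, identifies
    the transform of u with ev h + i od h [fourier_hart]. This carries the
    equation and all norms back to u [solitary_wave_hart, Hnorm_hart]. *)

(** * Integrals of real-valued functions *)

Notation itg m f := (m.-integrable [set: _] (EFin \o f)).
Notation mea f := (measurable_fun [set: _] f).

Lemma oppeK_fun (R : realType) (u : nat -> \bar R) : (-%E \o (-%E \o u)) = u.
Proof. by apply/funext => k /=; rewrite oppeK. Qed.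

Section real_integral.
Context d (T : measurableType d) (R : realType).
Variable m : {measure set T -> \bar R}.
Local Notation "'I' f" := (Rintegral m [set: T] f) (at level 10, f at level 8).
Implicit Types (f g : T -> R) (a : R).

Lemma itg_mea f : itg m f -> mea f.
Proof. by move=> /integrableP[/measurable_EFinP]. Qed.

Lemma eq_itg f g : f =1 g -> itg m f -> itg m g.
Proof. by move=> /funext ->. Qed.

Lemma itgD f g : itg m f -> itg m g -> itg m (fun x => f x + g x).
Proof. by move=> fi gi; exact: (integrableD measurableT fi gi). Qed.

Lemma itgZ a f : itg m f -> itg m (fun x => a * f x).
Proof. by move=> fi; exact: (integrableZl measurableT a fi). Qed.

Lemma itgN f : itg m f -> itg m (fun x => - f x).
Proof. by move=> fi; apply: eq_itg (itgZ (-1) fi) => x; rewrite mulN1r. Qed.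

Lemma itgB f g : itg m f -> itg m g -> itg m (fun x => f x - g x).
Proof. by move=> fi gi; apply: itgD => //; exact: itgN. Qed.

Lemma itg_le f g : mea f -> (forall x, `|f x| <= g x) -> itg m g -> itg m f.
Proof.
move=> mf fg; apply: le_integrable => //; first exact/measurable_EFinP.
by move=> x _ /=; rewrite lee_fin (le_trans (fg x))// ler_norm.
Qed.

Lemma itg_abs f : itg m f -> itg m (fun x => `|f x|).
Proof. exact: integrable_norm. Qed.

Lemma itg_fin f : mea f -> (\int[m]_x `|f x|%:E < +oo)%E -> itg m f.
Proof. by move=> mf h; apply/integrableP; split => //; exact/measurable_EFinP. Qed.

Lemma itg_sum (J : Type) (s : seq J) (F : J -> T -> R) :
  (forall j, itg m (F j)) -> itg m (fun x => \sum_(j <- s) F j x).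
Proof.
move=> h; elim: s => [|j s ih].
  by under eq_fun do rewrite big_nil; exact: (integrable0 m).
by apply: eq_itg (itgD (h j) ih) => x; rewrite big_cons.
Qed.

Lemma eqI f g : f =1 g -> I f = I g.
Proof. by move=> /funext ->. Qed.

Lemma IE f : itg m f -> ((I f)%:E = \int[m]_x (f x)%:E)%E.
Proof. by move=> fi; rewrite fineK //; exact: integrable_fin_num. Qed.

Lemma ID f g : itg m f -> itg m g -> I (fun x => f x + g x) = I f + I g.
Proof. exact: RintegralD. Qed.

Lemma IZ a f : itg m f -> I (fun x => a * f x) = a * I f.
Proof. by move=> fi; rewrite RintegralZl. Qed.

Lemma IN f : itg m f -> I (fun x => - f x) = - I f.
Proof. by move=> fi; rewrite -mulN1r -IZ//; apply: eqI => x; rewrite mulN1r. Qed.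

Lemma IB f g : itg m f -> itg m g -> I (fun x => f x - g x) = I f - I g.
Proof. by move=> fi gi; rewrite RintegralB. Qed.

Lemma I_sum (J : Type) (s : seq J) (F : J -> T -> R) :
  (forall j, itg m (F j)) -> I (fun x => \sum_(j <- s) F j x) = \sum_(j <- s) I (F j).
Proof.
move=> h; elim: s => [|j s ih].
  rewrite big_nil; under [LHS]eqI => x do rewrite big_nil.
  by rewrite Rintegral_cst// mul0r.
rewrite big_cons -ih -ID//; last exact: itg_sum.
by apply: eqI => x; rewrite big_cons.
Qed.

Lemma I_le f g : itg m f -> itg m g -> (forall x, f x <= g x) -> I f <= I g.
Proof. by move=> fi gi h; apply: le_Rintegral. Qed.

Lemma I_ge0 f : (forall x, 0 <= f x) -> 0 <= I f.
Proof. by move=> h; apply: Rintegral_ge0. Qed.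

Lemma I_abs f : itg m f -> `|I f| <= I (fun x => `|f x|).
Proof. by move=> fi; apply: le_normr_Rintegral. Qed.

Lemma I_abs_le f g : mea f -> itg m g -> (forall x, `|f x| <= g x) -> `|I f| <= I g.
Proof.
move=> mf gi fg; have fi := itg_le mf fg gi.
by apply: le_trans (I_abs fi) _; apply: I_le => //; exact: itg_abs.
Qed.

Lemma I_eq0_ae f : mea f -> (forall x, 0 <= f x) -> itg m f -> I f = 0 ->
  {ae m, forall x, f x = 0}.
Proof.
move=> mf f0 fi If0.
have : (\int[m]_(x in [set: T]) `|(f x)%:E| = 0)%E.
  under eq_integral do rewrite gee0_abs ?lee_fin//.
  by rewrite -IE// If0.
move=> /(ae_eq_integral_abs m measurableT (proj2 (measurable_EFinP _ _) mf)).
by apply: filterS => x /(_ Logic.I) [].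
Qed.

Lemma I_ae f g : mea f -> mea g -> {ae m, forall x, f x = g x} -> I f = I g.
Proof.
move=> mf mg h; congr fine; apply: ae_eq_integral => //.
- exact/measurable_EFinP.
- exact/measurable_EFinP.
- by apply: filterS h => x /= -> _.
Qed.

Lemma itg_ae f g : mea g -> {ae m, forall x, f x = g x} -> itg m f -> itg m g.
Proof.
move=> mg h fi; apply: itg_fin => //.
case/integrableP: (fi) => mf; apply: le_lt_trans.
rewrite le_eqVlt; apply/orP; left; apply/eqP; apply: ae_eq_integral => //.
- by apply/measurable_EFinP/measurableT_comp.
- exact: measurableT_comp.
- by apply: filterS h => x /= -> _.
Qed.

Lemma itg_fine (F : T -> \bar R) : m.-integrable setT F ->
  itg m (fun x => fine (F x)) /\ I (fun x => fine (F x)) = fine (\int[m]_x F x)%E.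
Proof.
move=> Fi; have mF := measurable_int _ Fi.
have mfF : mea (fun x => fine (F x)).
  exact: (measurableT_comp (fine_measurable measurableT) mF).
have aeF : {ae m, forall x, setT x -> (fine (F x))%:E = F x}.
  by apply: filterS (integrable_ae measurableT Fi) => x /(_ Logic.I) h _; rewrite fineK.
split; last first.
  by congr fine; apply: ae_eq_integral => //; exact/measurable_EFinP.
apply: itg_fin => //.
case/integrableP: (Fi) => _; apply: le_lt_trans.
rewrite le_eqVlt; apply/orP; left; apply/eqP; apply: ae_eq_integral => //.
- by apply/measurable_EFinP; exact: measurableT_comp.
- exact: measurableT_comp.
- by apply: filterS aeF => x h /h /= <-.
Qed.

Lemma dct (F : nat -> T -> R) f g :
  (forall k, mea (F k)) -> mea f -> itg m g -> (forall k x, `|F k x| <= g x) ->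
  {ae m, forall x, (F k x @[k --> \oo] --> f x)} ->
  [/\ itg m f & (I (F k) @[k --> \oo] --> I f)].
Proof.
move=> mF mf gi Fg cF.
have [||||fi _ c] := @dominated_convergence _ T R m setT measurableT
  (fun k x => (F k x)%:E) (EFin \o f) (EFin \o g) _ _ _ gi.
- by move=> k; exact/measurable_EFinP.
- exact/measurable_EFinP.
- apply: filterS cF => x h _; exact: cvg_comp h _.
- by apply: aeW => x k _ /=; rewrite lee_fin.
split => //.
have Fi k : itg m (F k) by apply: itg_le gi.
by apply: fine_cvg; rewrite IE.
Qed.

Lemma fatou_bound (F : nat -> T -> R) f K :
  (forall k, mea (F k)) -> mea f -> (forall k x, 0 <= F k x) ->
  (forall k, itg m (F k)) -> (forall k, I (F k) <= K) ->
  {ae m, forall x, (F k x @[k --> \oo] --> f x)} -> (forall x, 0 <= f x) ->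
  itg m f /\ I f <= K.
Proof.
move=> mF mf F0 Fi FK cF f0.
have fK : (\int[m]_x (f x)%:E <= K%:E)%E.
  have -> : (\int[m]_x (f x)%:E =
            \int[m]_x (limn_einf (fun k => (F k x)%:E)))%E.
    apply: ae_eq_integral => //.
    - exact/measurable_EFinP.
    - under eq_fun do rewrite -[X in limn_einf X]oppeK_fun limn_einfN.
      apply: measurableT_comp => //; apply: measurable_fun_limn_esup => k.
      by apply: measurableT_comp => //; exact/measurable_EFinP.
    - apply: filterS cF => x h _ /=.
      have : (F k x)%:E @[k --> \oo] --> (f x)%:E by exact: cvg_comp h _.
      by move=> /cvg_limn_einf_sup[-> _].
  apply: le_trans.
    apply: (@fatou _ T R m setT measurableT (fun k x => (F k x)%:E)).
    + by move=> k; exact/measurable_EFinP.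
    + by move=> k x _; rewrite lee_fin.
  rewrite limn_einf_lim; apply: lime_le; first exact: is_cvg_einfs.
  apply: nearW => k; apply: (@le_trans _ _ (\int[m]_x (F k x)%:E)%E).
    by apply: ereal_inf_lbound; exists k => /=.
  by rewrite -IE// lee_fin.
have fi : itg m f.
  apply: itg_fin => //; apply: le_lt_trans (ltry K).
  by under eq_integral do rewrite ger0_norm//.
by split => //; rewrite -lee_fin IE.
Qed.

End real_integral.

(** * Measurable and square-integrable functions *)

Section measurability.
Context d (T : measurableType d) (R : realType).
Implicit Types (f g : T -> R).

Lemma mea_cst (c : R) : mea (fun _ : T => c). Proof. exact: measurable_cst. Qed.
Lemma meaD f g : mea f -> mea g -> mea (fun x => f x + g x).
Proof. exact: measurable_funD. Qed.
Lemma meaB f g : mea f -> mea g -> mea (fun x => f x - g x).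
Proof. exact: measurable_funB. Qed.
Lemma meaM f g : mea f -> mea g -> mea (fun x => f x * g x).
Proof. exact: measurable_funM. Qed.
Lemma meaN f : mea f -> mea (fun x => - f x).
Proof. by move=> mf; exact: measurableT_comp. Qed.
Lemma meaX f k : mea f -> mea (fun x => f x ^+ k).
Proof. exact: measurable_funX. Qed.
Lemma mea_abs f : mea f -> mea (fun x => `|f x|).
Proof. by move=> mf; exact: measurableT_comp. Qed.
Lemma mea_comp (h : R -> R) f : mea h -> mea f -> mea (fun x => h (f x)).
Proof. by move=> mh mf; exact: (measurableT_comp mh mf). Qed.
Lemma mea_indic (A : set T) : measurable A -> mea (\1_A : T -> R).
Proof. by move=> mA; exact: measurable_indic. Qed.
End measurability.

Lemma mea_id (R : realType) : mea (fun x : R => x). Proof. exact: measurable_id. Qed.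
Lemma mea_fst (R : realType) : mea (fun x : R * R => x.1).
Proof. exact: measurable_fst. Qed.
Lemma mea_snd (R : realType) : mea (fun x : R * R => x.2).
Proof. exact: measurable_snd. Qed.
Lemma mea_cos (R : realType) : mea (@cos R).
Proof. by apply: continuous_measurable_fun; exact: continuous_cos. Qed.
Lemma mea_sin (R : realType) : mea (@sin R).
Proof. by apply: continuous_measurable_fun; exact: continuous_sin. Qed.

Ltac solve_mea :=
  repeat first [ assumption | exact: mea_id | exact: mea_fst | exact: mea_snd
  | exact: mea_cst | apply: meaD | apply: meaB | apply: meaM | apply: meaN
  | apply: meaX | apply: mea_abs
  | apply: (mea_comp (@mea_cos _)) | apply: (mea_comp (@mea_sin _))
  | match goal with H : measurable_fun _ ?h |- measurable_fun _ (fun _ => ?h _) =>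
      apply: (mea_comp H) end ].

Section square_integrable.
Context d (T : measurableType d) (R : realType).
Variable m : {measure set T -> \bar R}.
Local Notation "'I' f" := (Rintegral m [set: T] f) (at level 10, f at level 8).
Implicit Types (f g : T -> R) (a : R).

Definition sqi f := mea f /\ itg m (fun x => f x ^+ 2).

Lemma eq_sqi f g : f =1 g -> sqi f -> sqi g.
Proof. by move=> /funext ->. Qed.

Lemma sqi_mul f g : sqi f -> sqi g -> itg m (fun x => f x * g x).
Proof.
move=> [mf f2] [mg g2]; apply: itg_le (itgD f2 g2); first by solve_mea.
by move=> x; rewrite ler_norml; apply/andP; split; nra.
Qed.

Lemma sqiD f g : sqi f -> sqi g -> sqi (fun x => f x + g x).
Proof.
move=> hf hg; split; first by apply: meaD; [case: hf|case: hg].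
apply: eq_itg (itgD (itgD hf.2 hg.2) (itgZ 2 (sqi_mul hf hg))) => x.
by rewrite /=; ring.
Qed.

Lemma sqiZ a f : sqi f -> sqi (fun x => a * f x).
Proof.
move=> [mf f2]; split; first by solve_mea.
by apply: eq_itg (itgZ (a ^+ 2) f2) => x; rewrite exprMn.
Qed.

Lemma sqiN f : sqi f -> sqi (fun x => - f x).
Proof. by move=> [mf f2]; split; [solve_mea|apply: eq_itg f2 => x; rewrite sqrrN]. Qed.

Lemma sqiB f g : sqi f -> sqi g -> sqi (fun x => f x - g x).
Proof. by move=> hf /sqiN; exact: sqiD. Qed.

Lemma sqi_abs f : sqi f -> sqi (fun x => `|f x|).
Proof. by move=> [mf f2]; split; [solve_mea|apply: eq_itg f2 => x; rewrite real_normK// num_real]. Qed.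

Lemma sqi_le f g : mea f -> sqi g -> (forall x, `|f x| <= `|g x|) -> sqi f.
Proof.
move=> mf [mg g2] h; split => //; apply: itg_le g2; first by solve_mea.
move=> x; rewrite normrX -[leRHS]real_normK ?num_real//.
by rewrite ler_sqr ?nnegrE.
Qed.

Lemma sqi0 : sqi (fun _ => 0).
Proof.
split; first exact: mea_cst.
have h : itg m (fun _ : T => 0) by exact: (integrable0 m).
by apply: eq_itg h => x /=; rewrite expr0n.
Qed.

Lemma quad_disc (a b c : R) : 0 <= a -> 0 <= c ->
  (forall t, 0 <= a + 2 * t * b + t ^+ 2 * c) -> b ^+ 2 <= a * c.
Proof.
move=> a0 c0; have [->|cN0] := eqVneq c 0 => h.
  have [->|bN0] := eqVneq b 0; first by rewrite expr0n mulr0.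
  have := h (- (a + 1) / (2 * b)); rewrite mulr0 addr0.
  have -> : a + 2 * (- (a + 1) / (2 * b)) * b = -1 by field.
  lra.
have := h (- b / c).
have -> : a + 2 * (- b / c) * b + (- b / c) ^+ 2 * c = (a * c - b ^+ 2) / c by field.
by rewrite pmulr_lge0 ?invr_gt0 ?lt_def ?cN0// subr_ge0.
Qed.

Lemma sqi_CS f g : sqi f -> sqi g ->
  (I (fun x => f x * g x)) ^+ 2 <= I (fun x => f x ^+ 2) * I (fun x => g x ^+ 2).
Proof.
move=> hf hg; apply: quad_disc; try by apply: I_ge0 => x; rewrite sqr_ge0.
move=> t; have fg := sqi_mul hf hg.
rewrite -(IZ _ fg) -(IZ _ hg.2).
rewrite -ID; [|exact: hf.2|exact: itgZ].
rewrite -ID; [|by apply: itgD; [exact: hf.2|exact: itgZ]|by apply: itgZ; exact: hg.2].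
apply: I_ge0 => x; have -> : f x ^+ 2 + 2 * t * (f x * g x) + t ^+ 2 * g x ^+ 2 =
  (f x + t * g x) ^+ 2 by ring.
exact: sqr_ge0.
Qed.

Lemma sqi_CS_abs f g : sqi f -> sqi g ->
  (I (fun x => `|f x * g x|)) ^+ 2 <= I (fun x => f x ^+ 2) * I (fun x => g x ^+ 2).
Proof.
move=> hf hg; have := sqi_CS (sqi_abs hf) (sqi_abs hg).
rewrite (_ : (fun x => `|f x| * `|g x|) = (fun x => `|f x * g x|)); last first.
  by apply/funext => x; rewrite normrM.
by under [in leRHS]eqI do rewrite real_normK ?num_real//; under [X in _ * X]eqI do rewrite real_normK ?num_real//.
Qed.

End square_integrable.

(** * Completeness of the space of square-integrable functions *)

Section completeness.
Context d (T : measurableType d) (R : realType).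
Variable m : {measure set T -> \bar R}.
Local Notation "'I' f" := (Rintegral m [set: T] f) (at level 10, f at level 8).

Definition sqi_cauchy (u : nat -> T -> R) := forall e, 0 < e ->
  exists N, forall i j, (N <= i)%N -> (N <= j)%N -> I (fun x => (u i x - u j x) ^+ 2) <= e.

Lemma increasing_choice (P : nat -> nat -> Prop) :
  (forall k, exists N, forall i, (N <= i)%N -> P k i) ->
  exists2 s : nat -> nat, {homo s : i j / (i < j)%N} & forall k, P k (s k).
Proof.
move=> /choice[N hN].
pose s := fix s k := if k is k'.+1 then maxn (s k').+1 (N k) else N 0%N.
exists s; last by case=> [|k]; apply: hN => //=; rewrite leq_maxr.
apply: homo_ltn => [y x z|k]; first exact: ltn_trans.
by rewrite /= leq_max ltnSn.
Qed.

Lemma geometric_increments_cvg (v : nat -> R) (D : R) :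
  (forall k, 2 ^+ k * `|v k.+1 - v k| <= D) -> cvgn v.
Proof.
move=> h; suff: cvgn (series (telescope v)).
  rewrite telescopeK => c.
  have -> : v = (fun k => (v k - v 0%N) + v 0%N) by apply/funext => k; rewrite subrK.
  by apply: is_cvgD => //; exact: is_cvg_cst.
apply: normed_cvg; apply: (@series_le_cvg _ _ (geometric D 2^-1)) => [k|k|k|].
- exact: normr_ge0.
- rewrite /geometric /=; rewrite mulr_ge0// ?exprn_ge0// ?invr_ge0//; apply: le_trans (h 0%N); rewrite mulr_ge0// exprn_ge0.
- rewrite /geometric /= /telescope exprVn ler_pdivlMr ?exprn_gt0// mulrC.
  exact: h.
- by apply: is_cvg_geometric_series; rewrite gtr0_norm ?invr_gt0// invf_lt1// ltr1n.
Qed.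

(** The sum of the f k has integral at most 1, hence is finite almost
    everywhere. *)
Lemma nneseries_int_ae_bound (f : nat -> T -> R) :
  (forall k, mea (f k)) -> (forall k x, 0 <= f k x) ->
  (forall k, itg m (f k)) -> (forall k, I (f k) <= 1 / (2 ^ k.+1)%:R) ->
  {ae m, forall x, exists D, forall k, f k x <= D}.
Proof.
move=> mf f0 fi fI.
pose G x := (\sum_(k <oo) (f k x)%:E)%E.
have G0 x : (0 <= G x)%E by apply: nneseries_ge0 => k _ _; rewrite lee_fin.
have mG : measurable_fun setT G.
  by apply: ge0_emeasurable_sum => [k x _ _|k _]; [rewrite lee_fin|exact/measurable_EFinP].
have Gi : m.-integrable setT G.
  apply/integrableP; split => //.
  under eq_integral do rewrite gee0_abs//.
  rewrite integral_nneseries//; last 2 first.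
  - by move=> k; exact/measurable_EFinP.
  - by move=> k x _; rewrite lee_fin.
  apply: le_lt_trans (ltry 1); apply: le_trans (epsilon_trick0 _ (@ler01 R)).
  apply: lee_nneseries => [k _ _|k _]; first by apply: integral_ge0 => x _; rewrite lee_fin.
  by rewrite -IE// lee_fin.
apply: filterS (integrable_ae measurableT Gi) => x /(_ Logic.I) Gfin.
exists (fine (G x)) => k; rewrite -lee_fin fineK//.
apply: le_trans (@nneseries_lim_ge _ _ xpredT 0 k.+1 _); last by move=> n _ _; rewrite lee_fin.
rewrite big_nat_recr//= leeDr// sume_ge0// => i _; by rewrite lee_fin.
Qed.

(** Along a rapidly Cauchy subsequence the weighted squared increments are summable, so almost every
    pointwise sequence converges geometrically; Fatou controls the distance. *)
Lemma sqi_complete (u : nat -> T -> R) :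
  (forall k, sqi m (u k)) -> sqi_cauchy u ->
  exists2 l, sqi m l & forall e, 0 < e ->
    exists N, forall i, (N <= i)%N -> I (fun x => (u i x - l x) ^+ 2) <= e.
Proof.
move=> hu cu.
have [s sinc hs] : exists2 s : nat -> nat, {homo s : i j / (i < j)%N} &
    forall k j, (s k <= j)%N ->
    I (fun x => (u j x - u (s k) x) ^+ 2) <= (4 ^+ k)^-1 * (1 / (2 ^ k.+1)%:R).
  apply: (@increasing_choice (fun k i => forall j, (i <= j)%N ->
    I (fun x => (u j x - u i x) ^+ 2) <= (4 ^+ k)^-1 * (1 / (2 ^ k.+1)%:R))) => k.
  have e0 : 0 < (4 ^+ k)^-1 * (1 / (2 ^ k.+1)%:R) :> R.
    by rewrite mulr_gt0// ?invr_gt0 ?exprn_gt0// divr_gt0// ltr0n expn_gt0.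
  have [N hN] := cu _ e0; exists N => i Ni j ij.
  by apply: hN => //; exact: leq_trans ij.
have sle : {homo s : i j / (i <= j)%N}.
  by move=> i j; rewrite leq_eqVlt => /predU1P[->//|/sinc/ltnW].
have sk k : (k <= s k)%N.
  by elim: k => // k ih; apply: leq_ltn_trans ih (sinc _ _ _).
pose v k := u (s k).
have hd i j : sqi m (fun x => u i x - u j x) by apply: sqiB.
have aeD : {ae m, forall x, exists D, forall k, 4 ^+ k * (v k.+1 x - v k x) ^+ 2 <= D}.
  apply: nneseries_int_ae_bound => [k|k x|k|k].
  - by have [mk _] := hd (s k.+1) (s k); solve_mea; exact: (hu _).1.
  - by apply: mulr_ge0; [rewrite exprn_ge0|exact: sqr_ge0].
  - by apply: itgZ; exact: (hd _ _).2.
  - rewrite IZ; last exact: (hd _ _).2.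
    by rewrite -ler_pdivlMl ?exprn_gt0//; apply: hs; exact: sle.
have aec : {ae m, forall x, cvgn (v ^~ x)}.
  apply: filterS aeD => x [D hD]; apply: (@geometric_increments_cvg _ (D + 1)) => k.
  have D0 : 0 <= D by apply: le_trans (hD 0%N); apply: mulr_ge0; [rewrite exprn_ge0|exact: sqr_ge0].
  rewrite -(@ler_pXn2r _ 2)// ?nnegrE ?mulr_ge0 ?exprn_ge0// ?addr_ge0//.
  rewrite exprMn real_normK ?num_real// -exprM mulnC exprM -natrX.
  by apply: le_trans (hD k) _; nra.
pose l x := fine (limn_esup (fun k => (v k x)%:E)).
have vl : {ae m, forall x, v k x @[k --> \oo] --> l x}.
  apply: filterS aec => x cx.
  have c : (v k x)%:E @[k --> \oo] --> (limn (v ^~ x))%:E by exact: cvg_comp cx _.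
  by rewrite /l; have [_ ->] := cvg_limn_einf_sup c.
have ml : mea l.
  apply: (measurableT_comp (fine_measurable measurableT)).
  by apply: measurable_fun_limn_esup => k; apply/measurable_EFinP; exact: (hu _).1.
have main e i N : (forall j, (N <= j)%N -> I (fun x => (u i x - u j x) ^+ 2) <= e) ->
    itg m (fun x => (u i x - l x) ^+ 2) /\ I (fun x => (u i x - l x) ^+ 2) <= e.
  move=> hN; apply: (@fatou_bound _ _ _ _ (fun k x => (u i x - v (k + N)%N x) ^+ 2)).
  - by move=> k; have [mi _] := hu i; have [mk _] := hu (s (k + N)%N); solve_mea.
  - by have [mi _] := hu i; solve_mea.
  - by move=> k x; exact: sqr_ge0.
  - by move=> k; exact: (hd _ _).2.
  - by move=> k; apply: hN; apply: leq_trans (sk _); exact: leq_addl.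
  - apply: filterS vl => x cx.
    have cN : v (k + N)%N x @[k --> \oo] --> l x.
      by have := cx; rewrite -(cvg_shiftn N).
    rewrite expr2; under eq_fun do rewrite expr2.
    by apply: cvgM; apply: cvgB => //; exact: cvg_cst.
  - by move=> x; exact: sqr_ge0.
have [N1 hN1] := cu _ (@ltr01 R).
have [li _] := main 1 N1 N1 (fun j => hN1 _ _ (leqnn _)).
exists l.
  have h1 : sqi m (fun x => u N1 x - l x).
    by split => //; have [mi _] := hu N1; solve_mea.
  have [_ h2] := sqiB (hu N1) h1; split => //.
  by apply: eq_itg h2 => x; rewrite opprB addrC subrK.
move=> e e0; have [N hN] := cu _ e0; exists N => i Ni.
by have [] := main e i N (fun j => hN _ _ Ni).
Qed.

End completeness.

(** * Affine changes of variables on the line *)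

Notation leb2 R := ((@lebesgue_measure R) \x (@lebesgue_measure R))%E.

Section measure_preserving.
Context d (T : measurableType d) (R : realType).
Variable m : {measure set T -> \bar R}.
Variable phi : T -> T.
Hypothesis mphi : measurable_fun setT phi.
Variable c : {nonneg R}.
Hypothesis phiE : forall A, measurable A -> m (phi @^-1` A) = (c%:num%:E * m A)%E.
Local Notation "'I' f" := (Rintegral m [set: T] f) (at level 10, f at level 8).

(** The hypothesis on sets says that the image of m under phi is c * m. *)
Lemma scaled_ge0_integral (f : T -> R) : mea f -> (forall x, 0 <= f x) ->
  (\int[m]_x (f (phi x))%:E = c%:num%:E * \int[m]_x (f x)%:E)%E.
Proof.
move=> mf f0.
have := @ge0_integral_pushforward _ _ T T R phi mphi m setT (EFin \o f) measurableT.
move=> /(_ (proj2 (measurable_EFinP _ _) mf)) h.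
rewrite -[LHS]h; last by move=> x _; rewrite lee_fin.
have -> : (\int[pushforward m phi]_y (EFin \o f) y = \int[mscale c m]_y (f y)%:E)%E.
  by apply: eq_measure_integral => A mA _; exact: phiE.
rewrite ge0_integral_mscale//; first exact/measurable_EFinP.
by move=> x _; rewrite lee_fin.
Qed.

Lemma scaled_itg (f : T -> R) : itg m f -> itg m (fun x => f (phi x)).
Proof.
move=> fi; have mf := itg_mea fi; apply: itg_fin.
  exact: (measurableT_comp mf mphi).
rewrite (@scaled_ge0_integral (fun x => `|f x|))//; last by solve_mea.
rewrite -(IE (itg_abs fi)) -EFinM; exact: ltry.
Qed.

Lemma scaled_I_ge0 (f : T -> R) : itg m f -> (forall x, 0 <= f x) ->
  I (fun x => f (phi x)) = c%:num * I f.
Proof.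
move=> fi f0; apply: EFin_inj; rewrite IE; last exact: scaled_itg.
by rewrite EFinM IE// scaled_ge0_integral//; exact: itg_mea fi.
Qed.

Lemma scaled_I (f : T -> R) : itg m f -> I (fun x => f (phi x)) = c%:num * I f.
Proof.
move=> fi; have fai := itg_abs fi.
have gi : itg m (fun x => `|f x| + f x) by exact: itgD.
have -> : I (fun x => f (phi x)) =
    I (fun x => (`|f (phi x)| + f (phi x)) - `|f (phi x)|).
  by apply: eqI => x; rewrite addrC addKr.
rewrite (IB (scaled_itg gi) (scaled_itg fai)).
rewrite (scaled_I_ge0 gi); last first.
  by move=> x; have := ler_norm (- f x); rewrite normrN; lra.
rewrite (scaled_I_ge0 fai)// -mulrBr -IB//.
by congr (_ * _); apply: eqI => x; rewrite addrC addKr.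
Qed.

End measure_preserving.

Section lebesgue_affine.
Variable R : realType.
Local Notation mu := (@lebesgue_measure R).
Local Notation "'I' f" := (Rintegral mu [set: _] f) (at level 10, f at level 8).
Implicit Types (f : R -> R) (c : R).

Lemma leb_shift c A : measurable A -> mu ((fun x => c + x) @^-1` A) = mu A.
Proof.
move=> mA; have mf : measurable_fun setT (fun x : measurableTypeR R => c + x : measurableTypeR R).
  by apply: meaD; [exact: mea_cst|exact: mea_id].
apply/esym.
apply: (@lebesgue_measure_unique R (pushforward mu (fun x : measurableTypeR R => c + x : measurableTypeR R))) => // _ [[a b]] _ <-.
rewrite [RHS](_ : _ = mu `]a - c, b - c]%classic); last first.
  rewrite /pushforward; congr (mu _).
  by apply/seteqP; split => x /=; rewrite !in_itv/= ltrBlDl lerBrDl.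
rewrite !lebesgue_measure_itv/= !lte_fin ltrD2r.
by case: ifP => // _; rewrite -!EFinD; congr EFin; ring.
Qed.

Lemma leb_scale (e : {nonneg R}) A : 0 < e%:num -> measurable A ->
  mu ((fun x => e%:num^-1 * x) @^-1` A) = (e%:num%:E * mu A)%E.
Proof.
move=> e0 mA; have mf : measurable_fun setT (fun x : measurableTypeR R => e%:num^-1 * x : measurableTypeR R).
  by apply: meaM; [exact: mea_cst|exact: mea_id].
have i0 : 0 <= e%:num^-1 by rewrite invr_ge0 ltW.
pose nu := mscale (NngNum i0)
  (pushforward mu (fun x : measurableTypeR R => e%:num^-1 * x : measurableTypeR R)).
have H X : ocitv X -> mu X = nu mf X.
  move=> [[a b]] _ <-; rewrite /nu /mscale /pushforward /=.
  rewrite [X in (_ * X)%E](_ : _ = mu `]e%:num * a, e%:num * b]%classic); last first.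
    rewrite /pushforward; congr (mu _).
    by apply/seteqP; split => x /=; rewrite !in_itv/= ltr_pdivlMl// ler_pdivrMl.
  rewrite !lebesgue_measure_itv/= !lte_fin ltr_pM2l//.
  case: ifP => // _; last by rewrite mule0.
  by rewrite -!EFinD -EFinM; congr EFin; field; rewrite gt_eqF.
rewrite (lebesgue_measure_unique H mA) /nu /mscale /pushforward/=.
by rewrite muleA -EFinM divff ?mul1e// gt_eqF.
Qed.

Lemma mphi_shift c : measurable_fun [set: measurableTypeR R]
  (fun x : measurableTypeR R => c + x : measurableTypeR R).
Proof. by apply: meaD; [exact: mea_cst|exact: mea_id]. Qed.

Lemma mphi_opp : measurable_fun [set: measurableTypeR R]
  (fun x : measurableTypeR R => - x : measurableTypeR R).
Proof. by apply: meaN; exact: mea_id. Qed.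

Lemma mphi_scale c : measurable_fun [set: measurableTypeR R]
  (fun x : measurableTypeR R => c * x : measurableTypeR R).
Proof. by apply: meaM; [exact: mea_cst|exact: mea_id]. Qed.

Lemma leb_shift1 c (A : set (measurableTypeR R)) : measurable A ->
  mu ((fun x : measurableTypeR R => c + x : measurableTypeR R) @^-1` A) =
  ((NngNum (@ler01 R))%:num%:E * mu A)%E.
Proof. by move=> mA; rewrite mul1e leb_shift. Qed.

Lemma leb_opp1 (A : set (measurableTypeR R)) : measurable A ->
  mu ((fun x : measurableTypeR R => - x : measurableTypeR R) @^-1` A) =
  ((NngNum (@ler01 R))%:num%:E * mu A)%E.
Proof. by move=> mA; rewrite mul1e -[RHS]lebesgue_measureN. Qed.

Lemma leb_scale1 e (i0 : 0 <= e^-1) (A : set (measurableTypeR R)) : 0 < e -> measurable A ->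
  mu ((fun x : measurableTypeR R => e * x : measurableTypeR R) @^-1` A) =
  ((NngNum i0)%:num%:E * mu A)%E.
Proof.
move=> e0 mA; have := @leb_scale (NngNum i0) A _ mA; rewrite /= invrK; apply.
by rewrite invr_gt0.
Qed.

Lemma itg_shift c f : itg mu f -> itg mu (fun x => f (c + x)).
Proof. exact: (scaled_itg (@mphi_shift c) (@leb_shift1 c)). Qed.

Lemma I_shift c f : itg mu f -> I (fun x => f (c + x)) = I f.
Proof. by move=> /(scaled_I (@mphi_shift c) (@leb_shift1 c)) /= ->; rewrite mul1r. Qed.

Lemma itg_opp f : itg mu f -> itg mu (fun x => f (- x)).
Proof. exact: (scaled_itg mphi_opp leb_opp1). Qed.

Lemma I_opp f : itg mu f -> I (fun x => f (- x)) = I f.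
Proof. by move=> /(scaled_I mphi_opp leb_opp1) /= ->; rewrite mul1r. Qed.

Lemma itg_scale e f : 0 < e -> itg mu f -> itg mu (fun x => f (e * x)).
Proof.
move=> e0; have i0 : 0 <= e^-1 by rewrite invr_ge0 ltW.
by apply: (scaled_itg (@mphi_scale e)) => A; exact: (leb_scale1 i0).
Qed.

Lemma I_scale e f : 0 < e -> itg mu f -> I (fun x => f (e * x)) = e^-1 * I f.
Proof.
move=> e0; have i0 : 0 <= e^-1 by rewrite invr_ge0 ltW.
exact: (scaled_I (@mphi_scale e) (fun A => @leb_scale1 _ i0 A e0)).
Qed.

Lemma ae_opp (P : R -> Prop) : {ae mu, forall x, P x} -> {ae mu, forall x, P (- x)}.
Proof.
move=> [A [mA A0 hA]]; exists ((fun x => - x) @^-1` A); split.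
- by rewrite -[X in measurable X]setTI; apply: (meaN (@mea_id R)).
- by rewrite -A0 -[RHS]lebesgue_measureN.
- by move=> x /= hx; apply: hA.
Qed.

Lemma ae_shift c (P : R -> Prop) : {ae mu, forall x, P x} -> {ae mu, forall x, P (c + x)}.
Proof.
move=> [A [mA A0 hA]]; exists ((fun x => c + x) @^-1` A); split.
- by rewrite -[X in measurable X]setTI; apply: (meaD (@mea_cst _ _ _ c) (@mea_id R)).
- by rewrite -A0 leb_shift.
- by move=> x /= hx; apply: hA.
Qed.

Lemma ae_sub c (P : R -> Prop) : {ae mu, forall x, P x} -> {ae mu, forall x, P (c - x)}.
Proof. by move=> h; exact: ae_opp (ae_shift c h). Qed.

End lebesgue_affine.

(** * Iterated integrals and linear changes of variables on the plane *)

Section iterated_integrals.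
Variable R : realType.
Local Notation mu := (@lebesgue_measure R).
Local Notation mu2 := (leb2 R).
Local Notation "'I' f" := (Rintegral mu [set: _] f) (at level 10, f at level 8).
Local Notation "'I2' f" := (Rintegral mu2 [set: R * R] f) (at level 10, f at level 8).
Implicit Types (f : R * R -> R).

Lemma mea_pair1 f x : mea f -> mea (fun y => f (x, y)).
Proof. by move=> mf; exact: (measurableT_comp mf (measurable_pair1 x)). Qed.

Lemma mea_iterated f : mea f -> mea (fun x => I (fun y => f (x, y))).
Proof.
move=> mf; apply: (measurableT_comp (fine_measurable measurableT)).
under eq_fun do rewrite integralE.
have mE : measurable_fun setT (EFin \o f) by exact/measurable_EFinP.
apply: emeasurable_funB.
- rewrite (_ : (fun x => _) = fubini_F mu ((EFin \o f)^\+)%E).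
    by apply: measurable_fun_fubini_tonelli_F; [exact: measurable_funepos|move=> z; exact: funepos_ge0].
  by apply/funext => x; rewrite /fubini_F; apply: eq_integral => y _; rewrite ?funeposE ?funenegE.
- rewrite (_ : (fun x => _) = fubini_F mu ((EFin \o f)^\-)%E).
    by apply: measurable_fun_fubini_tonelli_F; [exact: measurable_funeneg|move=> z; exact: funeneg_ge0].
  by apply/funext => x; rewrite /fubini_F; apply: eq_integral => y _; rewrite ?funeposE ?funenegE.
Qed.

Lemma itg2_bound f (g : R -> R) : mea f -> (forall x, itg mu (fun y => f (x, y))) ->
  (forall x, I (fun y => `|f (x, y)|) <= g x) -> itg mu g ->
  itg mu2 f /\ I2 (fun z => `|f z|) <= I g.
Proof.
move=> mf fi fg gi.
have mE : measurable_fun setT (fun z => `|f z|%:E) by apply/measurable_EFinP/mea_abs.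
have e : (\int[mu2]_z `|f z|%:E <= \int[mu]_x (g x)%:E)%E.
  have -> : (\int[mu2]_z `|f z|%:E = \int[mu]_x fubini_F mu (fun z => `|f z|%:E) x)%E.
    by apply: fubini_tonelli1 => // z; rewrite lee_fin.
  apply: ge0_le_integral => //.
  - by move=> x _; apply: integral_ge0 => y _; rewrite lee_fin.
  - by apply: measurable_fun_fubini_tonelli_F => // z; rewrite lee_fin.
  - by apply/measurable_EFinP; exact: itg_mea gi.
  - move=> x _; rewrite /fubini_F.
    by rewrite -[leLHS](IE (itg_abs (fi x))) lee_fin.
have f2 : itg mu2 f.
  by apply: itg_fin => //; apply: le_lt_trans e _; rewrite -IE// ltry.
split => //.
by rewrite -lee_fin (IE (itg_abs f2)) IE.
Qed.

Lemma fubini1 f : itg mu2 f ->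
  itg mu (fun x => I (fun y => f (x, y))) /\ I2 f = I (fun x => I (fun y => f (x, y))).
Proof.
move=> fi; have [h1 h2] := itg_fine (integrable_fubini_F fi).
by split => //; rewrite h2 /Rintegral; congr fine; rewrite -[LHS](integral12_prod_meas1 fi).
Qed.

Lemma mea_of_pair (F G : R * R -> R) : mea F -> mea G ->
  measurable_fun [set: R * R] (fun z => (F z, G z)).
Proof. by move=> mF mG; exact: measurable_fun_pair. Qed.

Let RM := measurableTypeR R.

(** By uniqueness of the product measure, rectangles decide. *)
Lemma measure_preservingP (phi : RM * RM -> RM * RM) :
  measurable_fun [set: RM * RM] phi ->
  (forall A B : set RM, measurable A -> measurable B ->
    mu2 (phi @^-1` (A `*` B)) = (mu A * mu B)%E) ->
  forall X : set (RM * RM), measurable X ->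
  mu2 (phi @^-1` X) = ((NngNum (@ler01 R))%:num%:E * mu2 X)%E.
Proof.
move=> mphi h X mX; rewrite mul1e; apply/esym.
pose nu := (fun mf => pushforward mu2 phi : {measure set (RM * RM) -> \bar R}) mphi.
exact: (@product_measure_unique _ _ _ _ _ mu mu (nu mphi) h X mX).
Qed.

Lemma mu2_ysection (X : set (RM * RM)) : measurable X ->
  (mu2 X = \int[mu]_y mu (ysection X y))%E.
Proof.
move=> mX; rewrite (@product_measure_unique _ _ _ _ _ mu mu (mu \x^ mu)%E)//.
by move=> A B mA mB; exact: product_measure2E.
Qed.

(** Linear shears only translate or reflect the sections of a rectangle; this
    computes the measure of the result. *)
Lemma mu2_ysection_rect (X : set (RM * RM)) (A B : set RM) :
  measurable X -> measurable A ->
  (forall y, mu (ysection X y) = ((\1_A y)%:E * mu B)%E) ->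
  mu2 X = (mu A * mu B)%E.
Proof.
move=> mX mA h; rewrite mu2_ysection//.
under eq_integral do rewrite h.
rewrite ge0_integralZr//; last by apply/measurable_EFinP; exact: mea_indic.
by rewrite integral_indic// setIT.
Qed.

(** The cyclic change of variables on the plane a + b + c = 0. *)
Definition rot3 (z : RM * RM) : RM * RM := (z.2, - (z.1 + z.2)).
Definition shear (z : RM * RM) : RM * RM := (z.1 - z.2, z.2).

Lemma mphi_rot3 : measurable_fun setT rot3.
Proof. by apply: mea_of_pair; solve_mea. Qed.

Lemma mphi_shear : measurable_fun setT shear.
Proof. by apply: mea_of_pair; solve_mea. Qed.

Lemma measurable_preim (phi : RM * RM -> RM * RM) (X : set (RM * RM)) :
  measurable_fun setT phi -> measurable X -> measurable (phi @^-1` X).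
Proof. by move=> h mX; rewrite -[X in measurable X]setTI; exact: h. Qed.

Lemma rot3_preserving (X : set (RM * RM)) : measurable X ->
  mu2 (rot3 @^-1` X) = ((NngNum (@ler01 R))%:num%:E * mu2 X)%E.
Proof.
apply: measure_preservingP; first exact: mphi_rot3.
move=> A B mA mB; apply: mu2_ysection_rect => //.
  by apply: measurable_preim; [exact: mphi_rot3|exact: measurableX].
move=> y; have mB' : measurable ((fun x : RM => - x : RM) @^-1` B).
  by rewrite -[X in measurable X]setTI; exact: mphi_opp.
rewrite indicE; have [yA|yA] := boolP (y \in A); last first.
  have -> : ysection (rot3 @^-1` (A `*` B)) y = set0; last by rewrite mul0e measure0.
  apply/seteqP; split => // x; rewrite /ysection /= inE /= => -[/= /mem_set yA' _].
  by rewrite yA' in yA.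
rewrite mul1e; have <- : mu ((fun x : RM => - x : RM) @^-1` B) = mu B by exact: lebesgue_measureN.
have <- := leb_shift y mB'.
congr (mu _); apply/seteqP; split => x; rewrite /ysection /= inE /=.
  by move=> [_]; rewrite /= addrC.
by move=> h; split; rewrite /= ?(addrC x)//; rewrite inE in yA.
Qed.

Lemma shear_preserving (X : set (RM * RM)) : measurable X ->
  mu2 (shear @^-1` X) = ((NngNum (@ler01 R))%:num%:E * mu2 X)%E.
Proof.
apply: measure_preservingP; first exact: mphi_shear.
move=> A B mA mB; rewrite muleC; apply: mu2_ysection_rect => //.
  by apply: measurable_preim; [exact: mphi_shear|exact: measurableX].
move=> y; rewrite indicE; have [yB|yB] := boolP (y \in B); last first.
  have -> : ysection (shear @^-1` (A `*` B)) y = set0; last by rewrite mul0e measure0.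
  apply/seteqP; split => // x; rewrite /ysection /= inE /= => -[/= _ /mem_set yB'].
  by rewrite yB' in yB.
rewrite mul1e; have <- := leb_shift (- y) mA.
congr (mu _); apply/seteqP; split => x; rewrite /ysection /= inE /=.
  by move=> [+ _]; rewrite /= addrC.
by move=> h; split; rewrite /= ?(addrC x)//; rewrite inE in yB.
Qed.

Lemma itg_rot3 f : itg mu2 f -> itg mu2 (fun z => f (rot3 z)).
Proof. exact: (scaled_itg mphi_rot3 rot3_preserving). Qed.

Lemma I2_rot3 f : itg mu2 f -> I2 (fun z => f (rot3 z)) = I2 f.
Proof. by move=> /(scaled_I mphi_rot3 rot3_preserving) /= ->; rewrite mul1r. Qed.

Lemma itg_shear f : itg mu2 f -> itg mu2 (fun z => f (shear z)).
Proof. exact: (scaled_itg mphi_shear shear_preserving). Qed.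

Lemma I2_shear f : itg mu2 f -> I2 (fun z => f (shear z)) = I2 f.
Proof. by move=> /(scaled_I mphi_shear shear_preserving) /= ->; rewrite mul1r. Qed.

Let swp (z : RM * RM) : RM * RM := (z.2, z.1).

Let mphi_swp : measurable_fun setT swp.
Proof. by apply: mea_of_pair; solve_mea. Qed.

Let swp_preserving (X : set (RM * RM)) : measurable X ->
  mu2 (swp @^-1` X) = ((NngNum (@ler01 R))%:num%:E * mu2 X)%E.
Proof.
apply: measure_preservingP; first exact: mphi_swp.
move=> A B mA mB; apply: mu2_ysection_rect => //.
  by apply: measurable_preim; [exact: mphi_swp|exact: measurableX].
move=> y; rewrite indicE; have [yA|yA] := boolP (y \in A); last first.
  have -> : ysection (swp @^-1` (A `*` B)) y = set0; last by rewrite mul0e measure0.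
  apply/seteqP; split => // x; rewrite /ysection /= inE /= => -[/= /mem_set yA' _].
  by rewrite yA' in yA.
rewrite mul1e; congr (mu _); apply/seteqP; split => x; rewrite /ysection /= inE /=.
  by move=> [].
by move=> h; split => //=; rewrite inE in yA.
Qed.

Lemma fubini2 f : itg mu2 f ->
  itg mu (fun y => I (fun x => f (x, y))) /\ I2 f = I (fun y => I (fun x => f (x, y))).
Proof.
move=> fi; have := fubini1 (scaled_itg mphi_swp swp_preserving fi).
by rewrite (scaled_I mphi_swp swp_preserving fi) /= mul1r.
Qed.

End iterated_integrals.

(** * Continuous functions of two variables are measurable *)

Section continuous_plane.
Variable R : realType.
Implicit Types (k : nat).

Definition round k (x : R) : R := (Num.floor (k.+1%:R * x))%:~R / k.+1%:R.

Lemma round_near k (x : R) : `|round k x - x| <= k.+1%:R^-1.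
Proof.
have k0 : 0 < k.+1%:R :> R by rewrite ltr0n.
have /andP[h1 h2] := floor_itv (k.+1%:R * x).
have e : x = k.+1%:R * x / k.+1%:R by rewrite mulrAC mulfV ?mul1r// gt_eqF.
rewrite {2}e /round -mulrBl normrM (gtr0_norm (_ : 0 < k.+1%:R^-1)) ?invr_gt0//.
rewrite -[leRHS]mul1r ler_wpM2r// ?invr_ge0 ?(ltW k0)//.
rewrite distrC ger0_norm ?subr_ge0//; move: h2; rewrite intrD; lra.
Qed.

Lemma round_cvg (x : R) : round k x @[k --> \oo] --> x.
Proof.
apply/cvgrPdist_le => e e0.
have h : \forall k \near \oo, `|k.+1%:R^-1 : R| <= e.
  by have /cvgr0Pnorm_le := @cvg_harmonic R; apply.
apply: filterS h => k; apply: le_trans; rewrite distrC; apply: le_trans (round_near k x) _; exact: ler_norm.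
Qed.

Lemma measurable_round k (i : int) : measurable [set x : R | Num.floor (k.+1%:R * x) = i].
Proof.
have k0 : 0 < k.+1%:R :> R by rewrite ltr0n.
rewrite [X in measurable X](_ : _ = `[i%:~R / k.+1%:R, (i + 1)%:~R / k.+1%:R[%classic).
  exact: measurable_itv.
apply/seteqP; split => x /=; rewrite in_itv /= ler_pdivrMr// ltr_pdivlMr// mulrC.
  by move=> <-; exact: floor_itv.
exact: floor_def.
Qed.

(** A continuous function on the plane is the limit of functions constant on
    the cells of finer and finer grids. *)
Lemma mea_continuous2 (n : R * R -> R) : continuous n -> mea n.
Proof.
move=> cn; apply: (@measurable_fun_cvg _ _ _ setT (fun k z => n (round k z.1, round k z.2))).
  move=> k _ Y mY; rewrite setTI.
  pose c (i : int) : set R := [set x : R | Num.floor (k.+1%:R * x) = i].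
  pose D := [set ij : int * int | Y (n (ij.1%:~R / k.+1%:R, ij.2%:~R / k.+1%:R))].
  rewrite [X in measurable X](_ : _ = \bigcup_(ij in D) (c ij.1 `*` c ij.2)).
    rewrite bigcup_mkcond; apply: countable_bigcupT_measurable => [|[i j]]; first exact: countableP.
    by case: ifP => // _; apply: measurableX; exact: measurable_round.
  apply/seteqP; split => [[x y] /= h|[x y] [[i j] /= h []]].
    by exists (Num.floor (k.+1%:R * x), Num.floor (k.+1%:R * y)).
  by rewrite /c /= /round => -> ->.
move=> [x y] _; apply: (cvg_comp (fun k => (round k x, round k y)) n); last exact: cn.
exact: (cvg_pair (@round_cvg x) (@round_cvg y)).
Qed.

End continuous_plane.

Section almost_everywhere_lebesgue.
Variable R : realType.
Local Notation mu := (@lebesgue_measure R).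
Implicit Types P Q : R -> Prop.

Lemma ae_mono P Q : (forall x, P x -> Q x) -> {ae mu, forall x, P x} -> {ae mu, forall x, Q x}.
Proof.
by move=> PQ [A [mA A0 hA]]; exists A; split => // x /= h; apply: hA => /= /PQ.
Qed.

Lemma ae_and P Q : {ae mu, forall x, P x} -> {ae mu, forall x, Q x} ->
  {ae mu, forall x, P x /\ Q x}.
Proof.
move=> [A [mA A0 hA]] [B [mB B0 hB]]; exists (A `|` B); split.
- exact: measurableU.
- by apply: null_set_setU.
- move=> x /= h; have [Px|nP] := pselect (P x); last by left; exact: hA.
  by right; apply: hB => /= Qx; exact: h.
Qed.
End almost_everywhere_lebesgue.

(** * The L2 norm and trilinear integrals *)

Section norm2.
Context d (T : measurableType d) (R : realType).
Variable m : {measure set T -> \bar R}.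
Local Notation "'I' f" := (Rintegral m [set: T] f) (at level 10, f at level 8).
Implicit Types (f g : T -> R) (a : R).

Definition nrm2 f := Num.sqrt (I (fun x => f x ^+ 2)).

Lemma nrm2_ge0 f : 0 <= nrm2 f. Proof. exact: sqrtr_ge0. Qed.

Lemma nrm2_sqr f : nrm2 f ^+ 2 = I (fun x => f x ^+ 2).
Proof. by rewrite sqr_sqrtr// I_ge0// => x; exact: sqr_ge0. Qed.

Lemma nrm2_le f (K : R) : 0 <= K -> I (fun x => f x ^+ 2) <= K ^+ 2 -> nrm2 f <= K.
Proof. by move=> K0 h; rewrite -(ler_pXn2r (n:=2))// ?nnegrE ?nrm2_ge0// nrm2_sqr. Qed.

Lemma nrm2_abs f : nrm2 (fun x => `|f x|) = nrm2 f.
Proof. by congr Num.sqrt; apply: eqI => x; rewrite real_normK ?num_real. Qed.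

Lemma nrm2_CS f g : sqi m f -> sqi m g -> I (fun x => `|f x * g x|) <= nrm2 f * nrm2 g.
Proof.
move=> hf hg; rewrite -(ler_pXn2r (n:=2))// ?nnegrE ?mulr_ge0 ?nrm2_ge0//; last first.
  by apply: I_ge0 => x.
by rewrite exprMn !nrm2_sqr; exact: sqi_CS_abs.
Qed.

Lemma nrm2_CS1 f g : sqi m f -> sqi m g -> `|I (fun x => f x * g x)| <= nrm2 f * nrm2 g.
Proof. by move=> hf hg; apply: le_trans (I_abs (sqi_mul hf hg)) (nrm2_CS hf hg). Qed.

Lemma nrm2_mono f g : sqi m f -> sqi m g -> (forall x, `|f x| <= `|g x|) -> nrm2 f <= nrm2 g.
Proof.
move=> [mf fi] [mg gi] h; rewrite ler_sqrt ?I_ge0// => [|x]; last exact: sqr_ge0.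
apply: I_le => // x; rewrite -real_normK ?num_real// -[leRHS]real_normK ?num_real//.
by rewrite ler_sqr ?nnegrE.
Qed.

Lemma nrm2_Z a f : sqi m f -> nrm2 (fun x => a * f x) = `|a| * nrm2 f.
Proof.
move=> [mf fi]; rewrite /nrm2; under [in LHS]eqI do rewrite exprMn.
by rewrite IZ// sqrtrM ?sqr_ge0// sqrtr_sqr.
Qed.

Lemma nrm2_D f g : sqi m f -> sqi m g -> nrm2 (fun x => f x + g x) <= nrm2 f + nrm2 g.
Proof.
move=> hf hg; apply: nrm2_le; first by rewrite addr_ge0 ?nrm2_ge0.
have fg := sqi_mul hf hg.
have -> : I (fun x => (f x + g x) ^+ 2) =
    I (fun x => f x ^+ 2) + 2 * I (fun x => f x * g x) + I (fun x => g x ^+ 2).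
  rewrite -(IZ _ fg) -ID; [|exact: hf.2|exact: itgZ].
  rewrite -ID; [|by apply: itgD; [exact: hf.2|exact: itgZ]|exact: hg.2].
  by apply: eqI => x; ring.
rewrite -!nrm2_sqr; have := ler_norm (I (fun x => f x * g x)).
have := nrm2_CS1 hf hg; nra.
Qed.

End norm2.

Section trilinear.
Variable R : realType.
Local Notation mu := (@lebesgue_measure R).
Local Notation mu2 := (leb2 R).
Local Notation "'I' f" := (Rintegral mu [set: _] f) (at level 10, f at level 8).
Local Notation "'I2' f" := (Rintegral mu2 [set: R * R] f) (at level 10, f at level 8).
Local Notation N := (nrm2 mu).
Implicit Types (f F G W w : R -> R) (n : R * R -> R).

Lemma sqi_shift c f : sqi mu f -> sqi mu (fun x => f (c + x)).
Proof.
move=> [mf fi]; split; first by apply: (mea_comp mf); solve_mea.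
exact: (@itg_shift _ c (fun x => f x ^+ 2)).
Qed.

Lemma sqi_opp f : sqi mu f -> sqi mu (fun x => f (- x)).
Proof.
move=> [mf fi]; split; first by apply: (mea_comp mf); solve_mea.
exact: (@itg_opp _ (fun x => f x ^+ 2)).
Qed.

Lemma sqi_third c f : sqi mu f -> sqi mu (fun x => f (- (c + x))).
Proof. by move=> /sqi_opp /(@sqi_shift c). Qed.

Lemma nrm2_shift c f : sqi mu f -> N (fun x => f (c + x)) = N f.
Proof. by move=> [mf fi]; congr Num.sqrt; rewrite (@I_shift _ c (fun x => f x ^+ 2)). Qed.

Lemma nrm2_opp f : sqi mu f -> N (fun x => f (- x)) = N f.
Proof. by move=> [mf fi]; congr Num.sqrt; rewrite (@I_opp _ (fun x => f x ^+ 2)). Qed.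

Lemma nrm2_third c f : sqi mu f -> N (fun x => f (- (c + x))) = N f.
Proof.
by move=> h; rewrite (@nrm2_shift c (fun x => f (- x))) ?nrm2_opp//; exact: sqi_opp.
Qed.

(** The elementary convolution bound: one factor integrable, two square
    integrable; Cauchy-Schwarz in the inner variable. *)
Lemma tri_young G F2 F3 : itg mu G -> sqi mu F2 -> sqi mu F3 ->
  itg mu2 (fun z => G z.1 * F2 z.2 * F3 (- (z.1 + z.2))) /\
  I2 (fun z => `|G z.1 * F2 z.2 * F3 (- (z.1 + z.2))|) <=
    I (fun x => `|G x|) * (N F2 * N F3).
Proof.
move=> Gi h2 h3; have mG := itg_mea Gi; have [m2 _] := h2; have [m3 _] := h3.
have [] := @itg2_bound R (fun z => G z.1 * F2 z.2 * F3 (- (z.1 + z.2)))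
  (fun x => `|G x| * (N F2 * N F3)).
- by solve_mea.
- move=> x /=; apply: eq_itg (itgZ (G x) (sqi_mul h2 (sqi_third x h3))) => y.
  by rewrite mulrA.
- move=> x /=; under eqI do rewrite -mulrA normrM.
  rewrite IZ; last by apply: itg_abs; exact: sqi_mul (sqi_third x h3).
  apply: ler_wpM2l => //; rewrite -(nrm2_third x h3).
  exact: nrm2_CS (sqi_third x h3).
- apply: eq_itg (itgZ (N F2 * N F3) (itg_abs Gi)) => x; exact: mulrC.
move=> h1 hb; split => //; apply: le_trans hb _.
by rewrite RintegralZr//; exact: itg_abs.
Qed.

Definition tri_kernel n F1 F2 F3 (z : R * R) :=
  n z * (F1 z.1 * F2 z.2 * F3 (- (z.1 + z.2))).

Definition tri n F1 F2 F3 := I2 (tri_kernel n F1 F2 F3).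

(** The factors W are absorbed into the arguments of the form, and a
    square-integrable w, sitting at any one of the three frequencies, pays for
    the integration. *)
Definition dominated_symbol n w W := forall a b,
  `|n (a, b)| <= (w a + w b + w (- (a + b))) * (W a * W b * W (- (a + b))).

(** For each of the three weights w, the cyclic change of variables brings the
    factor that carries it to the front, where w times a square-integrable
    function is integrable; tri_young then applies. *)
Lemma tri_bound n w W F1 F2 F3 : mea n -> dominated_symbol n w W ->
  sqi mu w -> (forall x, 0 <= w x) -> (forall x, 0 <= W x) ->
  mea F1 -> mea F2 -> mea F3 ->
  sqi mu (fun x => W x * F1 x) -> sqi mu (fun x => W x * F2 x) ->
  sqi mu (fun x => W x * F3 x) ->
  itg mu2 (tri_kernel n F1 F2 F3) /\
  I2 (fun z => `|tri_kernel n F1 F2 F3 z|) <= 3 * N w *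
    (N (fun x => W x * F1 x) * N (fun x => W x * F2 x) * N (fun x => W x * F3 x)).
Proof.
move=> mn nw hw w0 W0 m1 m2 m3 h1 h2 h3.
pose H1 x := `|W x * F1 x|; pose H2 x := `|W x * F2 x|; pose H3 x := `|W x * F3 x|.
have k1 : sqi mu H1 by exact: sqi_abs.
have k2 : sqi mu H2 by exact: sqi_abs.
have k3 : sqi mu H3 by exact: sqi_abs.
pose J (A B C : R -> R) := fun z : R * R => (w z.1 * A z.1) * B z.2 * C (- (z.1 + z.2)).
have key A B C : sqi mu A -> sqi mu B -> sqi mu C ->
   (forall x, 0 <= A x) -> (forall x, 0 <= B x) -> (forall x, 0 <= C x) ->
   itg mu2 (J A B C) /\ I2 (J A B C) <= N w * (N A * N B * N C).
  move=> hA hB hC A0 B0 C0.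
  have [i1 i2] := tri_young (sqi_mul hw hA) hB hC; split => //.
  have -> : I2 (J A B C) =
     I2 (fun z => `|(w z.1 * A z.1) * B z.2 * C (- (z.1 + z.2))|).
    by apply: eqI => z; rewrite ger0_norm// !mulr_ge0.
  apply: le_trans i2 _; rewrite !mulrA -mulrA -[leRHS]mulrA.
  by apply: ler_wpM2r; [rewrite mulr_ge0 ?nrm2_ge0|exact: nrm2_CS].
have H0 (F : R -> R) x : 0 <= `|W x * F x| by [].
have [a1 b1] := key _ _ _ k1 k2 k3 (H0 F1) (H0 F2) (H0 F3).
have [a2 b2] := key _ _ _ k2 k3 k1 (H0 F2) (H0 F3) (H0 F1).
have [a3 b3] := key _ _ _ k3 k1 k2 (H0 F3) (H0 F1) (H0 F2).
have a2' := itg_rot3 a2; have a3' := itg_rot3 (itg_rot3 a3).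
pose D z := J H1 H2 H3 z + J H2 H3 H1 (rot3 z) + J H3 H1 H2 (rot3 (rot3 z)).
have Di : itg mu2 D by apply: itgD => //; exact: itgD.
have nD z : `|tri_kernel n F1 F2 F3 z| <= D z.
  case: z => a b; rewrite /D /J /rot3 /tri_kernel /=.
  rewrite (_ : - (b + - (a + b)) = a); last by ring.
  rewrite (_ : - (- (a + b) + a) = b); last by ring.
  rewrite normrM; apply: le_trans (ler_wpM2r (normr_ge0 _) (nw a b)) _.
  by rewrite /H1 /H2 /H3 !normrM !(ger0_norm (W0 _)) le_eqVlt; apply/orP; left; apply/eqP; ring.
have mk : mea (tri_kernel n F1 F2 F3) by rewrite /tri_kernel; solve_mea.
have ki : itg mu2 (tri_kernel n F1 F2 F3) := itg_le (m := mu2) mk nD Di.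
split => //; apply: le_trans (I_le (itg_abs ki) Di nD) _.
rewrite /D (ID (itgD a1 a2') a3') (ID a1 a2') (I2_rot3 a2).
rewrite (@I2_rot3 _ (fun z => J H3 H1 H2 (rot3 z)))//; last exact: itg_rot3.
rewrite (I2_rot3 a3).
rewrite -!(nrm2_abs mu (fun x => W x * _ x)) -/H1 -/H2 -/H3.
move: b1 b2 b3; rewrite -/H1 -/H2 -/H3.
set X := N w * (N H1 * N H2 * N H3) => b1 b2 b3.
have -> : 3 * N w * (N H1 * N H2 * N H3) = X + X + X by rewrite /X; ring.
apply: lerD; first apply: lerD => //.
  by apply: le_trans b2 _; rewrite /X le_eqVlt; apply/orP; left; apply/eqP; ring.
by apply: le_trans b3 _; rewrite /X le_eqVlt; apply/orP; left; apply/eqP; ring.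
Qed.

End trilinear.

(** * The Japanese bracket *)

Section japanese_bracket.
Variable R : realType.
Local Notation mu := (@lebesgue_measure R).
Local Notation "'I' f" := (Rintegral mu [set: _] f) (at level 10, f at level 8).
Local Notation J := (@japanese R).
Implicit Types x y p r : R.

Lemma japanese_sqr x : J x ^+ 2 = 1 + x ^+ 2.
Proof. by rewrite sqr_sqrtr// addr_ge0// sqr_ge0. Qed.

Lemma japanese_ge1 x : 1 <= J x.
Proof. by rewrite -[X in X <= _]sqrtr1 ler_sqrt ?addr_ge0 ?sqr_ge0// lerDl sqr_ge0. Qed.

Lemma japanese_gt0 x : 0 < J x.
Proof. exact: lt_le_trans (japanese_ge1 x). Qed.

Lemma japanese_ge_norm x : `|x| <= J x.
Proof.
rewrite -(ler_pXn2r (n:=2))// ?nnegrE//; last exact: ltW (japanese_gt0 x).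
by rewrite japanese_sqr real_normK ?num_real// lerDr.
Qed.

Lemma japanese_le1D x : J x <= 1 + `|x|.
Proof.
rewrite -(ler_pXn2r (n:=2))// ?nnegrE ?addr_ge0//; last exact: ltW (japanese_gt0 x).
rewrite japanese_sqr -(real_normK (num_real x)); have := normr_ge0 x; nra.
Qed.

Lemma japanese_mono x y : `|x| <= `|y| -> J x <= J y.
Proof.
move=> h; rewrite ler_sqrt; last by rewrite addr_ge0 ?sqr_ge0.
rewrite lerD2l -(real_normK (num_real x)) -(real_normK (num_real y)).
by rewrite ler_sqr ?nnegrE.
Qed.

Lemma japaneseN x : J (- x) = J x.
Proof. by rewrite /japanese sqrrN. Qed.

Lemma japaneseD x y : J (x + y) <= J x + J y.
Proof.
rewrite -(ler_pXn2r (n:=2))// ?nnegrE ?addr_ge0// ?(ltW (japanese_gt0 _))//.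
have : `|x * y| <= J x * J y.
  by rewrite normrM; apply: ler_pM => //; exact: japanese_ge_norm.
move=> /(le_trans (ler_norm _)); have := japanese_sqr x; have := japanese_sqr y.
by have := japanese_sqr (x + y); nra.
Qed.

Lemma mea_japanese_powR p : mea (fun x => J x `^ p).
Proof.
apply: (@mea_comp _ _ _ (fun x => x `^ p)); first exact: measurable_powR.
apply: continuous_measurable_fun => x.
apply: (@continuous_comp _ _ _ (fun x : R => 1 + x ^+ 2) Num.sqrt).
  by apply: cvgD; [exact: cvg_cst|exact: exprn_continuous].
exact: sqrt_continuous.
Qed.

Lemma contraction_step (q K C : R) : 0 < q -> K <= C -> C * (1 - 2 * q) = 4 ->
  4 + 2 * q * K <= C.
Proof. by move=> q0 KC h; nra. Qed.

(** By self-similarity the integral K_n over |x| <= 2^n satisfies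
    K_(n+1) <= 4 + 2^(1-p) K_n, hence stays bounded. *)
Lemma itg_max_powR p : 1 < p -> itg mu (fun x => Num.max 1 `|x| `^ (- p)).
Proof.
move=> p1; pose g x := Num.max 1 `|x| `^ (- p).
have mg : mea g.
  apply: (@mea_comp _ _ _ (fun x => x `^ (- p))); first exact: measurable_powR.
  by apply: measurable_maxr; [exact: mea_cst|apply: mea_abs; exact: mea_id].
have g0 x : 0 <= g x by exact: powR_ge0.
have M1 x : 1 <= Num.max 1 `|x| by rewrite le_max lexx.
have M0 x : 0 < Num.max 1 `|x| by exact: lt_le_trans (M1 x).
have g1 x : g x <= 1.
  rewrite /g powRN invf_le1 ?powR_gt0//.
  by rewrite -[leLHS](powRr0 (Num.max 1 `|x|)); apply: ler_powR => //; lra.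
pose B r := \1_(`[- r, r]%classic) : R -> R.
have mB r : mea (B r) by apply: mea_indic; exact: measurable_itv.
have Bi r : itg mu (B r) by exact: integrable_indic_itv.
have BE r x : B r x = if `|x| <= r then 1 else 0.
  by rewrite /B indicE mem_setE /= in_itv /= -ler_norml; case: ifP.
have IB1 : I (B 1) = 2.
  apply: EFin_inj; rewrite (IE (Bi 1)) integral_indic//= setIT lebesgue_measure_itv/=.
  by rewrite lte_fin (_ : -1 < 1 :> R); [rewrite -EFinD; congr EFin; lra|lra].
pose F k x := B (2 ^+ k) x * g x.
have mF k : mea (F k) by apply: meaM.
have Fi k : itg mu (F k).
  apply: itg_le (Bi (2 ^+ k)) => [|x]; first exact: mF.
  rewrite /F /= BE; case: ifP => _; last by rewrite mul0r normr0.
  by rewrite mul1r ger0_norm.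
pose q : R := 2 `^ (- p).
have q0 : 0 < q by exact: powR_gt0.
have q1 : 2 * q < 1.
  rewrite /q powRN -ltr_pdivlMr ?invr_gt0 ?powR_gt0// mul1r invrK -[ltLHS]powRr1//.
  by rewrite /powR pnatr_eq0/= ltr_expR ltr_pM2r// ln_gt0// ltr1n.
have step k : I (F k.+1) <= 4 + 2 * q * I (F k).
  have -> : I (F k.+1) = 2 * I (fun x => F k.+1 (2 * x)).
    by rewrite I_scale// mulrA divff ?mul1r.
  have -> : 4 + 2 * q * I (F k) = 2 * I (fun x => B 1 x + q * F k x).
    by rewrite (ID (Bi 1) (itgZ q (Fi k))) IZ// IB1; ring.
  rewrite ler_pM2l//; apply: I_le; [exact: itg_scale|by apply: itgD; last exact: itgZ|].
  move=> x; rewrite /F /= !BE normrM (ger0_norm (_ : 0 <= 2 :> R))// exprS ler_pM2l//.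
  case: ifP => xk; last by rewrite !mul0r mulr0 addr0; case: ifP.
  rewrite !mul1r; have [x1|x1] := lerP `|x| 1.
    by apply: le_trans (g1 _) _; rewrite lerDl mulr_ge0// ltW.
  rewrite add0r /g normrM (ger0_norm (_ : 0 <= 2 :> R))//.
  rewrite !max_r; [by rewrite powRM|exact: ltW|].
  by have := normr_ge0 x; lra.
have bound k : I (F k) <= 4 / (1 - 2 * q).
  have h : 4 / (1 - 2 * q) * (1 - 2 * q) = 4 by rewrite divfK// gt_eqF// subr_gt0.
  have D0 : 2 <= 4 / (1 - 2 * q).
    by rewrite ler_pdivlMr ?subr_gt0//; move: (q) q0 q1 => q' q0' q1'; lra.
  elim: k => [|k ih].
    apply: le_trans D0; rewrite -IB1; apply: I_le => [||x]; [exact: Fi|exact: Bi|rewrite /F /= expr0 BE].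
    by case: ifP => _; rewrite ?mul0r// mul1r.
  apply: le_trans (step k) _; exact: contraction_step ih h.
have [] := @fatou_bound _ _ _ mu F g _ mF mg _ Fi bound => //.
  by move=> k x; rewrite /F mulr_ge0// BE; case: ifP.
apply: aeW => x; apply: cvg_near_cst.
have [N hN] : exists N, `|x| <= 2 ^+ N.
  exists (Num.truncn `|x|).+1; apply: ltW; apply: lt_le_trans (truncnS_gt `|x|) _.
  by rewrite -natrX ler_nat ltnW// ltn_expl.
near=> k; rewrite /F /= BE (_ : `|x| <= 2 ^+ k) ?mul1r//.
apply: le_trans hN _; rewrite ler_weXn2l ?ler1n//; near: k; exact: nbhs_infty_ge.
Unshelve. all: by end_near. Qed.

Lemma itg_japanese p : 1 < p -> itg mu (fun x => J x `^ (- p)).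
Proof.
move=> p1; apply: itg_le (itg_max_powR p1); first exact: mea_japanese_powR.
move=> x; rewrite ger0_norm ?powR_ge0// !powRN.
have h1 : 0 < Num.max 1 `|x| by apply: lt_le_trans ltr01 _; rewrite le_max lexx.
have h0 := ltW h1.
rewrite lef_pV2 ?posrE ?powR_gt0 ?japanese_gt0//.
apply: ge0_ler_powR; rewrite ?nnegrE//; first by lra.
  exact: ltW (japanese_gt0 x).
by rewrite ge_max japanese_ge1 japanese_ge_norm.
Qed.

Lemma sqi_japanese r : 1 / 2 < r -> sqi mu (fun x => J x `^ (- r)).
Proof.
move=> r1; split; first exact: mea_japanese_powR.
have h : 1 < r * 2 by lra.
apply: eq_itg (itg_japanese h) => x.
by rewrite -powR_mulrn ?powR_ge0// -powRrM mulNr.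
Qed.

End japanese_bracket.

(** * Domination of the symbol by one-variable weights *)

Section weights.
Variable R : realType.
Local Notation J := (@japanese R).

(** Properties of the two symbols shared by both sets of assumptions, with
    mt = m - m(0). *)
Record symbols (s s' : R) (mt : R -> R) (n : R * R -> R) : Prop := {
  sy_s : 0 < s ;
  sy_s' : 1 / 2 < s' ;
  sy_mc : continuous mt ;
  sy_m0 : forall x, 0 <= mt x ;
  sy_me : forall x, mt (- x) = mt x ;
  sy_m : exists c1 c2 : R, [/\ 0 < c1, 0 < c2,
     forall x, 1 <= `|x| -> c1 * `|x| `^ s <= mt x <= c2 * `|x| `^ s &
     forall x, `|x| < 1 -> c1 * `|x| `^ s' <= mt x <= c2 * `|x| `^ s'] ;
  sy_nc : continuous n ;
  sy_ne : forall a b, n (- a, - b) = n (a, b) ;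
  sy_nrot : forall a b, n (a, b) = n (b, - (a + b)) ;
  sy_n0 : 0 < n (0, 0) ;
  sy_n : exists r1 r2 r3 C : R,
    [/\ 0 < C, r1 < s / 2, r2 < s / 2 & r3 < s / 2] /\ r1 + r2 + r3 < s - 1 / 2 /\
    forall a b c, a + b + c = 0 -> `|n (a, b)| <= C *
      (J a `^ r1 * J b `^ r2 * J c `^ r3 + J b `^ r1 * J c `^ r2 * J a `^ r3 +
       J c `^ r1 * J a `^ r2 * J b `^ r3) }.

Lemma mul3_le (a b c a' b' c' : R) : 0 <= a -> 0 <= b -> 0 <= c ->
  a <= a' -> b <= b' -> c <= c' -> a * b * c <= a' * b' * c'.
Proof. by move=> *; apply: ler_pM => //; [exact: mulr_ge0|exact: ler_pM]. Qed.

(** A product of radially decreasing factors at three points is largest when all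
    are evaluated at the point nearest the origin. *)
Lemma decreasing_product_le (p1 p2 p3 : R -> R) :
  (forall x, [/\ 0 <= p1 x, 0 <= p2 x & 0 <= p3 x]) ->
  (forall x y, `|x| <= `|y| -> [/\ p1 y <= p1 x, p2 y <= p2 x & p3 y <= p3 x]) ->
  forall a b c, p1 a * p2 b * p3 c <=
    p1 a * p2 a * p3 a + p1 b * p2 b * p3 b + p1 c * p2 c * p3 c.
Proof.
move=> p0 pd a b c; pose w x := p1 x * p2 x * p3 x; rewrite -!/(w _).
have w0 x : 0 <= w x by have [? ? ?] := p0 x; rewrite /w !mulr_ge0.
have near0 x : `|x| <= `|a| -> `|x| <= `|b| -> `|x| <= `|c| -> p1 a * p2 b * p3 c <= w x.
  move=> /pd[h1 _ _] /pd[_ h2 _] /pd[_ _ h3].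
  by have [? _ _] := p0 a; have [_ ? _] := p0 b; have [_ _ ?] := p0 c; exact: mul3_le.
have := w0 a; have := w0 b; have := w0 c.
have [ab|/ltW ba] := leP `|a| `|b|.
  have [ac|/ltW ca] := leP `|a| `|c|.
    by have := near0 a (lexx _) ab ac; lra.
  by have := near0 c ca (le_trans ca ab) (lexx _); lra.
have [bc|/ltW cb] := leP `|b| `|c|.
  by have := near0 b ba (lexx _) bc; lra.
by have := near0 c (le_trans cb ba) cb (lexx _); lra.
Qed.

(** Each J^(r i) is at most psi i times W, and the product of the decreasing
    psi i is controlled by its values at the point nearest the origin. *)
Lemma dominated_product (n : R * R -> R) (p1 p2 p3 W : R -> R) (r1 r2 r3 C : R) : 0 < C ->
  (forall a b c, a + b + c = 0 -> `|n (a, b)| <= C *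
      (J a `^ r1 * J b `^ r2 * J c `^ r3 + J b `^ r1 * J c `^ r2 * J a `^ r3 +
       J c `^ r1 * J a `^ r2 * J b `^ r3)) ->
  (forall x, 0 <= W x) ->
  (forall x, [/\ 0 <= p1 x, 0 <= p2 x & 0 <= p3 x]) ->
  (forall x y, `|x| <= `|y| -> [/\ p1 y <= p1 x, p2 y <= p2 x & p3 y <= p3 x]) ->
  (forall x, [/\ J x `^ r1 <= p1 x * W x, J x `^ r2 <= p2 x * W x &
    J x `^ r3 <= p3 x * W x]) ->
  dominated_symbol n (fun x => 3 * C * (p1 x * p2 x * p3 x)) W.
Proof.
move=> C0 nb W0 p0 pd pW a b; pose c := - (a + b).
have c0 : a + b + c = 0 by rewrite /c subrr.
apply: le_trans (nb a b c c0) _; rewrite -/c; pose w x := p1 x * p2 x * p3 x.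
have one x y z : J x `^ r1 * J y `^ r2 * J z `^ r3 <=
    (w x + w y + w z) * (W x * W y * W z).
  have [h1 _ _] := pW x; have [_ h2 _] := pW y; have [_ _ h3] := pW z.
  apply: le_trans (mul3_le _ _ _ h1 h2 h3) _; rewrite ?powR_ge0//.
  have := decreasing_product_le p0 pd x y z; rewrite -!/(w _) => h.
  have -> : p1 x * W x * (p2 y * W y) * (p3 z * W z) =
    (p1 x * p2 y * p3 z) * (W x * W y * W z) by ring.
  by apply: ler_wpM2r => //; rewrite !mulr_ge0.
have h1 := one a b c; have h2 := one b c a; have h3 := one c a b.
have -> : (3 * C * (p1 a * p2 a * p3 a) + 3 * C * (p1 b * p2 b * p3 b) +
  3 * C * (p1 c * p2 c * p3 c)) * (W a * W b * W c) =
  C * ((w a + w b + w c) * (W a * W b * W c) + (w b + w c + w a) * (W b * W c * W a)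
   + (w c + w a + w b) * (W c * W a * W b)) by rewrite /w; ring.
by rewrite ler_pM2l//; apply: lerD => //; exact: lerD.
Qed.

Lemma exponent_choice (a1 a2 a3 t : R) : 0 < a1 -> 0 < a2 -> 0 < a3 -> 0 < t ->
  t + 1 / 2 < a1 + a2 + a3 ->
  exists d1 d2 d3 : R, [/\ [/\ 0 <= d1, 0 <= d2 & 0 <= d3],
   [/\ d1 <= a1, d2 <= a2 & d3 <= a3], [/\ d1 <= t, d2 <= t & d3 <= t],
   t < d1 + d2 + d3 & 1 / 2 < a1 + a2 + a3 - (d1 + d2 + d3)].
Proof.
move=> a10 a20 a30 t0 h.
have mP (a : R) : 0 < a -> exists m : R, [/\ 0 < m, m <= a, m <= t & m = a \/ m = t].
  by move=> a0; have [le|/ltW ge] := leP a t; [exists a|exists t]; split => //; [left|right].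
have [m1 [p1 q1 u1 e1]] := mP _ a10; have [m2 [p2 q2 u2 e2]] := mP _ a20.
have [m3 [p3 q3 u3 e3]] := mP _ a30.
have mt_ : t < m1 + m2 + m3 by case: e1 => e1; case: e2 => e2; case: e3 => e3; lra.
pose M := m1 + m2 + m3; pose e := Num.min (M - t) ((a1 + a2 + a3 - t - 1 / 2) / 2).
have M0 : 0 < M by rewrite /M; lra.
have e0 : 0 < e by rewrite lt_min /M; apply/andP; split; lra.
have eM : e <= M - t by rewrite ge_min lexx.
have ea : e <= (a1 + a2 + a3 - t - 1 / 2) / 2 by rewrite ge_min lexx orbT.
pose th := (t + e) / M; have th0 : 0 < th by rewrite divr_gt0//; lra.
have th1 : th <= 1 by rewrite ler_pdivrMr//; lra.
have thM : th * m1 + th * m2 + th * m3 = t + e by rewrite -!mulrDr -/M /th divfK// gt_eqF.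
exists (th * m1), (th * m2), (th * m3); rewrite thM.
by split; [split|split|split| |]; try nra; lra.
Qed.

Variables (s s' : R) (mt : R -> R) (n : R * R -> R).
Hypothesis S : symbols s s' mt n.

Lemma japanese_lt1 x : `|x| < 1 -> J x <= 2.
Proof. by move=> h; apply: le_trans (japanese_le1D x) _; lra. Qed.

Lemma japanese_gt1 x : 1 <= `|x| -> J x <= 2 * `|x|.
Proof. by move=> h; apply: le_trans (japanese_le1D x) _; lra. Qed.

Lemma japanese_powR_lt1 x p : 0 <= p -> `|x| < 1 -> J x `^ p <= 2 `^ p.
Proof.
by move=> p0 h; apply: ge0_ler_powR; rewrite ?nnegrE ?japanese_lt1// ltW ?japanese_gt0.
Qed.

Lemma japanese_powR_gt1 x p : 0 <= p -> 1 <= `|x| -> J x `^ p <= 2 `^ p * `|x| `^ p.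
Proof.
move=> p0 h; rewrite -powRM//.
apply: ge0_ler_powR; rewrite ?nnegrE ?japanese_gt1 ?mulr_ge0//.
by rewrite ltW ?japanese_gt0.
Qed.

Lemma weight_high : exists2 c, 0 < c & forall t x, 1 <= t -> J x `^ s <= c * (t + mt x).
Proof.
have [c1 [c2 [c10 c20 hi lo]]] := sy_m S.
have s0 := ltW (sy_s S); have q0 : 0 < 2 `^ s :> R by exact: powR_gt0.
exists (2 `^ s * (1 + c1^-1)); first by rewrite mulr_gt0// addr_gt0// invr_gt0.
move=> t x t1; have m0 := sy_m0 S x; have i0 : 0 < c1^-1 by rewrite invr_gt0.
have [x1|x1] := lerP 1 `|x|.
  apply: le_trans (japanese_powR_gt1 s0 x1) _; rewrite -mulrA ler_pM2l//.
  have /andP[h _] := hi x x1; have : `|x| `^ s <= c1^-1 * mt x by rewrite ler_pdivlMl.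
  by nra.
apply: le_trans (japanese_powR_lt1 s0 x1) _; rewrite -mulrA ler_peMr ?(ltW q0)//; nra.
Qed.

Definition low_profile (t x : R) : R := t + Num.min 1 `|x| `^ s'.

Lemma weight_low : exists2 c, 0 < c & forall t x, 0 < t -> t <= 1 ->
  J x `^ s * low_profile t x <= c * (t + mt x).
Proof.
have [c1 [c2 [c10 c20 hi lo]]] := sy_m S.
have s0 := ltW (sy_s S); have q0 : 0 < 2 `^ s :> R by exact: powR_gt0.
exists (2 `^ s * (2 + 2 * c1^-1)).
  by rewrite mulr_gt0// addr_gt0// mulr_gt0// invr_gt0.
move=> t x t0 t1; have m0 := sy_m0 S x; have i0 : 0 < c1^-1 by rewrite invr_gt0.
rewrite /low_profile; have [x1|x1] := lerP 1 `|x|.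
  rewrite powR1 -mulrA.
  apply: le_trans (ler_wpM2r _ (japanese_powR_gt1 s0 x1)) _; first by lra.
  rewrite -mulrA ler_pM2l//.
  have /andP[h _] := hi x x1; have : `|x| `^ s <= c1^-1 * mt x by rewrite ler_pdivlMl.
  by have := powR_ge0 `|x| s; nra.
have /andP[h _] := lo x x1; have hx : `|x| `^ s' <= c1^-1 * mt x by rewrite ler_pdivlMl.
rewrite -mulrA; apply: ler_pM; rewrite ?powR_ge0 ?addr_ge0 ?powR_ge0 ?(ltW t0)//.
  exact: japanese_powR_lt1.
by nra.
Qed.

Lemma inv3_le (u v q : R) : 0 < u -> 0 < v -> 0 < q -> v <= q * u ->
  u ^- 3 <= q ^+ 3 * v ^- 3.
Proof.
move=> u0 v0 q0 h; rewrite ler_pdivlMr ?exprn_gt0// ler_pdivrMl ?exprn_gt0//.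
by rewrite mulrC -exprMn lerXn2r// nnegrE ?mulr_ge0// ltW.
Qed.

(** Rescaling x = t^(1/s') y turns the low frequencies into t^(1/s' - 3) times
    an integral that converges because 3 s' > 1; frequencies beyond 1
    contribute a bounded amount. *)
Lemma low_profile_itg (p : R) : 1 < p -> exists2 C, 0 < C & forall t, 0 < t -> t <= 1 ->
  let g x := low_profile t x ^- 3 * J x `^ (- p) in
  itg (@lebesgue_measure R) g /\
  Rintegral (@lebesgue_measure R) setT g <= C * t `^ (s'^-1 - 3).
Proof.
move=> p1; have s'0 : 0 < s' by have := sy_s' S; lra.
pose G (x : R) : R := (1 + `|x| `^ s') ^- 3.
have mabs : mea (fun x : R => `|x| `^ s').
  apply: (@mea_comp _ _ _ (fun x => x `^ s')); first exact: measurable_powR.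
  by apply: mea_abs; exact: mea_id.
have d0 (x : R) : 0 < 1 + `|x| `^ s' by rewrite ltr_pwDl ?powR_ge0.
have minv (f : R -> R) : mea f -> (forall x, 0 < f x) -> mea (fun x => f x ^- 3).
  move=> mf f0; under eq_fun do rewrite -powR_invn ?(ltW (f0 _))//.
  by apply: (@mea_comp _ _ _ (fun x => x `^ (- 3%:R))); first exact: measurable_powR.
have Gi : itg (@lebesgue_measure R) G.
  have q1 : 1 < s' * 3 by have := sy_s' S; lra.
  have q0 : 0 < 2 `^ s' :> R by exact: powR_gt0.
  apply: itg_le (itgZ ((2 `^ s') ^+ 3) (itg_japanese q1)).
    by apply: minv => //; apply: meaD => //; exact: mea_cst.
  move=> x; rewrite ger0_norm ?invr_ge0 ?exprn_ge0 ?(ltW (d0 _))//.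
  rewrite powRN powRrM powR_mulrn ?powR_ge0//.
  apply: inv3_le => //; first by rewrite powR_gt0 ?japanese_gt0.
  have [x1|x1] := lerP 1 `|x|.
    apply: le_trans (japanese_powR_gt1 (ltW s'0) x1) _; rewrite ler_pM2l//; lra.
  apply: le_trans (japanese_powR_lt1 (ltW s'0) x1) _; rewrite ler_peMr ?(ltW q0)//.
  by rewrite lerDl powR_ge0.
have Ji := itg_japanese p1.
pose A := Rintegral (@lebesgue_measure R) setT G.
pose B := Rintegral (@lebesgue_measure R) setT (fun x => J x `^ (- p)).
have A0 : 0 <= A by apply: I_ge0 => x; rewrite invr_ge0 exprn_ge0// ltW.
have B0 : 0 <= B by apply: I_ge0 => x; exact: powR_ge0.
exists (A + B + 1); first by rewrite ltr_wpDl ?addr_ge0.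
move=> t t0 t1 g; pose e := t `^ (- s'^-1); pose k := t `^ (s'^-1 - 3).
have e0 : 0 < e by exact: powR_gt0.
have k1 : 1 <= k.
  rewrite /k -[leLHS](powRr0 t) ger_powR ?t0 ?t1//.
  have : s'^-1 <= 2 by rewrite invf_ple ?posrE//; have := sy_s' S; lra.
  by lra.
have kE : t ^- 3 * e^-1 = k.
  rewrite /k /e powRN invrK -powR_invn ?(ltW t0)// -powRD; first by congr powR; rewrite addrC.
  by rewrite (gt_eqF t0) implybT.
have P0 x : 0 < low_profile t x by rewrite /low_profile ltr_pwDl ?powR_ge0.
have mg : mea g.
  apply: meaM; last exact: mea_japanese_powR.
  apply: minv => //; apply: meaD; first exact: mea_cst.
  apply: (@mea_comp _ _ _ (fun x => x `^ s')); first exact: measurable_powR.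
  by apply: measurable_minr; [exact: mea_cst|apply: mea_abs; exact: mea_id].
have hi := itgD (itgZ (t ^- 3) (itg_scale e0 Gi)) (itgZ k Ji).
have gle x : `|g x| <= t ^- 3 * G (e * x) + k * J x `^ (- p).
  have Jp0 : 0 <= J x `^ (- p) by exact: powR_ge0.
  have Jp1 : J x `^ (- p) <= 1.
    rewrite powRN invf_le1 ?powR_gt0 ?japanese_gt0// -[leLHS](powRr0 (J x)).
    by rewrite ler_powR ?japanese_ge1//; lra.
  have ge0 : 0 <= g x by rewrite mulr_ge0// invr_ge0 exprn_ge0// ltW.
  have G0 : 0 <= t ^- 3 * G (e * x).
    by rewrite mulr_ge0// invr_ge0 exprn_ge0// ltW.
  rewrite ger0_norm// /g; have [x1|x1] := lerP 1 `|x|.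
    apply: (@le_trans _ _ (k * J x `^ (- p))); last by rewrite lerDr.
    apply: ler_wpM2r => //; apply: le_trans k1.
    rewrite invf_le1 ?exprn_gt0// exprn_ege1// /low_profile min_l// powR1; lra.
  apply: (@le_trans _ _ (t ^- 3 * G (e * x))); last by rewrite lerDl mulr_ge0 ?(le_trans _ k1).
  have -> : low_profile t x ^- 3 = t ^- 3 * G (e * x).
    rewrite /low_profile min_r ?ltW// /G normrM (gtr0_norm e0) powRM ?(ltW e0)//.
    rewrite /e -powRrM mulNr mulVf ?gt_eqF// powR_inv1 ?(ltW t0)//.
    rewrite -invfM -exprMn; congr ((_ ^+ 3)^-1); field; exact: lt0r_neq0.
  by rewrite ler_piMr.
split; first exact: (itg_le (m := lebesgue_measure) mg gle hi).
have hb := I_abs_le (m := @lebesgue_measure R) mg hi gle.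
apply: le_trans (ler_norm _) _; apply: (le_trans hb).
rewrite (ID (itgZ _ (itg_scale e0 Gi)) (itgZ k Ji)) (IZ _ (itg_scale e0 Gi)) (IZ _ Ji).
rewrite I_scale// -/A -/B mulrA kE; rewrite -/k.
by rewrite !mulrDl mul1r (mulrC A) (mulrC B); have := k1; lra.
Qed.

(** Geometric mean of the two lower bounds t and J^s for t + mt. *)
Lemma weight_interp : exists ch : R, 0 < ch /\ forall t x d, 1 <= t -> 0 <= d ->
  d <= s / 2 -> t `^ (d / s) * J x `^ (s / 2 - d) <= ch * Num.sqrt (t + mt x).
Proof.
have [c c0 hc] := weight_high; have s0 := sy_s S.
exists (Num.sqrt (c + 1)); split; first by rewrite sqrtr_gt0; lra.
move=> t x d t1 d0 dsl; have t0 : 0 < t by lra.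
have m0 := sy_m0 S x; have J0 := japanese_gt0 x.
rewrite -sqrtrM; last by lra.
rewrite -(ler_pXn2r (n:=2))// ?nnegrE ?mulr_ge0 ?powR_ge0 ?sqrtr_ge0//.
rewrite sqr_sqrtr; last by rewrite mulr_ge0; lra.
rewrite exprMn -!powR_mulrn ?powR_ge0// -!powRrM.
pose th := d / s * 2%:R; have th0 : 0 <= th by rewrite /th !mulr_ge0// invr_ge0 ltW.
have th1 : th <= 1 by rewrite /th mulrAC ler_pdivrMr//; lra.
have -> : J x `^ ((s / 2 - d) * 2%:R) = (J x `^ s) `^ (1 - th).
  by rewrite -powRrM; congr powR; rewrite /th; field; exact: lt0r_neq0.
rewrite -/th; pose M := Num.max t (J x `^ s).
have M0 : 0 < M by rewrite /M lt_max t0.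
apply: (@le_trans _ _ (M `^ th * M `^ (1 - th))).
  apply: ler_pM; rewrite ?powR_ge0//; apply: ge0_ler_powR;
    rewrite ?nnegrE ?(ltW M0) ?(ltW t0) ?powR_ge0 ?subr_ge0// /M le_max lexx ?orbT//.
rewrite -powRD ?(gt_eqF M0) ?implybT// addrC subrK powRr1 ?(ltW M0)//.
rewrite /M ge_max; have := hc t x t1; nra.
Qed.

(** The power of t lost in the trilinear bound: low frequencies decide for
    t <= 1, the decay of the symbol relative to J^(3 s / 2) for t >= 1. *)
Definition gain (g t : R) := if t <= 1 then t `^ ((s'^-1 - 3) / 2) else t `^ (- g).

(** Low frequencies fix the exponent for t <= 1. For
    t >= 1 the factors t^(-d_i/s), with sum of d_i larger than s/2, come from the
    strict inequalities between the r_i and s: each d_i is at most min(s/2 - r_i, s/2),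
    and the leftover decay s/2 - r_i - d_i stays square integrable. *)
Lemma symbol_energy_dominated : exists C g : R, [/\ 0 < C, 1 / 2 < g &
  forall t, 0 < t -> exists w, [/\ sqi (@lebesgue_measure R) w, forall x, 0 <= w x,
    nrm2 (@lebesgue_measure R) w <= C * gain g t &
    dominated_symbol n w (fun x => Num.sqrt (t + mt x))]].
Proof.
have [r1 [r2 [r3 [C [[C0 h1 h2 h3] [hs nb]]]]]] := sy_n S.
have s0 := sy_s S; have s'0 : 0 < s' by have := sy_s' S; lra.
have [cl cl0 hcl] := weight_low.
have [d1 [d2 [d3 [[d10 d20 d30] [d1a d2a d3a] [d1s d2s d3s] ds as_]]]] :
  exists d1 d2 d3 : R, [/\ [/\ 0 <= d1, 0 <= d2 & 0 <= d3],
   [/\ d1 <= s / 2 - r1, d2 <= s / 2 - r2 & d3 <= s / 2 - r3],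
   [/\ d1 <= s / 2, d2 <= s / 2 & d3 <= s / 2], s / 2 < d1 + d2 + d3 &
   1 / 2 < (s / 2 - r1) + (s / 2 - r2) + (s / 2 - r3) - (d1 + d2 + d3)].
  by apply: exponent_choice; lra.
have [ch [ch0 hch]] := weight_interp.
pose al := (s / 2 - r1) + (s / 2 - r2) + (s / 2 - r3).
have al1 : 1 < al * 2 by rewrite /al; lra.
have [Cp Cp0 hCp] := low_profile_itg al1.
pose sg := al - (d1 + d2 + d3); have sg1 : 1 / 2 < sg by rewrite /sg /al; lra.
pose K1 := 3 * C * Num.sqrt cl ^+ 3; pose K2 := 3 * C * ch ^+ 3.
have K10 : 0 <= K1 by rewrite /K1 !mulr_ge0 ?exprn_ge0 ?sqrtr_ge0// ltW.
have K20 : 0 <= K2 by rewrite /K2 !mulr_ge0 ?exprn_ge0// ltW.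
pose NJ := nrm2 (@lebesgue_measure R) (fun x => J x `^ (- sg)).
have NJ0 : 0 <= NJ by exact: nrm2_ge0.
exists (K1 * Num.sqrt Cp + K2 * NJ + 1), ((d1 + d2 + d3) / s); split.
- by rewrite ltr_wpDl// addr_ge0// mulr_ge0// sqrtr_ge0.
- by rewrite ltr_pdivlMr//; lra.
move=> t t0; have W0 x : 0 <= Num.sqrt (t + mt x) by exact: sqrtr_ge0.
have tm0 x : 0 <= t + mt x by rewrite addr_ge0 ?(sy_m0 S)// ltW.
have Jp0 x p : 0 <= J x `^ p by exact: powR_ge0.
have J0 x : 0 < J x := japanese_gt0 x.
have JG x : 0 <= J x := ltW (J0 x).
have JN x y a : 0 <= a -> `|x| <= `|y| -> J y `^ (- a) <= J x `^ (- a).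
  move=> a0 xy; rewrite !powRN lef_pV2 ?posrE ?powR_gt0//.
  apply: ge0_ler_powR; rewrite ?nnegrE ?JG//; exact: japanese_mono.
rewrite /gain; case: (leP t 1) => t1.
  have P0 x : 0 < low_profile t x by rewrite /low_profile ltr_pwDl ?powR_ge0.
  pose L x := (Num.sqrt (low_profile t x))^-1.
  have L0 x : 0 <= L x by rewrite invr_ge0 sqrtr_ge0.
  have Lmono x y : `|x| <= `|y| -> L y <= L x.
    move=> xy; rewrite lef_pV2 ?posrE ?sqrtr_gt0// ler_sqrt ?(ltW (P0 _))// lerD2l.
    apply: ge0_ler_powR; rewrite ?nnegrE ?(ltW s'0) ?le_min ?ler01//=.
    by rewrite ge_min lexx/= ge_min xy orbT.
  pose psi r x := Num.sqrt cl * L x * J x `^ (- (s / 2 - r)).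
  have psi0 r x : 0 <= psi r x by rewrite !mulr_ge0// sqrtr_ge0.
  have psiM r x y : r < s / 2 -> `|x| <= `|y| -> psi r y <= psi r x.
    move=> rs xy; apply: ler_pM; rewrite ?mulr_ge0 ?sqrtr_ge0//.
      by apply: ler_wpM2l; rewrite ?sqrtr_ge0// Lmono.
    by apply: JN => //; lra.
  have psiW r x : J x `^ r <= psi r x * Num.sqrt (t + mt x).
    have -> : J x `^ r = J x `^ (s / 2) * J x `^ (- (s / 2 - r)).
      by rewrite -powRD ?(gt_eqF (J0 x)) ?implybT//; congr powR; ring.
    rewrite /psi mulrAC; apply: ler_wpM2r => //.
    rewrite mulrAC ler_pdivlMr ?sqrtr_gt0// -sqrtrM ?(ltW cl0)//.
    rewrite -(ler_pXn2r (n:=2))// ?nnegrE ?mulr_ge0 ?sqrtr_ge0//.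
    rewrite exprMn !sqr_sqrtr ?(ltW (P0 _)) ?mulr_ge0 ?(ltW cl0)//.
    by rewrite -powR_mulrn// -powRrM divfK ?pnatr_eq0//; exact: hcl.
  have wE x : (3 * C * (psi r1 x * psi r2 x * psi r3 x)) ^+ 2 =
      K1 ^+ 2 * (low_profile t x ^- 3 * J x `^ (- (al * 2))).
    have -> : low_profile t x ^- 3 = (L x ^+ 3) ^+ 2.
      by rewrite -exprM mulnC exprM /L exprVn sqr_sqrtr ?(ltW (P0 _))// exprVn.
    have -> : J x `^ (- (al * 2)) = (J x `^ (- (s / 2 - r1)) * J x `^ (- (s / 2 - r2)) * J x `^ (- (s / 2 - r3))) ^+ 2.
      rewrite -!powRD ?(gt_eqF (J0 x)) ?implybT// -powR_mulrn// -powRrM.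
      by congr powR; rewrite /al; ring.
    by rewrite /psi /K1; ring.
  have [gi gI] := hCp t t0 t1.
  exists (fun x => 3 * C * (psi r1 x * psi r2 x * psi r3 x)); split.
  - split; last by apply: eq_itg (itgZ (K1 ^+ 2) gi) => x; rewrite wE.
    have mpsi r : mea (psi r).
      apply: meaM; last exact: mea_japanese_powR.
      apply: meaM; first exact: mea_cst.
      have -> : L = fun x => low_profile t x `^ (- 2^-1).
        by apply/funext => x; rewrite /L -powR12_sqrt ?(ltW (P0 _))// -powRN.
      apply: (@mea_comp _ _ _ (fun x => x `^ (- 2^-1))); first exact: measurable_powR.
      apply: meaD; first exact: mea_cst.
      apply: (@mea_comp _ _ _ (fun x => x `^ s')); first exact: measurable_powR.
      by apply: measurable_minr; [exact: mea_cst|apply: mea_abs; exact: mea_id].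
    by apply: meaM; [exact: mea_cst|apply: meaM; [apply: meaM|]; exact: mpsi].
  - move=> x; apply: mulr_ge0; first by rewrite mulr_ge0// ltW.
  by apply: mulr_ge0 => //; exact: mulr_ge0.
  - apply: (@le_trans _ _ (K1 * Num.sqrt Cp * t `^ ((s'^-1 - 3) / 2))); last first.
      by apply: ler_wpM2r; rewrite ?powR_ge0//; have := mulr_ge0 K20 NJ0; lra.
    apply: nrm2_le.
      by apply: mulr_ge0; [apply: mulr_ge0 => //; exact: sqrtr_ge0|exact: powR_ge0].
    under eqI do rewrite wE.
    rewrite IZ//; have T2 : (t `^ ((s'^-1 - 3) / 2)) ^+ 2 = t `^ (s'^-1 - 3).
      by rewrite -powR_mulrn ?powR_ge0// -powRrM divfK ?pnatr_eq0.
    have -> : (K1 * Num.sqrt Cp * t `^ ((s'^-1 - 3) / 2)) ^+ 2 = K1 ^+ 2 * (Cp * t `^ (s'^-1 - 3)).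
      by rewrite -T2 -[in RHS](sqr_sqrtr (ltW Cp0)); ring.
    by apply: ler_wpM2l => //; exact: sqr_ge0.
  - apply: dominated_product nb _ _ _ _ => //.
      by move=> x y xy; split; exact: psiM.
pose psi d r x := ch * t `^ (- (d / s)) * J x `^ (- (s / 2 - r - d)).
have psi0 d r x : 0 <= psi d r x by rewrite !mulr_ge0 ?powR_ge0// ltW.
have psiM d r x y : d <= s / 2 - r -> `|x| <= `|y| -> psi d r y <= psi d r x.
  move=> dr xy; apply: ler_wpM2l; first by rewrite mulr_ge0 ?powR_ge0// ltW.
  by apply: JN => //; lra.
have psiW d r x : 0 <= d -> d <= s / 2 -> J x `^ r <= psi d r x * Num.sqrt (t + mt x).
  move=> d0 dsl; have -> : J x `^ r = J x `^ (s / 2 - d) * J x `^ (- (s / 2 - r - d)).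
    by rewrite -powRD ?(gt_eqF (J0 x)) ?implybT//; congr powR; ring.
  rewrite /psi mulrAC; apply: ler_wpM2r => //.
  rewrite mulrAC powRN ler_pdivlMr ?powR_gt0// mulrC.
  by apply: hch => //; exact: ltW.
have wE x : 3 * C * (psi d1 r1 x * psi d2 r2 x * psi d3 r3 x) =
    K2 * t `^ (- ((d1 + d2 + d3) / s)) * J x `^ (- sg).
  have -> : t `^ (- ((d1 + d2 + d3) / s)) = t `^ (- (d1 / s)) * t `^ (- (d2 / s)) * t `^ (- (d3 / s)).
    by rewrite -!powRD ?(gt_eqF t0) ?implybT//; congr powR; rewrite !mulrDl; ring.
  have -> : J x `^ (- sg) = J x `^ (- (s / 2 - r1 - d1)) * J x `^ (- (s / 2 - r2 - d2)) * J x `^ (- (s / 2 - r3 - d3)).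
    by rewrite -!powRD ?(gt_eqF (J0 x)) ?implybT//; congr powR; rewrite /sg /al; ring.
  by rewrite /psi /K2; ring.
exists (fun x => 3 * C * (psi d1 r1 x * psi d2 r2 x * psi d3 r3 x)); split.
- by rewrite (funext wE); apply: sqiZ; exact: sqi_japanese.
- move=> x; apply: mulr_ge0; first by rewrite mulr_ge0// ltW.
  by apply: mulr_ge0 => //; exact: mulr_ge0.
- rewrite (funext wE).
  rewrite nrm2_Z; last exact: sqi_japanese.
  rewrite ger0_norm; last by apply: mulr_ge0 => //; exact: powR_ge0.
  rewrite -/NJ (mulrAC K2).
  apply: ler_wpM2r; rewrite ?powR_ge0//.
  by have := mulr_ge0 K10 (sqrtr_ge0 Cp); lra.
- apply: dominated_product nb _ _ _ _ => //.
    by move=> x y xy; split; exact: psiM.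
  by move=> x; split; exact: psiW.
Qed.

(** As all inequalities between the exponents are strict, the weight can be
    lowered by a small power of J. *)
Lemma symbol_slack_dominated : exists d : R, exists w, [/\ 0 < d,
    sqi (@lebesgue_measure R) w, forall x, 0 <= w x &
    dominated_symbol n w (fun x => J x `^ (- d) * Num.sqrt (1 + mt x))].
Proof.
have [r1 [r2 [r3 [C [[C0 h1 h2 h3] [hs nb]]]]]] := sy_n S.
have s0 := sy_s S; have [ch [ch0 hch]] := weight_interp.
have [d [d0 d1 d2 d3 ds]] : exists d : R, [/\ 0 < d, d <= s / 2 - r1, d <= s / 2 - r2,
    d <= s / 2 - r3 & 1 / 2 < (s / 2 - r1) + (s / 2 - r2) + (s / 2 - r3) - 3 * d].
  pose a := Num.min (s / 2 - r1) (Num.min (s / 2 - r2) (s / 2 - r3)).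
  pose e := ((s / 2 - r1) + (s / 2 - r2) + (s / 2 - r3) - 1 / 2) / 4.
  have a0 : 0 < a by rewrite /a !lt_min; apply/and3P; split; lra.
  have e0 : 0 < e by rewrite /e; lra.
  have a1 : a <= s / 2 - r1 by rewrite /a ge_min lexx.
  have a2 : a <= s / 2 - r2 by rewrite /a ge_min ge_min lexx orbT.
  have a3 : a <= s / 2 - r3 by rewrite /a ge_min ge_min lexx !orbT.
  have eE : e = ((s / 2 - r1) + (s / 2 - r2) + (s / 2 - r3) - 1 / 2) / 4 by [].
  clearbody a e; exists (Num.min a e).
  have m1 : Num.min a e <= a by rewrite ge_min lexx.
  have m2 : Num.min a e <= e by rewrite ge_min lexx orbT.
  by split; rewrite ?lt_min ?a0//; lra.
have J0 x : 0 < J x := japanese_gt0 x.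
have JG x : 0 <= J x := ltW (J0 x).
have Jp0 x p : 0 <= J x `^ p by exact: powR_ge0.
pose psi r x := ch * J x `^ (- (s / 2 - r - d)).
have psi0 r x : 0 <= psi r x by rewrite mulr_ge0// ltW.
pose sg := (s / 2 - r1) + (s / 2 - r2) + (s / 2 - r3) - 3 * d.
have wE x : 3 * C * (psi r1 x * psi r2 x * psi r3 x) = 3 * C * ch ^+ 3 * J x `^ (- sg).
  have -> : J x `^ (- sg) = J x `^ (- (s / 2 - r1 - d)) * J x `^ (- (s / 2 - r2 - d)) * J x `^ (- (s / 2 - r3 - d)).
    by rewrite -!powRD ?(gt_eqF (J0 x)) ?implybT//; congr powR; rewrite /sg; ring.
  by rewrite /psi; ring.
exists d, (fun x => 3 * C * (psi r1 x * psi r2 x * psi r3 x)); split => //.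
- by rewrite (funext wE); apply: sqiZ; exact: sqi_japanese.
- move=> x; apply: mulr_ge0; first by rewrite mulr_ge0// ltW.
  by apply: mulr_ge0 => //; exact: mulr_ge0.
- apply: dominated_product nb _ _ _ _ => //.
  + by move=> x; rewrite mulr_ge0 ?sqrtr_ge0.
  + have psiM r x y : d <= s / 2 - r -> `|x| <= `|y| -> psi r y <= psi r x.
      move=> dr xy; apply: ler_wpM2l; first exact: ltW.
      rewrite !powRN lef_pV2 ?posrE ?powR_gt0//.
      by apply: ge0_ler_powR; rewrite ?nnegrE ?JG ?japanese_mono//; lra.
    by move=> x y xy; split; exact: psiM.
  + have psiW r x : J x `^ r <= psi r x * (J x `^ (- d) * Num.sqrt (1 + mt x)).
      have := hch 1 x 0 (lexx _) (lexx _); rewrite powR1 mul1r subr0 => /(_ (ltW _)) h.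
      have -> : J x `^ r = J x `^ (s / 2) * (J x `^ (- (s / 2 - r - d)) * J x `^ (- d)).
        by rewrite -!powRD ?(gt_eqF (J0 x)) ?implybT//; congr powR; ring.
      have -> : psi r x * (J x `^ (- d) * Num.sqrt (1 + mt x)) = 
        ch * Num.sqrt (1 + mt x) * (J x `^ (- (s / 2 - r - d)) * J x `^ (- d)) by rewrite /psi; ring.
      apply: ler_wpM2r; first by rewrite mulr_ge0.
      by apply: h; lra.
    by move=> x; split.
Qed.

End weights.

(** * Limits along ultrafilters and the Riesz representation *)

Lemma le_of_sqr (R : realDomainType) (x y : R) : 0 <= y -> x ^+ 2 <= y ^+ 2 -> x <= y.
Proof.
move=> y0 h; apply: le_trans (ler_norm x) _.
by rewrite -(ler_pXn2r (n:=2))// ?nnegrE// real_normK ?num_real.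
Qed.

Section ultrafilter_limits.
Variable R : realType.

(** This replaces the extraction of convergent subsequences. *)
Lemma ultra_bounded_cvg (T : Type) (U : set_system T) (x : T -> R) (c : R) :
  UltraFilter U -> (forall k, `|x k| <= c) -> exists l : R, x @ U --> l.
Proof.
move=> UU xc; have := @segment_compact R (- c) c (x @ U).
case=> [|l [_ cl]].
  by apply: (@filterS _ U _ setT); [move=> k _ /=; rewrite in_itv/= -ler_norml|exact: filterT].
exists l => N Nl; rewrite /= nbhs_filterE.
have [//|h] := in_ultra_setVsetC (x @^-1` N) UU.
by have [y [/= ny]] := cl (~` N) N h Nl.
Qed.

End ultrafilter_limits.

Section hilbert.
Variables (R : realType) (V : lmodType R) (B : V -> V -> R).
Hypothesis B_sym : forall x y, B x y = B y x.
Hypothesis B_lin : forall a x y z, B (a *: x + y) z = a * B x z + B y z.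
Hypothesis B_ge0 : forall x, 0 <= B x x.

Lemma formDl x y z : B (x + y) z = B x z + B y z.
Proof. by have := B_lin 1 x y z; rewrite scale1r mul1r. Qed.
Lemma form0l z : B 0 z = 0.
Proof. by have := formDl 0 0 z; rewrite addr0; lra. Qed.
Lemma formZl a x z : B (a *: x) z = a * B x z.
Proof. by have := B_lin a x 0 z; rewrite addr0 form0l addr0. Qed.
Lemma formNl x z : B (- x) z = - B x z.
Proof. by rewrite -scaleN1r formZl mulN1r. Qed.
Lemma formDr x y z : B z (x + y) = B z x + B z y.
Proof. by rewrite !(B_sym z) formDl. Qed.
Lemma formZr a x z : B z (a *: x) = a * B z x.
Proof. by rewrite !(B_sym z) formZl. Qed.
Lemma formNr x z : B z (- x) = - B z x.
Proof. by rewrite !(B_sym z) formNl. Qed.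
Definition formE := (formDl, formDr, formZl, formZr, formNl, formNr).

Lemma form_CS x y : B x y ^+ 2 <= B x x * B y y.
Proof.
apply: quad_disc => // t; have := B_ge0 (x + t *: y).
by rewrite !formE (B_sym y x); lra.
Qed.

Definition form_complete := forall u : nat -> V,
  (forall e, 0 < e -> exists N, forall i j, (N <= i)%N -> (N <= j)%N ->
     B (u i - u j) (u i - u j) <= e) ->
  exists l, forall e, 0 < e -> exists N, forall i, (N <= i)%N -> B (u i - l) (u i - l) <= e.

Hypothesis B_complete : form_complete.

Lemma small_eventually (e : R) : 0 < e -> exists N, forall i, (N <= i)%N -> i.+1%:R^-1 <= e.
Proof.
move=> e0; exists (Num.truncn e^-1) => i Ni.
rewrite invf_ple ?posrE ?ltr0n//; apply: ltW; apply: lt_le_trans (truncnS_gt e^-1) _.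
by rewrite ler_nat.
Qed.

(** The representative minimizes B v v - 2 l v; a minimizing sequence is
    Cauchy by the parallelogram identity. *)
Lemma riesz (l : V -> R) (K : R) : 0 <= K -> (forall a x y, l (a *: x + y) = a * l x + l y) ->
  (forall v, l v ^+ 2 <= K * B v v) -> exists h, forall v, l v = B h v.
Proof.
move=> K0 llin lb.
have lD x y : l (x + y) = l x + l y by have := llin 1 x y; rewrite scale1r mul1r.
have l0 : l 0 = 0 by have := lD 0 0; rewrite addr0; lra.
have lZ a x : l (a *: x) = a * l x by have := llin a x 0; rewrite addr0 l0 addr0.
have lN x : l (- x) = - l x by rewrite -scaleN1r lZ mulN1r.
pose Jf v := B v v - 2 * l v.
have Jlb v : - K <= Jf v.
  have h := lb v; have := B_ge0 v; rewrite /Jf => b0.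
  have : 2 * l v <= K + B v v; last by lra.
  by apply: le_of_sqr; [exact: addr_ge0|have := sqr_ge0 (K - B v v); lra].
pose A := [set Jf v | v in [set: V]].
have hA : has_inf A by split; [exists (Jf 0), 0|exists (- K) => _ [v _ <-]].
pose i0 := inf A.
have i0le v : i0 <= Jf v by apply: ge_inf; [exact: hA.2|exists v].
have /choice[u hu] : forall k : nat, exists v, Jf v <= i0 + k.+1%:R^-1.
  move=> k; have k0 : 0 < k.+1%:R^-1 :> R by rewrite invr_gt0 ltr0n.
  by have [_ [v _ <-] /ltW] := inf_adherent k0 hA; exists v.
have par x y : B (x - y) (x - y) = 2 * Jf x + 2 * Jf y - 4 * Jf (2^-1 *: (x + y)).
  by rewrite /Jf !(formE, lD, lZ) (B_sym y x); field.
have [e0|h hh] := @B_complete u.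
  move=> ep; have [N hN] := @small_eventually (e0 / 4) ltac:(lra).
  exists N => i j Ni Nj; rewrite par.
  move: (hu i) (hu j) (hN _ Ni) (hN _ Nj) (i0le (2^-1 *: (u i + u j))).
  by move: (Jf (u i)) (Jf (u j)) (Jf _) (i.+1%:R^-1) (j.+1%:R^-1) => *; lra.
have Jh : Jf h <= i0.
  apply/ler_addgt0Pr => e ep.
  have [N1 hN1] := @small_eventually (e / 2) ltac:(lra).
  suff [N2 hN2] : exists N, forall i, (N <= i)%N -> Jf h <= Jf (u i) + e / 2.
    move: (hN2 _ (leq_maxr N1 N2)) (hN1 _ (leq_maxl N1 N2)) (hu (maxn N1 N2)).
    by move: (Jf (u (maxn N1 N2))) (Jf h) ((maxn N1 N2).+1%:R^-1) => *; lra.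
  (* Jf h - Jf (u i) = - |u i - h|^2 - 2 B h (u i - h) + 2 l (u i - h) *)
  have M0 : 0 < B h h + `|K| + 1 by rewrite ltr_wpDl// addr_ge0.
  pose d := (e / 8) ^+ 2 / (B h h + `|K| + 1).
  have d0 : 0 < d by rewrite divr_gt0// exprn_gt0//; lra.
  have [N hN] := hh _ d0; exists N => i Ni; have {hN} := hN _ Ni.
  set w := u i - h => wd.
  have -> : u i = w + h by rewrite /w subrK.
  clearbody w.
  have b1 : `|B h w| <= e / 8.
    rewrite -(ler_pXn2r (n:=2))// ?nnegrE//; last by lra.
    rewrite real_normK ?num_real//; apply: le_trans (form_CS h w) _.
    have := ler_wpM2l (B_ge0 h) wd; move=> /le_trans; apply.
    rewrite /d mulrCA ler_piMr ?sqr_ge0// ler_pdivrMr// mul1r.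
    by have := normr_ge0 K; lra.
  have b2 : `|l w| <= e / 8.
    rewrite -(ler_pXn2r (n:=2))// ?nnegrE//; last by lra.
    rewrite real_normK ?num_real//; apply: le_trans (lb w) _.
    apply: (@le_trans _ _ (`|K| * d)).
      apply: (@le_trans _ _ (`|K| * B w w)); last exact: ler_wpM2l.
      by apply: ler_wpM2r => //; exact: ler_norm.
    rewrite /d mulrCA ler_piMr ?sqr_ge0// ler_pdivrMr// mul1r.
    by have := B_ge0 h; lra.
  rewrite /Jf !(formE, lD) (B_sym w h); have := B_ge0 w.
  by move: b1 b2; rewrite !ler_norml => /andP[? ?] /andP[? ?]; lra.
exists h => v; apply/eqP; rewrite -subr_eq0 -sqrf_eq0 eq_le sqr_ge0 andbT.
have := @quad_disc R 0 (B h v - l v) (B v v) (lexx _) (B_ge0 v).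
rewrite mul0r (_ : (B h v - l v) ^+ 2 = (l v - B h v) ^+ 2); last by ring.
apply=> t; have := le_trans Jh (i0le (h + t *: v)).
by rewrite /Jf !(formE, lD, lZ) (B_sym v h); lra.
Qed.

End hilbert.

(** * Constrained minimization in a Hilbert space *)

Lemma eqW_le (R : numDomainType) (x y : R) : x = y -> x <= y.
Proof. by move=> ->. Qed.

Section constrained_minimization.
Variables (R : realType) (V : lmodType R) (B0 Bm : V -> V -> R) (T : V -> V -> V -> R).
Hypothesis B0_sym : forall x y, B0 x y = B0 y x.
Hypothesis B0_lin : forall a x y z, B0 (a *: x + y) z = a * B0 x z + B0 y z.
Hypothesis B0_ge0 : forall x, 0 <= B0 x x.
Hypothesis Bm_sym : forall x y, Bm x y = Bm y x.
Hypothesis Bm_lin : forall a x y z, Bm (a *: x + y) z = a * Bm x z + Bm y z.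
Hypothesis Bm_ge0 : forall x, 0 <= Bm x x.
Let B x y := B0 x y + Bm x y.
Hypothesis B_complete : form_complete B.
Hypothesis T_lin : forall a x y z w, T (a *: x + y) z w = a * T x z w + T y z w.
Hypothesis T_rot : forall x y z, T x y z = T y z x.

Let B_sym x y : B x y = B y x. Proof. by rewrite /B B0_sym Bm_sym. Qed.
Let B_lin a x y z : B (a *: x + y) z = a * B x z + B y z.
Proof. by rewrite /B B0_lin Bm_lin; ring. Qed.
Let B_ge0 x : 0 <= B x x. Proof. by rewrite addr_ge0. Qed.

Lemma cubicD1 x y z w : T (x + y) z w = T x z w + T y z w.
Proof. by have := T_lin 1 x y z w; rewrite scale1r mul1r. Qed.
Lemma cubic01 z w : T 0 z w = 0.
Proof. by have := cubicD1 0 0 z w; rewrite addr0; lra. Qed.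
Lemma cubicZ1 a x z w : T (a *: x) z w = a * T x z w.
Proof. by have := T_lin a x 0 z w; rewrite addr0 cubic01 addr0. Qed.
Lemma cubicD2 x y z w : T w (x + y) z = T w x z + T w y z.
Proof. by rewrite 3!(T_rot w) cubicD1. Qed.
Lemma cubicD3 x y z w : T z w (x + y) = T z w x + T z w y.
Proof. by rewrite -!(T_rot _ z w) cubicD1. Qed.
Lemma cubicZ2 a x z w : T w (a *: x) z = a * T w x z.
Proof. by rewrite 2!(T_rot w) cubicZ1. Qed.
Lemma cubicZ3 a x z w : T z w (a *: x) = a * T z w x.
Proof. by rewrite -!(T_rot _ z w) cubicZ1. Qed.

Lemma cubic_expand x y : T (x + y) (x + y) (x + y) =
  T x x x + 3 * T x x y + 3 * T x y y + T y y y.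
Proof.
rewrite !(cubicD1, cubicD2, cubicD3) (T_rot y x x) (T_rot x y x) (T_rot y x x).
by rewrite (T_rot y y x) (T_rot y x y); ring.
Qed.

Definition energy v := 2^-1 * Bm v v - 3^-1 * T v v v.

Lemma energyZ a v : energy (a *: v) = a ^+ 2 * (2^-1 * Bm v v) - a ^+ 3 * (3^-1 * T v v v).
Proof.
rewrite /energy cubicZ1 cubicZ2 cubicZ3.
by rewrite (formZl Bm_lin) (formZr Bm_sym Bm_lin); ring.
Qed.

Hypothesis T_bound : exists2 C, 0 <= C & forall x y z, T x y z ^+ 2 <= C * (B x x * B y y * B z z).
Hypothesis B0_def : forall v, B0 v v = 0 -> B v v = 0.
Hypothesis coercive : forall M, exists K, forall v, B0 v v <= M -> Bm v v <= T v v v -> B v v <= K.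
Hypothesis compact_quadratic : forall (U : set_system nat) (w : nat -> V) K, UltraFilter U ->
  (forall k, B (w k) (w k) <= K) -> (forall v, B (w k) v @[k --> U] --> 0) ->
  forall v, T v (w k) (w k) @[k --> U] --> 0.
Hypothesis nonvanishing : forall c K, 0 < c -> exists (fs : seq V) (d : R), 0 < d /\
  forall v, B v v <= K -> c <= T v v v -> exists v',
    [/\ B0 v' v' = B0 v v, Bm v' v' = Bm v v, T v' v' v' = T v v v &
        exists2 f, f \in fs & d <= `|B v' f|].

(** The limits along U of B (u k) v form a bounded functional of v, to which
    the Riesz representation applies. *)
Lemma weak_limit (U : set_system nat) (u : nat -> V) K : UltraFilter U ->
  (forall k, B (u k) (u k) <= K) -> exists h, forall v, B (u k) v @[k --> U] --> B h v.
Proof.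
move=> UU uK; have K0 : 0 <= K := le_trans (B_ge0 _) (uK 0%N).
have bnd v k : B (u k) v ^+ 2 <= K * B v v.
  by apply: le_trans (form_CS B_sym B_lin B_ge0 _ _) _; exact: ler_wpM2r.
have /choice[l hl] : forall v, exists l : R, B (u k) v @[k --> U] --> l.
  move=> v; apply: (@ultra_bounded_cvg _ _ _ _ (K * B v v + 1)) => k.
  have h0 : 0 <= K * B v v by exact: mulr_ge0.
  apply: le_of_sqr; first by lra.
  by rewrite real_normK ?num_real//; apply: le_trans (bnd v k) _; nra.
have UP : ProperFilter U by apply: ultra_proper.
have [||h hh] := @riesz R V B B_sym B_lin B_ge0 B_complete l K K0.
- move=> a x y; have h1 := hl (a *: x + y).
  have h2 : B (u k) (a *: x + y) @[k --> U] --> a * l x + l y.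
    have -> : (fun k => B (u k) (a *: x + y)) = (fun k => a * B (u k) x + B (u k) y).
      by apply/funext => k; rewrite B_sym B_lin !(B_sym _ (u k)).
    by apply: cvgD => //; apply: cvgM => //; exact: cvg_cst.
  exact: (@norm_cvg_unique _ R^o _ _ _ _ h1 h2).
- move=> v; have h1 : B (u k) v * B (u k) v @[k --> U] --> l v * l v by exact: cvgM.
  rewrite expr2; apply: (ler_cvg_to h1 (cvg_cst (K * B v v))).
  by apply: nearW => k; rewrite /= -expr2; exact: bnd.
by exists h => v; rewrite -hh.
Qed.

Lemma weak_limit_functional (U : set_system nat) (w : nat -> V) (l : V -> R) K :
  ProperFilter U -> 0 <= K -> (forall a x y, l (a *: x + y) = a * l x + l y) ->
  (forall v, l v ^+ 2 <= K * B v v) ->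
  (forall v, B (w k) v @[k --> U] --> 0) -> l (w k) @[k --> U] --> 0.
Proof.
move=> UU K0 llin lb hw; have [f hf] := riesz B_sym B_lin B_ge0 B_complete K0 llin lb.
by rewrite (_ : (fun k => _) = fun k => B (w k) f); [exact: hw|apply/funext => k; rewrite hf B_sym].
Qed.

(** Compare v with its multiple t v of mass M: the quadratic part of the
    energy grows by t^2 and the cubic part by t^3, so v keeps its share of I0
    up to a gain in the cubic term when t > 1. *)
Lemma energy_scaling M I0 v : 0 < M -> (forall v, B0 v v = M -> I0 <= energy v) ->
  0 < B0 v v ->
  B0 v v / M * I0 + (Num.sqrt (M / B0 v v) - 1) * (3^-1 * T v v v) <= energy v.
Proof.
move=> M0 hI v0; set t := Num.sqrt _; have q0 : 0 < M / B0 v v by rewrite divr_gt0.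
have t0 : 0 < t by rewrite sqrtr_gt0.
have t2 : t ^+ 2 = M / B0 v v by rewrite sqr_sqrtr// ltW.
have := hI (t *: v).
rewrite (formZl B0_lin) (formZr B0_sym B0_lin) mulrA -expr2 t2 divfK ?(gt_eqF v0)// => /(_ erefl).
rewrite energyZ => h.
have -> : B0 v v / M = (t ^+ 2)^-1 by rewrite t2 invf_div.
have : (t ^+ 2)^-1 * I0 <= (t ^+ 2)^-1 * (t ^+ 2 * (2^-1 * Bm v v) - t ^+ 3 * (3^-1 * T v v v)).
  by rewrite ler_pM2l// invr_gt0 exprn_gt0.
have -> : (t ^+ 2)^-1 * (t ^+ 2 * (2^-1 * Bm v v) - t ^+ 3 * (3^-1 * T v v v)) =
    2^-1 * Bm v v - t * (3^-1 * T v v v) by field; exact: lt0r_neq0.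
by rewrite /energy; lra.
Qed.


Lemma energy_lower M K v : (forall v, B0 v v <= M -> Bm v v <= T v v v -> B v v <= K) ->
  B0 v v <= M -> energy v < 0 -> B v v <= K /\ - energy v <= 3^-1 * T v v v.
Proof.
move=> hK vM e0; have m0 := Bm_ge0 v; move: e0; rewrite /energy => e0.
by split; [apply: hK => //; lra|lra].
Qed.

(** A weak limit h of a minimizing sequence, each member of which may be
    replaced by a translate, is nonzero. The quadratic and cubic terms split
    along h and the remainder, so the energy is additive in the limit, and any
    loss of mass would contradict the strict scaling inequality. *)
Theorem minimizer_exists M : 0 < M -> (exists2 v, B0 v v = M & energy v < 0) ->
  exists h, B0 h h = M /\ forall v, B0 v v = M -> energy h <= energy v.
Proof.
move=> M0 [v0 v0M v0e]; have [K hK] := coercive M.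
have [C C0 hC] := T_bound.
have K0 : 0 <= K.
  have [h _] := energy_lower hK (eqW_le v0M) v0e.
  exact: le_trans (B_ge0 v0) h.
have lowb v : B0 v v = M -> - (3^-1 * Num.sqrt (C * (K * K * K))) <= energy v.
  move=> vM; have [e0|e0] := leP 0 (energy v).
    by apply: le_trans e0; rewrite oppr_le0 mulr_ge0// ?invr_ge0// sqrtr_ge0.
  have [bK _] := energy_lower hK (eqW_le vM) e0.
  have h : T v v v <= Num.sqrt (C * (K * K * K)).
    apply: le_of_sqr; first exact: sqrtr_ge0.
    rewrite sqr_sqrtr; last by rewrite !mulr_ge0.
    apply: le_trans (hC v v v) _; apply: ler_wpM2l => //.
    by apply: ler_pM => //; [exact: mulr_ge0|exact: ler_pM].
  by have := Bm_ge0 v; rewrite /energy; lra.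
pose A := [set energy v | v in [set v | B0 v v = M]].
have hA : has_inf A.
  split; first by exists (energy v0), v0.
  by exists (- (3^-1 * Num.sqrt (C * (K * K * K)))) => _ [v vM <-]; exact: lowb.
pose I0 := inf A.
have I0le v : B0 v v = M -> I0 <= energy v.
  by move=> vM; apply: ge_inf; [exact: hA.2|exists v].
have I0neg : I0 < 0 by apply: le_lt_trans v0e; exact: I0le.
have seq_ex (e : R) : 0 < e -> exists v, B0 v v = M /\ energy v <= I0 + e.
  by move=> e0; have [_ [v vM <-] /ltW ve] := inf_adherent e0 hA; exists v.
clearbody I0.
have I02 : 0 < - I0 / 2 by lra.
have [fs [d [d0 hnv]]] := nonvanishing K I02.
have /choice[u hu] : forall k : nat, exists v, [/\ B0 v v = M, energy v <= I0 + k.+1%:R^-1,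
    B v v <= K & exists2 f, f \in fs & d <= `|B v f|].
  move=> k; have k0 : 0 < k.+1%:R^-1 :> R by rewrite invr_gt0 ltr0n.
  pose e := Num.min (k.+1%:R^-1) (- I0 / 2).
  have e0 : 0 < e by rewrite lt_min k0.
  have ek : e <= k.+1%:R^-1 by rewrite ge_min lexx.
  have eI : e <= - I0 / 2 by rewrite ge_min lexx orbT.
  clearbody e.
  have [v [vM ve]] := seq_ex _ e0.
  have vneg : energy v < 0 by lra.
  have [bK Tb] := energy_lower hK (eqW_le vM) vneg.
  have [|v' [h0 hm hT hf]] := hnv v bK; first by lra.
  exists v'; split => //; first by rewrite h0.
    by rewrite {1}/energy hm hT -/(energy v) (le_trans ve)// lerD2l.
  by rewrite /B h0 hm.
have [U [UU Uoo]] := ultraFilterLemma eventually_filter.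
have UP : ProperFilter U by apply: ultra_proper.
have uK k : B (u k) (u k) <= K by have [] := hu k.
have [h hh] := weak_limit UU uK.
pose w k := u k - h.
have uw k : u k = h + w k by rewrite /w addrC subrK.
have wB v : B (w k) v @[k --> U] --> 0.
  rewrite (_ : (fun k => _) = fun k => B (u k) v - B h v); last first.
    by apply/funext => k; rewrite /w (formDl B_lin) (formNl B_lin).
  by rewrite -(subrr (B h v)); apply: cvgB; [exact: hh|exact: cvg_cst].
have wK k : B (w k) (w k) <= 2 * K + 2 * B h h.
  have := B_ge0 (u k + h); have := uK k.
  rewrite /w !(formDl B_lin, formDr B_sym B_lin, formNl B_lin, formNr B_sym B_lin).
  by rewrite (B_sym h (u k)); lra.
clearbody w.
have B0le x : B0 x x <= B x x by rewrite /B lerDl.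
have Bmle x : Bm x x <= B x x by rewrite /B lerDr.
have c0 : B0 h (w k) @[k --> U] --> 0.
  apply: (@weak_limit_functional U w (B0 h) (B0 h h)) => //.
    by move=> a x y; rewrite (formDr B0_sym B0_lin) (formZr B0_sym B0_lin).
  move=> v; apply: le_trans (form_CS B0_sym B0_lin B0_ge0 _ _) _.
  exact: ler_wpM2l.
have cm : Bm h (w k) @[k --> U] --> 0.
  apply: (@weak_limit_functional U w (Bm h) (Bm h h)) => //.
    by move=> a x y; rewrite (formDr Bm_sym Bm_lin) (formZr Bm_sym Bm_lin).
  move=> v; apply: le_trans (form_CS Bm_sym Bm_lin Bm_ge0 _ _) _.
  exact: ler_wpM2l.
have cT : T h h (w k) @[k --> U] --> 0.
  apply: (@weak_limit_functional U w (T h h) (C * (B h h * B h h))) => //.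
  - by rewrite !mulr_ge0.
  - by move=> a x y; rewrite cubicD3 cubicZ3.
  - by move=> v; apply: le_trans (hC _ _ _) _; rewrite !mulrA.
have cTT : T h (w k) (w k) @[k --> U] --> 0 by exact: (compact_quadratic UU wK wB).
have mass k : B0 (w k) (w k) = M - B0 h h - 2 * B0 h (w k).
  have [<- _ _ _] := hu k; rewrite (uw k).
  rewrite !(formDl B0_lin, formDr B0_sym B0_lin) (B0_sym (w k) h); ring.
have ener k : energy (w k) = energy (u k) - energy h - Bm h (w k) + T h h (w k) + T h (w k) (w k).
  rewrite (uw k) /energy cubic_expand !(formDl Bm_lin, formDr Bm_sym Bm_lin) (Bm_sym (w k) h).
  by field.
have cmass : B0 (w k) (w k) @[k --> U] --> M - B0 h h.
  rewrite (funext mass).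
  rewrite -[X in _ --> X]subr0 -(mulr0 2); apply: cvgB; first exact: cvg_cst.
  by apply: cvgM => //; exact: cvg_cst.
have cu : energy (u k) @[k --> U] --> I0.
  apply/cvgrPdist_le => e e0; apply: Uoo.
  have [N hN] := small_eventually e0; exists N => // k Nk.
  have [uM ue _ _] := hu k; have := hN _ Nk; have := I0le _ uM.
  by move=> h1 h2; rewrite distrC ger0_norm ?subr_ge0// lerBlDl (le_trans ue)// lerD2l.
have cen : energy (w k) @[k --> U] --> I0 - energy h.
  rewrite (funext ener).
  rewrite -[X in _ --> X]addr0; apply: cvgD => //.
  rewrite -[X in _ --> X]addr0; apply: cvgD => //.
  rewrite -[X in _ --> X]subr0; apply: cvgB => //.
  by apply: cvgB => //; exact: cvg_cst.
have lam_pos : 0 < B0 h h.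
  rewrite lt_def B0_ge0 andbT; apply/negP => /eqP /B0_def Bh0.
  have Bh v : B h v = 0.
    apply/eqP; rewrite -sqrf_eq0 eq_le sqr_ge0 andbT.
    by apply: le_trans (form_CS B_sym B_lin B_ge0 _ _) _; rewrite Bh0 mul0r.
  have small : \forall k \near U, forall f, f \in fs -> `|B (u k) f| < d.
    elim: (fs) => [|f fs' ih]; first by apply: nearW.
    have cf : B (u k) f @[k --> U] --> 0 by rewrite -(Bh f).
    have hf : \forall k \near U, `|B (u k) f| < d.
      by move/cvgrPdist_lt : cf => /(_ _ d0); apply: filterS => k; rewrite sub0r normrN.
    apply: filterS2 ih hf => k h1 h2 g; rewrite inE => /predU1P[->//|]; exact: h1.
  have [k hk] := filter_ex small.
  have [_ _ _ [f ffs df]] := hu k.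
  by have := hk _ ffs; rewrite ltNge df.
have lamM : B0 h h <= M.
  by rewrite -subr_ge0; apply: (ler_cvg_to (cvg_cst 0) cmass); apply: nearW => k /=.
have share v : B0 v v <= M -> B0 v v / M * I0 <= energy v.
  move=> vM; have [v00|v0N] := eqVneq (B0 v v) 0.
    have Bv0 := B0_def v00.
    have T0 : T v v v = 0.
      apply/eqP; rewrite -sqrf_eq0 eq_le sqr_ge0 andbT.
      by apply: le_trans (hC _ _ _) _; rewrite Bv0 !mul0r mulr0.
    by rewrite v00 mul0r mul0r /energy T0 mulr0 subr0 mulr_ge0// invr_ge0.
  have vp : 0 < B0 v v by rewrite lt_def v0N B0_ge0.
  have sc := energy_scaling M0 I0le vp; move: sc => /=.
  have [Tp|Tn] := leP 0 (T v v v).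
    apply: le_trans; rewrite lerDl mulr_ge0//; last by rewrite mulr_ge0// invr_ge0.
    rewrite subr_ge0 -[leLHS]sqrtr1 ler_sqrt ?divr_ge0 ?(ltW M0)//.
    by rewrite ler_pdivlMr// mul1r.
  move=> _; apply: (@le_trans _ _ 0).
    by rewrite nmulr_lle0// divr_ge0// ltW.
  by have := Bm_ge0 v; rewrite /energy; lra.
have split_le : energy h <= B0 h h / M * I0.
  have h1 : (M - B0 h h) / M * I0 <= I0 - energy h.
    have ltM : M - B0 h h < M by lra.
    have h1 : B0 (w k) (w k) / M * I0 @[k --> U] --> (M - B0 h h) / M * I0.
      by apply: cvgM; [apply: cvgM => //; exact: cvg_cst|exact: cvg_cst].
    apply: (ler_cvg_to h1 cen).
    by apply: filterS (cvgr_le _ cmass _ ltM) => k; exact: share.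
  by move: h1; rewrite mulrBl divff ?gt_eqF// mulrBl mul1r; lra.
have hneg : energy h < 0.
  by apply: le_lt_trans split_le _; rewrite pmulr_rlt0// divr_gt0.
have Tp : 0 < T h h h by have := Bm_ge0 h; move: hneg; rewrite /energy; lra.
have := energy_scaling M0 I0le lam_pos => /=.
set t := Num.sqrt _ => sc.
have t1 : t <= 1.
  rewrite -subr_le0; rewrite -(@pmulr_lle0 _ (3^-1 * T h h h)) ?mulr_gt0 ?invr_gt0//; lra.
have lamE : B0 h h = M.
  apply/eqP; rewrite eq_le lamM/=.
  have : t ^+ 2 <= 1 by rewrite expr_le1// sqrtr_ge0.
  rewrite /t sqr_sqrtr ?divr_ge0 ?(ltW M0)// ler_pdivrMr// mul1r//.
exists h; split => // v vM; apply: le_trans (I0le _ vM).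
by move: split_le; rewrite lamE divff ?mul1r// gt_eqF.
Qed.

End constrained_minimization.

(** * The Euler-Lagrange equation *)

Section euler_lagrange.
Variable R : realType.

Lemma poly_local_min0 (p : {poly R}) : p.[0] = 0 ->
  (\forall t \near (0 : R), 0 <= p.[t]) -> p^`().[0] = 0.
Proof.
move=> p0 pp; have /factor_theorem[g pE] : root p 0 by apply/eqP.
have gE t : p.[t] = g.[t] * t by rewrite pE hornerM hornerXsubC subr0.
have -> : p^`().[0] = g.[0] by rewrite pE derivM derivXsubC hornerD !hornerM hornerXsubC hornerC subrr mulr0 add0r mulr1.
have cg : g.[t] @[t --> (0 : R)] --> g.[0] by exact: continuous_horner.
apply/eqP; rewrite eq_le; apply/andP; split; rewrite leNgt; apply/negP => g0.
- have h : \forall t \near (0 : R), 0 < g.[t] by apply: (cvgr_gt _ cg).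
  have [e /= e0 he] : nbhs_ball (0 : R) [set t | 0 <= p.[t] /\ 0 < g.[t]].
    by apply/nbhs_ballP; exact: filterI pp h.
  have [] := he (- (e / 2)).
    by rewrite /ball /= sub0r opprK gtr0_norm; lra.
  by rewrite gE => h1 h2; nra.
- have h : \forall t \near (0 : R), g.[t] < 0 by apply: (cvgr_lt _ cg).
  have [e /= e0 he] : nbhs_ball (0 : R) [set t | 0 <= p.[t] /\ g.[t] < 0].
    by apply/nbhs_ballP; exact: filterI pp h.
  have [] := he (e / 2).
    by rewrite /ball /= sub0r normrN gtr0_norm; lra.
  by rewrite gE => h1 h2; nra.
Qed.

Variables (V : lmodType R) (B0 Bm : V -> V -> R) (T : V -> V -> V -> R).
Hypothesis B0_sym : forall x y, B0 x y = B0 y x.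
Hypothesis B0_lin : forall a x y z, B0 (a *: x + y) z = a * B0 x z + B0 y z.
Hypothesis Bm_sym : forall x y, Bm x y = Bm y x.
Hypothesis Bm_lin : forall a x y z, Bm (a *: x + y) z = a * Bm x z + Bm y z.
Hypothesis T_lin : forall a x y z w, T (a *: x + y) z w = a * T x z w + T y z w.
Hypothesis T_rot : forall x y z, T x y z = T y z x.
Local Notation energy := (energy Bm T).

(** The variation h + t f has the wrong mass, so it is rescaled; comparing
    energies and squaring away the square root in the scaling factor leaves a
    polynomial in t that is nonnegative near 0 and vanishes at 0. *)
Theorem minimizer_equation M h : 0 < M -> B0 h h = M -> energy h < 0 -> 0 <= Bm h h ->
  (forall v, B0 v v = M -> energy h <= energy v) ->
  forall f, Bm h f + (T h h h - Bm h h) / M * B0 h f = T h h f.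
Proof.
move=> M0 hM he hm hmin f.
set I0 := energy h in he hmin.
have T0 : 0 < T h h h by move: he; rewrite /I0 /energy; lra.
pose q : {poly R} := M%:P + (2 * B0 h f) *: 'X + (B0 f f) *: 'X^2.
pose A : {poly R} := (2^-1 * M * (Bm h h + 0))%:P + (M * Bm h f) *: 'X + (2^-1 * M * Bm f f) *: 'X^2 - I0 *: q.
pose C : {poly R} := (T h h h)%:P + (3 * T h h f) *: 'X + (3 * T h f f) *: 'X^2 + (T f f f) *: 'X^3.
pose k := M ^+ 3 / 9.
have qE t : q.[t] = B0 (h + t *: f) (h + t *: f).
  rewrite /q !hornerE /= !(formDl B0_lin, formDr B0_sym B0_lin, formZl B0_lin, formZr B0_sym B0_lin).
  rewrite hM (B0_sym f h); ring.
have AE t : A.[t] = 2^-1 * M * Bm (h + t *: f) (h + t *: f) - I0 * q.[t].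
  rewrite /A !hornerE /= !(formDl Bm_lin, formDr Bm_sym Bm_lin, formZl Bm_lin, formZr Bm_sym Bm_lin).
  by rewrite (Bm_sym f h); field.
have CE t : C.[t] = T (h + t *: f) (h + t *: f) (h + t *: f).
  rewrite (cubic_expand T_lin T_rot) /C !hornerE /=.
  rewrite !(cubicZ1 T_lin, cubicZ2 T_lin T_rot, cubicZ3 T_lin T_rot); ring.
have PE t : (q * A ^+ 2 - k *: C ^+ 2).[t] = q.[t] * A.[t] ^+ 2 - k * C.[t] ^+ 2.
  by rewrite hornerD hornerN hornerM hornerZ !horner_exp.
have key t : 0 < q.[t] -> 0 < C.[t] -> 0 <= (q * A ^+ 2 - k *: C ^+ 2).[t].
  move=> q0 C0; rewrite PE.
  set v := h + t *: f in qE AE CE.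
  pose r := Num.sqrt (M / q.[t]).
  have Mq : 0 < M / q.[t] by rewrite divr_gt0.
  have r0 : 0 < r by rewrite sqrtr_gt0.
  have r2 : r ^+ 2 = M / q.[t] by rewrite sqr_sqrtr// ltW.
  have := hmin (r *: v).
  rewrite (formZl B0_lin) (formZr B0_sym B0_lin) mulrA -expr2 r2 /v -qE divfK ?(gt_eqF q0)// => /(_ erefl).
  rewrite (energyZ Bm_sym Bm_lin T_lin T_rot) -CE => hh.
  have Ar : A.[t] = q.[t] * (r ^+ 2 * (2^-1 * Bm (h + t *: f) (h + t *: f)) - I0).
    by rewrite AE r2; field; exact: lt0r_neq0.
  have rq : r ^+ 2 * q.[t] = M by rewrite r2 divfK ?(gt_eqF q0).
  have c1 : r ^+ 3 * (3^-1 * C.[t]) <= r ^+ 2 * (2^-1 * Bm (h + t *: f) (h + t *: f)) - I0 by lra.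
  have c0 : 0 <= r ^+ 3 * (3^-1 * C.[t]).
    by rewrite !mulr_ge0 ?exprn_ge0 ?invr_ge0// ltW.
  rewrite subr_ge0 Ar /k -rq.
  have -> : (r ^+ 2 * q.[t]) ^+ 3 / 9 * C.[t] ^+ 2 = q.[t] ^+ 3 * (r ^+ 3 * (3^-1 * C.[t])) ^+ 2 by field.
  have -> : q.[t] * (q.[t] * (r ^+ 2 * (2^-1 * Bm (h + t *: f) (h + t *: f)) - I0)) ^+ 2 =
    q.[t] ^+ 3 * (r ^+ 2 * (2^-1 * Bm (h + t *: f) (h + t *: f)) - I0) ^+ 2 by ring.
  by rewrite ler_pM2l ?exprn_gt0// lerXn2r// nnegrE// (le_trans c0).
have I0E : 2^-1 * M * Bm h h - I0 * M = M * (3^-1 * T h h h) by rewrite /I0 /energy; ring.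
have := @poly_local_min0 (q * A ^+ 2 - k *: C ^+ 2).
have q00 : q.[0] = M by rewrite qE scale0r addr0.
have A00 : A.[0] = M * (3^-1 * T h h h) by rewrite -I0E AE scale0r addr0 q00; ring.
have C00 : C.[0] = T h h h by rewrite CE scale0r addr0.
have e0 : (q * A ^+ 2 - k *: C ^+ 2).[0] = 0.
  by rewrite PE q00 A00 C00 /k; field.
have ne : \forall t \near (0 : R), 0 <= (q * A ^+ 2 - k *: C ^+ 2).[t].
  have cq : q.[t] @[t --> (0 : R)] --> M by rewrite -q00; exact: continuous_horner.
  have cC : C.[t] @[t --> (0 : R)] --> T h h h by rewrite -C00; exact: continuous_horner.
  have h1 : \forall t \near (0 : R), 0 < q.[t] by apply: (cvgr_gt _ cq).
  have h2 : \forall t \near (0 : R), 0 < C.[t] by apply: (cvgr_gt _ cC).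
  by apply: filterS2 h1 h2 => t; exact: key.
have dq : q^`().[0] = 2 * B0 h f by rewrite /q !(derivD, derivN, derivC, derivZ, derivX, derivXn) /= !hornerE /=; ring.
have dA : A^`().[0] = M * Bm h f - I0 * (2 * B0 h f).
  by rewrite /A /q !(derivD, derivN, derivC, derivZ, derivX, derivXn) /= !hornerE /=; ring.
have dC : C^`().[0] = 3 * T h h f by rewrite /C !(derivD, derivN, derivC, derivZ, derivX, derivXn) /= !hornerE /=; ring.
move=> /(_ e0 ne); clearbody q A C.
rewrite !(expr2, derivB, derivZ, derivM, hornerD, hornerN, hornerZ, hornerM) q00 A00 C00 dq dA dC.
move=> e1; have MN := lt0r_neq0 M0; have TN := lt0r_neq0 T0.
have {e1} e2 : M ^+ 2 * T h h h * (T h h h * (2 * B0 h f) + 6 * (M * Bm h f - I0 * (2 * B0 h f)) - 6 * M * T h h f) = 0.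
  by rewrite -(mulr0 9) -e1 /k; field.
have /eqP := e2; rewrite mulf_eq0 gt_eqF ?mulr_gt0 ?exprn_gt0//= => /eqP e3.
apply: (mulfI MN); rewrite mulrDr mulrA (mulrCA M) mulfV// mulr1.
by move: e3; rewrite /I0 /energy; lra.
Qed.

End euler_lagrange.

(** * Transform of a two-sided exponential *)

Section exponential_transform.
Variable R : realType.
Local Notation mu := (@lebesgue_measure R).
Local Notation "'I' f" := (Rintegral mu [set: _] f) (at level 10, f at level 8).

Lemma I_indic (D : set R) (f : R -> R) : I (fun x => \1_D x * f x) = \int[mu]_(x in D) f x.
Proof.
rewrite [RHS]Rintegral_mkcond; apply: eqI => x.
rewrite indicE /patch; case: ifPn => h; [by rewrite mul1r|by rewrite mul0r].
Qed.

Lemma itg_indic_bounded (a b M : R) (f : R -> R) : mea f ->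
  (forall x, a <= x <= b -> `|f x| <= M) -> itg mu (fun x => \1_(`[a, b]%classic) x * f x).
Proof.
move=> mf fM.
have h : itg mu (fun x => M * (\1_(`[a, b]%classic) x : R)).
  by apply: itgZ; exact: integrable_indic_itv.
apply: (itg_le (m := mu) _ _ h).
- by apply: meaM => //; apply: mea_indic; exact: measurable_itv.
- move=> x; rewrite indicE; have [|_] := boolP (x \in _).
    by rewrite inE /= in_itv /= => /fM hx; rewrite mul1r mulr1.
  by rewrite mul0r mulr0 normr0.
Qed.

Lemma ftc_segment (f F : R -> R) (a b : R) : a < b -> continuous f ->
  (forall x : R, is_derive x 1 F (f x)) ->
  I (fun x => \1_(`[a, b]%classic) x * f x) = F b - F a.
Proof.
move=> ab cf dF; rewrite I_indic /Rintegral.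
have cF x : {for x, continuous F}.
  by apply: differentiable_continuous; apply/derivable1_diffP; exact: ex_derive.
rewrite (@continuous_FTC2 R f F a b ab)//.
- exact: continuous_subspaceT.
- split => [x _| |]; first exact: ex_derive.
  + by apply: cvg_at_right_filter; exact: cF.
  + by apply: cvg_at_left_filter; exact: cF.
- by move=> x _; rewrite derive1E; exact: derive_val.
Qed.

Definition cauchy_kernel (x : R) : R := 2 / (1 + x ^+ 2).

Lemma cauchy_kernel_itg : itg mu cauchy_kernel /\ I cauchy_kernel = 2 * pi.
Proof.
pose g (x : R) : R := (oneDsqr x)^-1.
have g0 x : 0 <= g x by rewrite invr_ge0 (le_trans ler01)// oneDsqr_ge1.
have cg : continuous g by exact: continuous_oneDsqrV.
have mg : mea g by exact: continuous_measurable_fun.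
have E : (\int[mu]_x (g x)%:E = pi%:E)%E.
  rewrite (@ge0_symfun_integralT R g)//; last by move=> x; rewrite /g /= /oneDsqr sqrrN.
  by rewrite -set_itvcy integral0y_oneDsqr -EFinM mulrC divfK ?pnatr_eq0.
have gi : itg mu g.
  apply: itg_fin => //; under eq_integral do rewrite ger0_norm//.
  by rewrite E ltry.
have Ig : I g = pi by apply: EFin_inj; rewrite IE.
have kE x : 2 * g x = cauchy_kernel x by [].
split; first by apply: eq_itg (itgZ 2 gi).
by rewrite -(eqI mu kE) IZ// Ig.
Qed.

Lemma exp_cos_primitive (e z x : R) : 0 < e -> is_derive x 1
  (fun y => expR (- e * y) * (z * sin (z * y) - e * cos (z * y)) / (e ^+ 2 + z ^+ 2))
  (expR (- e * x) * cos (z * x)).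
Proof.
move=> e0; have d0 : e ^+ 2 + z ^+ 2 != 0.
  by rewrite gt_eqF// ltr_pwDl ?exprn_gt0// sqr_ge0.
pose D : R := (expR (- e * x) * (z * (z * cos (z * x)) - e * (- (z * sin (z * x)))) +
  (- e * expR (- e * x)) * (z * sin (z * x) - e * cos (z * x))) / (e ^+ 2 + z ^+ 2).
have h : is_derive x 1 (fun y => expR (- e * y) * (z * sin (z * y) - e * cos (z * y)) / (e ^+ 2 + z ^+ 2)) D.
  have dl (c : R) : is_derive x 1 (fun y => c * y) c.
    by apply: (is_derive_eq (is_deriveZ c (is_derive_id x 1))); rewrite /GRing.scale /= mulr1.
  have d1 : is_derive x 1 (fun y => expR (- e * y)) (expR (- e * x) * - e).
    exact: (is_derive1_comp (is_derive_expR _) (dl (- e))).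
  have d2 : is_derive x 1 (fun y => sin (z * y)) (cos (z * x) * z).
    exact: (is_derive1_comp (is_derive_sin _) (dl z)).
  have d3 : is_derive x 1 (fun y => cos (z * y)) (- sin (z * x) * z).
    exact: (is_derive1_comp (is_derive_cos _) (dl z)).
  have h1 := is_deriveB (is_deriveZ z d2) (is_deriveZ e d3).
  have h2 := is_deriveM (is_deriveM d1 h1) (is_derive_cst ((e ^+ 2 + z ^+ 2)^-1) x 1).
  apply: (is_derive_eq h2); rewrite /D !fctE /= /GRing.scale /= /GRing.scale /=; ring.
by apply: (is_derive_eq h); rewrite /D; field.
Qed.

Lemma expR_tail_cvg0 (e C : R) : 0 < e -> 0 <= C ->
  expR (- e * k%:R) * C @[k --> \oo] --> (0 : R).
Proof.
move=> e0 C0; pose e' := Num.min 1 e.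
have e'0 : 0 < e' by rewrite lt_min ltr01.
have [e'1 e'e] : e' <= 1 /\ e' <= e by rewrite !ge_min !lexx orbT.
clearbody e'.
have ub k : 0 <= expR (- e * k%:R) * C <= C / e' * harmonic k.
  rewrite mulr_ge0 ?expR_ge0//= mulrC -mulrA; apply: ler_wpM2l => //.
  rewrite mulNr expRN /= -invfM lef_pV2 ?posrE ?expR_gt0 ?mulr_gt0 ?ltr0n//.
  apply: le_trans (expR_ge1Dx _); rewrite -natr1 mulrDr mulr1 addrC; apply: lerD => //.
  by apply: ler_wpM2r.
apply: (@squeeze_cvgr _ _ _ _ (fun=> 0) (fun k => C / e' * harmonic k)).
- exact: nearW.
- exact: cvg_cst.
- rewrite -(mulr0 (C / e')); apply: cvgM; [exact: cvg_cst|exact: cvg_harmonic].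
Qed.

Lemma exp_half_transform (e z : R) : 0 < e ->
  let g x := \1_(`[0, +oo[%classic) x * (expR (- e * x) * cos (z * x)) in
  itg mu g /\ I g = e / (e ^+ 2 + z ^+ 2).
Proof.
move=> e0.
pose F z y := expR (- e * y) * (z * sin (z * y) - e * cos (z * y)) / (e ^+ 2 + z ^+ 2).
pose f z y : R := expR (- e * y) * cos (z * y).
have cexp : continuous (fun x : R => expR (- e * x)).
  by move=> x; apply: (@continuous_comp _ _ _ (fun x : R => - e * x) expR); [exact: mulrl_continuous|exact: continuous_expR].
have cf z' : continuous (f z').
  move=> x; apply: (@cvgM _ _ (nbhs x) _ (fun x => expR (- e * x)) (fun x => cos (z' * x))); first exact: cexp.
  by apply: (@continuous_comp _ _ _ (fun x : R => z' * x) cos); [exact: mulrl_continuous|exact: continuous_cos].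
have mf z' : mea (f z') by exact: continuous_measurable_fun.
pose A k := \1_(`[0, k.+1%:R]%classic) : R -> R.
have seg z' k : I (fun x => A k x * f z' x) = F z' k.+1%:R - F z' 0.
  by apply: ftc_segment => // x; exact: exp_cos_primitive.
have fb z' x : 0 <= x -> `|f z' x| <= expR (- e * x).
  move=> x0; rewrite normrM (ger0_norm (expR_ge0 _)) ler_piMr ?expR_ge0// ler_norml.
  by rewrite cos_geN1 cos_le1.
have eb x : 0 <= x -> expR (- e * x) <= 1.
  by move=> x0; rewrite -expR0 ler_expR mulNr oppr_le0 mulr_ge0// ltW.
have si z' k : itg mu (fun x => A k x * f z' x).
  apply: (@itg_indic_bounded _ _ 1) => // x /andP[x0 _].
  by apply: le_trans (fb z' x x0) (eb x x0).
pose P := \1_(`[0, +oo[%classic) : R -> R.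
have mP : mea P by apply: mea_indic; exact: measurable_itv.
have mA k : mea (A k) by apply: mea_indic; exact: measurable_itv.
have AE k x : A k x = if (0 <= x) && (x <= k.+1%:R) then 1 else 0.
  by rewrite /A indicE mem_setE /= in_itv /=; case: ifP.
have PE x : P x = if 0 <= x then 1 else 0.
  by rewrite /P indicE mem_setE /= in_itv /= andbT; case: ifP.
have lim z' x : A k x * f z' x @[k --> \oo] --> P x * f z' x.
  apply: cvg_near_cst; near=> k; rewrite AE PE; case: (leP 0 x) => //= x0.
  rewrite (_ : x <= k.+1%:R)//; apply: ltW; apply: lt_le_trans (truncnS_gt x) _.
  by rewrite ler_nat ltnS; near: k; exact: nbhs_infty_ge.
have F00 z' : F z' 0 = - (e / (e ^+ 2 + z' ^+ 2)).
  by rewrite /F !mulr0 expR0 sin0 cos0; ring.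
have Flim z' : F z' k.+1%:R @[k --> \oo] --> (0 : R).
  have D0 : 0 < e ^+ 2 + z' ^+ 2 by rewrite ltr_pwDl ?exprn_gt0// sqr_ge0.
  pose C := (`|z'| + e) / (e ^+ 2 + z' ^+ 2).
  have C0 : 0 <= C by apply: divr_ge0; [apply: addr_ge0 => //|]; exact: ltW.
  have h : F z' k%:R @[k --> \oo] --> (0 : R).
    apply/norm_cvg0P; apply: (@squeeze_cvgr _ _ _ _ (fun=> 0) (fun k => expR (- e * k%:R) * C)).
    - apply: nearW => k; rewrite normr_ge0/= /F -mulrA normrM (ger0_norm (expR_ge0 _)).
      apply: ler_wpM2l; first exact: expR_ge0.
      rewrite /C normrM normfV (gtr0_norm D0) ler_pM2r ?invr_gt0//.
      apply: le_trans (ler_normB _ _) _; rewrite !normrM (gtr0_norm e0); apply: lerD.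
        by rewrite ler_piMr// ler_norml sin_geN1 sin_le1.
      by rewrite ler_piMr ?(ltW e0)// ler_norml cos_geN1 cos_le1.
    - exact: cvg_cst.
    - exact: expR_tail_cvg0.
  by have := h; rewrite -(cvg_shiftS (fun k => F z' k%:R)).
have Pexp : itg mu (fun x => P x * expR (- e * x)).
  have e1 x : P x * f 0 x = P x * expR (- e * x) by rewrite /f mul0r cos0 mulr1.
  rewrite -(funext e1).
  have [] := @fatou_bound _ _ _ mu (fun k x => A k x * f 0 x) (fun x => P x * f 0 x) (e / (e ^+ 2 + 0 ^+ 2)) => //.
  - by move=> k; exact: (meaM (mA k) (mf 0)).
  - exact: (meaM mP (mf 0)).
  - move=> k x; rewrite /f mul0r cos0 mulr1 AE; case: ifP => _; rewrite ?mul0r// mul1r expR_ge0//.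
  - move=> k; rewrite seg F00 opprK gerDr /F !mul0r cos0 mulr1 sub0r.
    rewrite mulrN mulNr oppr_le0; apply: divr_ge0; last by rewrite addr_ge0 ?sqr_ge0.
    by apply: mulr_ge0; [exact: expR_ge0|exact: ltW].
  - by apply: aeW => x; exact: lim.
  - by move=> x; rewrite /f mul0r cos0 mulr1 PE; case: ifP => _; rewrite ?mul0r// mul1r expR_ge0//.
have [] := @dct _ _ _ mu (fun k x => A k x * f z x) (fun x => P x * f z x) (fun x => P x * expR (- e * x)).
- by move=> k; exact: (meaM (mA k) (mf z)).
- exact: (meaM mP (mf z)).
- exact: Pexp.
- move=> k x; rewrite AE PE; case: (leP 0 x) => x0 /=; last by rewrite !mul0r normr0.
  case: ifP => _; rewrite ?mul1r ?mul0r ?normr0 ?expR_ge0//; exact: fb.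
- by apply: aeW => x; exact: lim.
move=> i c; split => //.
have c2 : I (fun x => A k x * f z x) @[k --> \oo] --> 0 - F z 0.
  by rewrite (funext (seg z)); apply: cvgB; [exact: Flim|exact: cvg_cst].
have := @norm_cvg_unique _ R^o _ _ _ _ c c2.
by rewrite F00 sub0r opprK => h; exact: h.
Unshelve. all: by end_near. Qed.

(** By evenness, twice the half-line integral. *)
Lemma exp_abs_transform (e z : R) : 0 < e ->
  let g x := expR (- e * `|x|) * cos (z * x) in
  itg mu g /\ I g = 2 * e / (e ^+ 2 + z ^+ 2).
Proof.
move=> e0 g; have [hi hI] := exp_half_transform z e0.
set f := (fun x => _) in hi hI.
have ho := itg_opp hi.
have mg : mea g.
  apply: meaM; last by apply: (mea_comp (@mea_cos _)); apply: meaM; [exact: mea_cst|exact: mea_id].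
  apply: (@mea_comp _ _ _ expR); first exact: measurable_expR.
  by apply: meaM; [exact: mea_cst|apply: mea_abs; exact: mea_id].
have ae0 : {ae mu, forall x, f x + f (- x) = g x}.
  exists [set 0]; split; [exact: measurable_set1|exact: lebesgue_measure_set1|].
  move=> x /= h; apply: contrapT => /eqP x0; apply: h.
  have fE y : f y = if 0 <= y then expR (- e * y) * cos (z * y) else 0.
    by rewrite /f indicE mem_setE /= in_itv /= andbT; case: ifP => _; rewrite ?mul1r ?mul0r.
  rewrite !fE oppr_ge0 /g; have [xp|xn|xe] := ltrgtP 0 x.
  - by rewrite addr0 gtr0_norm.
  - by rewrite add0r ltr0_norm// (mulrN z) cosN.
  - by rewrite xe eqxx in x0.
have fi := itgD hi ho.
split; first exact: (itg_ae (m := mu) mg ae0 fi).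
by rewrite -(I_ae (m := mu) (itg_mea fi) mg ae0) (ID hi ho) I_opp// hI; ring.
Qed.

End exponential_transform.

(** * Continuity of translation *)

Section translation_continuity.
Variable R : realType.
Local Notation mu := (@lebesgue_measure R).
Local Notation "'I' f" := (Rintegral mu [set: _] f) (at level 10, f at level 8).

Definition cut (A : R) (f : R -> R) (x : R) : R := \1_(`[- A, A]%classic) x * f x.

Lemma cutE A f x : cut A f x = if `|x| <= A then f x else 0.
Proof.
by rewrite /cut indicE mem_setE /= in_itv /= -ler_norml; case: ifP => _; rewrite ?mul1r ?mul0r.
Qed.

Lemma mea_cut A f : mea f -> mea (cut A f).
Proof. by move=> mf; apply: meaM => //; apply: mea_indic; exact: measurable_itv. Qed.

Lemma cut_le A f x : `|cut A f x| <= `|f x|.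
Proof. by rewrite cutE; case: ifP => _; rewrite ?normr0. Qed.

Lemma itg_cut A f : itg mu f -> itg mu (cut A f).
Proof.
move=> fi; apply: (itg_le (m := mu) _ _ (itg_abs fi)); last exact: cut_le.
exact: mea_cut (itg_mea fi).
Qed.

Lemma sqi_cut A f : sqi mu f -> sqi mu (cut A f).
Proof. by move=> fi; apply: (sqi_le _ fi); [exact: mea_cut fi.1|exact: cut_le]. Qed.

Lemma cut_near f x : \forall k \near \oo, cut k%:R f x = f x.
Proof.
near=> k; rewrite cutE (_ : `|x| <= k%:R)//.
apply: ltW; apply: lt_le_trans (truncnS_gt `|x|) _; rewrite ler_nat.
by near: k; exact: nbhs_infty_gt.
Unshelve. all: by end_near. Qed.

Lemma cut_cvg_L1 f : itg mu f -> I (fun x => `|f x - cut k%:R f x|) @[k --> \oo] --> (0 : R).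
Proof.
move=> fi; have mf := itg_mea fi.
have [] := @dct _ _ _ mu (fun k x => `|f x - cut k%:R f x|) (fun=> 0) (fun x => `|f x|).
- by move=> k; apply: mea_abs; apply: meaB => //; exact: mea_cut.
- exact: mea_cst.
- exact: itg_abs.
- by move=> k x; rewrite normr_id cutE; case: ifP => _; rewrite ?subrr ?normr0// subr0.
- apply: aeW => x; apply: cvg_near_cst; apply: filterS (cut_near f x) => k ->.
  by rewrite subrr normr0.
by move=> _; rewrite Rintegral_cst// mul0r.
Qed.

Lemma continuous_bounded_segment (g : R -> R) (A : R) : continuous g ->
  exists M : R, forall x, `|x| <= A -> `|g x| <= M.
Proof.
move=> cg; have [M [_ hM]] : bounded_set (g @` `[- A, A]%classic).
  apply: compact_bounded; apply: continuous_compact; last exact: segment_compact.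
  exact: continuous_subspaceT.
exists (M + 1) => x xA; apply: hM; first by rewrite ltrDl.
by exists x => //; rewrite /= in_itv /= -ler_norml.
Qed.

Lemma cut_continuous_approx A f (e : R) : itg mu f -> 0 < e ->
  exists g : R -> R, continuous g /\ I (fun x => `|cut A f x - cut A g x|) <= e.
Proof.
move=> fi e6; have mA : measurable (`[- A, A]%classic : set R) by exact: measurable_itv.
have fiA : mu.-integrable `[- A, A]%classic (EFin \o f) by apply: integrableS fi.
pose DA : set R := `[- A, A]%classic.
have fin : (mu DA < +oo)%E.
  by rewrite /DA lebesgue_measure_itv /=; case: ifP => _; rewrite ?ltry// -EFinB ltry.
have [g_ [cg gi gc]] := @approximation_continuous_integrable R _ f mA fin fiA.
have fc : fine (\int[mu]_(x in DA) `|(f x - g_ k x)%:E|)%E @[k --> \oo] --> (0 : R).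
  exact: fine_cvg gc.
have /cvgr0Pnorm_le /(_ _ e6) [K _ hK] := fc.
exists (g_ K); split => //; apply: le_trans (hK K _) => //=.
apply: le_trans (ler_norm _); rewrite le_eqVlt; apply/orP; left; apply/eqP.
rewrite -[RHS]/(\int[mu]_(x in DA) `|f x - g_ K x|) -I_indic.
apply: eqI => x; rewrite /DA !cutE indicE mem_setE /= in_itv /= -ler_norml.
by case: ifP => _; rewrite ?mul1r ?mul0r// subrr normr0.
Qed.

Variable z : nat -> R.
Hypothesis z1 : forall k, `|z k| <= 1.
Hypothesis z0 : z k @[k --> \oo] --> (0 : R).

Lemma shift_cvg_continuous (g : R -> R) (A : R) : continuous g -> 0 <= A ->
  I (fun x => `|cut A g (z k + x) - cut A g x|) @[k --> \oo] --> (0 : R).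
Proof.
move=> cg A0; have mg : mea g by exact: continuous_measurable_fun.
have [M hM] := continuous_bounded_segment A cg.
have M0 : 0 <= M by apply: le_trans (hM 0 _); rewrite ?normr0.
have cM x : `|cut A g x| <= M * \1_(`[- (A + 1), A + 1]%classic) x.
  rewrite cutE indicE mem_setE /= in_itv /= -ler_norml; case: ifP => [xA|_].
    by rewrite (_ : `|x| <= A + 1) ?mulr1 ?hM// (le_trans xA)// lerDl.
  by rewrite normr0 mulr_ge0// ler0n.
have mc := mea_cut A mg.
have [] := @dct _ _ _ mu (fun k x => `|cut A g (z k + x) - cut A g x|) (fun=> 0)
   (fun x => 2 * M * \1_(`[- (A + 1), A + 1]%classic) x).
- move=> k; apply: mea_abs; apply: meaB => //; apply: (mea_comp mc).
  by apply: meaD; [exact: mea_cst|exact: mea_id].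
- exact: mea_cst.
- by apply: itgZ; exact: integrable_indic_itv.
- move=> k x; rewrite normr_id; apply: le_trans (ler_normB _ _) _.
  have -> : 2 * M * \1_(`[- (A + 1), A + 1]%classic) x = M * \1_(`[- (A + 1), A + 1]%classic) x + M * \1_(`[- (A + 1), A + 1]%classic) x by ring.
  apply: lerD => //; rewrite cutE indicE mem_setE /= in_itv /= -ler_norml.
  case: ifP => [xA|_]; last by rewrite normr0 mulr_ge0// ler0n.
  rewrite (_ : `|x| <= A + 1) ?mulr1 ?hM//.
  have -> : x = (z k + x) - z k by ring.
  by apply: le_trans (ler_normB _ _) _; exact: lerD.
- exists ([set A] `|` [set - A]); split.
  + by apply: measurableU; exact: measurable_set1.
  + by rewrite measureU0; [exact: lebesgue_measure_set1|exact: measurable_set1|exact: measurable_set1|exact: lebesgue_measure_set1].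
  + move=> x /= h; apply: contrapT => /not_orP[xA xNA]; apply: h.
    have cz : z k + x @[k --> \oo] --> x.
      by rewrite -[X in _ --> X]add0r; apply: cvgD => //; exact: cvg_cst.
    have cN : `|z k + x| @[k --> \oo] --> `|x| by exact: cvg_norm.
    have cgx : g (z k + x) @[k --> \oo] --> g x by apply: (cvg_comp _ _ cz); exact: cg.
    rewrite -(normr0 R); apply: cvg_norm; rewrite -(subrr (cut A g x)).
    apply: cvgB; last exact: cvg_cst.
    rewrite cutE; case: (ltrgtP `|x| A) => [lt|gt|e].
    * apply: cvg_trans cgx; apply: near_eq_cvg.
      have hl : \forall k \near \oo, `|z k + x| < A by apply: (cvgr_lt _ cN).
      by apply: filterS hl => k hk; rewrite cutE ltW.
    * apply: cvg_near_cst.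
      have hl : \forall k \near \oo, A < `|z k + x| by apply: (cvgr_gt _ cN).
      by apply: filterS hl => k hk; rewrite cutE leNgt hk.
    * by exfalso; have [x0|x0] := leP 0 x; [apply: xA; rewrite -e ger0_norm|apply: xNA; rewrite -e ltr0_norm// opprK].
by move=> _; rewrite Rintegral_cst// mul0r.
Qed.

Lemma shift_diff_L1 f k : itg mu f -> I (fun x => `|f (z k + x) - f x|) <= 2 * I (fun x => `|f x|).
Proof.
move=> fi; have fs := itg_shift (z k) fi.
apply: (@le_trans _ _ (I (fun x => `|f (z k + x)| + `|f x|))).
  apply: I_le; [exact/itg_abs/itgB|by apply: itgD; exact: itg_abs|].
  by move=> x; exact: ler_normB.
rewrite (ID (itg_abs fs) (itg_abs fi)) (@I_shift _ (z k) (fun x => `|f x|)); last exact: itg_abs.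
lra.
Qed.

(** Approximate f by truncated continuous functions, for which dominated
    convergence applies. *)
Lemma shift_cvg_L1 f : itg mu f ->
  I (fun x => `|f (z k + x) - f x|) @[k --> \oo] --> (0 : R).
Proof.
move=> fi; apply/cvgr0Pnorm_le => e e0.
have e6 : 0 < e / 6 by lra.
have /cvgr0Pnorm_le /(_ _ e6) [N _ hN] := cut_cvg_L1 fi.
pose A : R := N%:R; have A0 : 0 <= A by exact: ler0n.
have hA : I (fun x => `|f x - cut A f x|) <= e / 6.
  by apply: le_trans (ler_norm _) _; apply: hN => /=.
have [g [cgx hg]] := cut_continuous_approx A fi e6.
have mg : mea g by exact: continuous_measurable_fun.
have e3 : 0 < e / 3 by lra.
have /cvgr0Pnorm_le /(_ _ e3) := shift_cvg_continuous cgx A0.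
apply: filterS => k hk; have mf := itg_mea fi.
have cfi := itg_cut A fi.
have di : itg mu (fun x => f x - cut A f x) by exact: itgB.
have cgi : itg mu (cut A g).
  have [M hM] := continuous_bounded_segment A cgx.
  apply: (@itg_indic_bounded R (- A) A M) => // x xA.
  by apply: hM; rewrite ler_norml.
have di2 : itg mu (fun x => cut A f x - cut A g x) by exact: itgB.
rewrite ger0_norm; last by apply: I_ge0 => x.
rewrite ger0_norm in hk; last by apply: I_ge0 => x.
pose d1 x := f x - cut A f x; pose d2 x := cut A f x - cut A g x.
have s1 := itg_shift (z k) di; have s2 := itg_shift (z k) di2; have s3 := itg_shift (z k) cgi.
have n1 : itg mu (fun x => `|d1 (z k + x) - d1 x|) by apply: itg_abs; exact: itgB.
have n2 : itg mu (fun x => `|d2 (z k + x) - d2 x|) by apply: itg_abs; exact: itgB.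
have n3 : itg mu (fun x => `|cut A g (z k + x) - cut A g x|) by apply: itg_abs; exact: itgB.
have b1 := shift_diff_L1 k di; have b2 := shift_diff_L1 k di2.
have : I (fun x => `|f (z k + x) - f x|) <= I (fun x => (`|d1 (z k + x) - d1 x| + `|d2 (z k + x) - d2 x|)
     + `|cut A g (z k + x) - cut A g x|).
  apply: I_le; [by apply: itg_abs; apply: itgB => //; exact: itg_shift|by apply: itgD => //; exact: itgD|].
  move=> x; rewrite /d1 /d2; apply: le_trans (lerD (ler_normD _ _) (lexx _)).
  apply: le_trans (ler_normD _ _); rewrite le_eqVlt; apply/orP; left; apply/eqP.
  by congr `|_|; ring.
rewrite (ID (itgD n1 n2) n3) (ID n1 n2).
by rewrite /d1 /d2; move: hA hg hk b1 b2; lra.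
Qed.

End translation_continuity.

(** * The Plancherel identity *)

Section plancherel.
Variable R : realType.
Local Notation mu := (@lebesgue_measure R).
Local Notation mu2 := (leb2 R).
Local Notation "'I' f" := (Rintegral mu [set: _] f) (at level 10, f at level 8).
Local Notation "'I2' f" := (Rintegral mu2 [set: R * R] f) (at level 10, f at level 8).
Implicit Types F G : R -> R.

Definition cos_transform F y := I (fun x => F x * cos (y * x)).
Definition sin_transform F y := I (fun x => F x * sin (y * x)).

Lemma itg_bounded_mul F (b : R -> R) : itg mu F -> mea b -> (forall x, `|b x| <= 1) ->
  itg mu (fun x => F x * b x).
Proof.
move=> Fi mb b1; apply: (itg_le (m := mu) _ _ (itg_abs Fi)).
  by apply: meaM => //; exact: itg_mea Fi.
by move=> x; rewrite normrM ler_piMr.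
Qed.

Lemma I_bounded_mul F (b : R -> R) : itg mu F -> mea b -> (forall x, `|b x| <= 1) ->
  `|I (fun x => F x * b x)| <= I (fun x => `|F x|).
Proof.
move=> Fi mb b1; apply: I_abs_le; [|exact: itg_abs|].
  by apply: meaM => //; exact: itg_mea Fi.
by move=> x; rewrite normrM ler_piMr.
Qed.

Lemma norm_cos_le1 (x : R) : `|cos x| <= 1.
Proof. by rewrite ler_norml cos_geN1 cos_le1. Qed.
Lemma norm_sin_le1 (x : R) : `|sin x| <= 1.
Proof. by rewrite ler_norml sin_geN1 sin_le1. Qed.
Lemma mea_cosM (y : R) : mea (fun x : R => cos (y * x)).
Proof. by apply: (mea_comp (@mea_cos _)); apply: meaM; [exact: mea_cst|exact: mea_id]. Qed.
Lemma mea_sinM (y : R) : mea (fun x : R => sin (y * x)).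
Proof. by apply: (mea_comp (@mea_sin _)); apply: meaM; [exact: mea_cst|exact: mea_id]. Qed.

Lemma itg_ctr F y : itg mu F -> itg mu (fun x => F x * cos (y * x)).
Proof. by move=> Fi; apply: itg_bounded_mul => // [|x]; [exact: mea_cosM|exact: norm_cos_le1]. Qed.
Lemma itg_str F y : itg mu F -> itg mu (fun x => F x * sin (y * x)).
Proof. by move=> Fi; apply: itg_bounded_mul => // [|x]; [exact: mea_sinM|exact: norm_sin_le1]. Qed.
Lemma ctr_le F y : itg mu F -> `|cos_transform F y| <= I (fun x => `|F x|).
Proof. by move=> Fi; apply: I_bounded_mul => // [|x]; [exact: mea_cosM|exact: norm_cos_le1]. Qed.
Lemma str_le F y : itg mu F -> `|sin_transform F y| <= I (fun x => `|F x|).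
Proof. by move=> Fi; apply: I_bounded_mul => // [|x]; [exact: mea_sinM|exact: norm_sin_le1]. Qed.

Lemma mea_ctr F : mea F -> mea (cos_transform F).
Proof.
move=> mF; apply: (@mea_iterated R (fun z => F z.2 * cos (z.1 * z.2))).
by solve_mea.
Qed.
Lemma mea_str F : mea F -> mea (sin_transform F).
Proof.
move=> mF; apply: (@mea_iterated R (fun z => F z.2 * sin (z.1 * z.2))).
by solve_mea.
Qed.

Lemma ctr_shifted F (y b : R) : itg mu F ->
  I (fun a => F a * cos ((a - b) * y)) = cos (y * b) * cos_transform F y + sin (y * b) * sin_transform F y.
Proof.
move=> Fi; rewrite /cos_transform /sin_transform -!IZ ?itg_ctr ?itg_str//.
rewrite -ID; [|by apply: itgZ; exact: itg_ctr|by apply: itgZ; exact: itg_str].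
by apply: eqI => a; rewrite mulrBl cosB (mulrC a) (mulrC b); ring.
Qed.

Section autocorrelation.
Variable F : R -> R.
Hypotheses (Fi : itg mu F) (F2 : sqi mu F).

(** Cutting off the large values of F reduces this to continuity of
    translation in L1. *)
Lemma shift_cvg_L2 (z : nat -> R) : (forall k, `|z k| <= 1) -> z k @[k --> \oo] --> (0 : R) ->
  I (fun x => (F (z k + x) - F x) ^+ 2) @[k --> \oo] --> (0 : R).
Proof.
move=> z1 z0; have mF := itg_mea Fi.
pose FM (M : R) x := if `|F x| <= M then F x else 0.
have mFM M : mea (FM M).
  have hb : measurable_fun [set: R] (fun x => `|F x| <= M).
    by apply: measurable_fun_ler; [exact: mea_abs|exact: mea_cst].
  by apply: measurable_fun_ifT; first [exact: hb|exact: mF|exact: mea_cst].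
have FMle M x : `|FM M x| <= `|F x| by rewrite /FM; case: ifP; rewrite ?normr0.
have FMi M : itg mu (FM M) := (itg_le (m := mu) (mFM M) (FMle M) (itg_abs Fi)).
have FM2 M : sqi mu (FM M) := (sqi_le (m := mu) (mFM M) F2 (FMle M)).
have tail : I (fun x => (F x - FM k%:R x) ^+ 2) @[k --> \oo] --> (0 : R).
  have [] := @dct _ _ _ mu (fun k x => (F x - FM k%:R x) ^+ 2) (fun=> 0) (fun x => F x ^+ 2).
  - by move=> k; apply: meaX; exact: (meaB mF (mFM _)).
  - exact: mea_cst.
  - exact: F2.2.
  - move=> k x; rewrite ger0_norm ?sqr_ge0// /FM; case: ifP => _; last by rewrite subr0.
    by rewrite subrr expr0n sqr_ge0.
  - apply: aeW => x; apply: cvg_near_cst; near=> k; rewrite /FM (_ : `|F x| <= k%:R).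
      by rewrite subrr expr0n.
    apply: ltW; apply: lt_le_trans (truncnS_gt `|F x|) _; rewrite ler_nat.
    by near: k; exact: nbhs_infty_gt.
  by move=> _; rewrite Rintegral_cst// mul0r.
apply/cvgr0Pnorm_le => e e0.
have e16 : 0 < e / 16 by lra.
have /cvgr0Pnorm_le /(_ _ e16) [N _ hN] := tail.
pose M : R := N%:R + 1; pose G x := F x - FM N%:R x.
have hG : I (fun x => G x ^+ 2) <= e / 16.
  by apply: le_trans (ler_norm _) _; apply: hN => /=.
have M0 : 0 < M by rewrite ltr_wpDl.
have eM : 0 < e / (8 * M) by rewrite divr_gt0// mulr_gt0.
have /cvgr0Pnorm_le /(_ _ eM) := shift_cvg_L1 z1 z0 (FMi N%:R).
apply: filterS => k; rewrite ger0_norm; last by apply: I_ge0 => x.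
move=> hk; rewrite ger0_norm; last by apply: I_ge0 => x; exact: sqr_ge0.
have G2 : sqi mu G by exact: sqiB.
have Gs := sqi_shift (z k) G2.
have FMs := sqi_shift (z k) (FM2 N%:R).
have d1 : itg mu (fun x => `|FM N%:R (z k + x) - FM N%:R x|).
  by apply: itg_abs; apply: itgB => //; exact: itg_shift.
have bM x : `|FM N%:R x| <= N%:R.
  by rewrite /FM; case: ifP => // _; rewrite normr0.
have maj x : (F (z k + x) - F x) ^+ 2 <= 4 * M * `|FM N%:R (z k + x) - FM N%:R x| +
    (4 * G (z k + x) ^+ 2 + 4 * G x ^+ 2).
  have -> : F (z k + x) - F x = (FM N%:R (z k + x) - FM N%:R x) + (G (z k + x) - G x).
    by rewrite /G; ring.
  move: (bM (z k + x)) (bM x); move: (FM N%:R (z k + x)) (FM N%:R x) (G (z k + x)) (G x) => a b c d ha hb.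
  have hab : `|a - b| <= 2 * M by apply: le_trans (ler_normB _ _) _; rewrite /M; lra.
  have s1 : (a - b) ^+ 2 <= 2 * M * `|a - b|.
    by rewrite -real_normK ?num_real// expr2 ler_wpM2r.
  have := sqr_ge0 ((a - b) - (c - d)); have := sqr_ge0 (c + d); nra.
have hA := (sqiB (sqi_shift (z k) F2) F2).2.
have hB := itgD (itgZ (4 * M) d1) (itgD (itgZ 4 Gs.2) (itgZ 4 G2.2)).
apply: (le_trans (I_le (m := mu) hA hB maj)).
rewrite ID; [|exact: itgZ|by apply: itgD; apply: itgZ; [exact: Gs.2|exact: G2.2]].
rewrite ID; [|by apply: itgZ; exact: Gs.2|by apply: itgZ; exact: G2.2].
rewrite (IZ _ d1) (IZ _ Gs.2) (IZ _ G2.2) (@I_shift _ (z k) (fun x => G x ^+ 2)); last exact: G2.2.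
have : 4 * M * I (fun x => `|FM N%:R (z k + x) - FM N%:R x|) <= 4 * M * (e / (8 * M)).
  by rewrite ler_pM2l// mulr_gt0.
have -> : 4 * M * (e / (8 * M)) = e / 2 by field; rewrite gt_eqF.
lra.
Unshelve. all: by end_near. Qed.

Definition autocorr t := I (fun b => F b * F (t + b)).

Lemma autocorr_le t : `|autocorr t| <= I (fun x => F x ^+ 2).
Proof.
apply: le_trans (nrm2_CS1 F2 (sqi_shift t F2)) _.
by rewrite nrm2_shift// -expr2 nrm2_sqr.
Qed.

Lemma autocorr_cvg (z : nat -> R) : (forall k, `|z k| <= 1) -> z k @[k --> \oo] --> (0 : R) ->
  autocorr (z k) @[k --> \oo] --> I (fun x => F x ^+ 2).
Proof.
move=> z1 z0; have h := shift_cvg_L2 z1 z0.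
have e k : autocorr (z k) = I (fun x => F x ^+ 2) - 2^-1 * I (fun x => (F (z k + x) - F x) ^+ 2).
  have s2 := sqi_shift (z k) F2; have m2 := sqi_mul F2 s2.
  have -> : I (fun x => (F (z k + x) - F x) ^+ 2) =
     2 * I (fun x => F x ^+ 2) - 2 * autocorr (z k).
    rewrite /autocorr -(IZ 2 m2).
    have -> : 2 * I (fun x => F x ^+ 2) = I (fun x => F (z k + x) ^+ 2 + F x ^+ 2).
      rewrite (ID s2.2 F2.2) (@I_shift _ (z k) (fun x => F x ^+ 2)); [ring|exact: F2.2].
    rewrite -IB; [|by apply: itgD; [exact: s2.2|exact: F2.2]|exact: itgZ].
    by apply: eqI => x; ring.
  by field.
rewrite (funext e) -[X in _ --> X]subr0 -(mulr0 2^-1).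
by apply: cvgB; [exact: cvg_cst|apply: cvgM => //; exact: cvg_cst].
Qed.

(** Written as a double integral, the squared transform of F pairs F(a) F(b)
    with cos (y (a - b)). Integrating in y first gives a Poisson kernel in
    a - b. *)
Lemma damped_plancherel (e : R) : 0 < e ->
  let g y := expR (- e * `|y|) * (cos_transform F y ^+ 2 + sin_transform F y ^+ 2) in
  itg mu g /\ I g = I (fun t => cauchy_kernel t * autocorr (e * t)).
Proof.
move=> e0 g; have mF := itg_mea Fi.
pose w (y : R) := expR (- e * `|y|).
have mw : mea w.
  apply: (@mea_comp _ _ _ expR); first exact: measurable_expR.
  by apply: meaM; [exact: mea_cst|apply: mea_abs; exact: mea_id].
have wi : itg mu w.
  have [h _] := exp_abs_transform 0 e0; apply: eq_itg h => y.
  by rewrite mul0r cos0 mulr1.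
have w0 y : 0 <= w y by exact: expR_ge0.
pose K z : R := 2 * e / (e ^+ 2 + z ^+ 2).
have KE z : I (fun y => w y * cos (z * y)) = K z.
  by have [_ ->] := exp_abs_transform z e0.
pose N1 := I (fun x => `|F x|).
have N10 : 0 <= N1 by apply: I_ge0 => x.
have mc := mea_ctr mF; have ms := mea_str mF.
have inner b : I (fun y => w y * (cos (y * b) * cos_transform F y + sin (y * b) * sin_transform F y)) =
    I (fun a => F a * K (a - b)).
  pose H z := w z.1 * (F z.2 * cos ((z.2 - b) * z.1)).
  have mH : mea H by rewrite /H; solve_mea.
  have Hb y : itg mu (fun a => F a * cos ((a - b) * y)).
    apply: itg_bounded_mul => // [|x]; last exact: norm_cos_le1.
    by solve_mea.
  have [Hi _] : itg mu2 H /\ I2 (fun z => `|H z|) <= I (fun y => N1 * w y).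
    apply: itg2_bound => //.
    - by move=> y; rewrite /H /=; apply: itgZ; exact: Hb.
    - move=> y; rewrite /H /=; under eqI do rewrite normrM (ger0_norm (w0 _)).
      rewrite IZ; last exact: itg_abs.
      rewrite mulrC; apply: ler_wpM2r => //; apply: I_le; [exact: itg_abs|exact: itg_abs|].
      by move=> x; rewrite normrM ler_piMr// norm_cos_le1.
    - exact: itgZ.
  have [_ h1] := fubini1 Hi; have [_ h2] := fubini2 Hi.
  rewrite [LHS](_ : _ = I2 H); last first.
    by rewrite h1; apply: eqI => y; rewrite /H /= IZ// ctr_shifted.
  rewrite h2; apply: eqI => a; rewrite /H /= -KE -IZ.
    by apply: eqI => y; ring.
  by apply: itg_bounded_mul => // [|x]; [exact: mea_cosM|exact: norm_cos_le1].
pose H z := w z.1 * (F z.2 * (cos (z.1 * z.2) * cos_transform F z.1 + sin (z.1 * z.2) * sin_transform F z.1)).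
have mH : mea H.
  rewrite /H; have ms1 : mea (fun z : R * R => sin_transform F z.1) := mea_comp ms (@mea_fst R).
  have mc1 : mea (fun z : R * R => cos_transform F z.1) := mea_comp mc (@mea_fst R).
  by solve_mea.
have bb y x : `|cos (y * x) * cos_transform F y + sin (y * x) * sin_transform F y| <= 2 * N1.
  apply: le_trans (ler_normD _ _) _; rewrite !normrM (_ : 2 * N1 = N1 + N1); last by ring.
  apply: lerD.
    by apply: le_trans (ctr_le y Fi); rewrite ler_piMl// norm_cos_le1.
  by apply: le_trans (str_le y Fi); rewrite ler_piMl// norm_sin_le1.
have Hin y : itg mu (fun x => F x * (cos (y * x) * cos_transform F y + sin (y * x) * sin_transform F y)).
  apply: eq_itg (itgD (itgZ (cos_transform F y) (itg_ctr y Fi)) (itgZ (sin_transform F y) (itg_str y Fi))) => x.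
  by ring.
have HinE y : I (fun x => F x * (cos (y * x) * cos_transform F y + sin (y * x) * sin_transform F y)) =
    cos_transform F y ^+ 2 + sin_transform F y ^+ 2.
  rewrite [LHS](_ : _ = I (fun x => cos_transform F y * (F x * cos (y * x)) + sin_transform F y * (F x * sin (y * x)))).
    by rewrite (ID (itgZ _ (itg_ctr y Fi)) (itgZ _ (itg_str y Fi))) (IZ _ (itg_ctr y Fi)) (IZ _ (itg_str y Fi)) !expr2.
  by apply: eqI => x; ring.
have [Hi _] : itg mu2 H /\ I2 (fun z => `|H z|) <= I (fun y => (N1 * (2 * N1)) * w y).
  apply: itg2_bound => //.
  - by move=> y; rewrite /H /=; apply: itgZ; exact: Hin.
  - move=> y; rewrite /H /=; under eqI do rewrite normrM (ger0_norm (w0 _)).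
    rewrite IZ; last exact: itg_abs.
    rewrite mulrC; apply: ler_wpM2r => //.
    rewrite /N1 -RintegralZr//; last exact: itg_abs.
    apply: I_le; [exact: itg_abs|apply: eq_itg (itgZ (2 * N1) (itg_abs Fi)) => x; exact: mulrC|].
    by move=> x; rewrite normrM; apply: ler_wpM2l.
  - exact: itgZ.
have [g1 h1] := fubini1 Hi; have [_ h2] := fubini2 Hi.
have gE y : I (fun x => H (y, x)) = g y by rewrite /H /= IZ// HinE.
split; first by apply: eq_itg g1.
rewrite -(eqI mu gE) -h1 h2.
(* substituting a = e t + b turns K (a - b) into the Cauchy kernel in t *)
have poisson b : I (fun a => F a * K (a - b)) = I (fun t => cauchy_kernel t * F (e * t + b)).
  have Kle z : `|K z| <= 2 / e.
    have D0 : 0 < e ^+ 2 + z ^+ 2 by rewrite ltr_pwDl ?exprn_gt0// sqr_ge0.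
    rewrite ger0_norm; last by rewrite /K divr_ge0 ?mulr_ge0 ?(ltW e0) ?(ltW D0).
    rewrite /K ler_pdivrMr// mulrAC ler_pdivlMr// -mulrA -expr2 ler_pM2l//.
    by rewrite lerDl sqr_ge0.
  have mK : mea K.
    have -> : K = fun z => (2 * e) * (e ^+ 2 + z ^+ 2) `^ (-1).
      by apply/funext => z; rewrite /K powR_inv1// addr_ge0 ?sqr_ge0.
    apply: meaM; first exact: mea_cst.
    apply: (@mea_comp _ _ _ (fun x => x `^ (-1))); first exact: measurable_powR.
    by apply: meaD; [exact: mea_cst|apply: meaX; exact: mea_id].
  pose f a := F a * K (a - b).
  have mf : mea f by apply: meaM => //; apply: (mea_comp mK); apply: meaB; [exact: mea_id|exact: mea_cst].
  have fi : itg mu f.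
    apply: (itg_le (m := mu) mf _ (itgZ (2 / e) (itg_abs Fi))) => x.
    by rewrite normrM mulrC; apply: ler_wpM2r.
  have := I_scale e0 (itg_shift b fi); rewrite (I_shift b fi) => hs.
  rewrite -/f; have -> : I f = e * I (fun x => f (b + e * x)).
    by rewrite hs mulrA divff ?mul1r// gt_eqF.
  rewrite -IZ; last exact: (itg_scale e0 (itg_shift b fi)).
  apply: eqI => t; rewrite /f /K /cauchy_kernel (addrC b) addrK.
  have D0 : 1 + t ^+ 2 != 0 by rewrite gt_eqF// ltr_pwDl// sqr_ge0.
  have D1 : e ^+ 2 + (e * t) ^+ 2 != 0.
    by rewrite gt_eqF// ltr_pwDl ?exprn_gt0// sqr_ge0.
  by field; rewrite D0 D1 /=.
have [ki kI] := cauchy_kernel_itg R.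
have k0 (t : R) : 0 <= cauchy_kernel t by rewrite /cauchy_kernel divr_ge0// addr_ge0// sqr_ge0.
pose H3 z := cauchy_kernel z.1 * (F z.2 * F (e * z.1 + z.2)).
have mk := itg_mea ki.
have [H3i _] : itg mu2 H3 /\ I2 (fun z => `|H3 z|) <= I (fun t => I (fun x => F x ^+ 2) * cauchy_kernel t).
  apply: itg2_bound.
  - have mk1 : mea (fun z : R * R => cauchy_kernel z.1) := mea_comp mk (@mea_fst R).
    by rewrite /H3; solve_mea.
  - by move=> t; rewrite /H3 /=; apply: itgZ; exact: sqi_mul F2 (sqi_shift _ F2).
  - move=> t; rewrite /H3 /=; under eqI do rewrite normrM (ger0_norm (k0 _)).
    rewrite IZ; last by apply: itg_abs; exact: sqi_mul F2 (sqi_shift _ F2).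
    rewrite mulrC; apply: ler_wpM2r => //.
    apply: le_trans (nrm2_CS F2 (sqi_shift _ F2)) _.
    by rewrite nrm2_shift// -expr2 nrm2_sqr.
  - exact: itgZ.
have [_ k1] := fubini1 H3i; have [_ k2] := fubini2 H3i.
transitivity (I2 H3); last first.
  by rewrite k1; apply: eqI => t; rewrite /H3 /= IZ//; exact: sqi_mul F2 (sqi_shift _ F2).
rewrite k2; apply: eqI => b; rewrite /H3 /H /=.
have -> : I (fun x => w x * (F b * (cos (x * b) * cos_transform F x + sin (x * b) * sin_transform F x))) =
    F b * I (fun y => w y * (cos (y * b) * cos_transform F y + sin (y * b) * sin_transform F y)).
  rewrite -IZ; first by apply: eqI => y; ring.
  apply: (itg_le (m := mu) _ _ (itgZ (2 * N1) wi)).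
    by solve_mea.
  by move=> y; rewrite normrM (ger0_norm (w0 _)) mulrC; apply: ler_wpM2r.
rewrite inner poisson -IZ; first by apply: eqI => t; ring.
have hs := itg_scale e0 (itg_shift b Fi).
have hk (x : R) : `|cauchy_kernel x| <= 2.
  rewrite ger0_norm// /cauchy_kernel ler_pdivrMr ?ler_peMr ?lerDl ?sqr_ge0//.
  by rewrite ltr_pwDl// sqr_ge0.
apply: (itg_le (m := mu) _ _ (itgZ 2 (itg_abs hs))).
  by apply: meaM => //; apply: (mea_comp mF); solve_mea.
by move=> x; rewrite normrM (addrC _ b); apply: ler_wpM2r.
Qed.

(** In the damped identity let e tend to 0: the Cauchy kernel has total mass 2
    pi and the autocorrelation is continuous at 0. *)
Theorem plancherel :
  itg mu (fun y => cos_transform F y ^+ 2 + sin_transform F y ^+ 2) /\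
  I (fun y => cos_transform F y ^+ 2 + sin_transform F y ^+ 2) = 2 * pi * I (fun x => F x ^+ 2).
Proof.
have mF := itg_mea Fi; have mc := mea_ctr mF; have ms := mea_str mF.
pose e k : R := k.+1%:R^-1.
have e0 k : 0 < e k by rewrite invr_gt0 ltr0n.
have e1 k : e k <= 1 by rewrite invf_le1 ?ler1n ?ltr0n.
have ec : e k @[k --> \oo] --> (0 : R) by exact: cvg_harmonic.
pose P y := cos_transform F y ^+ 2 + sin_transform F y ^+ 2.
have P0 y : 0 <= P y by rewrite addr_ge0 ?sqr_ge0.
have mP : mea P by rewrite /P; solve_mea.
pose w k (y : R) := expR (- e k * `|y|).
have w0 k y : 0 <= w k y by exact: expR_ge0.
have w1 k y : w k y <= 1.
  by rewrite /w -expR0 ler_expR mulNr oppr_le0 mulr_ge0// ltW.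
have mw k : mea (w k).
  apply: (@mea_comp _ _ _ expR); first exact: measurable_expR.
  by apply: meaM; [exact: mea_cst|apply: mea_abs; exact: mea_id].
have [ki kI] := cauchy_kernel_itg R; have mk := itg_mea ki.
have k0 (t : R) : 0 <= cauchy_kernel t by rewrite /cauchy_kernel divr_ge0// addr_ge0// sqr_ge0.
set N := I (fun x => F x ^+ 2).
have dl k := damped_plancherel (e0 k).
have wc y : w k y * P y @[k --> \oo] --> P y.
  rewrite -[X in _ --> X]mul1r; apply: cvgM; last exact: cvg_cst.
  rewrite -expR0; apply: (cvg_comp (fun k => - e k * `|y|) expR); last exact: continuous_expR.
  rewrite -(mul0r `|y|); apply: cvgM; last exact: cvg_cst.
  by rewrite -oppr0; exact: cvgN.
have mphi k : mea (fun t => autocorr (e k * t)).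
  by apply: (@mea_iterated R (fun z => F z.2 * F (e k * z.1 + z.2))); solve_mea.
have rhs : I (fun t => cauchy_kernel t * autocorr (e k * t)) @[k --> \oo] --> 2 * pi * N.
  have [] := @dct _ _ _ mu (fun k t => cauchy_kernel t * autocorr (e k * t))
     (fun t => cauchy_kernel t * N) (fun t => N * cauchy_kernel t).
  - by move=> k; exact: (meaM mk (mphi k)).
  - by apply: meaM; [exact: mk|exact: mea_cst].
  - exact: itgZ.
  - move=> k t; rewrite normrM (ger0_norm (k0 _)) mulrC; apply: ler_wpM2r => //.
    exact: autocorr_le.
  - apply: aeW => t; apply: cvgM; first exact: cvg_cst.
    pose a := `|t| + 1; have a1 : 1 <= a by rewrite lerDr.
    have z1 : \forall k \near \oo, `|e k * t| <= 1.
      have hz : `|e k * t| @[k --> \oo] --> (0 : R).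
        rewrite -(normr0 R) -(mul0r t); apply: cvg_norm; apply: cvgM => //; exact: cvg_cst.
      have := cvgr_le _ hz _ (@ltr01 R); exact.
    case: z1 => n _ hn.
    suff : autocorr (e (k + n)%N * t) @[k --> \oo] --> N.
      by rewrite (cvg_shiftn n (fun k => autocorr (e k * t))).
    apply: autocorr_cvg; first by move=> k; apply: hn => /=; exact: leq_addl.
    have hz : e k * t @[k --> \oo] --> (0 : R).
      by rewrite -(mul0r t); apply: cvgM => //; exact: cvg_cst.
    by rewrite (cvg_shiftn n (fun k => e k * t)).
  by move=> _; rewrite RintegralZr// kI.
have lhsE k : I (fun y => w k y * P y) = I (fun t => cauchy_kernel t * autocorr (e k * t)).
  by have [_ ->] := dl k.
have bnd k : I (fun y => w k y * P y) <= 2 * pi * N.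
  rewrite lhsE -kI -RintegralZr//; apply: I_le.
  - apply: (itg_le (m := mu) _ _ (itgZ N ki)); first exact: (meaM mk (mphi k)).
    move=> t; rewrite normrM (ger0_norm (k0 _)) mulrC; apply: ler_wpM2r => //; exact: autocorr_le.
  - by apply: eq_itg (itgZ N ki) => x; rewrite mulrC.
  - move=> t; apply: ler_wpM2l => //; apply: le_trans (ler_norm _) (autocorr_le _).
have [Pi _] : itg mu P /\ I P <= 2 * pi * N.
  apply: (@fatou_bound _ _ _ mu (fun k y => w k y * P y)) => //.
  - by move=> k; exact: (meaM (mw k) mP).
  - by move=> k y; exact: mulr_ge0.
  - by move=> k; have [] := dl k.
  - by apply: aeW.
split => //.
have [] := @dct _ _ _ mu (fun k y => w k y * P y) P P => //.
- by move=> k; exact: (meaM (mw k) mP).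
- by move=> k y; rewrite ger0_norm ?mulr_ge0// ler_piMl.
- by apply: aeW.
move=> _; rewrite (funext lhsE) => h.
exact: (@norm_cvg_unique _ R^o _ _ _ _ h rhs).
Qed.

End autocorrelation.
End plancherel.

(** * Convolution *)

Section convolution.
Variable R : realType.
Local Notation mu := (@lebesgue_measure R).
Local Notation mu2 := (leb2 R).
Local Notation "'I' f" := (Rintegral mu [set: _] f) (at level 10, f at level 8).
Local Notation "'I2' f" := (Rintegral mu2 [set: R * R] f) (at level 10, f at level 8).
Local Notation N := (nrm2 mu).
Implicit Types F G f g : R -> R.

Lemma I2_product f g : itg mu f -> itg mu g ->
  itg mu2 (fun z => f z.1 * g z.2) /\ I2 (fun z => f z.1 * g z.2) = I f * I g.
Proof.
move=> fi gi; have mf := itg_mea fi; have mg := itg_mea gi.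
have [h _] : itg mu2 (fun z => f z.1 * g z.2) /\ I2 (fun z => `|f z.1 * g z.2|) <=
    I (fun x => I (fun y => `|g y|) * `|f x|).
  apply: itg2_bound; first by solve_mea.
  - by move=> x /=; exact: itgZ.
  - move=> x /=; under eqI do rewrite normrM.
    by rewrite IZ ?(mulrC `|f x|)//; exact: itg_abs.
  - by apply: itgZ; exact: itg_abs.
split => //; have [_ ->] := fubini1 h.
by rewrite -(RintegralZr _ _ fi)//; apply: eqI => x /=; rewrite IZ.
Qed.

Definition conv G F x := I (fun b => G (x - b) * F b).

Section bounds.
Variables G F : R -> R.
Hypotheses (Gi : itg mu G) (G2 : sqi mu G) (Fi : itg mu F) (F2 : sqi mu F).

Let sqi_sub x : sqi mu (fun b => G (x - b)).
Proof. exact: sqi_opp (sqi_shift x G2). Qed.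

Lemma conv_pairing (phi : R -> R) :
  itg mu2 (fun z => G z.1 * F z.2 * phi (z.1 + z.2)) ->
  itg mu (fun x => conv G F x * phi x) /\
  I2 (fun z => G z.1 * F z.2 * phi (z.1 + z.2)) = I (fun x => conv G F x * phi x).
Proof.
move=> h; have [h1 h2] := fubini1 (itg_shear h).
have E x : I (fun y => G (shear (x, y)).1 * F (shear (x, y)).2 * phi ((shear (x, y)).1 + (shear (x, y)).2))
   = conv G F x * phi x.
  rewrite [RHS]mulrC /conv -(IZ _ (sqi_mul (sqi_sub x) F2)).
  by apply: eqI => y; rewrite /shear /= subrK mulrC.
by rewrite -(I2_shear h) h2 (eqI mu E); split => //; exact: eq_itg E h1.
Qed.

Lemma itg_conv : itg mu (conv G F).
Proof.
have [h _] := I2_product Gi Fi.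
have [] := @conv_pairing (fun=> 1); first by apply: eq_itg h => z; rewrite mulr1.
by move=> + _; apply: eq_itg => x; rewrite mulr1.
Qed.

Lemma conv_bounded x : `|conv G F x| <= N G * N F.
Proof.
apply: le_trans (nrm2_CS1 (sqi_sub x) F2) _.
by rewrite (@nrm2_opp _ (fun b => G (x + b)))  ?nrm2_shift//; exact: sqi_shift.
Qed.

Lemma sqi_conv : sqi mu (conv G F).
Proof.
have ci := itg_conv; have mc := itg_mea ci; split => //.
apply: (itg_le (m := mu) (meaX 2 mc) _ (itgZ (N G * N F) (itg_abs ci))) => x.
by rewrite normrX expr2 ler_wpM2r// conv_bounded.
Qed.

Lemma conv_trigonometric y :
  cos_transform (conv G F) y = cos_transform G y * cos_transform F y - sin_transform G y * sin_transform F y /\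
  sin_transform (conv G F) y = sin_transform G y * cos_transform F y + cos_transform G y * sin_transform F y.
Proof.
have [cc ccE] := I2_product (itg_ctr y Gi) (itg_ctr y Fi).
have [ss ssE] := I2_product (itg_str y Gi) (itg_str y Fi).
have [sc scE] := I2_product (itg_str y Gi) (itg_ctr y Fi).
have [cs csE] := I2_product (itg_ctr y Gi) (itg_str y Fi).
split.
- have e z : G z.1 * cos (y * z.1) * (F z.2 * cos (y * z.2)) -
     G z.1 * sin (y * z.1) * (F z.2 * sin (y * z.2)) =
     G z.1 * F z.2 * cos (y * (z.1 + z.2)) by rewrite mulrDr cosD; ring.
  have hi : itg mu2 (fun z => G z.1 * F z.2 * cos (y * (z.1 + z.2))).
    by apply: eq_itg (itgB cc ss) => z; rewrite -e.
  have [_ E] := @conv_pairing (fun x => cos (y * x)) hi; rewrite [LHS](_ : _ = I (fun x => conv G F x * cos (y * x)))// -E.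
  by rewrite -ccE -ssE -(IB cc ss); apply: eqI => z; rewrite e.
- have e z : G z.1 * sin (y * z.1) * (F z.2 * cos (y * z.2)) +
     G z.1 * cos (y * z.1) * (F z.2 * sin (y * z.2)) =
     G z.1 * F z.2 * sin (y * (z.1 + z.2)) by rewrite mulrDr sinD; ring.
  have hi : itg mu2 (fun z => G z.1 * F z.2 * sin (y * (z.1 + z.2))).
    by apply: eq_itg (itgD sc cs) => z; rewrite -e.
  have [_ E] := @conv_pairing (fun x => sin (y * x)) hi; rewrite [LHS](_ : _ = I (fun x => conv G F x * sin (y * x)))// -E.
  by rewrite -scE -csE -(ID sc cs); apply: eqI => z; rewrite e.
Qed.

(** Plancherel, for F and for its convolution with G: the transforms differ by
    that of G. *)
Lemma conv_multiplier (D : R) : 0 <= D ->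
  (forall y, cos_transform G y ^+ 2 + sin_transform G y ^+ 2 <= D ^+ 2) -> N (conv G F) <= D * N F.
Proof.
move=> D0 hD; apply: nrm2_le; first by rewrite mulr_ge0 ?nrm2_ge0.
have [Ki KE] := plancherel itg_conv sqi_conv; have [Pi PE] := plancherel Fi F2.
have pp : 0 < 2 * pi :> R by rewrite mulr_gt0// pi_gt0.
rewrite -(ler_pM2l pp) -KE exprMn nrm2_sqr mulrCA -PE -(IZ _ Pi).
apply: I_le => //; first exact: itgZ.
move=> y; have [-> ->] := conv_trigonometric y.
have -> : (cos_transform G y * cos_transform F y - sin_transform G y * sin_transform F y) ^+ 2 +
  (sin_transform G y * cos_transform F y + cos_transform G y * sin_transform F y) ^+ 2 =
  (cos_transform G y ^+ 2 + sin_transform G y ^+ 2) * (cos_transform F y ^+ 2 + sin_transform F y ^+ 2) by ring.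
by apply: ler_wpM2r => //; rewrite addr_ge0 ?sqr_ge0.
Qed.

(** The form pairs the convolution of G and F with the reflection of F3. *)
Lemma tri_multiplier (D : R) F3 : 0 <= D -> sqi mu F3 ->
  (forall y, cos_transform G y ^+ 2 + sin_transform G y ^+ 2 <= D ^+ 2) ->
  `|I2 (fun z => G z.1 * F z.2 * F3 (- (z.1 + z.2)))| <= D * N F * N F3.
Proof.
move=> D0 h3 hD; have [h _] := tri_young Gi F2 h3.
have [_ ->] := @conv_pairing (fun x => F3 (- x)) h.
apply: le_trans (nrm2_CS1 sqi_conv (sqi_opp h3)) _.
by rewrite nrm2_opp// ler_wpM2r ?nrm2_ge0// conv_multiplier.
Qed.

End bounds.
End convolution.

(** * The space of profiles *)

Section profile_space.
Variables (R : realType) (mt : R -> R).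
Local Notation mu := (@lebesgue_measure R).

Definition finite_energy : {pred R -> R} := fun h =>
  `[< mea h /\ sqi mu (fun x => Num.sqrt (1 + mt x) * h x) >].

Lemma finite_energyP h : reflect (mea h /\ sqi mu (fun x => Num.sqrt (1 + mt x) * h x))
  (h \in finite_energy).
Proof. exact: asboolP. Qed.

Lemma finite_energy_submod : submod_closed finite_energy.
Proof.
split.
  apply/finite_energyP; split; first exact: mea_cst.
  by apply: eq_sqi (sqi0 mu) => x; rewrite mulr0.
move=> a f g /finite_energyP[mf hf] /finite_energyP[mg hg]; apply/finite_energyP; split.
  by apply: meaD => //; apply: meaM => //; exact: mea_cst.
apply: eq_sqi (sqiD (sqiZ a hf) hg) => x /=.
by rewrite mulrDr mulrCA.
Qed.

HB.instance Definition _ := GRing.isSubmodClosed.Build _ _ finite_energy finite_energy_submod.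

Record profile := Profile { profile_fun :> R -> R; profileP : profile_fun \in finite_energy }.

HB.instance Definition _ := [isSub for profile_fun].
HB.instance Definition _ := [Choice of profile by <:].
HB.instance Definition _ := [SubChoice_isSubLmodule of profile by <:].

Lemma profileB (u v : profile) x : (u - v) x = u x - v x. Proof. by []. Qed.
Lemma profile_lin a (u v : profile) x : (a *: u + v) x = a * u x + v x. Proof. by []. Qed.

Lemma mea_profile (u : profile) : mea u.
Proof. by have /finite_energyP[] := profileP u. Qed.

Lemma sqi_profile (u : profile) : sqi mu (fun x => Num.sqrt (1 + mt x) * u x).
Proof. by have /finite_energyP[] := profileP u. Qed.

End profile_space.

(** * Parity decomposition and the cubic form *)

Section parity.
Variable R : realType.
Local Notation mu := (@lebesgue_measure R).
Local Notation N := (nrm2 mu).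
Implicit Types (h W : R -> R).

(** A real function h stands for the Hermitian function ev h + i od h, the
    Fourier transform of the real function whose Hartley transform is h. *)
Definition ev h x := 2^-1 * (h x + h (- x)).
Definition od h x := 2^-1 * (h (- x) - h x).

Lemma ev_opp h x : ev h (- x) = ev h x.
Proof. by rewrite /ev opprK addrC. Qed.
Lemma od_opp h x : od h (- x) = - od h x.
Proof. by rewrite /od opprK; ring. Qed.
Lemma ev_lin a h k x : ev (fun x => a * h x + k x) x = a * ev h x + ev k x.
Proof. by rewrite /ev; ring. Qed.
Lemma od_lin a h k x : od (fun x => a * h x + k x) x = a * od h x + od k x.
Proof. by rewrite /od; ring. Qed.

Lemma mea_flip h : mea h -> mea (fun x : R => h (- x)).
Proof. by move=> mh; apply: (mea_comp mh); solve_mea. Qed.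
Lemma mea_ev h : mea h -> mea (ev h).
Proof. by move=> mh; have mf := mea_flip mh; rewrite /ev; solve_mea. Qed.
Lemma mea_od h : mea h -> mea (od h).
Proof. by move=> mh; have mf := mea_flip mh; rewrite /od; solve_mea. Qed.

Section weighted.
Variables (W h : R -> R).
Hypotheses (We : forall x, W (- x) = W x) (hW : sqi mu (fun x => W x * h x)).

Let flip : sqi mu (fun x => W x * h (- x)).
Proof. by apply: eq_sqi (sqi_opp hW) => x; rewrite We. Qed.

Let flipE : N (fun x => W x * h (- x)) = N (fun x => W x * h x).
Proof. by rewrite -(nrm2_opp hW); congr nrm2; apply/funext => x; rewrite We. Qed.

Let evE x : W x * ev h x = 2^-1 * (W x * h x + W x * h (- x)).
Proof. by rewrite /ev; ring. Qed.
Let odE x : W x * od h x = 2^-1 * (W x * h (- x) - W x * h x).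
Proof. by rewrite /od; ring. Qed.

Lemma sqi_ev : sqi mu (fun x => W x * ev h x).
Proof. by rewrite (funext evE); apply: sqiZ; exact: sqiD. Qed.
Lemma sqi_od : sqi mu (fun x => W x * od h x).
Proof. by rewrite (funext odE); apply: sqiZ; exact: sqiB. Qed.

Lemma nrm2_ev : N (fun x => W x * ev h x) <= N (fun x => W x * h x).
Proof.
rewrite (funext evE) nrm2_Z; last exact: sqiD.
rewrite gtr0_norm ?invr_gt0//; have := nrm2_D hW flip; rewrite flipE; lra.
Qed.
Lemma nrm2_od : N (fun x => W x * od h x) <= N (fun x => W x * h x).
Proof.
rewrite (funext odE) nrm2_Z; last exact: sqiB.
rewrite gtr0_norm ?invr_gt0//; have := nrm2_D flip (sqiN hW).
have -> : N (fun x => - (W x * h x)) = N (fun x => W x * h x).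
  by congr Num.sqrt; apply: eqI => x; rewrite sqrrN.
by rewrite flipE; lra.
Qed.

End weighted.
End parity.

Section cubic_form.
Variable R : realType.
Variable n : R * R -> R.
Local Notation mu := (@lebesgue_measure R).
Local Notation mu2 := (leb2 R).
Local Notation "'I' f" := (Rintegral mu [set: _] f) (at level 10, f at level 8).
Local Notation "'I2' f" := (Rintegral mu2 [set: R * R] f) (at level 10, f at level 8).
Local Notation N := (nrm2 mu).
Implicit Types (h k l W w : R -> R).

(** Real part of (p1 + i q1) (p2 + i q2) (p3 + i q3). *)
Definition re3 (p1 q1 p2 q2 p3 q3 : R) :=
  p1 * p2 * p3 - p1 * q2 * q3 - q1 * p2 * q3 - q1 * q2 * p3.

Definition cubic_kernel h k l (z : R * R) :=
  n z * re3 (ev h z.1) (od h z.1) (ev k z.2) (od k z.2)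
            (ev l (- (z.1 + z.2))) (od l (- (z.1 + z.2))).

(** By Parseval, the integral of u N(u, u) when h = k = l is the Hartley
    transform of u. The imaginary part of the triple product is odd and
    integrates to zero. *)
Definition cubic h k l := I2 (cubic_kernel h k l).

Lemma cubic_kernel_tri h k l z : cubic_kernel h k l z =
  tri_kernel n (ev h) (ev k) (ev l) z - tri_kernel n (ev h) (od k) (od l) z
  - tri_kernel n (od h) (ev k) (od l) z - tri_kernel n (od h) (od k) (ev l) z.
Proof. by rewrite /cubic_kernel /re3 /tri_kernel; ring. Qed.

Lemma cubic_tri h k l : itg mu2 (tri_kernel n (ev h) (ev k) (ev l)) ->
  itg mu2 (tri_kernel n (ev h) (od k) (od l)) ->
  itg mu2 (tri_kernel n (od h) (ev k) (od l)) ->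
  itg mu2 (tri_kernel n (od h) (od k) (ev l)) ->
  cubic h k l = tri n (ev h) (ev k) (ev l) - tri n (ev h) (od k) (od l) -
   tri n (od h) (ev k) (od l) - tri n (od h) (od k) (ev l).
Proof.
move=> i1 i2 i3 i4; rewrite /cubic (eqI mu2 (@cubic_kernel_tri h k l)).
by rewrite (IB (itgB (itgB i1 i2) i3) i4) (IB (itgB i1 i2) i3) (IB i1 i2).
Qed.

Lemma cubic_bound w W h k l : mea n -> dominated_symbol n w W -> sqi mu w ->
  (forall x, 0 <= w x) -> (forall x, 0 <= W x) -> (forall x, W (- x) = W x) ->
  mea h -> mea k -> mea l -> sqi mu (fun x => W x * h x) ->
  sqi mu (fun x => W x * k x) -> sqi mu (fun x => W x * l x) ->
  itg mu2 (cubic_kernel h k l) /\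
  `|cubic h k l| <= 12 * N w *
    (N (fun x => W x * h x) * N (fun x => W x * k x) * N (fun x => W x * l x)).
Proof.
move=> mn nw hw w0 W0 We mh mk ml hh hk hl.
have := tri_bound mn nw hw w0 W0 => tb.
have [[b1 b2] b3] := (mea_ev mh, mea_ev mk, mea_ev ml).
have [[c1 c2] c3] := (mea_od mh, mea_od mk, mea_od ml).
have [[d1 d2] d3] := (sqi_ev We hh, sqi_ev We hk, sqi_ev We hl).
have [[e1 e2] e3] := (sqi_od We hh, sqi_od We hk, sqi_od We hl).
have [[f1 f2] f3] := (nrm2_ev We hh, nrm2_ev We hk, nrm2_ev We hl).
have [[g1 g2] g3] := (nrm2_od We hh, nrm2_od We hk, nrm2_od We hl).
have [i1 j1] := tb _ _ _ b1 b2 b3 d1 d2 d3.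
have [i2 j2] := tb _ _ _ b1 c2 c3 d1 e2 e3.
have [i3 j3] := tb _ _ _ c1 b2 c3 e1 d2 e3.
have [i4 j4] := tb _ _ _ c1 c2 b3 e1 e2 d3.
set X := N (fun x => W x * h x) * N (fun x => W x * k x) * N (fun x => W x * l x).
have one F1 F2 F3 : itg mu2 (tri_kernel n F1 F2 F3) ->
    I2 (fun z => `|tri_kernel n F1 F2 F3 z|) <= 3 * N w *
    (N (fun x => W x * F1 x) * N (fun x => W x * F2 x) * N (fun x => W x * F3 x)) ->
    N (fun x => W x * F1 x) <= N (fun x => W x * h x) ->
    N (fun x => W x * F2 x) <= N (fun x => W x * k x) ->
    N (fun x => W x * F3 x) <= N (fun x => W x * l x) ->
    `|tri n F1 F2 F3| <= 3 * N w * X.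
  move=> i j a1 a2 a3; apply: le_trans (I_abs i) _; apply: le_trans j _.
  apply: ler_wpM2l; first by rewrite mulr_ge0 ?nrm2_ge0.
  by apply: mul3_le => //; exact: nrm2_ge0.
have k1 := one _ _ _ i1 j1 f1 f2 f3; have k2 := one _ _ _ i2 j2 f1 g2 g3.
have k3 := one _ _ _ i3 j3 g1 f2 g3; have k4 := one _ _ _ i4 j4 g1 g2 f3.
have ki := itgB (itgB (itgB i1 i2) i3) i4.
split; first by apply: eq_itg ki => z; rewrite cubic_kernel_tri.
rewrite cubic_tri//.
apply: le_trans (ler_normB _ _) _; rewrite (_ : 12 * N w * X = 3 * N w * X + 3 * N w * X + 3 * N w * X + 3 * N w * X); last by ring.
apply: lerD => //; apply: le_trans (ler_normB _ _) _; apply: lerD => //.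
by apply: le_trans (ler_normB _ _) _; exact: lerD.
Qed.

Lemma cubic_kernel_rot h k l z : (forall a b, n (a, b) = n (b, - (a + b))) ->
  cubic_kernel k l h (rot3 z) = cubic_kernel h k l z.
Proof.
case: z => a b nc; rewrite /cubic_kernel /rot3 /re3 /= -nc.
rewrite (_ : - (b + - (a + b)) = a); last by ring.
by congr (_ * _); ring.
Qed.

Lemma cubic_rot h k l : (forall a b, n (a, b) = n (b, - (a + b))) ->
  itg mu2 (cubic_kernel k l h) -> cubic h k l = cubic k l h.
Proof.
move=> nc ki; rewrite /cubic -(I2_rot3 ki); apply: eqI => z.
by rewrite cubic_kernel_rot.
Qed.

(** Hartley transform of a translate: multiplication of ev h + i od h
    by the phase exp(- i y x). *)
Definition modulate y h x := h x * cos (y * x) + h (- x) * sin (y * x).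

Lemma ev_modulate y h x : ev (modulate y h) x = ev h x * cos (y * x) + od h x * sin (y * x).
Proof. by rewrite /ev /od /modulate mulrN cosN sinN opprK; ring. Qed.

Lemma od_modulate y h x : od (modulate y h) x = od h x * cos (y * x) - ev h x * sin (y * x).
Proof. by rewrite /ev /od /modulate mulrN cosN sinN opprK; ring. Qed.

(** The three phases multiply to 1 because the frequencies sum to zero. *)
Lemma cubic_kernel_modulate y h z :
  cubic_kernel (modulate y h) (modulate y h) (modulate y h) z = cubic_kernel h h h z.
Proof.
rewrite /cubic_kernel /re3 !ev_modulate !od_modulate.
rewrite (mulrN y) cosN sinN (mulrDr y) cosD sinD.
have := cos2Dsin2 (y * z.1); have := cos2Dsin2 (y * z.2).
move: (cos (y * z.1)) (sin (y * z.1)) (cos (y * z.2)) (sin (y * z.2)) => c1 s1 c2 s2 e2 e1.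
congr (_ * _).
rewrite -[RHS]mul1r -[in RHS](mulr1 1) -{1}e1 -e2; ring.
Qed.

Lemma modulate_sqr y h x :
  modulate y h x ^+ 2 + modulate y h (- x) ^+ 2 = h x ^+ 2 + h (- x) ^+ 2.
Proof.
rewrite /modulate mulrN cosN sinN opprK.
have := cos2Dsin2 (y * x); move: (cos _) (sin _) => c s e.
by rewrite -[RHS]mul1r -e; ring.
Qed.

Lemma mea_modulate y h : mea h -> mea (modulate y h).
Proof.
move=> mh; have mf := mea_flip mh; have mc := mea_cosM y; have ms := mea_sinM y.
by rewrite /modulate; solve_mea.
Qed.

Lemma modulate_sqi W y h : (forall x, W (- x) = W x) -> sqi mu (fun x => W x * h x) ->
  mea h -> mea W ->
  sqi mu (fun x => W x * modulate y h x) /\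
  I (fun x => (W x * modulate y h x) ^+ 2) = I (fun x => (W x * h x) ^+ 2).
Proof.
move=> We hW mh mW; have mm := mea_modulate y mh.
have hf : sqi mu (fun x => W x * h (- x)).
  by apply: eq_sqi (sqi_opp hW) => x; rewrite We.
have mW2 : mea (fun x => W x * modulate y h x) by exact: meaM.
have hs : sqi mu (fun x => W x * modulate y h x).
  apply: (sqi_le (m := mu) mW2 (sqiD (sqi_abs hW) (sqi_abs hf))) => x.
  rewrite /modulate mulrDr !mulrA [leRHS]ger0_norm ?addr_ge0//.
  apply: le_trans (ler_normD _ _) _; rewrite !(normrM _ (cos _)) !(normrM _ (sin _)).
  by apply: lerD; rewrite ler_piMr// ?norm_cos_le1 ?norm_sin_le1.
split => //.
have half (f : R -> R) : itg mu f -> I f = 2^-1 * I (fun x => f x + f (- x)).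
  by move=> fi; rewrite (ID fi (itg_opp fi)) (I_opp fi); field.
rewrite (half _ hs.2) (half _ hW.2); congr (_ * _); apply: eqI => x.
rewrite !We !exprMn -!mulrDr modulate_sqr; ring.
Qed.

End cubic_form.

(** * Mass, dispersion and the cubic form on profiles *)

Section profile_forms.
Variables (R : realType) (s s' : R) (mt : R -> R) (n : R * R -> R).
Hypothesis S : symbols s s' mt n.
Local Notation mu := (@lebesgue_measure R).
Local Notation mu2 := (leb2 R).
Local Notation "'I' f" := (Rintegral mu [set: _] f) (at level 10, f at level 8).
Local Notation "'I2' f" := (Rintegral mu2 [set: R * R] f) (at level 10, f at level 8).
Local Notation N := (nrm2 mu).
Local Notation V := (profile mt).
Implicit Types (u v w : V).

Definition mass_form u v := I (fun x => u x * v x).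
Definition dispersion_form u v := I (fun x => mt x * (u x * v x)).
Definition profile_cubic u v w := cubic n u v w.

Lemma mea_mt : mea mt. Proof. by apply: continuous_measurable_fun; exact: sy_mc S. Qed.

Lemma mea_n : mea n.
Proof. by apply: mea_continuous2; exact: sy_nc S. Qed.

Lemma mea_sqrt_mt t : mea (fun x => Num.sqrt (t + mt x)).
Proof.
apply: (mea_comp (h := Num.sqrt)); first by apply: continuous_measurable_fun; exact: sqrt_continuous.
by apply: meaD; [exact: mea_cst|exact: mea_mt].
Qed.

Lemma tmt_ge0 t x : 0 <= t -> 0 <= t + mt x.
Proof. by move=> t0; rewrite addr_ge0 ?(sy_m0 S). Qed.

Lemma sqi_weighted t u : 0 <= t -> sqi mu (fun x => Num.sqrt (t + mt x) * u x).
Proof.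
move=> t0; have h := sqi_profile u; have mu_ := mea_profile u.
have mw := mea_sqrt_mt t.
apply: (sqi_le (m := mu) (meaM mw mu_) (sqiZ (Num.sqrt (1 + t)) h)) => x.
rewrite mulrA !normrM ler_wpM2r// !ger0_norm ?mulr_ge0 ?sqrtr_ge0// -sqrtrM; last by lra.
rewrite ler_sqrt; first by have := sy_m0 S x; nra.
by rewrite mulr_ge0 ?tmt_ge0//; lra.
Qed.

Lemma sqi_u u : sqi mu u.
Proof.
have h := sqi_profile u; have mu_ := mea_profile u.
apply: (sqi_le (m := mu) mu_ h) => x; rewrite normrM ler_peMl// ger0_norm ?sqrtr_ge0//.
by rewrite -[leLHS]sqrtr1 ler_sqrt ?tmt_ge0// lerDl (sy_m0 S).
Qed.

Lemma itg_mt u v : itg mu (fun x => mt x * (u x * v x)).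
Proof.
apply: eq_itg (sqi_mul (sqi_weighted u (lexx _)) (sqi_weighted v (lexx _))) => x.
by rewrite add0r mulrACA -expr2 sqr_sqrtr ?(sy_m0 S).
Qed.

Lemma itg_mass u v : itg mu (fun x => u x * v x).
Proof. exact: sqi_mul (sqi_u u) (sqi_u v). Qed.

Lemma weighted_form t u : 0 <= t ->
  N (fun x => Num.sqrt (t + mt x) * u x) ^+ 2 = t * mass_form u u + dispersion_form u u.
Proof.
move=> t0; rewrite nrm2_sqr -(IZ _ (itg_mass u u)) -ID; [|exact: itgZ (itg_mass _ _)|exact: itg_mt].
by apply: eqI => x; rewrite exprMn sqr_sqrtr ?tmt_ge0//; ring.
Qed.

Lemma mass_sym u v : mass_form u v = mass_form v u.
Proof. by apply: eqI => x; rewrite mulrC. Qed.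
Lemma mass_lin a u v w : mass_form (a *: u + v) w = a * mass_form u w + mass_form v w.
Proof.
rewrite -(IZ _ (itg_mass u w)) -ID; [|exact: itgZ (itg_mass _ _)|exact: itg_mass].
by apply: eqI => x; rewrite profile_lin; ring.
Qed.
Lemma mass_ge0 u : 0 <= mass_form u u.
Proof. by apply: I_ge0 => x; rewrite -expr2 sqr_ge0. Qed.
Lemma dispersion_sym u v : dispersion_form u v = dispersion_form v u.
Proof. by apply: eqI => x; rewrite (mulrC (u x)). Qed.
Lemma dispersion_lin a u v w :
  dispersion_form (a *: u + v) w = a * dispersion_form u w + dispersion_form v w.
Proof.
rewrite -(IZ _ (itg_mt u w)) -ID; [|exact: itgZ (itg_mt _ _)|exact: itg_mt].
by apply: eqI => x; rewrite profile_lin; ring.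
Qed.
Lemma dispersion_ge0 u : 0 <= dispersion_form u u.
Proof. by apply: I_ge0 => x; rewrite mulr_ge0 ?(sy_m0 S)// -expr2 sqr_ge0. Qed.

Lemma mass_def u : mass_form u u = 0 -> mass_form u u + dispersion_form u u = 0.
Proof.
move=> h; rewrite h add0r; have i := itg_mass u u.
have ae : {ae mu, forall x, u x * u x = 0}.
  by apply: (I_eq0_ae (m := mu) _ _ i h); [exact: itg_mea i|move=> x; rewrite -expr2 sqr_ge0].
rewrite /dispersion_form (@I_ae _ _ _ mu _ (fun=> 0)); [|exact: itg_mea (itg_mt u u)|exact: mea_cst|].
  by rewrite Rintegral_cst// mul0r.
by apply: ae_mono ae => x ->; rewrite mulr0.
Qed.

Lemma profile_complete : form_complete (fun u v => mass_form u v + dispersion_form u v).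
Proof.
have W0 x : 0 < Num.sqrt (1 + mt x) by rewrite sqrtr_gt0 ltr_pwDl ?(sy_m0 S).
move=> u cu; have [] := @sqi_complete _ _ _ mu (fun k x => Num.sqrt (1 + mt x) * u k x).
- by move=> k; exact: sqi_profile.
- move=> e e0; have [K hK] := cu e e0; exists K => i j Ki Kj; apply: le_trans (hK i j Ki Kj).
  rewrite -[X in X + _]mul1r -weighted_form// nrm2_sqr le_eqVlt; apply/orP; left; apply/eqP.
  by apply: eqI => x; rewrite profileB mulrBr.
move=> l' hl' cl'; pose l x := (Num.sqrt (1 + mt x))^-1 * l' x.
have lE x : Num.sqrt (1 + mt x) * l x = l' x by rewrite /l mulrA mulfV ?mul1r// gt_eqF.
have ml : mea l.
  have -> : l = fun x => (Num.sqrt (1 + mt x)) `^ (-1) * l' x.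
    by apply/funext => x; rewrite powR_inv1// ltW.
  apply: meaM; last exact: hl'.1.
  apply: (mea_comp (h := fun x => x `^ (-1))); first exact: measurable_powR.
  exact: mea_sqrt_mt.
have lV : l \in finite_energy mt by apply/finite_energyP; split => //; apply: eq_sqi hl' => x.
exists (Profile lV) => e e0; have [K hK] := cl' e e0; exists K => i Ki.
rewrite -[X in X + _]mul1r -weighted_form// nrm2_sqr; apply: le_trans (hK i Ki).
rewrite le_eqVlt; apply/orP; left; apply/eqP; apply: eqI => x.
by rewrite profileB mulrBr /= lE.
Qed.

Lemma weight_even t x : Num.sqrt (t + mt (- x)) = Num.sqrt (t + mt x).
Proof. by rewrite (sy_me S). Qed.

Lemma cubic_profile_bound : exists C g : R, [/\ 0 < C, 1 / 2 < g &
  forall t u v w, 0 < t -> itg mu2 (cubic_kernel n u v w) /\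
   `|profile_cubic u v w| <= C * gain s' g t *
    (N (fun x => Num.sqrt (t + mt x) * u x) * N (fun x => Num.sqrt (t + mt x) * v x) *
     N (fun x => Num.sqrt (t + mt x) * w x))].
Proof.
have [C [g [C0 g1 hC]]] := symbol_energy_dominated S.
exists (12 * C), g; split => [|//|t u v w t0]; first by rewrite mulr_gt0.
have [om [h1 h2 h3 h4]] := hC t t0; have t0' := ltW t0.
have [i b] := cubic_bound mea_n h4 h1 h2 (fun x => sqrtr_ge0 _) (weight_even t)
  (mea_profile u) (mea_profile v) (mea_profile w) (sqi_weighted u t0')
  (sqi_weighted v t0') (sqi_weighted w t0').
split => //; apply: le_trans b _; rewrite -(mulrA 12 C).
apply: ler_wpM2r; first by rewrite !mulr_ge0 ?nrm2_ge0.
by rewrite ler_pM2l.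
Qed.

Lemma itg_cubic u v w : itg mu2 (cubic_kernel n u v w).
Proof. by have [C [g [_ _ /(_ 1 u v w ltr01)[]]]] := cubic_profile_bound. Qed.

Lemma profile_cubic_lin a u v w z :
  profile_cubic (a *: u + v) w z = a * profile_cubic u w z + profile_cubic v w z.
Proof.
rewrite -(IZ _ (itg_cubic u w z)) -ID; [|exact: itgZ (itg_cubic _ _ _)|exact: itg_cubic].
apply: eqI => p; rewrite /cubic_kernel.
by rewrite (@ev_lin R a u v) (@od_lin R a u v) /re3; ring.
Qed.

Lemma profile_cubic_rot u v w : profile_cubic u v w = profile_cubic v w u.
Proof. by apply: cubic_rot; [exact: sy_nrot S|exact: itg_cubic]. Qed.

Lemma profile_cubic_bound : exists2 C, 0 <= C & forall u v w,
  profile_cubic u v w ^+ 2 <= C * ((mass_form u u + dispersion_form u u) *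
    (mass_form v v + dispersion_form v v) * (mass_form w w + dispersion_form w w)).
Proof.
have [C [g [C0 g1 hC]]] := cubic_profile_bound; exists ((C * gain s' g 1) ^+ 2); first exact: sqr_ge0.
move=> u v w; have [_ h] := hC 1 u v w ltr01.
rewrite -real_normK ?num_real//.
rewrite -(mul1r (mass_form u u)) -(mul1r (mass_form v v)) -(mul1r (mass_form w w)).
rewrite -!weighted_form// -!exprMn.
by rewrite lerXn2r// nnegrE//; apply: le_trans h.
Qed.

(** With t the ratio of dispersion to mass, t * mass and dispersion balance in
    the weighted norm. *)
Lemma cubic_growth : exists C g : R, [/\ 0 < C, 1 / 2 < g & forall u M, 0 < M ->
  mass_form u u <= M -> 0 < dispersion_form u u ->
  profile_cubic u u u <= C * gain s' g (dispersion_form u u / M) *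
     Num.sqrt (dispersion_form u u) ^+ 3].
Proof.
have [C [g [C0 g1 hC]]] := cubic_profile_bound.
exists (C * Num.sqrt 2 ^+ 3), g; split => // [|u M M0 uM q0].
  by rewrite mulr_gt0// exprn_gt0// sqrtr_gt0.
set q := dispersion_form u u; have t0 : 0 < q / M by rewrite divr_gt0.
have [_ h] := hC _ u u u t0; have G0 : 0 <= gain s' g (q / M).
  by rewrite /gain; case: ifP => _; exact: powR_ge0.
apply: le_trans (ler_norm _) _; apply: le_trans h _.
have -> : C * Num.sqrt 2 ^+ 3 * gain s' g (q / M) * Num.sqrt q ^+ 3 =
   C * gain s' g (q / M) * ((Num.sqrt 2 * Num.sqrt q) ^+ 3) by rewrite exprMn; ring.
apply: ler_wpM2l; first by rewrite mulr_ge0// ltW.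
have Nle : N (fun x => Num.sqrt (q / M + mt x) * u x) <= Num.sqrt 2 * Num.sqrt q.
  rewrite -sqrtrM// -(ler_pXn2r (n:=2))// ?nnegrE ?nrm2_ge0 ?sqrtr_ge0//.
  rewrite weighted_form ?(ltW t0)// sqr_sqrtr; last by rewrite mulr_ge0// ltW.
  have : q / M * mass_form u u <= q / M * M by rewrite ler_pM2l.
  by rewrite divfK ?gt_eqF// -/q; lra.
rewrite -[X in X <= _]/(_ ^+ 2 * _) (_ : (Num.sqrt 2 * Num.sqrt q) ^+ 3 = (Num.sqrt 2 * Num.sqrt q) * (Num.sqrt 2 * Num.sqrt q) * (Num.sqrt 2 * Num.sqrt q)); last by ring.
by apply: mul3_le => //; exact: nrm2_ge0.
Qed.

(** As g > 1/2, the cubic term grows at most like the power 3/2 - g < 1 of a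
    large dispersion. *)
Lemma profile_coercive M : exists K, forall u, mass_form u u <= M ->
  dispersion_form u u <= profile_cubic u u u -> mass_form u u + dispersion_form u u <= K.
Proof.
have [C [g [C0 g1 hC]]] := cubic_growth.
pose M1 := Num.max M 1; have M10 : 0 < M1 by rewrite lt_max ltr01 orbT.
have MM1 : M <= M1 by rewrite le_max lexx.
pose K0 := (C * M1 `^ g) `^ ((g - 1 / 2)^-1).
have K00 : 0 <= K0 by exact: powR_ge0.
exists (M1 + (M1 + K0)) => u uM uT.
have uM1 := le_trans uM MM1; apply: lerD => //.
set q := dispersion_form u u in uT *.
have [q1|q1] := leP q M1; first by lra.
have q0 : 0 < q by lra.
have := hC u M1 M10 uM1 q0; rewrite -/q => /(le_trans uT).
rewrite /gain (_ : q / M1 <= 1 = false); last by rewrite ler_pdivrMr// mul1r leNgt q1.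
have -> : Num.sqrt q ^+ 3 = q `^ (3 / 2).
  rewrite -powR12_sqrt ?(ltW q0)// -powR_mulrn ?powR_ge0// -powRrM; congr powR; lra.
have -> : (q / M1) `^ (- g) = q `^ (- g) * M1 `^ g.
  have i0 : 0 <= M1^-1 by rewrite invr_ge0 ltW.
  rewrite powRM ?(ltW q0)//; congr (_ * _).
  by rewrite -powR_inv1 ?(ltW M10)// -powRrM mulN1r opprK.
have -> : C * (q `^ (- g) * M1 `^ g) * q `^ (3 / 2) = (C * M1 `^ g) * q `^ (3 / 2 - g).
  by rewrite powRD ?(gt_eqF q0) ?implybT//; ring.
move=> h; suff : q <= K0 by lra.
have e : q = q `^ (g - 1 / 2) * q `^ (3 / 2 - g).
  rewrite -powRD ?(gt_eqF q0) ?implybT// (_ : g - 1 / 2 + (3 / 2 - g) = 1); last by lra.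
  by rewrite powRr1// ltW.
have : q `^ (g - 1 / 2) <= C * M1 `^ g.
  by rewrite -(ler_pM2r (powR_gt0 (3 / 2 - g) q0)) -e.
have gp : 0 < g - 1 / 2 by lra.
move=> h2; have := ge0_ler_powR (_ : 0 <= (g - 1 / 2)^-1) _ _ h2.
rewrite !nnegrE invr_ge0 (ltW gp) powR_ge0 mulr_ge0 ?powR_ge0 ?(ltW C0)// => /(_ erefl erefl erefl).
by rewrite -powRrM mulfV ?gt_eqF// powRr1 ?(ltW q0).
Qed.

Lemma modulate_profile y u : modulate y u \in finite_energy mt.
Proof.
apply/finite_energyP; have mh := mea_profile u; split; first exact: mea_modulate.
by have [] := modulate_sqi y (weight_even 1) (sqi_profile u) mh (mea_sqrt_mt 1).
Qed.

(** Multiplying the transform by a unimodular phase translates the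
    function. *)
Definition translate y u : V := Profile (modulate_profile y u).

Lemma translate_forms y u : [/\ mass_form (translate y u) (translate y u) = mass_form u u,
  dispersion_form (translate y u) (translate y u) = dispersion_form u u &
  profile_cubic (translate y u) (translate y u) (translate y u) = profile_cubic u u u].
Proof.
have mh := mea_profile u.
have h t : 0 <= t -> t * mass_form (translate y u) (translate y u) +
   dispersion_form (translate y u) (translate y u) = t * mass_form u u + dispersion_form u u.
  move=> t0; rewrite -!weighted_form// !nrm2_sqr.
  by have [_] := modulate_sqi y (weight_even t) (sqi_weighted u t0) mh (mea_sqrt_mt t).
have h0 := h 0 (lexx _); have h1 := h 1 ler01; split; try lra.
by apply: eqI => z; rewrite cubic_kernel_modulate.
Qed.

End profile_forms.

(** * Approximation of continuous functions by step functions *)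

Section step_functions.
Variable R : realType.
Local Notation mu := (@lebesgue_measure R).
Local Notation mu2 := (leb2 R).
Local Notation "'I' f" := (Rintegral mu [set: _] f) (at level 10, f at level 8).
Local Notation "'I2' f" := (Rintegral mu2 [set: R * R] f) (at level 10, f at level 8).
Implicit Types (n : R * R -> R) (A : R).

(** A bad pair of points for every mesh would cluster at a point of discontinuity. *)
Lemma round_uniform n A (eps : R) : continuous n -> 0 < eps ->
  exists k, forall a b, `|a| <= A -> `|b| <= A ->
    `|n (a, b) - n (round k a, round k b)| <= eps.
Proof.
move=> cn e0; apply: contrapT => /forallNP H.
have /choice[p hp] : forall k, exists p : R * R, [/\ `|p.1| <= A, `|p.2| <= A &
    eps < `|n p - n (round k p.1, round k p.2)|].
  move=> k; apply: contrapT => hk; apply: (H k) => a b ha hb; rewrite leNgt; apply/negP => h.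
  by apply: hk; exists (a, b).
have [U [UU Uoo]] := ultraFilterLemma eventually_filter.
have UP : ProperFilter U by apply: ultra_proper.
have [a ca] := @ultra_bounded_cvg _ _ U (fun k => (p k).1) A UU (fun k => let: And3 h _ _ := hp k in h).
have [b cb] := @ultra_bounded_cvg _ _ U (fun k => (p k).2) A UU (fun k => let: And3 _ h _ := hp k in h).
have rc (q : nat -> R) (c : R) : q k @[k --> U] --> c -> round k (q k) @[k --> U] --> c.
  move=> cq; apply/cvgrPdist_le => e ep.
  have h1 : \forall k \near U, `|c - q k| <= e / 2.
    by move/cvgrPdist_le : cq; apply; lra.
  have h2 : \forall k \near U, k.+1%:R^-1 <= e / 2.
    apply: Uoo; have [K hK] := @small_eventually R (e / 2) ltac:(lra).
    by exists K => // k /= Kk; exact: hK.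
  apply: filterS2 h1 h2 => k k1 k2; have r := round_near k (q k).
  have -> : c - round k (q k) = (c - q k) - (round k (q k) - q k) by ring.
  apply: le_trans (ler_normB _ _) _; rewrite (_ : e = e / 2 + e / 2); last by lra.
  by apply: lerD => //; exact: le_trans k2.
have c1 : n (p k) @[k --> U] --> n (a, b).
  have -> : (fun k => n (p k)) = (fun k => n ((p k).1, (p k).2)).
    by apply/funext => k; case: (p k).
  by apply: (cvg_comp (fun k => ((p k).1, (p k).2)) n); [exact: (cvg_pair ca cb)|exact: cn].
have c2 : n (round k (p k).1, round k (p k).2) @[k --> U] --> n (a, b).
  apply: (cvg_comp (fun k => (round k (p k).1, round k (p k).2)) n); last exact: cn.
  exact: (cvg_pair (rc _ _ ca) (rc _ _ cb)).
have c3 : `|n (p k) - n (round k (p k).1, round k (p k).2)| @[k --> U] --> (0 : R).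
  by rewrite -(normr0 R) -(subrr (n (a, b))); apply: cvg_norm; exact: cvgB.
have : \forall k \near U, `|n (p k) - n (round k (p k).1, round k (p k).2)| < eps.
  by apply: (cvgr_lt _ c3).
move=> /filter_ex[k]; have [_ _ h] := hp k.
by rewrite ltNge (ltW h).
Qed.

(** Abstracts the indicator of a piece of [-A, A]. *)
Definition cell A (e : R -> R) := [/\ mea e, forall x, 0 <= e x, forall x, e x <= 1 &
  forall x, A < `|x| -> e x = 0].

(** Finitely many cells of a fine grid meet the square, and n is nearly
    constant on their products. *)
Lemma step_approx n A (eps : R) : continuous n -> 0 <= A -> 0 < eps ->
  exists (L : nat) (x : 'I_L -> R) (e : 'I_L -> R -> R), (forall i, cell A (e i)) /\
  forall a b, `|a| <= A -> `|b| <= A ->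
    `|n (a, b) - \sum_i \sum_j n (x i, x j) * (e i a * e j b)| <= eps.
Proof.
move=> cn A0 e0; have [k hk] := round_uniform A cn e0.
have k0 : 0 < k.+1%:R :> R by rewrite ltr0n.
pose M := (Num.truncn (k.+1%:R * A)).+2.
pose idx (i : 'I_(M + M)) : int := (i%:Z - M%:Z)%R.
pose c (i : 'I_(M + M)) (x : R) : R := \1_[set x : R | Num.floor (k.+1%:R * x) = idx i] x.
have idx_inj : injective idx.
  by move=> i j /(congr1 (fun z => z + M%:Z)%R); rewrite /idx !subrK => -[] /val_inj.
have cE i x : c i x = (Num.floor (k.+1%:R * x) == idx i)%:R.
  by rewrite /c indicE; congr ((_ : bool)%:R); apply/idP/eqP; rewrite inE.
have idx_ex x : `|x| <= A -> exists i, Num.floor (k.+1%:R * x) = idx i.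
  move=> xA; set z := Num.floor _.
  have /andP[z1 z2] := floor_itv (k.+1%:R * x); rewrite -/z in z1 z2.
  have t := truncnS_gt (k.+1%:R * A).
  have hx : `|k.+1%:R * x| <= k.+1%:R * A by rewrite normrM gtr0_norm// ler_pM2l.
  have Mk : k.+1%:R * A + 1 < M%:R by rewrite /M -[X in _ < X]natr1 ltrD2r.
  move: hx; rewrite ler_norml => /andP[x1 x2].
  have zlo : (- M%:Z <= z)%R.
    rewrite -(ler_int R) rmorphN /= -pmulrn; move: z2 x1 Mk; rewrite intrD.
    by move: (_ * x) (_ * A) (M%:R) (z%:~R) => *; lra.
  have zhi : (z < M%:Z)%R.
    rewrite -(ltr_int R) -pmulrn; move: z1 x2 Mk.
    by move: (_ * x) (_ * A) (M%:R) (z%:~R) => *; lra.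
  have zM : (0 <= z + M%:Z)%R by rewrite -lerBlDr sub0r.
  have lt : (absz (z + M%:Z)%R < M + M)%N by rewrite -ltz_nat gez0_abs ?PoszD ?ltrD2r.
  by exists (Ordinal lt); rewrite /idx /= gez0_abs ?addrK.
have sumE (F : 'I_(M + M) -> R) x i : Num.floor (k.+1%:R * x) = idx i ->
    \sum_j F j * c j x = F i.
  move=> xi; rewrite (bigD1 i)//= cE xi eqxx mulr1 big1 ?addr0// => j ji.
  by rewrite cE xi (inj_eq idx_inj) eq_sym (negbTE ji) mulr0.
pose e i x := cut A (c i) x.
have mc i : mea (c i) by apply: mea_indic; exact: measurable_round.
exists (M + M)%N, (fun i => (idx i)%:~R / k.+1%:R), e; split.
  move=> i; split.
  - exact: mea_cut.
  - by move=> x; rewrite /e cutE cE; case: ifP.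
  - by move=> x; rewrite /e cutE cE; case: ifP => // _; rewrite lern1 leq_b1.
  - by move=> x; rewrite /e cutE ltNge => /negbTE ->.
move=> a b aA bA; have [i ai] := idx_ex a aA; have [j bj] := idx_ex b bA.
have -> : \sum_i \sum_j n ((idx i)%:~R / k.+1%:R, (idx j)%:~R / k.+1%:R) * (e i a * e j b) =
   n (round k a, round k b).
  rewrite /e; under eq_bigr => i' _.
    rewrite cutE aA; under eq_bigr => j' _ do rewrite cutE bA mulrCA mulrC.
    rewrite -mulr_suml (sumE _ _ _ bj); over.
  by rewrite (sumE _ _ _ ai) /round ai bj.
exact: hk.
Qed.

Lemma cell_itg A e : cell A e -> itg mu e.
Proof.
move=> [me e0 e1 eA]; apply: (itg_le (m := mu) me (g := \1_(`[- A, A]%classic))).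
  move=> x; rewrite ger0_norm// indicE mem_setE /= in_itv /= -ler_norml.
  by case: (leP `|x| A) => [_|/eA ->].
exact: integrable_indic_itv.
Qed.

Lemma cell_sqi A e : cell A e -> sqi mu e.
Proof.
move=> ce; have [me e0 e1 eA] := ce; split => //.
apply: (itg_le (m := mu) (meaX 2 me) _ (cell_itg ce)) => x.
by rewrite ger0_norm ?sqr_ge0// expr2 ler_piMl.
Qed.

End step_functions.

(** * Truncation of frequencies *)

Section profile_truncation.
Variables (R : realType) (s s' : R) (mt : R -> R) (n : R * R -> R).
Hypothesis S : symbols s s' mt n.
Local Notation mu := (@lebesgue_measure R).
Local Notation mu2 := (leb2 R).
Local Notation "'I' f" := (Rintegral mu [set: _] f) (at level 10, f at level 8).
Local Notation "'I2' f" := (Rintegral mu2 [set: R * R] f) (at level 10, f at level 8).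
Local Notation N := (nrm2 mu).
Local Notation V := (profile mt).
Local Notation J := (@japanese R).
Implicit Types (u v w : V).

Definition energy_form u v := mass_form u v + dispersion_form u v.
Definition energy_norm u := N (fun x => Num.sqrt (1 + mt x) * u x).

Lemma energy_norm_ge0 u : 0 <= energy_norm u. Proof. exact: nrm2_ge0. Qed.
Lemma energy_norm_sqr u : energy_norm u ^+ 2 = energy_form u u.
Proof. by rewrite /energy_norm (weighted_form S)// mul1r. Qed.

Lemma cut_finite_energy A u : cut A u \in finite_energy mt.
Proof.
apply/finite_energyP; split; first exact: mea_cut (mea_profile u).
apply: eq_sqi (sqi_cut A (sqi_profile u)) => x.
by rewrite !cutE; case: ifP; rewrite ?mulr0.
Qed.

Definition cut_profile A u : V := Profile (cut_finite_energy A u).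

Lemma cut_ev A (h : R -> R) x : ev (cut A h) x = cut A (ev h) x.
Proof. by rewrite /ev !cutE normrN; case: ifP; rewrite ?addr0 ?mulr0. Qed.
Lemma cut_od A (h : R -> R) x : od (cut A h) x = cut A (od h) x.
Proof. by rewrite /od !cutE normrN; case: ifP; rewrite ?subr0 ?mulr0. Qed.

Lemma slack_bound : exists C d : R, [/\ 0 < C, 0 < d & forall u v w,
  `|profile_cubic n u v w| <= C *
    (N (fun x => J x `^ (- d) * Num.sqrt (1 + mt x) * u x) *
     N (fun x => J x `^ (- d) * Num.sqrt (1 + mt x) * v x) *
     N (fun x => J x `^ (- d) * Num.sqrt (1 + mt x) * w x)) /\
  sqi mu (fun x => J x `^ (- d) * Num.sqrt (1 + mt x) * u x)].
Proof.
have [d [om [d0 h1 h2 h3]]] := symbol_slack_dominated S.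
exists (12 * N om + 1), d; split => [|//|u v w]; first by rewrite ltr_wpDl// mulr_ge0 ?nrm2_ge0.
have W0 x : 0 <= J x `^ (- d) * Num.sqrt (1 + mt x) by rewrite mulr_ge0 ?powR_ge0 ?sqrtr_ge0.
have We x : J (- x) `^ (- d) * Num.sqrt (1 + mt (- x)) = J x `^ (- d) * Num.sqrt (1 + mt x).
  by rewrite japaneseN (sy_me S).
have J1 x : J x `^ (- d) <= 1.
  rewrite powRN invf_le1 ?powR_gt0 ?japanese_gt0// -[leLHS](powRr0 (J x)).
  by rewrite ler_powR ?japanese_ge1// ltW.
have hs u' : sqi mu (fun x => J x `^ (- d) * Num.sqrt (1 + mt x) * profile_fun u' x).
  have mW : mea (fun x => J x `^ (- d) * Num.sqrt (1 + mt x)).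
    by apply: meaM; [exact: mea_japanese_powR|exact: mea_sqrt_mt S 1].
  apply: (sqi_le (m := mu) (meaM mW (mea_profile u')) (sqi_profile u')) => x.
  by rewrite -mulrA normrM ler_piMl// ger0_norm ?powR_ge0.
have [_ b] := cubic_bound (mea_n S) h3 h1 h2 W0 We (mea_profile u) (mea_profile v)
  (mea_profile w) (hs u) (hs v) (hs w).
split => //; apply: le_trans b _; apply: ler_wpM2r; first by rewrite !mulr_ge0 ?nrm2_ge0.
by rewrite lerDl.
Qed.

(** The slack in the domination makes high frequencies negligible. *)
Lemma cubic_truncation : exists C d : R, [/\ 0 < C, 0 < d & forall A u v w, 0 <= A ->
  `|profile_cubic n u v w - profile_cubic n (cut_profile A u) (cut_profile A v) (cut_profile A w)|
  <= C * J A `^ (- d) * (energy_norm u * energy_norm v * energy_norm w)].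
Proof.
have [C [d [C0 d0 hC]]] := slack_bound.
exists (3 * C), d; split => [|//|A u v w A0]; first by rewrite mulr_gt0.
pose W x := J x `^ (- d) * Num.sqrt (1 + mt x).
have W0 x : 0 <= W x by rewrite mulr_ge0 ?powR_ge0 ?sqrtr_ge0.
have J1 x : J x `^ (- d) <= 1.
  rewrite powRN invf_le1 ?powR_gt0 ?japanese_gt0// -[leLHS](powRr0 (J x)).
  by rewrite ler_powR ?japanese_ge1// ltW.
have hs u' : sqi mu (fun x => W x * profile_fun u' x) by have [] := hC u' u' u'.
have hs1 u' := sqi_profile u'.
have WW x : `|W x| <= `|Num.sqrt (1 + mt x)|.
  by rewrite normrM ler_piMl// ger0_norm ?powR_ge0.
have b1 u' : N (fun x => W x * profile_fun u' x) <= energy_norm u'.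
  apply: nrm2_mono => [||x]; [exact: hs|exact: hs1|].
  by rewrite normrM [leRHS]normrM ler_wpM2r.
have b2 u' : N (fun x => W x * profile_fun (cut_profile A u') x) <= energy_norm u'.
  apply: nrm2_mono => [||x]; [exact: hs|exact: hs1|].
  by rewrite normrM [leRHS]normrM ler_pM//; exact: cut_le.
have b3 u' : N (fun x => W x * profile_fun (u' - cut_profile A u') x) <=
    J A `^ (- d) * energy_norm u'.
  have -> : J A `^ (- d) * energy_norm u' =
      N (fun x => J A `^ (- d) * (Num.sqrt (1 + mt x) * u' x)).
    by rewrite nrm2_Z// ger0_norm ?powR_ge0.
  apply: nrm2_mono; [exact: hs|exact: sqiZ|move=> x].
  rewrite profileB /= cutE; case: ifP => [_|/negbT]; first by rewrite subrr mulr0 normr0.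
  rewrite -ltNge => Ax; rewrite subr0 /W -mulrA normrM [leRHS]normrM ler_wpM2r//.
  rewrite !ger0_norm ?powR_ge0// !powRN lef_pV2 ?posrE ?powR_gt0 ?japanese_gt0//.
  apply: ge0_ler_powR; rewrite ?nnegrE ?(ltW d0) ?(ltW (japanese_gt0 _))//.
  by apply: japanese_mono; rewrite (ger0_norm A0) ltW.
have linB u1 u2 v' w' : profile_cubic n (u1 - u2) v' w' =
    profile_cubic n u1 v' w' - profile_cubic n u2 v' w'.
  by rewrite -scaleN1r addrC (profile_cubic_lin S) mulN1r addrC.
have rot := profile_cubic_rot S.
set uA := cut_profile A u; set vA := cut_profile A v; set wA := cut_profile A w.
have -> : profile_cubic n u v w - profile_cubic n uA vA wA =
  profile_cubic n (u - uA) v w + profile_cubic n (v - vA) w uA + profile_cubic n (w - wA) uA vA.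
  by rewrite !linB (rot uA v w) (rot vA w uA) (rot wA uA vA); ring.
have E0 u' := energy_norm_ge0 u'.
have JA0 : 0 <= J A `^ (- d) by exact: powR_ge0.
set X := energy_norm u * energy_norm v * energy_norm w.
have t1 : `|profile_cubic n (u - uA) v w| <= C * (J A `^ (- d) * X).
  have [h _] := hC (u - uA) v w; apply: le_trans h _; rewrite ler_pM2l//.
  apply: le_trans (mul3_le _ _ _ (b3 u) (b1 v) (b1 w)) _; rewrite ?nrm2_ge0//.
  by rewrite /X !mulrA.
have t2 : `|profile_cubic n (v - vA) w uA| <= C * (J A `^ (- d) * X).
  have [h _] := hC (v - vA) w uA; apply: le_trans h _; rewrite ler_pM2l//.
  apply: le_trans (mul3_le _ _ _ (b3 v) (b1 w) (b2 u)) _; rewrite ?nrm2_ge0//.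
  by rewrite /X le_eqVlt; apply/orP; left; apply/eqP; ring.
have t3 : `|profile_cubic n (w - wA) uA vA| <= C * (J A `^ (- d) * X).
  have [h _] := hC (w - wA) uA vA; apply: le_trans h _; rewrite ler_pM2l//.
  apply: le_trans (mul3_le _ _ _ (b3 w) (b2 u) (b2 v)) _; rewrite ?nrm2_ge0//.
  by rewrite /X le_eqVlt; apply/orP; left; apply/eqP; ring.
have -> : 3 * C * J A `^ (- d) * X = C * (J A `^ (- d) * X) + C * (J A `^ (- d) * X) + C * (J A `^ (- d) * X) by ring.
apply: le_trans (ler_normD _ _) _; apply: lerD => //.
by apply: le_trans (ler_normD _ _) _; exact: lerD.
Qed.

Lemma truncation_choice (eps K : R) : 0 < eps -> 0 <= K -> exists A : R, 0 <= A /\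
  forall u v w, energy_norm u <= K -> energy_norm v <= K -> energy_norm w <= K ->
  `|profile_cubic n u v w - profile_cubic n (cut_profile A u) (cut_profile A v) (cut_profile A w)|
  <= eps.
Proof.
move=> e0 K0; have [C [d [C0 d0 hC]]] := cubic_truncation.
pose q := C * (K ^+ 3 + 1) / eps.
have q0 : 0 < q by rewrite divr_gt0// mulr_gt0// ltr_wpDl// exprn_ge0.
exists (q `^ d^-1); split => [|u v w hu hv hw]; first exact: powR_ge0.
set A := q `^ d^-1; have A0 : 0 <= A by exact: powR_ge0.
apply: le_trans (hC A u v w A0) _.
have JA : J A `^ (- d) <= q^-1.
  rewrite powRN lef_pV2 ?posrE ?powR_gt0 ?japanese_gt0//.
  have -> : q = A `^ d by rewrite /A -powRrM mulVf ?powRr1 ?(ltW q0)// gt_eqF.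
  apply: ge0_ler_powR; rewrite ?nnegrE ?(ltW d0)//; first exact: ltW (japanese_gt0 _).
  by apply: le_trans (japanese_ge_norm A); exact: ler_norm.
have X : energy_norm u * energy_norm v * energy_norm w <= K ^+ 3 + 1.
  apply: le_trans (mul3_le _ _ _ hu hv hw) _; rewrite ?energy_norm_ge0//.
  by rewrite (_ : K * K * K = K ^+ 3) ?lerDl//; ring.
apply: (@le_trans _ _ (C * q^-1 * (K ^+ 3 + 1))).
  apply: ler_pM => //; first by rewrite mulr_ge0 ?powR_ge0// ltW.
    by rewrite !mulr_ge0 ?energy_norm_ge0.
  by rewrite ler_pM2l.
rewrite /q le_eqVlt; apply/orP; left; apply/eqP; field.
by rewrite !gt_eqF// ltr_wpDl// exprn_ge0.
Qed.

(** Pairing with e is bounded in the energy norm, so the Riesz representation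
    provides f. *)
Lemma represented (e : R -> R) : sqi mu e ->
  exists f : V, forall v, energy_form v f = I (fun x => e x * v x).
Proof.
move=> he; have D0 x : 0 < 1 + mt x by rewrite ltr_pwDl ?(sy_m0 S).
pose f x := (1 + mt x) `^ (-1) * e x.
have mf : mea f.
  apply: meaM; last exact: he.1; apply: (mea_comp (h := fun x => x `^ (-1))).
    exact: measurable_powR.
  by apply: meaD; [exact: mea_cst|exact: (mea_mt S)].
have fV : f \in finite_energy mt.
  apply/finite_energyP; split => //.
  apply: (sqi_le (m := mu) (meaM (mea_sqrt_mt S 1) mf) he) => x.
  rewrite /f mulrA normrM ler_piMl// ger0_norm ?mulr_ge0 ?sqrtr_ge0 ?powR_ge0//.
  rewrite powR_inv1 ?(ltW (D0 x))// ler_pdivrMr// mul1r.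
  have r1 : 1 <= Num.sqrt (1 + mt x) by rewrite -[leLHS]sqrtr1 ler_sqrt ?(ltW (D0 x))// lerDl (sy_m0 S).
  by rewrite -[leRHS](sqr_sqrtr (ltW (D0 x))) expr2 ler_peMl ?sqrtr_ge0.
exists (Profile fV) => v.
rewrite /energy_form -(ID (itg_mass S v _) (itg_mt S v _)); apply: eqI => x /=.
rewrite /f powR_inv1 ?(ltW (D0 x))//; field; exact: lt0r_neq0.
Qed.

Lemma ev_adjoint (e : R -> R) v : sqi mu e ->
  I (fun x => e x * ev v x) = I (fun x => ev e x * v x) /\
  I (fun x => e x * od v x) = I (fun x => od e x * v x).
Proof.
move=> he; have hv := sqi_u S v; have hev := sqi_mul he hv.
have a := sqi_mul he (sqi_opp hv).
have b := sqi_mul (sqi_opp he) hv.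
have E : I (fun x => e x * v (- x)) = I (fun x => e (- x) * v x).
  by rewrite -(I_opp a); apply: eqI => x; rewrite opprK.
split.
  have -> : I (fun x => e x * ev v x) = I (fun x => 2^-1 * (e x * v x + e x * v (- x))).
    by apply: eqI => x; rewrite /ev; ring.
  rewrite (IZ _ (itgD hev a)) (ID hev a) E -(ID hev b) -(IZ _ (itgD hev b)).
  by apply: eqI => x; rewrite /ev; ring.
have -> : I (fun x => e x * od v x) = I (fun x => 2^-1 * (e x * v (- x) - e x * v x)).
  by apply: eqI => x; rewrite /od; ring.
rewrite (IZ _ (itgB a hev)) (IB a hev) E -(IB b hev) -(IZ _ (itgB b hev)).
by apply: eqI => x; rewrite /od; ring.
Qed.

Lemma parity_functionals L (e : 'I_L -> R -> R) : (forall i, sqi mu (e i)) ->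
  exists fs : seq V, forall i,
    (exists2 f, f \in fs & forall v, energy_form v f = I (fun x => e i x * ev v x)) /\
    (exists2 f, f \in fs & forall v, energy_form v f = I (fun x => e i x * od v x)).
Proof.
move=> he; have one i : sqi mu (fun x => 1 * e i x) by apply: eq_sqi (he i) => x; rewrite mul1r.
have /choice[f hf] : forall i, exists f : V, forall v, energy_form v f = I (fun x => e i x * ev v x).
  move=> i; have [|f hf] := @represented (ev (e i)).
    by apply: eq_sqi (@sqi_ev R (fun=> 1) _ (fun=> erefl) (one i)) => x; rewrite mul1r.
  by exists f => v; rewrite hf (ev_adjoint v (he i)).1.
have /choice[g hg] : forall i, exists f : V, forall v, energy_form v f = I (fun x => e i x * od v x).
  move=> i; have [|g hg] := @represented (od (e i)).
    by apply: eq_sqi (@sqi_od R (fun=> 1) _ (fun=> erefl) (one i)) => x; rewrite mul1r.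
  by exists g => v; rewrite hg (ev_adjoint v (he i)).2.
exists (map f (enum 'I_L) ++ map g (enum 'I_L)) => i; split.
  by exists (f i) => //; rewrite mem_cat map_f// mem_enum.
by exists (g i) => //; rewrite mem_cat map_f ?orbT// mem_enum.
Qed.

End profile_truncation.

(** * Trilinear forms with step symbols *)

Section plane_steps.
Variable R : realType.
Local Notation mu := (@lebesgue_measure R).
Local Notation mu2 := (leb2 R).
Local Notation "'I' f" := (Rintegral mu [set: _] f) (at level 10, f at level 8).
Local Notation "'I2' f" := (Rintegral mu2 [set: R * R] f) (at level 10, f at level 8).
Local Notation N := (nrm2 mu).

Lemma cell_mul_sqi A (e F : R -> R) : cell A e -> sqi mu F -> sqi mu (fun x => e x * F x).
Proof.
move=> [me e0 e1 _] hF; apply: (sqi_le (m := mu) (meaM me hF.1) hF) => x.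
by rewrite normrM ler_piMl// ger0_norm.
Qed.

(** Integrating the step approximation of n term by term costs at most eps times
    the integral of |P|. *)
Lemma plane_step (n : R * R -> R) A (eps : R) : continuous n -> 0 <= A -> 0 < eps ->
  exists (L : nat) (x : 'I_L -> R) (e : 'I_L -> R -> R), (forall i, cell A (e i)) /\
  forall P : R * R -> R, itg mu2 P -> (forall a b, A < `|a| \/ A < `|b| -> P (a, b) = 0) ->
  itg mu2 (fun z => n z * P z) /\
  `|I2 (fun z => n z * P z)| <= eps * I2 (fun z => `|P z|) +
    \sum_i \sum_j `|n (x i, x j)| * `|I2 (fun z => e i z.1 * e j z.2 * P z)|.
Proof.
move=> cn A0 e0; have [L [x [e [ce he]]]] := step_approx cn A0 e0.
exists L, x, e; split => // P Pi P0; have mP := itg_mea Pi; have mn := mea_continuous2 cn.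
pose Q i j (z : R * R) := e i z.1 * e j z.2 * P z.
have Qi i j : itg mu2 (Q i j).
  have [mi i0 i1 _] := ce i; have [mj j0 j1 _] := ce j.
  have mQ : mea (Q i j) by rewrite /Q; solve_mea.
  apply: (itg_le (m := mu2) mQ _ (itg_abs Pi)) => z.
  by rewrite /Q normrM ler_piMl// ger0_norm ?mulr_ge0// mulr_ile1.
pose D z := \sum_i \sum_j n (x i, x j) * Q i j z.
have Di : itg mu2 D by apply: itg_sum => i; apply: itg_sum => j; apply: itgZ.
have near z : `|n z * P z - D z| <= eps * `|P z|.
  case: z => a b; rewrite /D /Q /=.
  have -> : \sum_i \sum_j n (x i, x j) * (e i a * e j b * P (a, b)) =
     (\sum_i \sum_j n (x i, x j) * (e i a * e j b)) * P (a, b).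
    by rewrite mulr_suml; apply: eq_bigr => i _; rewrite mulr_suml; apply: eq_bigr => j _; rewrite mulrA.
  rewrite -mulrBl normrM; have [/andP[ha hb]|] := boolP ((`|a| <= A) && (`|b| <= A)).
    by rewrite ler_wpM2r// he.
  by rewrite negb_and -!ltNge => /orP h; rewrite P0// normr0 !mulr0.
have mnP : mea (fun z => n z * P z) by exact: meaM.
have di : itg mu2 (fun z => n z * P z - D z).
  by apply: (itg_le (m := mu2) (meaB mnP (itg_mea Di)) near); apply: itgZ; exact: itg_abs.
have ni : itg mu2 (fun z => n z * P z).
  by apply: eq_itg (itgD di Di) => z; rewrite subrK.
split => //.
have -> : I2 (fun z => n z * P z) = I2 (fun z => n z * P z - D z) + I2 D.
  by rewrite -(ID di Di); apply: eqI => z; rewrite subrK.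
apply: le_trans (ler_normD _ _) _; apply: lerD.
  rewrite -(IZ _ (itg_abs Pi)); have h := itgZ eps (itg_abs Pi).
  exact: (I_abs_le (m := mu2) (itg_mea di) h near).
rewrite /D I_sum; last by move=> i; apply: itg_sum => j; apply: itgZ.
apply: le_trans (ler_norm_sum _ _ _) _; apply: ler_sum => i _.
rewrite I_sum; last by move=> j; apply: itgZ.
apply: le_trans (ler_norm_sum _ _ _) _; apply: ler_sum => j _.
by rewrite IZ// normrM.
Qed.

Lemma itg_supported A F : sqi mu F -> (forall x, A < `|x| -> F x = 0) ->
  itg mu F /\ I (fun x => `|F x|) <= N (cut A (fun=> 1)) * N F.
Proof.
move=> hF F0.
have h1 : sqi mu (cut A (fun=> 1)).
  have m1 : mea (cut A (fun=> 1 : R)) by apply: mea_cut; exact: mea_cst.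
  split => //; apply: (itg_le (m := mu) (meaX 2 m1) (g := \1_(`[- A, A]%classic))).
    move=> x; rewrite cutE indicE mem_setE /= in_itv /= -ler_norml.
    by case: ifP => _; rewrite ?expr1n ?expr0n /= ?normr1 ?normr0.
  exact: integrable_indic_itv.
have E x : F x = cut A (fun=> 1) x * F x.
  by rewrite cutE; case: leP => [_|/F0 ->]; rewrite ?mul1r ?mulr0.
split; first by apply: eq_itg (sqi_mul h1 hF) => x; rewrite -E.
by under eqI do rewrite E; exact: nrm2_CS.
Qed.

(** Splitting the symbol over cells splits the form into finitely many
    convolution pairings, each bounded by the inverse transform of its first
    factor. *)
Lemma tri_cells (n : R * R -> R) A (eps : R) : continuous n -> 0 <= A -> 0 < eps ->
  exists (L : nat) (e : 'I_L -> R -> R) (Lam : R), [/\ forall i, cell A (e i), 0 <= Lam &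
  forall F1 F2 F3 D, sqi mu F1 -> sqi mu F2 -> sqi mu F3 ->
   (forall x, A < `|x| -> F1 x = 0) -> (forall x, A < `|x| -> F2 x = 0) -> 0 <= D ->
   (forall i y, cos_transform (fun x => e i x * F1 x) y ^+ 2 + sin_transform (fun x => e i x * F1 x) y ^+ 2 <= D ^+ 2) ->
   itg mu2 (tri_kernel n F1 F2 F3) /\
   `|tri n F1 F2 F3| <= (eps * N F1 + Lam * D) * (N F2 * N F3)].
Proof.
move=> cn A0 e0; pose a0 := N (cut A (fun=> 1)); have a00 : 0 <= a0 by exact: nrm2_ge0.
have e0' : 0 < eps / (a0 + 1) by rewrite divr_gt0// ltr_wpDl.
have [L [x [e [ce he]]]] := plane_step cn A0 e0'.
exists L, e, (\sum_i \sum_j `|n (x i, x j)|); split => //.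
  by apply: sumr_ge0 => i _; apply: sumr_ge0 => j _.
move=> F1 F2 F3 D h1 h2 h3 s1 s2 D0 hD.
have [i1 b1] := itg_supported h1 s1; have [i2 b2] := itg_supported h2 s2.
pose P z := F1 z.1 * F2 z.2 * F3 (- (z.1 + z.2)).
have [Pi Pb] := tri_young i1 h2 h3.
have P0 a b : A < `|a| \/ A < `|b| -> P (a, b) = 0.
  by rewrite /P /=; case=> [/s1|/s2] ->; rewrite ?mulr0 !mul0r.
have [ni nb] := he P Pi P0; split => //.
have N20 : 0 <= N F2 * N F3 by rewrite mulr_ge0 ?nrm2_ge0.
apply: le_trans nb _; rewrite mulrDl; apply: lerD.
  apply: (@le_trans _ _ (eps / (a0 + 1) * (a0 * N F1 * (N F2 * N F3)))).
    apply: ler_wpM2l; first exact: ltW.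
    by apply: le_trans Pb _; apply: ler_wpM2r.
  rewrite !mulrA ler_wpM2r ?nrm2_ge0// ler_wpM2r ?nrm2_ge0// ler_wpM2r ?nrm2_ge0//.
  by rewrite mulrAC ler_pdivrMr ?ltr_wpDl// ler_wpM2l ?ltW// ltrDl.
rewrite -mulrA mulr_suml; apply: ler_sum => i _; rewrite mulr_suml; apply: ler_sum => j _.
apply: ler_wpM2l => //.
have g1 := cell_mul_sqi (ce i) h1; have g2 := cell_mul_sqi (ce j) h2.
have z1 y : A < `|y| -> e i y * F1 y = 0 by move=> /s1 ->; rewrite mulr0.
have z2 y : A < `|y| -> e j y * F2 y = 0 by move=> /s2 ->; rewrite mulr0.
have [j1 _] := itg_supported g1 z1; have [j2 _] := itg_supported g2 z2.
have := tri_multiplier j1 g1 j2 g2 D0 h3 (hD i).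
rewrite (_ : I2 _ = I2 (fun z => e i z.1 * e j z.2 * P z)); last first.
  by apply: eqI => z; rewrite /P; ring.
move=> /le_trans; apply; rewrite -mulrA ler_wpM2l// ler_wpM2r ?nrm2_ge0//.
have [_ q0 q1 _] := ce j.
by apply: nrm2_mono => // y; rewrite normrM ler_piMl// ger0_norm.
Qed.

End plane_steps.

(** * Nonvanishing up to translation *)

Lemma small_phases (R : realDomainType) (d c1 s1 c3 s3 : R) :
  `|c1 + s3| < d -> `|c3 - s1| < d -> `|c1 - s3| < d -> `|c3 + s1| < d ->
  c1 ^+ 2 + s1 ^+ 2 <= (2 * d) ^+ 2 /\ c3 ^+ 2 + s3 ^+ 2 <= (2 * d) ^+ 2.
Proof.
move=> h1 h2 h3 h4; have d0 : 0 < d by apply: le_lt_trans h1.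
have sq (z : R) : `|z| < d -> z ^+ 2 <= d ^+ 2.
  by move=> h; rewrite -real_normK ?num_real// lerXn2r// ?nnegrE// ltW.
move: (sq _ h1) (sq _ h2) (sq _ h3) (sq _ h4) (sqr_ge0 d) (sqr_ge0 c1) (sqr_ge0 c3)
  (sqr_ge0 s1) (sqr_ge0 s3); clear; rewrite !expr2 => *; split; lra.
Qed.

Lemma ratio_le (R : realFieldType) (c a q : R) : 0 < c -> 0 < a -> 0 <= q ->
  c / (a * (q + 1)) * q <= c / a.
Proof.
move=> c0 a0 q0; rewrite mulrAC ler_pdivrMr ?mulr_gt0 ?ltr_wpDl//.
rewrite mulrA divfK ?gt_eqF// ler_pM2l//; lra.
Qed.

Section profile_compactness.
Variables (R : realType) (s s' : R) (mt : R -> R) (n : R * R -> R).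
Hypothesis S : symbols s s' mt n.
Local Notation mu := (@lebesgue_measure R).
Local Notation mu2 := (leb2 R).
Local Notation "'I' f" := (Rintegral mu [set: _] f) (at level 10, f at level 8).
Local Notation "'I2' f" := (Rintegral mu2 [set: R * R] f) (at level 10, f at level 8).
Local Notation N := (nrm2 mu).
Local Notation V := (profile mt).
Implicit Types (u v w : V).

Lemma cut_supported A (f : R -> R) x : A < `|x| -> cut A f x = 0.
Proof. by rewrite cutE ltNge => /negbTE ->. Qed.

Lemma nrm2_mass u : N u <= energy_norm u.
Proof.
apply: nrm2_mono; [exact: sqi_u S u|exact: sqi_profile|move=> x].
rewrite normrM ler_peMl// ger0_norm ?sqrtr_ge0// -[leLHS]sqrtr1 ler_sqrt ?lerDl ?(sy_m0 S)//.
by rewrite addr_ge0 ?(sy_m0 S).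
Qed.

Lemma parts A u : [/\ sqi mu (ev (cut A u)), sqi mu (od (cut A u)),
  N (ev (cut A u)) <= energy_norm u & N (od (cut A u)) <= energy_norm u].
Proof.
have h : sqi mu (fun x => 1 * cut A u x).
  by apply: eq_sqi (sqi_cut A (sqi_u S u)) => x; rewrite mul1r.
have one (f : R -> R) : (fun x => 1 * f x) = f by apply/funext => x; rewrite mul1r.
have We (x : R) : (fun=> 1 : R) (- x) = (fun=> 1 : R) x by [].
have b : N (cut A u) <= energy_norm u.
  apply: le_trans (nrm2_mass u); apply: nrm2_mono; [exact: sqi_cut (sqi_u S u)|exact: sqi_u S u|].
  exact: cut_le.
have a1 := sqi_ev We h; have a2 := sqi_od We h.
have a3 := nrm2_ev We h; have a4 := nrm2_od We h.
rewrite /= !one in a1 a2 a3 a4.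
by split => //; apply: le_trans b.
Qed.

Lemma parts_supported A u x : A < `|x| -> ev (cut A u) x = 0 /\ od (cut A u) x = 0.
Proof. by move=> h; rewrite cut_ev cut_od !cut_supported. Qed.

Lemma cell_cut A (e f : R -> R) x : cell A e -> e x * cut A f x = e x * f x.
Proof. by move=> [_ _ _ e0]; rewrite cutE; case: leP => // /e0 ->; rewrite !mul0r. Qed.

(** Integrating a translate against a cell evaluates the inverse transform of
    the part of u in that cell. *)
Lemma translate_cells A (e : R -> R) u y : cell A e ->
  let F := fun x => e x * ev (cut A u) x in let G := fun x => e x * od (cut A u) x in
  I (fun x => e x * ev (translate S y u) x) = cos_transform F y + sin_transform G y /\
  I (fun x => e x * od (translate S y u) x) = cos_transform G y - sin_transform F y.
Proof.
move=> ce F G; have [p1 p2 _ _] := parts A u.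
have [h1 _] := itg_supported (cell_mul_sqi ce p1)
  (fun x h => etrans (congr1 _ (parts_supported u h).1) (mulr0 _)).
have [h2 _] := itg_supported (cell_mul_sqi ce p2)
  (fun x h => etrans (congr1 _ (parts_supported u h).2) (mulr0 _)).
rewrite /cos_transform /sin_transform -(ID (itg_ctr y h1) (itg_str y h2)) -(IB (itg_ctr y h2) (itg_str y h1)).
split; apply: eqI => x /=.
  by rewrite ev_modulate cut_ev cut_od !(cell_cut _ _ ce); ring.
by rewrite od_modulate cut_ev cut_od !(cell_cut _ _ ce); ring.
Qed.

(** Contrapositive: if every translate is nearly orthogonal to the finitely
    many test profiles, all cells of v have small inverse transforms, hence so
    has the cubic term. *)
Theorem profile_nonvanishing (c K : R) : 0 < c -> exists (fs : seq V) (d : R), 0 < d /\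
  forall v, mass_form v v + dispersion_form v v <= K -> c <= profile_cubic n v v v -> exists v',
    [/\ mass_form v' v' = mass_form v v, dispersion_form v' v' = dispersion_form v v,
        profile_cubic n v' v' v' = profile_cubic n v v v &
        exists2 f, f \in fs & d <= `|mass_form v' f + dispersion_form v' f|].
Proof.
move=> c0; pose k := Num.sqrt K; have k0 : 0 <= k by exact: sqrtr_ge0.
have c2 : 0 < c / 2 by lra.
have [A [A0 hA]] := truncation_choice S c2 k0.
pose eps := c / (32 * (k ^+ 3 + 1)); have k3 : 0 <= k ^+ 3 by exact: exprn_ge0.
have e0 : 0 < eps by rewrite divr_gt0// mulr_gt0// ltr_wpDl.
have [L [e [Lam [ce L0 he]]]] := tri_cells (sy_nc S) A0 e0.
have [fs hfs] := parity_functionals S (fun i => cell_sqi (ce i)).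
pose d := c / (64 * (Lam * k ^+ 2 + 1)).
have Lk : 0 <= Lam * k ^+ 2 by rewrite mulr_ge0// exprn_ge0.
have d0 : 0 < d by rewrite divr_gt0// mulr_gt0// ltr_wpDl.
exists fs, d; split => // v vK vc.
apply: contrapT => H.
have vk : energy_norm v <= k.
  rewrite -(ler_pXn2r (n:=2))// ?nnegrE ?energy_norm_ge0// (energy_norm_sqr S).
  rewrite sqr_sqrtr; first exact: vK.
  by apply: le_trans vK; rewrite addr_ge0 ?mass_ge0 ?(dispersion_ge0 S).
have small y i : `|I (fun x => e i x * ev (translate S y v) x)| < d /\
    `|I (fun x => e i x * od (translate S y v) x)| < d.
  have [h1 h2 h3] := translate_forms S y v.
  have [[f ffs hf] [g gfs hg]] := hfs i.
  split; rewrite ltNge; apply/negP => h; apply: H; exists (translate S y v); split => //.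
    by exists f => //; rewrite -hf in h.
  by exists g => //; rewrite -hg in h.
have [p1 p2 q1 q2] := parts A v.
have trig i y : cos_transform (fun x => e i x * ev (cut A v) x) y ^+ 2 +
    sin_transform (fun x => e i x * ev (cut A v) x) y ^+ 2 <= (2 * d) ^+ 2 /\
    cos_transform (fun x => e i x * od (cut A v) x) y ^+ 2 +
    sin_transform (fun x => e i x * od (cut A v) x) y ^+ 2 <= (2 * d) ^+ 2.
  have [a1 a2] := translate_cells v y (ce i); have [b1 b2] := translate_cells v (- y) (ce i).
  have cN F : cos_transform F (- y) = cos_transform F y by apply: eqI => x; rewrite mulNr cosN.
  have sN F : itg mu F -> sin_transform F (- y) = - sin_transform F y.
    by move=> Fi; rewrite /sin_transform -(IN (itg_str y Fi)); apply: eqI => x; rewrite mulNr sinN mulrN.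
  have [h1 _] := itg_supported (cell_mul_sqi (ce i) p1)
    (fun x h => etrans (congr1 _ (parts_supported v h).1) (mulr0 _)).
  have [h2 _] := itg_supported (cell_mul_sqi (ce i) p2)
    (fun x h => etrans (congr1 _ (parts_supported v h).2) (mulr0 _)).
  have [s1 s2] := small y i; have [s3 s4] := small (- y) i.
  rewrite a1 in s1; rewrite a2 in s2; rewrite b1 cN sN// in s3; rewrite b2 cN sN// in s4.
  move: s1 s2 s3 s4; move: (cos_transform _ y) (sin_transform _ y) (cos_transform _ y) (sin_transform _ y) => c1 s1 c3 s3.
  by rewrite !opprK => x1 x2 x3 x4; exact: small_phases.
have D0 : 0 <= 2 * d by lra.
have sp x : A < `|x| -> ev (cut A v) x = 0 by move=> /(parts_supported v)[].
have sq x : A < `|x| -> od (cut A v) x = 0 by move=> /(parts_supported v)[].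
have T1 := he _ _ _ _ p1 p1 p1 sp sp D0 (fun i y => (trig i y).1).
have T2 := he _ _ _ _ p1 p2 p2 sp sq D0 (fun i y => (trig i y).1).
have T3 := he _ _ _ _ p2 p1 p2 sq sp D0 (fun i y => (trig i y).2).
have T4 := he _ _ _ _ p2 p2 p1 sq sq D0 (fun i y => (trig i y).2).
have fin (a b b' : R) : 0 <= a -> a <= energy_norm v -> 0 <= b -> b <= energy_norm v ->
    0 <= b' -> b' <= energy_norm v -> (eps * a + Lam * (2 * d)) * (b * b') <= c / 16.
  move=> a0 ak b0 bk b0' bk'.
  apply: (@le_trans _ _ ((eps * k + Lam * (2 * d)) * (k * k))).
    apply: ler_pM.
    - by apply: addr_ge0; apply: mulr_ge0 => //; exact: ltW.
    - exact: mulr_ge0.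
    - by rewrite lerD2r ler_pM2l// (le_trans ak).
    - by apply: ler_pM => //; apply: le_trans vk.
  have -> : (eps * k + Lam * (2 * d)) * (k * k) = eps * k ^+ 3 + 2 * (d * (Lam * k ^+ 2)) by ring.
  have X1 : eps * k ^+ 3 <= c / 32.
    by rewrite /eps ratio_le.
  have X2 : d * (Lam * k ^+ 2) <= c / 64.
    by rewrite /d ratio_le.
  move: X1 X2; move: (eps * _) (d * _) c0; clear => x y *; lra.
have [i1 j1] := T1; have [i2 j2] := T2; have [i3 j3] := T3; have [i4 j4] := T4.
have N0 := @nrm2_ge0 _ _ _ mu.
have := hA v v v vk vk vk.
rewrite {2}/profile_cubic (cubic_tri i1 i2 i3 i4) => /(le_trans (ler_norm _)).
move: (le_trans j1 (fin _ _ _ (N0 _) q1 (N0 _) q1 (N0 _) q1)).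
move: (le_trans j2 (fin _ _ _ (N0 _) q1 (N0 _) q2 (N0 _) q2)).
move: (le_trans j3 (fin _ _ _ (N0 _) q2 (N0 _) q1 (N0 _) q2)).
move: (le_trans j4 (fin _ _ _ (N0 _) q2 (N0 _) q2 (N0 _) q1)).
move: vc; move: (profile_cubic _ _ _ _) (tri _ _ _ _) (tri _ _ _ _) (tri _ _ _ _) (tri _ _ _ _).
move: c0; clear => c0 T t1 t2 t3 t4; rewrite !ler_norml => vc /andP[? ?] /andP[? ?] /andP[? ?] /andP[? ?]; lra.
Qed.

End profile_compactness.

(** * Trilinear forms with one factor fixed *)

Section compact_form.
Variable R : realType.
Local Notation mu := (@lebesgue_measure R).
Local Notation mu2 := (leb2 R).
Local Notation "'I' f" := (Rintegral mu [set: _] f) (at level 10, f at level 8).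
Local Notation "'I2' f" := (Rintegral mu2 [set: R * R] f) (at level 10, f at level 8).
Local Notation N := (nrm2 mu).

Lemma square_bounded (n : R * R -> R) A : continuous n -> 0 <= A ->
  exists2 M, 0 < M & forall a b, `|a| <= A -> `|b| <= A -> `|n (a, b)| <= M.
Proof.
move=> cn A0; have [L [x [e [ce he]]]] := step_approx cn A0 ltr01.
have S0 : 0 <= \sum_i \sum_j `|n (x i, x j)|.
  by apply: sumr_ge0 => i _; apply: sumr_ge0 => j _.
exists (1 + \sum_i \sum_j `|n (x i, x j)|); first by rewrite ltr_wpDr.
move=> a b ha hb.
have -> : n (a, b) = (n (a, b) - \sum_i \sum_j n (x i, x j) * (e i a * e j b)) +
   \sum_i \sum_j n (x i, x j) * (e i a * e j b) by rewrite subrK.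
apply: le_trans (ler_normD _ _) _; apply: lerD; first exact: he.
apply: le_trans (ler_norm_sum _ _ _) _; apply: ler_sum => i _.
apply: le_trans (ler_norm_sum _ _ _) _; apply: ler_sum => j _.
have [_ i0 i1 _] := ce i; have [_ j0 j1 _] := ce j.
by rewrite normrM ler_piMr// ger0_norm ?mulr_ge0// mulr_ile1.
Qed.

Lemma tri_young3 F1 F2 G : sqi mu F1 -> sqi mu F2 -> itg mu G ->
  itg mu2 (fun z => F1 z.1 * F2 z.2 * G (- (z.1 + z.2))) /\
  I2 (fun z => `|F1 z.1 * F2 z.2 * G (- (z.1 + z.2))|) <= I (fun x => `|G x|) * (N F1 * N F2).
Proof.
move=> h1 h2 Gi; have [i b] := tri_young Gi h1 h2.
have ii := itg_rot3 (itg_rot3 i); have ai := itg_rot3 (itg_abs i).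
have E (z : R * R) : G (rot3 (rot3 z)).1 * F1 (rot3 (rot3 z)).2 *
    F2 (- ((rot3 (rot3 z)).1 + (rot3 (rot3 z)).2)) = F1 z.1 * F2 z.2 * G (- (z.1 + z.2)).
  case: z => a b' /=; rewrite (_ : - (b' + - (a + b')) = a); last by ring.
  by rewrite (_ : - (- (a + b') + a) = b'); ring.
split; first by apply: eq_itg ii.
rewrite -(I2_rot3 (itg_abs i)) -(I2_rot3 ai) in b; apply: le_trans b.
by rewrite le_eqVlt; apply/orP; left; apply/eqP; apply: eqI => z /=; rewrite -E.
Qed.

(** With one factor fixed, the form is nearly of finite rank in the other two:
    replace the fixed factor by a continuous function, so that the symbol times
    it is a continuous kernel on a square. *)
Lemma tri_finite_rank (n : R * R -> R) A F3 (eps : R) : continuous n -> 0 <= A -> 0 < eps ->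
  itg mu F3 ->
  exists (L : nat) (e : 'I_L -> R -> R) (Lam : R), [/\ forall i, cell A (e i), 0 <= Lam &
  forall F1 F2, sqi mu F1 -> sqi mu F2 ->
   (forall x, A < `|x| -> F1 x = 0) -> (forall x, A < `|x| -> F2 x = 0) ->
   itg mu2 (tri_kernel n F1 F2 F3) /\
   `|tri n F1 F2 F3| <= eps * (N F1 * N F2) +
     Lam * \sum_i \sum_j `|I (fun x => e i x * F1 x)| * `|I (fun x => e j x * F2 x)|].
Proof.
move=> cn A0 e0 h3; have [M M0 hM] := square_bounded cn A0.
have e1 : 0 < eps / (2 * M) by rewrite divr_gt0// mulr_gt0.
have [g [cg hg]] := cut_continuous_approx (2 * A) h3 e1.
pose kap (z : R * R) := n z * g (- (z.1 + z.2)).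
have ck : continuous kap.
  move=> z; apply: cvgM; first exact: cn.
  apply: (cvg_comp (fun z : R * R => - (z.1 + z.2)) g); last exact: cg.
  by apply: cvgN; apply: cvgD; [exact: cvg_fst|exact: cvg_snd].
pose a0 := N (cut A (fun=> 1)); have a00 : 0 <= a0 by exact: nrm2_ge0.
have e2 : 0 < eps / (2 * (a0 ^+ 2 + 1)) by rewrite divr_gt0// mulr_gt0// ltr_wpDl// sqr_ge0.
have [L [x [e [ce he]]]] := plane_step ck A0 e2.
have S0 : 0 <= \sum_i \sum_j `|kap (x i, x j)|.
  by apply: sumr_ge0 => i _; apply: sumr_ge0 => j _.
exists L, e, (\sum_i \sum_j `|kap (x i, x j)|); split => // F1 F2 h1 h2 s1 s2.
have [i1 b1] := itg_supported h1 s1; have [i2 b2] := itg_supported h2 s2.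
have [Pi PE] := I2_product i1 i2.
pose P z := F1 z.1 * F2 z.2.
have P0 a b : A < `|a| \/ A < `|b| -> P (a, b) = 0.
  by rewrite /P /=; case=> [/s1|/s2] ->; rewrite ?mulr0 ?mul0r.
have [ki kb] := he P Pi P0.
pose r x := cut (2 * A) F3 x - cut (2 * A) g x.
have cgi : itg mu (cut (2 * A) g).
  have [Mg hMg] := continuous_bounded_segment (2 * A) cg.
  apply: (@itg_indic_bounded R (- (2 * A)) (2 * A) Mg); first exact: continuous_measurable_fun.
  by move=> y yA; apply: hMg; rewrite ler_norml.
have ri : itg mu r by apply: itgB => //; exact: itg_cut.
have [qi qb] := tri_young3 h1 h2 ri.
pose Q z := F1 z.1 * F2 z.2 * r (- (z.1 + z.2)).
have mn := mea_continuous2 cn.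
have nQ z : `|n z * Q z| <= M * `|Q z|.
  case: z => a b; rewrite normrM; have [/andP[ha hb]|] := boolP ((`|a| <= A) && (`|b| <= A)).
    by rewrite ler_wpM2r// hM.
  rewrite negb_and -!ltNge => /orP h; have := P0 a b h; rewrite /Q /P /= => ->.
  by rewrite mul0r normr0 !mulr0.
have nQi : itg mu2 (fun z => n z * Q z).
  apply: (itg_le (m := mu2) (meaM mn (itg_mea qi)) nQ); apply: itgZ; exact: itg_abs.
have E z : n z * Q z + kap z * P z = tri_kernel n F1 F2 F3 z.
  case: z => a b; rewrite /tri_kernel /Q /P /kap /=.
  have [/andP[ha hb]|] := boolP ((`|a| <= A) && (`|b| <= A)).
    rewrite /r !cutE (_ : `|- (a + b)| <= 2 * A); first by ring.
    by rewrite normrN mulr_natl mulr2n (le_trans (ler_normD _ _))// lerD.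
  rewrite negb_and -!ltNge => /orP h; have := P0 a b h; rewrite /P /= => ->.
  by rewrite !mul0r !mulr0 addr0.
split; first by apply: eq_itg (itgD nQi ki) => z; exact: E.
have N12 : 0 <= N F1 * N F2 by rewrite mulr_ge0 ?nrm2_ge0.
have -> : tri n F1 F2 F3 = I2 (fun z => n z * Q z) + I2 (fun z => kap z * P z).
  by rewrite -(ID nQi ki); apply: eqI => z; rewrite E.
have bQ : `|I2 (fun z => n z * Q z)| <= eps / 2 * (N F1 * N F2).
  have h := itgZ M (itg_abs qi).
  apply: le_trans (I_abs_le (m := mu2) (itg_mea nQi) h nQ) _.
  rewrite (IZ _ (itg_abs qi)); apply: (@le_trans _ _ (M * (eps / (2 * M) * (N F1 * N F2)))).
    by rewrite ler_pM2l//; apply: le_trans qb _; apply: ler_wpM2r.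
  by rewrite le_eqVlt; apply/orP; left; apply/eqP; field; exact: lt0r_neq0.
have PN : I2 (fun z => `|P z|) <= a0 ^+ 2 * (N F1 * N F2).
  have [_ E2] := I2_product (itg_abs i1) (itg_abs i2).
  have -> : I2 (fun z => `|P z|) = I (fun x => `|F1 x|) * I (fun x => `|F2 x|).
    by rewrite -E2; apply: eqI => z; rewrite /P normrM.
  have -> : a0 ^+ 2 * (N F1 * N F2) = (a0 * N F1) * (a0 * N F2) by ring.
  by apply: ler_pM => //; apply: I_ge0.
apply: le_trans (ler_normD _ _) _.
have -> : eps * (N F1 * N F2) = eps / 2 * (N F1 * N F2) + eps / 2 * (N F1 * N F2) by field.
rewrite -addrA; apply: lerD => //; apply: le_trans kb _; apply: lerD.
  apply: (@le_trans _ _ (eps / (2 * (a0 ^+ 2 + 1)) * (a0 ^+ 2 * (N F1 * N F2)))).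
    by apply: ler_wpM2l => //; exact: ltW.
  rewrite (mulrA (eps / _)); apply: ler_wpM2r => //.
  by apply: ratio_le; rewrite ?sqr_ge0.
rewrite mulr_suml; apply: ler_sum => i _; rewrite mulr_suml; apply: ler_sum => j _.
apply: ler_wpM2l => //.
have g1 := cell_mul_sqi (ce i) h1; have g2 := cell_mul_sqi (ce j) h2.
have z1 y : A < `|y| -> e i y * F1 y = 0 by move=> /s1 ->; rewrite mulr0.
have z2 y : A < `|y| -> e j y * F2 y = 0 by move=> /s2 ->; rewrite mulr0.
have [j1 _] := itg_supported g1 z1; have [j2 _] := itg_supported g2 z2.
have [_ E3] := I2_product j1 j2.
rewrite (_ : I2 _ = I2 (fun z => e i z.1 * F1 z.1 * (e j z.2 * F2 z.2))); last first.
  by apply: eqI => z; rewrite /P; ring.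
rewrite E3 normrM.
rewrite (bigD1 i)//= (bigD1 j)//= -addrA lerDl; apply: addr_ge0; apply: sumr_ge0 => k _.
  exact: mulr_ge0.
by apply: sumr_ge0 => l _; exact: mulr_ge0.
Qed.

End compact_form.

(** * The cubic form along weakly vanishing sequences *)

Section weak_vanishing.
Variable R : realType.
Local Notation mu := (@lebesgue_measure R).
Local Notation mu2 := (leb2 R).
Local Notation "'I' f" := (Rintegral mu [set: _] f) (at level 10, f at level 8).
Local Notation N := (nrm2 mu).

(** Up to a small error only finitely many pairings with cells enter, and each
    of them tends to zero. *)
Lemma tri_weakly_vanishing (n : R * R -> R) A F3 (K : R) (U : set_system nat)
    (P Q : nat -> R -> R) : Filter U -> continuous n -> 0 <= A -> itg mu F3 ->
  (forall k, sqi mu (P k)) -> (forall k, sqi mu (Q k)) ->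
  (forall k x, A < `|x| -> P k x = 0) -> (forall k x, A < `|x| -> Q k x = 0) ->
  (forall k, N (P k) <= K) -> (forall k, N (Q k) <= K) ->
  (forall e, cell A e -> I (fun x => e x * P k x) @[k --> U] --> (0 : R)) ->
  (forall e, cell A e -> I (fun x => e x * Q k x) @[k --> U] --> (0 : R)) ->
  (forall k, itg (leb2 R) (tri_kernel n (P k) (Q k) F3)) /\
  tri n (P k) (Q k) F3 @[k --> U] --> (0 : R).
Proof.
move=> FU cn A0 h3 hP hQ sP sQ nP nQ wP wQ; split.
  by move=> k; have [L [e [Lam [_ _ /(_ _ _ (hP k) (hQ k) (sP k) (sQ k))[]]]]] :=
    tri_finite_rank cn A0 ltr01 h3.
apply/cvgr0Pnorm_le => eps e0.
have e1 : 0 < eps / (2 * (K ^+ 2 + 1)) by rewrite divr_gt0// mulr_gt0// ltr_wpDl// sqr_ge0.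
have [L [e [Lam [ce L0 he]]]] := tri_finite_rank cn A0 e1 h3.
have s0 (G : 'I_L -> nat -> R) : (forall i, G i k @[k --> U] --> (0 : R)) ->
    \sum_i G i k @[k --> U] --> (0 : R).
  move=> h; elim: (index_enum _) => [|i r ih].
    by under eq_fun do rewrite big_nil; exact: cvg_cst.
  rewrite (_ : (fun k => _) = fun k => G i k + \sum_(j <- r) G j k).
    by have := cvgD (h i) ih; rewrite addr0; apply.
  by apply/funext => k; rewrite big_cons.
have c0 : Lam * \sum_i \sum_j `|I (fun x => e i x * P k x)| * `|I (fun x => e j x * Q k x)|
    @[k --> U] --> (0 : R).
  pose X i j k := `|I (fun x => e i x * P k x)| * `|I (fun x => e j x * Q k x)|.
  suff h : \sum_i \sum_j X i j k @[k --> U] --> (0 : R).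
    have := cvgM (@cvg_cst _ Lam _ U _) h; rewrite mulr0; apply.
  apply: (s0 (fun i k => \sum_j X i j k)) => i; apply: (s0 (X i)) => j.
  have := cvgM (cvg_norm (wP _ (ce i))) (cvg_norm (wQ _ (ce j))).
  by rewrite normr0 mulr0; apply.
have e2 : 0 < eps / 2 by lra.
move/cvgr0Pnorm_le : c0 => /(_ _ e2); apply: filterS => k hk.
have [_ b] := he _ _ (hP k) (hQ k) (sP k) (sQ k); apply: le_trans b _.
have NN : N (P k) * N (Q k) <= K ^+ 2.
  by rewrite expr2; apply: ler_pM; rewrite ?nrm2_ge0.
rewrite [leRHS](_ : eps = eps / 2 + eps / 2); last by lra.
apply: lerD; last exact: le_trans (ler_norm _) hk.
have a0 : 0 < 2 :> R by [].
apply: le_trans (ratio_le e0 a0 (sqr_ge0 K)).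
by apply: ler_wpM2l => //; exact: ltW.
Qed.

End weak_vanishing.

Section profile_weak_limits.
Variables (R : realType) (s s' : R) (mt : R -> R) (n : R * R -> R).
Hypothesis S : symbols s s' mt n.
Local Notation mu := (@lebesgue_measure R).
Local Notation "'I' f" := (Rintegral mu [set: _] f) (at level 10, f at level 8).
Local Notation V := (profile mt).

(** Truncating frequencies leaves a sum of trilinear forms with one fixed
    factor, to which the finite-rank approximation applies. *)
Theorem profile_compact (U : set_system nat) (w : nat -> V) (K : R) : UltraFilter U ->
  (forall k, mass_form (w k) (w k) + dispersion_form (w k) (w k) <= K) ->
  (forall v, mass_form (w k) v + dispersion_form (w k) v @[k --> U] --> (0 : R)) ->
  forall v, profile_cubic n v (w k) (w k) @[k --> U] --> (0 : R).
Proof.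
move=> UU wK wB v; have UP : ProperFilter U by apply: ultra_proper.
have wk k : energy_norm (w k) <= Num.sqrt K.
  rewrite -(ler_pXn2r (n:=2))// ?nnegrE ?energy_norm_ge0 ?sqrtr_ge0// (energy_norm_sqr S).
  rewrite sqr_sqrtr; first exact: wK.
  by apply: le_trans (wK k); rewrite addr_ge0 ?mass_ge0 ?(dispersion_ge0 S).
pose K1 := Num.max (Num.sqrt K) (energy_norm v).
have K10 : 0 <= K1 by rewrite le_max sqrtr_ge0.
have vK1 : energy_norm v <= K1 by rewrite le_max lexx orbT.
have wK1 k : energy_norm (w k) <= K1 by rewrite le_max wk.
apply/cvgr0Pnorm_le => eps e0; have e2 : 0 < eps / 2 by lra.
have [A [A0 hA]] := truncation_choice S e2 K10.
have [v1 v2 _ _] := parts S A v.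
have [i1 _] := itg_supported v1 (fun x h => (parts_supported v h).1).
have [i2 _] := itg_supported v2 (fun x h => (parts_supported v h).2).
pose P k := ev (cut A (w k)); pose Q k := od (cut A (w k)).
have wP e : cell A e -> I (fun x => e x * P k x) @[k --> U] --> (0 : R).
  move=> ce; have [fs hfs] := parity_functionals S (fun i : 'I_1 => cell_sqi ce).
  have [[f _ hf] _] := hfs ord0; have := wB f.
  rewrite (_ : (fun k => _) = fun k => I (fun x => e x * P k x))//.
  apply/funext => k; rewrite -[LHS]/(energy_form _ _) hf; apply: eqI => x.
  by rewrite /P cut_ev (cell_cut _ _ ce).
have wQ e : cell A e -> I (fun x => e x * Q k x) @[k --> U] --> (0 : R).
  move=> ce; have [fs hfs] := parity_functionals S (fun i : 'I_1 => cell_sqi ce).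
  have [_ [f _ hf]] := hfs ord0; have := wB f.
  rewrite (_ : (fun k => _) = fun k => I (fun x => e x * Q k x))//.
  apply/funext => k; rewrite -[LHS]/(energy_form _ _) hf; apply: eqI => x.
  by rewrite /Q cut_od (cell_cut _ _ ce).
have hP k : sqi mu (P k) by have [] := parts S A (w k).
have hQ k : sqi mu (Q k) by have [] := parts S A (w k).
have sP k x : A < `|x| -> P k x = 0 by move=> /(parts_supported (w k))[].
have sQ k x : A < `|x| -> Q k x = 0 by move=> /(parts_supported (w k))[].
have nP k : nrm2 mu (P k) <= K1 by have [_ _ h _] := parts S A (w k); exact: le_trans h _.
have nQ k : nrm2 mu (Q k) <= K1 by have [_ _ _ h] := parts S A (w k); exact: le_trans h _.
have FU : Filter U by exact: filter_filter.
have van (F3 : R -> R) (P' Q' : nat -> R -> R) (i : itg mu F3) := @tri_weakly_vanishing _ n A F3 K1 U P' Q' FU (sy_nc S) A0 i.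
have [j1 c1] := van (ev (cut A v)) P P i1 hP hP sP sP nP nP wP wP.
have [j2 c2] := van (od (cut A v)) P Q i2 hP hQ sP sQ nP nQ wP wQ.
have [j3 c3] := van (od (cut A v)) Q P i2 hQ hP sQ sP nQ nP wQ wP.
have [j4 c4] := van (ev (cut A v)) Q Q i1 hQ hQ sQ sQ nQ nQ wQ wQ.
have c : profile_cubic n (cut_profile A v) (cut_profile A (w k)) (cut_profile A (w k)) @[k --> U] --> (0 : R).
  have -> : (fun k => profile_cubic n (cut_profile A v) (cut_profile A (w k)) (cut_profile A (w k))) =
    fun k => tri n (P k) (P k) (ev (cut A v)) - tri n (P k) (Q k) (od (cut A v)) -
      tri n (Q k) (P k) (od (cut A v)) - tri n (Q k) (Q k) (ev (cut A v)).
    by apply/funext => k; rewrite (profile_cubic_rot S); exact: (cubic_tri (j1 k) (j2 k) (j3 k) (j4 k)).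
  have z : (0 : R) = 0 - 0 - 0 - 0 by rewrite !subr0.
  by rewrite [X in _ --> X]z; apply: cvgB => //; apply: cvgB => //; exact: cvgB.
move/cvgr0Pnorm_le : c => /(_ _ e2); apply: filterS => k hk.
have := hA v (w k) (w k) vK1 (wK1 k) (wK1 k).
move: hk; move: (profile_cubic _ _ _ _) (profile_cubic _ _ _ _) => a b.
clear; rewrite !ler_norml => /andP[? ?] /andP[? ?]; apply/andP; split; lra.
Qed.

End profile_weak_limits.

(** * A low-frequency test profile *)

Section test_profile.
Variables (R : realType) (s s' : R) (mt : R -> R) (n : R * R -> R).
Hypothesis S : symbols s s' mt n.
Local Notation mu := (@lebesgue_measure R).
Local Notation mu2 := (leb2 R).
Local Notation "'I' f" := (Rintegral mu [set: _] f) (at level 10, f at level 8).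
Local Notation "'I2' f" := (Rintegral mu2 [set: R * R] f) (at level 10, f at level 8).
Local Notation V := (profile mt).

Definition box (d : R) : R -> R := cut d (fun=> 1).

Lemma boxE d x : box d x = (`|x| <= d)%R%:R.
Proof. by rewrite /box cutE; case: ifP. Qed.

Lemma box_itg d : 0 <= d -> itg mu (box d) /\ I (box d) = 2 * d.
Proof.
move=> d0; have E x : \1_(`[- d, d]%classic) x = box d x.
  by rewrite indicE mem_setE /= in_itv /= -ler_norml boxE.
have i : itg mu (\1_(`[- d, d]%classic) : R -> R) by exact: integrable_indic_itv.
split; first by apply: eq_itg i.
rewrite -(eqI mu E); apply: EFin_inj; rewrite (IE i) integral_indic//= setIT lebesgue_measure_itv/= lte_fin.
case: ltP => h; first by rewrite -EFinD; congr EFin; lra.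
by congr EFin; lra.
Qed.

Lemma box_cell d : cell d (box d).
Proof.
split => [|x|x|x].
- by apply: mea_cut; exact: mea_cst.
- by rewrite boxE.
- by rewrite boxE lern1 leq_b1.
- by rewrite boxE ltNge => /negbTE ->.
Qed.

Lemma box_sqr d x : box d x * box d x = box d x.
Proof. by rewrite boxE; case: (_ <= _); rewrite ?mulr1 ?mulr0. Qed.

Lemma symbol_near0 : exists d0 : R, [/\ 0 < d0, d0 < 1 & forall a b, `|a| <= d0 -> `|b| <= d0 ->
  n (0, 0) / 2 <= n (a, b)].
Proof.
have n0 := sy_n0 S; have n2 : n (0, 0) / 2 < n (0, 0) by lra.
have cn := @sy_nc _ _ _ _ _ S (0, 0); have h := cvgr_gt (FF := nbhs_filter _) _ cn _ n2.
have [e /= e0 he] := (nbhs_ballP _ _).1 h.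
exists (Num.min (e / 2) (1 / 2)); split.
- by rewrite lt_min; apply/andP; split; lra.
- by rewrite gt_min; apply/orP; right; lra.
move=> a b; rewrite !le_min => /andP[a1 _] /andP[b1 _]; apply: ltW; apply: he.
by split; rewrite /ball /= sub0r normrN; lra.
Qed.

(** Concentrating a fixed mass on frequencies |x| <= d costs d^s' in dispersion
    and gains d^(1/2) in the cubic term; d ~ M^(1/(2 s' - 1)) balances the two. *)
Lemma negative_energy (M0 : R) : 0 < M0 -> exists2 c, 0 < c & forall M, 0 < M -> M <= M0 ->
  exists2 v : V, mass_form v v = M &
    energy (@dispersion_form R mt) (@profile_cubic R mt n) v <= - c * M `^ (1 + s' / (2 * s' - 1)).
Proof.
move=> M00; have s'1 := sy_s' S; have s'0 : 0 < 2 * s' - 1 by lra.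
have [c1 [c2 [c10 c20 _ lo]]] := sy_m S; have n0 := sy_n0 S.
have [d0 [d00 d01 hn]] := symbol_near0.
pose e := (2 * s' - 1)^-1; have e0 : 0 < e by rewrite invr_gt0.
have eN : 2 * s' - 1 != 0 by rewrite gt_eqF.
pose r0 : R := 2 `^ (- (3 / 2)); have r00 : 0 < r0 by exact: powR_gt0.
pose c' := n (0, 0) / 6 * r0; have c'0 : 0 < c' by rewrite !mulr_gt0.
pose kap := Num.min (d0 / M0 `^ e) ((c' / c2) `^ (s' - 1 / 2)^-1).
have k0 : 0 < kap by rewrite lt_min divr_gt0 ?powR_gt0// divr_gt0.
have k1 : kap * M0 `^ e <= d0 by rewrite -ler_pdivlMr ?powR_gt0// ge_min lexx.
have k2 : kap `^ (s' - 1 / 2) <= c' / c2.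
  have q0 : 0 < s' - 1 / 2 by lra.
  have -> : c' / c2 = ((c' / c2) `^ (s' - 1 / 2)^-1) `^ (s' - 1 / 2).
    by rewrite -powRrM mulVf ?gt_eqF// powRr1// divr_ge0// ltW.
  apply: ge0_ler_powR; rewrite ?nnegrE ?(ltW q0) ?(ltW k0) ?powR_ge0//.
  by rewrite ge_min lexx orbT.
exists (2^-1 * (c' * kap `^ (1 / 2))); first by rewrite !mulr_gt0 ?powR_gt0.
move=> M M_0 MM0; pose d := kap * M `^ e.
have dp : 0 < d by rewrite mulr_gt0// powR_gt0.
have dd0 : d <= d0.
  apply: le_trans k1; rewrite ler_pM2l//.
  by apply: ge0_ler_powR; rewrite ?nnegrE ?(ltW e0) ?(ltW M_0) ?(ltW M00).
have [bi bI] := box_itg (ltW dp); have [mb b0 b1 bz] := box_cell d.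
have bV : box d \in finite_energy mt.
  apply/finite_energyP; split => //.
  have mw := mea_sqrt_mt S 1.
  apply: (sqi_le (m := mu) (meaM mw mb) (sqiZ (Num.sqrt (1 + c2)) (cell_sqi (box_cell d)))) => x.
  rewrite boxE; case: (leP `|x| d) => h /=; last by rewrite !mulr0.
  rewrite !mulr1 !ger0_norm ?sqrtr_ge0// ler_sqrt; last by lra.
  have x1 : `|x| < 1 by lra.
  have /andP[_ h2] := lo x x1; rewrite lerD2l; apply: le_trans h2 _.
  have p1 : 1 `^ s' = 1 :> R by rewrite powR1.
  rewrite ler_piMr ?(ltW c20)// -[leRHS]p1.
  by apply: ge0_ler_powR; rewrite ?nnegrE//; lra.
pose b : V := Profile bV.
have bm : mass_form b b = 2 * d.
  by rewrite -bI; apply: eqI => x; exact: box_sqr.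
have bd : dispersion_form b b <= c2 * d `^ s' * (2 * d).
  rewrite -bI -(IZ _ bi); apply: I_le; [exact: (itg_mt S b b)|exact: itgZ|move=> x /=].
  rewrite box_sqr boxE; case: (leP `|x| d) => h /=; last by rewrite !mulr0.
  rewrite !mulr1; have x1 : `|x| < 1 by lra.
  have /andP[_ h2] := lo x x1; apply: le_trans h2 _; rewrite ler_pM2l//.
  by apply: ge0_ler_powR; rewrite ?nnegrE//; lra.
have bT : n (0, 0) / 2 * d ^+ 2 <= profile_cubic n b b b.
  have d2 : 0 <= d / 2 by lra.
  have [hi hI] := box_itg d2.
  have [Pi PI] := I2_product hi hi.
  have -> : n (0, 0) / 2 * d ^+ 2 = I2 (fun z => n (0, 0) / 2 * (box (d / 2) z.1 * box (d / 2) z.2)).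
    by rewrite (IZ _ Pi) PI hI; field.
  apply: I_le; [exact: itgZ|exact: (itg_cubic S b b b)|move=> [x y]].
  have evb z : ev (box d) z = box d z by rewrite /ev !boxE normrN; field.
  have odb z : od (box d) z = 0 by rewrite /od !boxE normrN subrr mulr0.
  rewrite /cubic_kernel /re3 /= !odb !evb !(mulr0, mul0r, subr0) !boxE.
  have [hx|hx] := leP `|x| d; have [hy|hy] := leP `|y| d; rewrite /= ?mul0r ?mulr0.
  - have nn : n (0, 0) / 2 <= n (x, y) by apply: hn; lra.
    have [h1|h1] := leP `|x| (d / 2); have [h2|h2] := leP `|y| (d / 2); rewrite /= ?mul0r ?mulr0 ?mulr1 ?mul1r.
    + rewrite (_ : `|- (x + y)| <= d) ?mulr1// normrN; apply: le_trans (ler_normD _ _) _; lra.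
    + by rewrite mulr_ge0//; lra.
    + by rewrite mulr_ge0//; lra.
    + by rewrite mulr_ge0//; lra.
  - by rewrite (_ : `|y| <= d / 2 = false) /= ?(mulr0, mul0r)//; apply: negbTE; rewrite -ltNge; lra.
  - by rewrite (_ : `|x| <= d / 2 = false) /= ?(mulr0, mul0r)//; apply: negbTE; rewrite -ltNge; lra.
  - by rewrite (_ : `|x| <= d / 2 = false) /= ?(mulr0, mul0r)//; apply: negbTE; rewrite -ltNge; lra.
pose r := (2 * kap) `^ (- (1 / 2)); pose a := r * M `^ ((1 - e) / 2).
have k20 : 0 < 2 * kap by rewrite mulr_gt0.
have MD x y : M `^ x * M `^ y = M `^ (x + y) by rewrite powRD ?(gt_eqF M_0) ?implybT.
have r2 : r ^+ 2 * (2 * kap) = 1.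
  rewrite -powR_mulrn ?powR_ge0// -powRrM mulNr divfK ?pnatr_eq0// powR_inv1 ?(ltW k20)//.
  by rewrite mulVf// gt_eqF.
have X2 x : (M `^ (x / 2)) ^+ 2 = M `^ x.
  by rewrite -powR_mulrn ?powR_ge0// -powRrM divfK ?pnatr_eq0.
have am : a ^+ 2 * (2 * d) = M.
  rewrite /a /d exprMn X2.
  have -> : r ^+ 2 * M `^ (1 - e) * (2 * (kap * M `^ e)) = (r ^+ 2 * (2 * kap)) * (M `^ (1 - e) * M `^ e) by ring.
  by rewrite r2 mul1r MD subrK powRr1 ?(ltW M_0).
have betaE : s' / (2 * s' - 1) = s' * e by [].
have eE : e = 2 * (s' * e) - 1 by rewrite /e; field.
have ds : d `^ s' * M = kap `^ s' * M `^ (1 + s' * e).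
  rewrite /d powRM ?powR_ge0 ?(ltW k0)// -powRrM -{2}(powRr1 (ltW M_0)) -mulrA MD.
  by congr (_ * _ `^ _); ring.
have ad : a ^+ 3 * d ^+ 2 = r0 * kap `^ (1 / 2) * M `^ (1 + s' * e).
  have -> : a ^+ 3 * d ^+ 2 = (r ^+ 3 * kap ^+ 2) * (M `^ ((1 - e) / 2) ^+ 2 * M `^ ((1 - e) / 2) * (M `^ e * M `^ e)).
    by rewrite /a /d; ring.
  have -> : r ^+ 3 * kap ^+ 2 = r0 * kap `^ (1 / 2).
    rewrite -!powR_mulrn ?powR_ge0 ?(ltW k0)// -powRrM powRM ?(ltW k0)// -mulrA -powRD; last by rewrite (gt_eqF k0) implybT.
    by rewrite /r0; congr (_ `^ _ * _ `^ _); lra.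
  by rewrite X2 !MD; congr (_ * _ `^ _); move: eE; move: (s' * e) (e) => *; lra.
exists (a *: b).
  by rewrite (formZl (mass_lin S)) (formZr (@mass_sym R mt) (mass_lin S)) bm mulrA -expr2.
rewrite (energyZ (@dispersion_sym R mt) (dispersion_lin S) (profile_cubic_lin S) (profile_cubic_rot S)).
have a0 : 0 < a by rewrite mulr_gt0// powR_gt0.
have q1 : a ^+ 2 * (2^-1 * dispersion_form b b) <= 2^-1 * c2 * (kap `^ s' * M `^ (1 + s' * e)).
  rewrite -ds -am; apply: (@le_trans _ _ (a ^+ 2 * (2^-1 * (c2 * d `^ s' * (2 * d))))).
    by rewrite ler_pM2l ?exprn_gt0// ler_pM2l.
  by rewrite le_eqVlt; apply/orP; left; apply/eqP; ring.
have q2 : c' * kap `^ (1 / 2) * M `^ (1 + s' * e) <= a ^+ 3 * (3^-1 * profile_cubic n b b b).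
  apply: (@le_trans _ _ (a ^+ 3 * (3^-1 * (n (0, 0) / 2 * d ^+ 2)))).
    have -> : a ^+ 3 * (3^-1 * (n (0, 0) / 2 * d ^+ 2)) = n (0, 0) / 6 * (a ^+ 3 * d ^+ 2) by field.
    by rewrite ad /c' !mulrA.
  by rewrite ler_pM2l ?exprn_gt0// ler_pM2l.
have q3 : c2 * kap `^ s' <= c' * kap `^ (1 / 2).
  have -> : kap `^ s' = kap `^ (s' - 1 / 2) * kap `^ (1 / 2).
    by rewrite -powRD ?(gt_eqF k0) ?implybT // subrK.
  by rewrite mulrA ler_pM2r ?powR_gt0// mulrC -ler_pdivlMr.
rewrite betaE; have Mp : 0 < M `^ (1 + s' * e) by exact: powR_gt0.
have q4 : c2 * kap `^ s' * M `^ (1 + s' * e) <= c' * kap `^ (1 / 2) * M `^ (1 + s' * e).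
  by rewrite ler_pM2r.
move: q1 q2 q4; move: (a ^+ 2 * _) (a ^+ 3 * _) (kap `^ s') (kap `^ _) (M `^ _) (c') => x y z t u.
clear => *; lra.
Qed.

End test_profile.

(** * Minimizers and their wave speed *)

Section minimizers.
Variables (R : realType) (s s' : R) (mt : R -> R) (n : R * R -> R).
Hypothesis S : symbols s s' mt n.
Local Notation mu := (@lebesgue_measure R).
Local Notation "'I' f" := (Rintegral mu [set: _] f) (at level 10, f at level 8).
Local Notation V := (profile mt).
Local Notation beta := (s' / (2 * s' - 1)).
Local Notation Q := (@dispersion_form R mt).
Local Notation T := (@profile_cubic R mt n).
Local Notation Energy := (energy Q T).

(** kappa is the gap between m(0) and the wave speed. *)
Definition solitary_profile (M kappa : R) (h : V) :=
  [/\ mass_form h h = M, kappa * M = T h h h - Q h h, Energy h < 0,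
    forall v, mass_form v v = M -> Energy h <= Energy v &
    forall f, Q h f + kappa * mass_form h f = T h h f].

Lemma solitary_profile_exists (M : R) : 0 < M -> exists h kappa, solitary_profile M kappa h.
Proof.
move=> M0; have [c c0 hc] := negative_energy S M0.
have neg : exists2 v : V, mass_form v v = M & Energy v < 0.
  have [v vM ve] := hc M M0 (lexx M); exists v => //; apply: le_lt_trans ve _.
  by rewrite mulNr oppr_lt0 mulr_gt0// powR_gt0.
have [h [hM hmin]] := minimizer_exists (@mass_sym R mt) (mass_lin S) (@mass_ge0 R mt)
  (@dispersion_sym R mt) (dispersion_lin S) (dispersion_ge0 S) (profile_complete S)
  (profile_cubic_lin S) (profile_cubic_rot S) (profile_cubic_bound S) (mass_def S)
  (profile_coercive S) (profile_compact S) (profile_nonvanishing S) M0 neg.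
have hneg : Energy h < 0.
  by have [v vM ve] := neg; apply: le_lt_trans ve; exact: hmin.
exists h, ((T h h h - Q h h) / M); split => //; first by rewrite divfK// gt_eqF.
exact: (minimizer_equation (@mass_sym R mt) (mass_lin S)
  (@dispersion_sym R mt) (dispersion_lin S) (profile_cubic_lin S) (profile_cubic_rot S)
  M0 hM hneg (dispersion_ge0 S h) hmin).
Qed.

Section estimates.
Variables (M kappa : R) (h : V).
Hypotheses (M0 : 0 < M) (hs : solitary_profile M kappa h).

Lemma cubic_gt_dispersion : 3 / 2 * Q h h < T h h h.
Proof. by have [_ _ + _ _] := hs; rewrite /energy; lra. Qed.

Lemma kappa_energy : kappa * M = 2^-1 * Q h h - 3 * Energy h.
Proof. by have [_ -> _ _ _] := hs; rewrite /energy; field. Qed.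

Lemma kappa_gt0 : 0 < kappa.
Proof.
rewrite -(pmulr_lgt0 _ M0) kappa_energy.
have [_ _ e _ _] := hs; have := dispersion_ge0 S h; move: e; move: (Q h h) (Energy h).
by move=> *; lra.
Qed.

Lemma dispersion_gt0 : 0 < Q h h.
Proof.
rewrite lt_def (dispersion_ge0 S) andbT; apply/negP => /eqP q0.
have [c1 [c2 [c10 c20 hi lo]]] := sy_m S; have i := itg_mt S h h.
have mp x : x != 0 -> 0 < mt x.
  move=> x0; have [h1|h1] := leP 1 `|x|.
    by have /andP[+ _] := hi x h1; apply: lt_le_trans; rewrite mulr_gt0// powR_gt0 ?normr_gt0.
  by have /andP[+ _] := lo x h1; apply: lt_le_trans; rewrite mulr_gt0// powR_gt0 ?normr_gt0.
have z : {ae mu, forall x, mt x * (h x * h x) = 0}.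
  apply: (I_eq0_ae (m := mu) (itg_mea i) _ i q0) => x.
  by rewrite mulr_ge0 ?(sy_m0 S)// -expr2 sqr_ge0.
have nz : {ae mu, forall x : R, x != 0}.
  exists [set 0]; split; [exact: measurable_set1|exact: lebesgue_measure_set1|].
  by move=> x /= /negP; rewrite negbK => /eqP.
have hM : mass_form h h = M by have [] := hs.
have : mass_form h h = 0.
  rewrite /mass_form (@I_ae _ _ _ mu _ (fun=> 0)); [|exact: itg_mea (itg_mass S h h)|exact: mea_cst|].
    by rewrite Rintegral_cst// mul0r.
  apply: ae_mono (ae_and z nz) => x [e x0]; have := mp x x0 => p.
  by move/eqP: e; rewrite mulf_eq0 gt_eqF//= => /eqP.
by rewrite hM => e; move: M0; rewrite e ltxx.
Qed.

End estimates.

Lemma beta_gt : 1 / 2 < beta.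
Proof.
have s1 := sy_s' S; have p : 0 < 2 * s' - 1 by lra.
by rewrite ltr_pdivlMr//; lra.
Qed.

Lemma powR_inv_le (x y a : R) : 0 <= x -> 0 <= y -> 0 < a -> x `^ a <= y -> x <= y `^ a^-1.
Proof.
move=> x0 y0 a0 h; have ai : 0 <= a^-1 by rewrite invr_ge0 ltW.
have := ge0_ler_powR ai _ _ h; rewrite !nnegrE powR_ge0 y0 => /(_ erefl erefl).
by rewrite -powRrM mulfV ?gt_eqF// powRr1.
Qed.

(** If the dispersion is at most the mass, low frequencies dominate and the growth bound
    with t = Q/M closes up; otherwise the mass is bounded below. *)
Lemma minimizer_upper_bounds (M0 : R) : 0 < M0 -> exists2 C, 0 < C &
  forall M kappa h, 0 < M -> M <= M0 -> solitary_profile M kappa h ->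
  Q h h <= C * M /\ T h h h <= C * M `^ (1 + beta).
Proof.
move=> M00; have [C [g [C0 g1 hC]]] := cubic_growth S.
have [K hK] := profile_coercive S M0.
have s1 := sy_s' S; have s0 : 0 < s' by lra.
have p0 : 0 < 2 * s' - 1 by lra.
pose e1 := 1 - (2 * s')^-1; have e10 : 0 < e1.
  by rewrite subr_gt0 invf_lt1 ?mulr_gt0//; lra.
pose C1 := C * (C `^ e1^-1) `^ (2 * s')^-1.
pose K1 := Num.max K 1; have K10 : 0 < K1 by rewrite lt_max ltr01 orbT.
have KK : K <= K1 by rewrite le_max lexx.
pose m0 := C ^- 2; have m00 : 0 < m0 by rewrite invr_gt0 exprn_gt0.
pose T0 := C * Num.sqrt K1 ^+ 3; have T00 : 0 < T0 by rewrite mulr_gt0// exprn_gt0// sqrtr_gt0.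
have b0 : 0 < 1 + beta by have := beta_gt; lra.
pose C2 := T0 / m0 `^ (1 + beta); have C20 : 0 < C2 by rewrite divr_gt0// powR_gt0.
have C10 : 0 < C1 by rewrite mulr_gt0// powR_gt0// powR_gt0.
exists (1 + K1 / m0 + C1 + C2); first by rewrite !addr_gt0// divr_gt0.
move=> M kappa h M_0 MM0 hs; have q0 := dispersion_gt0 M_0 hs.
have hM : mass_form h h = M by have [] := hs.
have hT := cubic_gt_dispersion hs.
have := hC h M M_0 (eqW_le hM) q0; set q := Q h h in q0 hT *; move=> up.
have qK : q <= K1.
  apply: le_trans KK; apply: le_trans (hK h _ _); rewrite ?hM//; first by rewrite lerDr ltW.
  by move: hT; rewrite /q; move: (Q h h) (dispersion_ge0 S h) => *; lra.
have qT : q <= T h h h by move: hT q0; move: (q) => *; lra.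
have M1p : 0 < M `^ (1 + beta) by exact: powR_gt0.
have Km : 0 < K1 / m0 by rewrite divr_gt0.
have sq3 : Num.sqrt q ^+ 3 = q `^ (3 / 2).
  by rewrite -powR12_sqrt ?(ltW q0)// -powR_mulrn ?powR_ge0// -powRrM; congr powR; lra.
rewrite /gain in up; case: (leP (q / M) 1) up => [h1|h1] up.
  have up2 : T h h h <= C * (q `^ (2 * s')^-1 * M `^ ((3 - s'^-1) / 2)).
    apply: le_trans up _; rewrite -mulrA ler_pM2l// sq3.
    rewrite powRM ?(ltW q0) ?invr_ge0 ?(ltW M_0)// -(powR_inv1 (ltW M_0)) -powRrM.
    rewrite mulrAC -powRD ?(gt_eqF q0) ?implybT//.
    rewrite le_eqVlt; apply/orP; left; apply/eqP; congr (_ `^ _ * _ `^ _); field; rewrite ?gt_eqF//.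
  have qe : q `^ e1 <= C * M `^ ((3 - s'^-1) / 2).
    have e : q = q `^ e1 * q `^ (2 * s')^-1.
      by rewrite -powRD ?(gt_eqF q0) ?implybT// /e1 subrK powRr1// ltW.
    rewrite -(ler_pM2r (powR_gt0 (2 * s')^-1 q0)) -e; apply: le_trans qT _.
    by apply: le_trans up2 _; rewrite le_eqVlt; apply/orP; left; apply/eqP; ring.
  have q2 := powR_inv_le (ltW q0) _ e10 qe; rewrite mulr_ge0 ?powR_ge0 ?(ltW C0)// in q2.
  have {}q2 := q2 erefl.
  split.
    have : q <= M by move: h1; rewrite ler_pdivrMr// mul1r.
    by move: Km C10 C20 M_0; move: (K1 / m0) (C1) (C2) (q) => *; nra.
  apply: (@le_trans _ _ (C1 * M `^ (1 + beta))); last first.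
    by rewrite ler_wpM2r ?(ltW M1p)//; move: Km C20; move: (K1 / m0) (C2) (C1) => *; lra.
  apply: le_trans up2 _; rewrite /C1 -mulrA ler_pM2l//.
  have i0 : 0 <= (2 * s')^-1 by rewrite invr_ge0; lra.
  have := ge0_ler_powR i0 _ _ q2; rewrite !nnegrE (ltW q0) powR_ge0 => /(_ erefl erefl) q3.
  apply: (@le_trans _ _ (((C * M `^ ((3 - s'^-1) / 2)) `^ e1^-1) `^ (2 * s')^-1 * M `^ ((3 - s'^-1) / 2))).
    by rewrite ler_wpM2r ?powR_ge0.
  rewrite powRM ?powR_ge0 ?(ltW C0)// powRM ?powR_ge0// -mulrA ler_pM2l; last by rewrite powR_gt0// powR_gt0.
  rewrite -!powRrM -powRD ?(gt_eqF M_0) ?implybT//.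
  rewrite le_eqVlt; apply/orP; left; apply/eqP; congr powR; rewrite /e1; field.
  by rewrite !gt_eqF//=; lra.
have qM : M < q by move: h1; rewrite ltr_pdivlMr// mul1r.
have Mm : m0 <= M.
  have qg : q <= C * (q / M) `^ (- g) * q `^ (3 / 2) by rewrite -sq3; apply: le_trans up.
  have r1 : (q / M) `^ (- g) <= (q / M) `^ (- (1 / 2)).
    by rewrite ler_powR//; [exact: ltW|lra].
  have qg2 : q <= C * (M `^ (1 / 2) * q).
    apply: le_trans qg _; rewrite -mulrA ler_pM2l//.
    apply: (@le_trans _ _ ((q / M) `^ (- (1 / 2)) * q `^ (3 / 2))).
      by rewrite ler_wpM2r ?powR_ge0.
    rewrite powRM ?(ltW q0) ?invr_ge0 ?(ltW M_0)// -(powR_inv1 (ltW M_0)) -powRrM mulrAC.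
    rewrite -powRD ?(gt_eqF q0) ?implybT// (_ : - (1 / 2) + 3 / 2 = 1) ?powRr1 ?(ltW q0)//; last by lra.
    by rewrite mulN1r opprK mulrC.
  have : 1 <= C * M `^ (1 / 2) by rewrite -(ler_pM2r q0) [leLHS]mul1r -mulrA.
  move=> h2; rewrite /m0 -[leLHS]mul1r ler_pdivrMr ?exprn_gt0//.
  have := lerXn2r 2 (_ : 1 \in Num.nneg) (_ : C * M `^ (1 / 2) \in Num.nneg) h2.
  rewrite !nnegrE ler01 mulr_ge0 ?powR_ge0 ?(ltW C0)// => /(_ erefl erefl).
  have -> : (C * M `^ (1 / 2)) ^+ 2 = M * C ^+ 2.
    by rewrite exprMn -(powR_mulrn 2 (powR_ge0 M _)) -powRrM divfK ?pnatr_eq0// powRr1 ?(ltW M_0)// mulrC.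
  by rewrite expr1n.
split.
  have : q <= K1 / m0 * M.
    by apply: le_trans qK _; rewrite mulrAC ler_pdivlMr// ler_pM2l.
  by move: C10 C20 M_0; move: (K1 / m0) (C1) (C2) (q) => *; nra.
apply: (@le_trans _ _ (C2 * M `^ (1 + beta))); last first.
  by rewrite ler_wpM2r ?(ltW M1p)//; move: Km C10; move: (K1 / m0) (C2) (C1) => *; lra.
apply: (@le_trans _ _ T0).
  apply: le_trans up _; rewrite /T0 -mulrA ler_pM2l//.
  apply: (@le_trans _ _ (1 * Num.sqrt q ^+ 3)).
    rewrite ler_wpM2r ?exprn_ge0 ?sqrtr_ge0// powRN invf_le1 ?powR_gt0 ?divr_gt0//.
    rewrite -[leLHS](powRr0 (q / M)) ler_powR//; [exact: ltW|lra].
  by rewrite mul1r lerXn2r ?nnegrE ?sqrtr_ge0// ler_sqrt// ltW.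
rewrite /C2 mulrAC ler_pdivlMr ?powR_gt0// ler_pM2l//.
by apply: ge0_ler_powR; rewrite ?nnegrE ?(ltW b0) ?(ltW m00) ?(ltW M_0).
Qed.

(** From below, kappa * M is at least three times the negative of the energy;
    from above, it is at most the cubic term. *)
Lemma kappa_bounds (M0 : R) : 0 < M0 -> exists c C : R, [/\ 0 < c, 0 < C &
  forall M kappa h, 0 < M -> M <= M0 -> solitary_profile M kappa h ->
  c * M `^ beta <= kappa <= C * M `^ beta].
Proof.
move=> M00; have [c c0 hc] := negative_energy S M00.
have [C C0 hC] := minimizer_upper_bounds M00.
exists (3 * c), C; split => // [|M kappa h M_0 MM0 hs]; first by rewrite mulr_gt0.
have [_ hT] := hC _ _ _ M_0 MM0 hs; have ME : M `^ (1 + beta) = M * M `^ beta.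
  by rewrite powRD ?(gt_eqF M_0) ?implybT// powRr1// ltW.
have qg := dispersion_ge0 S h.
apply/andP; split; rewrite -(ler_pM2r M_0).
  rewrite (kappa_energy hs); have [v vM ve] := hc M M_0 MM0.
  have [_ _ _ hm _] := hs; have := hm v vM; rewrite ME in ve.
  move: ve qg; move: (Energy v) (Energy h) (Q h h) (M `^ beta) => *; nra.
have [_ -> _ _ _] := hs; rewrite -mulrA (mulrC _ M) -ME.
by move: hT qg; move: (T h h h) (Q h h) (C * _) => *; lra.
Qed.

End minimizers.

(** * Regularity *)

Section regularity.
Variables (R : realType) (s s' : R) (mt : R -> R) (n : R * R -> R).
Hypothesis S : symbols s s' mt n.
Local Notation mu := (@lebesgue_measure R).
Local Notation mu2 := (leb2 R).
Local Notation "'I' f" := (Rintegral mu [set: _] f) (at level 10, f at level 8).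
Local Notation "'I2' f" := (Rintegral mu2 [set: R * R] f) (at level 10, f at level 8).
Local Notation N := (nrm2 mu).
Local Notation V := (profile mt).
Local Notation J := (@japanese R).
Local Notation W0 := (fun x => Num.sqrt (1 + mt x)).
Local Notation Q := (@dispersion_form R mt).
Local Notation T := (@profile_cubic R mt n).

(** A common even majorant of the two parts of h. *)
Definition envelope (h : R -> R) x := `|h x| + `|h (- x)|.

Lemma envelope_ge0 h x : 0 <= envelope h x. Proof. by rewrite addr_ge0. Qed.

Lemma mea_envelope h : mea h -> mea (envelope h).
Proof. by move=> mh; have mf := mea_flip mh; rewrite /envelope; solve_mea. Qed.

Lemma ev_le h x : `|ev h x| <= envelope h x.
Proof.
rewrite /ev normrM gtr0_norm ?invr_gt0//; have := ler_normD (h x) (h (- x)).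
have := envelope_ge0 h x; rewrite /envelope; lra.
Qed.

Lemma od_le h x : `|od h x| <= envelope h x.
Proof.
rewrite /od normrM gtr0_norm ?invr_gt0//; have := ler_normB (h (- x)) (h x).
have := envelope_ge0 h x; rewrite /envelope; lra.
Qed.

Lemma envelope_weighted (X h : R -> R) : (forall x, X (- x) = X x) -> (forall x, 0 <= X x) ->
  sqi mu (fun x => X x * h x) ->
  sqi mu (fun x => X x * envelope h x) /\
  N (fun x => X x * envelope h x) <= 2 * N (fun x => X x * h x).
Proof.
move=> Xe X0 hX; have a := sqi_abs hX; have b := sqi_opp a.
have E x : `|X x * h x| + `|X (- x) * h (- x)| = X x * envelope h x.
  by rewrite !normrM Xe !(ger0_norm (X0 x)) -mulrDr.
split; first by apply: eq_sqi (sqiD a b).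
rewrite -(funext E); apply: le_trans (nrm2_D a b) _.
by rewrite (nrm2_opp a) nrm2_abs; lra.
Qed.

Lemma re3_le (p1 q1 p2 q2 p3 q3 A1 A2 A3 : R) : `|p1| <= A1 -> `|q1| <= A1 ->
  `|p2| <= A2 -> `|q2| <= A2 -> `|p3| <= A3 -> `|q3| <= A3 ->
  `|re3 p1 q1 p2 q2 p3 q3| <= 4 * (A1 * A2 * A3).
Proof.
move=> h1 k1 h2 k2 h3 k3.
have m x y z : `|x| <= A1 -> `|y| <= A2 -> `|z| <= A3 -> `|x * y * z| <= A1 * A2 * A3.
  by move=> *; rewrite !normrM; exact: mul3_le.
rewrite /re3; apply: le_trans (ler_normB _ _) _.
rewrite (_ : 4 * _ = A1 * A2 * A3 + A1 * A2 * A3 + A1 * A2 * A3 + A1 * A2 * A3); last by ring.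
apply: lerD; last exact: m; apply: le_trans (ler_normB _ _) _.
apply: lerD; last exact: m; apply: le_trans (ler_normB _ _) _.
by apply: lerD; exact: m.
Qed.

Lemma japanese_triangle (t a b c : R) : 0 <= t -> a + b + c = 0 ->
  J c `^ t <= 2 `^ t * (J a `^ t + J b `^ t).
Proof.
move=> t0 abc; have Jc : J c <= 2 * Num.max (J a) (J b).
  have -> : c = - (a + b) by lra.
  rewrite japaneseN; apply: le_trans (japaneseD a b) _.
  have : J a <= Num.max (J a) (J b) by rewrite le_max lexx.
  have : J b <= Num.max (J a) (J b) by rewrite le_max lexx orbT.
  by move: (Num.max _ _) => *; lra.
have J0 x : 0 <= J x := ltW (japanese_gt0 x).
have m0 : 0 <= Num.max (J a) (J b) by rewrite le_max J0.
apply: (@le_trans _ _ ((2 * Num.max (J a) (J b)) `^ t)).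
  by apply: ge0_ler_powR; rewrite ?nnegrE ?mulr_ge0.
rewrite powRM// ler_wpM2l ?powR_ge0//.
by case: (leP (J a) (J b)) => _; rewrite ?lerDr ?lerDl powR_ge0.
Qed.

(** Cut at r so that the square of the weight times a profile is again a
    profile, and below 1 so that mt controls 1 + mt. *)
Definition high_weight (t r x : R) := cut r (fun x => J x `^ t) x * (1 - box 1 x).

Lemma high_weightE t r x : high_weight t r x = if (1 < `|x|) && (`|x| <= r) then J x `^ t else 0.
Proof.
rewrite /high_weight cutE boxE ltNge andbC.
by case: (`|x| <= r); case: (`|x| <= 1); rewrite /= ?subrr ?subr0 ?mulr0 ?mulr1 ?mul0r.
Qed.

Lemma high_weight_ge0 t r x : 0 <= high_weight t r x.
Proof. by rewrite high_weightE; case: ifP => // _; exact: powR_ge0. Qed.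

Lemma high_weight_le t r x : high_weight t r x <= J x `^ t.
Proof. by rewrite high_weightE; case: ifP => // _; exact: powR_ge0. Qed.

Lemma high_weight_even t r x : high_weight t r (- x) = high_weight t r x.
Proof. by rewrite !high_weightE normrN japaneseN. Qed.

Lemma mea_high_weight t r : mea (high_weight t r).
Proof.
apply: meaM; first by apply: mea_cut; exact: mea_japanese_powR.
by apply: meaB; [exact: mea_cst|apply: mea_cut; exact: mea_cst].
Qed.

Lemma high_weight_bound t r x : 0 <= t -> 0 <= r -> high_weight t r x <= J r `^ t.
Proof.
move=> t0 r0; rewrite high_weightE; case: ifP => [/andP[_ h]|_]; last exact: powR_ge0.
apply: ge0_ler_powR; rewrite ?nnegrE ?(ltW (japanese_gt0 _))//.
by apply: japanese_mono; rewrite (ger0_norm r0).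
Qed.

Lemma high_weight_profile t r (h : V) : 0 <= t -> 0 <= r ->
  (fun x => high_weight t r x ^+ 2 * h x) \in finite_energy mt.
Proof.
move=> t0 r0; apply/finite_energyP.
have mh := mea_profile h; have mw := mea_high_weight t r.
have mp : mea (fun x => high_weight t r x ^+ 2 * h x) by apply: meaM => //; exact: meaX.
split => //; have mW := mea_sqrt_mt S 1.
apply: (sqi_le (m := mu) (meaM mW mp) (sqiZ ((J r `^ t) ^+ 2) (sqi_profile h))) => x.
rewrite mulrCA normrM [leRHS]normrM ler_wpM2r// !ger0_norm ?sqr_ge0//.
by rewrite lerXn2r ?nnegrE ?powR_ge0 ?high_weight_ge0// high_weight_bound.
Qed.

Lemma elliptic : exists2 c, 0 < c & forall x, 1 < `|x| -> c * (1 + mt x) <= mt x.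
Proof.
have [c1 [c2 [c10 c20 hi _]]] := sy_m S; exists (c1 / (1 + c1)).
  by rewrite divr_gt0// addr_gt0.
move=> x x1; have /andP[h _] := hi x (ltW x1).
have h1 : c1 <= mt x.
  apply: le_trans h; rewrite ler_peMr ?(ltW c10)// -[leLHS](powRr0 `|x|) ler_powR// ltW//.
  exact: sy_s S.
rewrite mulrAC ler_pdivrMr ?addr_gt0//; move: (mt x) h1 => m h1; nra.
Qed.

(** In frequency c = - (a + b), the weight J^t is shared between a and b, and the
    slack d of the domination pays for d further powers. *)
Lemma cubic_weighted_bound (d : R) (w : R -> R) (t r : R) (h : V) (f : V) : 0 < d -> 0 <= t -> 0 <= r ->
  sqi mu w -> (forall x, 0 <= w x) ->
  dominated_symbol n w (fun x => J x `^ (- d) * Num.sqrt (1 + mt x)) ->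
  (forall x, f x = high_weight (t + d) r x ^+ 2 * h x) ->
  sqi mu (fun x => J x `^ t * W0 x * h x) ->
  `|T h h f| <= 192 * 2 `^ t * N w * (N (fun x => J x `^ t * W0 x * h x) * energy_norm h *
     N (fun x => high_weight (t + d) r x * W0 x * h x)).
Proof.
move=> d0 t0 r0 hw w0 dom fE ht; have td : 0 <= t + d by lra.
pose p := high_weight (t + d) r; pose A := envelope h.
have mh := mea_profile h; have mA := mea_envelope mh; have A0 x : 0 <= A x := envelope_ge0 h x.
have p0 x : 0 <= p x := high_weight_ge0 _ _ x; have mp : mea p := mea_high_weight _ _.
have mW := mea_sqrt_mt S 1; have W00 x : 0 <= W0 x := sqrtr_ge0 _.
have We x : W0 (- x) = W0 x := weight_even S 1 x.
have Jp0 x a : 0 <= J x `^ a := powR_ge0 _ _; have mJ a := @mea_japanese_powR R a.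
pose psi x := p x * J x `^ d * A x.
have JdJ x a : J x `^ (- d) * J x `^ (a + d) = J x `^ a.
  by rewrite -powRD ?(gt_eqF (japanese_gt0 x)) ?implybT//; congr powR; ring.
have Jd1 x : J x `^ (- d) <= 1.
  rewrite powRN invf_le1 ?powR_gt0 ?japanese_gt0// -[leLHS](powRr0 (J x)).
  by rewrite ler_powR ?japanese_ge1// ltW.
pose W x := J x `^ (- d) * W0 x.
have Wge0 x : 0 <= W x by exact: mulr_ge0.
have mWd : mea W by exact: meaM.
have e1 : sqi mu (fun x => J x `^ t * W0 x * A x) /\
    N (fun x => J x `^ t * W0 x * A x) <= 2 * N (fun x => J x `^ t * W0 x * h x).
  by apply: envelope_weighted => // [x|x]; [rewrite japaneseN We|exact: mulr_ge0].
have e2 : sqi mu (fun x => W0 x * A x) /\ N (fun x => W0 x * A x) <= 2 * energy_norm h.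
  by apply: envelope_weighted => //; exact: sqi_profile.
have hp : sqi mu (fun x => p x * W0 x * h x).
  have mph : mea (fun x => p x * W0 x * h x) by apply: meaM => //; exact: meaM.
  apply: (sqi_le (m := mu) mph (sqiZ (J r `^ (t + d)) (sqi_profile h))) => x.
  rewrite -mulrA normrM [leRHS]normrM ler_wpM2r// !ger0_norm//; exact: high_weight_bound.
have e3 : sqi mu (fun x => p x * W0 x * A x) /\
    N (fun x => p x * W0 x * A x) <= 2 * N (fun x => p x * W0 x * h x).
  by apply: envelope_weighted => // [x|x]; [rewrite /p high_weight_even We|exact: mulr_ge0].
have mJA : mea (fun x => J x `^ t * A x) by exact: meaM.
have mpsi : mea psi by apply: meaM => //; exact: meaM.
have k1 : sqi mu (fun x => W x * (J x `^ t * A x)) /\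
    N (fun x => W x * (J x `^ t * A x)) <= N (fun x => J x `^ t * W0 x * A x).
  have le x : `|W x * (J x `^ t * A x)| <= `|J x `^ t * W0 x * A x|.
    have -> : W x * (J x `^ t * A x) = J x `^ (- d) * (J x `^ t * W0 x * A x) by rewrite /W; ring.
    by rewrite normrM ler_piMl// ger0_norm.
  have k : sqi mu (fun x => W x * (J x `^ t * A x)) := sqi_le (m := mu) (meaM mWd mJA) e1.1 le.
  by split => //; exact: nrm2_mono k e1.1 le.
have k2 : sqi mu (fun x => W x * A x) /\ N (fun x => W x * A x) <= N (fun x => W0 x * A x).
  have le x : `|W x * A x| <= `|W0 x * A x|.
    by rewrite /W -mulrA normrM ler_piMl// ger0_norm.
  have k : sqi mu (fun x => W x * A x) := sqi_le (m := mu) (meaM mWd mA) e2.1 le.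
  by split => //; exact: nrm2_mono k e2.1 le.
have psiE x : W x * psi x = p x * W0 x * A x.
  rewrite /W /psi; have := JdJ x 0; rewrite add0r powRr0 => E.
  have -> : J x `^ (- d) * W0 x * (p x * J x `^ d * A x) = (J x `^ (- d) * J x `^ d) * (p x * W0 x * A x) by ring.
  by rewrite E mul1r.
have k3 : sqi mu (fun x => W x * psi x) by apply: eq_sqi e3.1 => x; rewrite psiE.
have tb := tri_bound (mea_n S) dom hw w0 Wge0.
have [i1 b1] := tb _ _ _ mJA mA mpsi k1.1 k2.1 k3.
have [i2 b2] := tb _ _ _ mA mJA mpsi k2.1 k1.1 k3.
have psi0 x : 0 <= psi x by apply: mulr_ge0; [apply: mulr_ge0; [exact: p0|exact: Jp0]|exact: A0].
have fenv x : envelope f x <= J x `^ t * psi x.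
  have pE : p x ^+ 2 <= p x * J x `^ (t + d) by rewrite expr2 ler_wpM2l// high_weight_le.
  have -> : envelope f x = p x ^+ 2 * A x.
    have nf y : `|f y| = p y ^+ 2 * `|h y| by rewrite fE normrM ger0_norm ?sqr_ge0.
    by rewrite /envelope !nf {2}/p high_weight_even -mulrDr.
  apply: (@le_trans _ _ (p x * J x `^ (t + d) * A x)); first exact: ler_wpM2r.
  rewrite /psi powRD ?(gt_eqF (japanese_gt0 x)) ?implybT// le_eqVlt; apply/orP; left; apply/eqP; ring.
have JA0 x : 0 <= J x `^ t * A x by exact: mulr_ge0.
have tkE F1 F2 F3 z : (forall x, 0 <= F1 x) -> (forall x, 0 <= F2 x) -> (forall x, 0 <= F3 x) ->
    `|tri_kernel n F1 F2 F3 z| = `|n z| * (F1 z.1 * F2 z.2 * F3 (- (z.1 + z.2))).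
  move=> f1 f2 f3; rewrite /tri_kernel normrM; congr (_ * _); rewrite ger0_norm//.
  by apply: mulr_ge0 => //; exact: mulr_ge0.
have point z : `|cubic_kernel n h h f z| <= 4 * 2 `^ t *
   (`|tri_kernel n (fun x => J x `^ t * A x) A psi z| + `|tri_kernel n A (fun x => J x `^ t * A x) psi z|).
  case: z => a b; rewrite !tkE// /cubic_kernel normrM /=; set c := - (a + b).
  have abc : a + b + c = 0 by rewrite /c subrr.
  have r3 := re3_le (ev_le h a) (od_le h a) (ev_le h b) (od_le h b)
    (le_trans (ev_le f c) (fenv c)) (le_trans (od_le f c) (fenv c)).
  have jt := japanese_triangle t0 abc.
  apply: le_trans (ler_wpM2l (normr_ge0 _) r3) _; rewrite -/A.
  have -> : 4 * 2 `^ t * (`|n (a, b)| * (J a `^ t * A a * A b * psi c) + `|n (a, b)| * (A a * (J b `^ t * A b) * psi c))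
    = `|n (a, b)| * (4 * (A a * A b * (2 `^ t * (J a `^ t + J b `^ t) * psi c))) by ring.
  apply: ler_wpM2l => //; rewrite ler_pM2l//; apply: ler_wpM2l; first exact: mulr_ge0.
  exact: ler_wpM2r.
have ki := itg_cubic S h h f.
apply: le_trans (I_abs ki) _.
have ri := itgZ (4 * 2 `^ t) (itgD (itg_abs i1) (itg_abs i2)).
apply: (le_trans (I_le (m := mu2) (itg_abs ki) ri point)).
rewrite (IZ _ (itgD (itg_abs i1) (itg_abs i2))) (ID (itg_abs i1) (itg_abs i2)).
set X := N (fun x => J x `^ t * W0 x * h x) * energy_norm h * N (fun x => p x * W0 x * h x).
have X3 : N (fun x => W x * psi x) <= 2 * N (fun x => p x * W0 x * h x).
  by rewrite (funext psiE); exact: e3.2.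
have c1 : N (fun x => W x * (J x `^ t * A x)) * N (fun x => W x * A x) * N (fun x => W x * psi x) <= 8 * X.
  apply: le_trans (mul3_le _ _ _ (le_trans k1.2 e1.2) (le_trans k2.2 e2.2) X3) _; rewrite ?nrm2_ge0//.
  by rewrite /X le_eqVlt; apply/orP; left; apply/eqP; ring.
have w3 : 0 <= 3 * N w by rewrite mulr_ge0 ?nrm2_ge0.
have -> : 192 * 2 `^ t * N w * X = 4 * 2 `^ t * (3 * N w * (8 * X) + 3 * N w * (8 * X)) by ring.
apply: ler_wpM2l; first by rewrite mulr_ge0 ?powR_ge0.
apply: lerD.
  by apply: le_trans b1 _; apply: ler_wpM2l.
apply: le_trans b2 _; apply: ler_wpM2l => //; apply: le_trans c1.
by rewrite [X in X * _ <= _]mulrC.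
Qed.

(** Test the equation with the square of the high-frequency weight times h.
    The dispersion then controls the square of the weighted norm, and the
    cubic term contains that norm only once. The bound is uniform in r, so r
    may tend to infinity. *)
Lemma regularity_step : exists2 d, 0 < d & forall t, 0 <= t -> exists2 C, 0 < C &
  forall (h : V) kappa, 0 <= kappa ->
  (forall f, Q h f + kappa * mass_form h f = T h h f) ->
  sqi mu (fun x => J x `^ t * W0 x * h x) ->
  sqi mu (fun x => J x `^ (t + d) * W0 x * h x) /\
  N (fun x => J x `^ (t + d) * W0 x * h x) <=
    C * (1 + energy_norm h) * N (fun x => J x `^ t * W0 x * h x).
Proof.
have [d [w [d0 hw w0 dom]]] := symbol_slack_dominated S; exists d => // t t0.
have [c c0 hc] := elliptic.
pose C1 := 192 * 2 `^ t * N w / c; have C10 : 0 <= C1 by rewrite !mulr_ge0 ?nrm2_ge0 ?invr_ge0 ?(ltW c0)// powR_ge0.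
have q0 : 0 < 2 `^ d :> R by exact: powR_gt0.
exists (C1 + 2 `^ d); first by rewrite ltr_wpDl.
move=> h kappa kap0 EL ht; have td : 0 <= t + d by lra.
set Nt := N (fun x => J x `^ t * W0 x * h x); have Nt0 : 0 <= Nt by exact: nrm2_ge0.
have E0 := energy_norm_ge0 h.
have mW := mea_sqrt_mt S 1; have W00 x : 0 <= W0 x := sqrtr_ge0 _.
have mh := mea_profile h.
pose K := C1 * Nt * energy_norm h; have K0 : 0 <= K by apply: mulr_ge0 => //; exact: mulr_ge0.
pose G r x := high_weight (t + d) r x * W0 x * h x.
have mG r : mea (G r) by apply: meaM => //; apply: meaM => //; exact: mea_high_weight.
have cutoff r : 0 <= r -> sqi mu (G r) /\ N (G r) <= K.
  move=> r0; have hp : sqi mu (G r).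
    apply: (sqi_le (m := mu) (mG r) (sqiZ (J r `^ (t + d)) (sqi_profile h))) => x.
    rewrite /G -mulrA normrM [leRHS]normrM ler_wpM2r// !ger0_norm ?powR_ge0 ?high_weight_ge0//.
    exact: high_weight_bound.
  split => //; pose f : V := Profile (high_weight_profile h td r0).
  have ub := cubic_weighted_bound d0 t0 r0 hw w0 dom (fun x => erefl (f x)) ht.
  have lb : c * N (G r) ^+ 2 <= Q h f.
    rewrite nrm2_sqr -(IZ _ hp.2); apply: I_le; [apply: itgZ; exact: hp.2|exact: (itg_mt S h f)|].
    move=> x; have -> : G r x ^+ 2 = high_weight (t + d) r x ^+ 2 * (1 + mt x) * h x ^+ 2.
      by rewrite /G !exprMn sqr_sqrtr ?(tmt_ge0 S).
    have -> : c * (high_weight (t + d) r x ^+ 2 * (1 + mt x) * h x ^+ 2) =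
      (high_weight (t + d) r x ^+ 2 * h x ^+ 2) * (c * (1 + mt x)) by ring.
    rewrite /f /=; have -> : mt x * (h x * (high_weight (t + d) r x ^+ 2 * h x)) =
      (high_weight (t + d) r x ^+ 2 * h x ^+ 2) * mt x by ring.
    rewrite high_weightE; case: ifP => [/andP[x1 _]|_]; last by rewrite expr0n /= !mul0r.
    by apply: ler_wpM2l; [rewrite mulr_ge0 ?sqr_ge0|exact: hc].
  have mf : 0 <= mass_form h f.
    by apply: I_ge0 => x; rewrite /f /= mulrCA -expr2 mulr_ge0 ?sqr_ge0.
  have {lb} : c * N (G r) ^+ 2 <= c * (K * N (G r)).
    apply: le_trans lb _; have -> : Q h f = T h h f - kappa * mass_form h f by rewrite -EL addrK.
    apply: (@le_trans _ _ (T h h f)); first by rewrite gerBl mulr_ge0.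
    apply: le_trans (ler_norm _) _; apply: le_trans ub _.
    rewrite -/Nt /K /C1 le_eqVlt; apply/orP; left; apply/eqP.
    by rewrite /G; field; rewrite gt_eqF.
  rewrite ler_pM2l// expr2; have [->|nz] := eqVneq (N (G r)) 0; first by [].
  by rewrite ler_pM2r// lt_def nz nrm2_ge0.
pose H x := J x `^ (t + d) * (1 - box 1 x) * W0 x * h x.
have mb : mea (fun x : R => 1 - box 1 x) by apply: meaB; [exact: mea_cst|apply: mea_cut; exact: mea_cst].
have mH : mea H.
  by apply: meaM => //; apply: meaM => //; apply: meaM => //; exact: mea_japanese_powR.
have [Hi HI] : itg mu (fun x => H x ^+ 2) /\ I (fun x => H x ^+ 2) <= K ^+ 2.
  apply: (@fatou_bound _ _ _ mu (fun k x => G k%:R x ^+ 2)).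
  - by move=> k; exact: (meaX 2 (mG _)).
  - exact: meaX.
  - by move=> k x; exact: sqr_ge0.
  - by move=> k; have [[]] := cutoff k%:R (ler0n _ _).
  - move=> k; have [_ h1] := cutoff k%:R (ler0n _ _).
    by rewrite -nrm2_sqr lerXn2r ?nnegrE ?nrm2_ge0.
  - apply: aeW => x; apply: cvg_near_cst.
    by apply: filterS (cut_near (fun x => J x `^ (t + d)) x) => k hk; rewrite /G /H /high_weight hk.
  - by move=> x; exact: sqr_ge0.
pose L x := 2 `^ d * (J x `^ t * W0 x * h x); have Ls := sqiZ (2 `^ d) ht.
pose F x := J x `^ (t + d) * W0 x * h x.
have mF : mea F by apply: meaM => //; apply: meaM => //; exact: mea_japanese_powR.
have FE x : F x ^+ 2 <= H x ^+ 2 + L x ^+ 2.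
  rewrite /F /H /L boxE; have [x1|x1] := leP `|x| 1; last first.
    by rewrite /= subr0 mulr1 lerDl sqr_ge0.
  rewrite /= subrr mulr0 !mul0r expr0n /= add0r.
  have -> : J x `^ (t + d) * W0 x * h x = J x `^ d * (J x `^ t * W0 x * h x).
    by rewrite powRD ?(gt_eqF (japanese_gt0 x)) ?implybT//; ring.
  rewrite exprMn [leRHS]exprMn; apply: ler_wpM2r; first exact: sqr_ge0.
  rewrite lerXn2r ?nnegrE ?powR_ge0//; apply: ge0_ler_powR; rewrite ?nnegrE ?(ltW d0) ?(ltW (japanese_gt0 _))//.
  by apply: le_trans (japanese_le1D x) _; lra.
have sumi := itgD Hi Ls.2.
have Fs : sqi mu F.
  split => //; apply: (itg_le (m := mu) (meaX 2 mF) _ sumi) => x.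
  by rewrite ger0_norm ?sqr_ge0.
split => //; apply: nrm2_le.
  by rewrite !mulr_ge0 ?addr_ge0 ?(ltW q0).
apply: (le_trans (I_le (m := mu) Fs.2 sumi FE)); rewrite (ID Hi Ls.2) -(nrm2_sqr _ (fun x => _ * _)) nrm2_Z// -/Nt.
apply: (@le_trans _ _ (K ^+ 2 + (2 `^ d * Nt) ^+ 2)).
  by rewrite (ger0_norm (ltW q0)) lerD2r.
have dN : 0 <= 2 `^ d * Nt by apply: mulr_ge0 => //; exact: ltW.
apply: (@le_trans _ _ ((K + 2 `^ d * Nt) ^+ 2)).
  by rewrite sqrrD -addrA lerD2l lerDr mulrn_wge0//; exact: mulr_ge0.
have le : K + 2 `^ d * Nt <= (C1 + 2 `^ d) * (1 + energy_norm h) * Nt.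
  have -> : (C1 + 2 `^ d) * (1 + energy_norm h) * Nt = (K + 2 `^ d * Nt) + (C1 * Nt + 2 `^ d * (Nt * energy_norm h)).
    by rewrite /K; ring.
  by rewrite lerDl addr_ge0//; [exact: mulr_ge0|apply: mulr_ge0; [exact: ltW|exact: mulr_ge0]].
have KL0 : 0 <= K + 2 `^ d * Nt by exact: addr_ge0.
by rewrite lerXn2r// nnegrE//; exact: le_trans le.
Qed.

(** Each application of the regularity step raises the weight by the same
    power of J, starting from the energy norm. *)
Theorem profile_regularity (t E0 : R) : 0 <= E0 -> exists2 C, 0 < C & forall (h : V) kappa, 0 <= kappa ->
  (forall f, Q h f + kappa * mass_form h f = T h h f) -> energy_norm h <= E0 ->
  sqi mu (fun x => J x `^ t * h x) /\ N (fun x => J x `^ t * h x) <= C * energy_norm h.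
Proof.
move=> E00; have [d d0 hd] := regularity_step.
have iter k : exists2 C, 0 < C & forall (h : V) kappa, 0 <= kappa ->
  (forall f, Q h f + kappa * mass_form h f = T h h f) -> energy_norm h <= E0 ->
  sqi mu (fun x => J x `^ (k%:R * d) * W0 x * h x) /\
  N (fun x => J x `^ (k%:R * d) * W0 x * h x) <= C * energy_norm h.
  elim: k => [|k [C C0 hC]].
    exists 1 => // h kappa _ _ _.
    have E : (fun x => J x `^ (0%:R * d) * W0 x * h x) = (fun x => W0 x * h x).
      by apply/funext => x; rewrite mul0r powRr0 mul1r.
    by rewrite E mul1r; split; first exact: sqi_profile.
  have kd : 0 <= k%:R * d by rewrite mulr_ge0 ?ler0n// ltW.
  have [C' C'0 hC'] := hd _ kd.
  have E1 : 0 < 1 + E0 by rewrite ltr_pwDl.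
  exists (C' * (1 + E0) * C); first by rewrite !mulr_gt0.
  move=> h kappa k0 EL hE; have [s1 b1] := hC h kappa k0 EL hE.
  have [] := hC' h kappa k0 EL s1; rewrite (_ : k%:R * d + d = k.+1%:R * d); last by rewrite -natr1 mulrDl mul1r.
  move=> s2 b2; split => //; apply: le_trans b2 _; rewrite -(mulrA _ C).
  apply: ler_pM => //; rewrite ?nrm2_ge0//.
    by rewrite mulr_ge0 ?(ltW C'0)// addr_ge0 ?energy_norm_ge0.
  by rewrite ler_pM2l// lerD2l.
pose k := (Num.truncn (`|t| / d)).+1; have [C C0 hC] := iter k.
exists C => // h kappa k0 EL hE; have [s1 b1] := hC h kappa k0 EL hE.
have tk : t <= k%:R * d.
  rewrite -ler_pdivrMr//; apply: ltW; apply: le_lt_trans (truncnS_gt (`|t| / d)).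
  by rewrite ler_pM2r ?invr_gt0// ler_norm.
have mJ : mea (fun x => J x `^ t * h x) by apply: meaM; [exact: mea_japanese_powR|exact: mea_profile].
have le x : `|J x `^ t * h x| <= `|J x `^ (k%:R * d) * W0 x * h x|.
  rewrite normrM [leRHS]normrM ler_wpM2r// !ger0_norm ?mulr_ge0 ?powR_ge0 ?sqrtr_ge0//.
  rewrite -[leLHS]mulr1; apply: ler_pM; rewrite ?powR_ge0 ?ler_powR ?japanese_ge1//.
  by rewrite -[leLHS]sqrtr1 ler_sqrt ?(tmt_ge0 S)// lerDl (sy_m0 S).
have s2 : sqi mu (fun x => J x `^ t * h x) := sqi_le (m := mu) mJ s1 le.
by split => //; apply: le_trans b1; exact: nrm2_mono s2 s1 le.
Qed.

End regularity.

(** * The pointwise equation for the profile *)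

Section spectral_equation.
Variables (R : realType) (s s' : R) (mt : R -> R) (n : R * R -> R).
Hypothesis S : symbols s s' mt n.
Local Notation mu := (@lebesgue_measure R).
Local Notation mu2 := (leb2 R).
Local Notation "'I' f" := (Rintegral mu [set: _] f) (at level 10, f at level 8).
Local Notation "'I2' f" := (Rintegral mu2 [set: R * R] f) (at level 10, f at level 8).
Local Notation N := (nrm2 mu).
Local Notation V := (profile mt).
Local Notation J := (@japanese R).
Local Notation Q := (@dispersion_form R mt).
Local Notation T := (@profile_cubic R mt n).
Implicit Types F G : R -> R.

Definition rapidly_decreasing F := forall t, sqi mu (fun x => J x `^ t * F x).

Lemma rapid_sqi F : rapidly_decreasing F -> sqi mu F.
Proof. by move=> h; apply: eq_sqi (h 0) => x; rewrite powRr0 mul1r. Qed.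

Lemma rapid_itg F t : rapidly_decreasing F -> itg mu (fun x => J x `^ t * F x).
Proof.
move=> h; have h1 : 1 / 2 < 1 :> R by lra.
apply: eq_itg (sqi_mul (sqi_japanese h1) (h (t + 1))) => x.
by rewrite mulrA -powRD ?(gt_eqF (japanese_gt0 x)) ?implybT//; congr (_ `^ _ * _); ring.
Qed.

Lemma rapid_itg0 F : rapidly_decreasing F -> itg mu F.
Proof. by move=> h; apply: eq_itg (rapid_itg 0 h) => x; rewrite powRr0 mul1r. Qed.

Lemma rapid_ev F : rapidly_decreasing F -> rapidly_decreasing (ev F).
Proof. by move=> h t; apply: sqi_ev => // x; rewrite japaneseN. Qed.

Lemma rapid_od F : rapidly_decreasing F -> rapidly_decreasing (od F).
Proof. by move=> h t; apply: sqi_od => // x; rewrite japaneseN. Qed.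

Lemma symbol_polynomial : exists C k : R, [/\ 0 < C, 0 <= k &
  forall a b, `|n (a, b)| <= C * (J a `^ k * J b `^ k)].
Proof.
have [r1 [r2 [r3 [C [[C0 _ _ _] [_ nb]]]]]] := sy_n S.
pose r := Num.max `|r1| (Num.max `|r2| `|r3|).
have h1 : r1 <= r by apply: le_trans (ler_norm _) _; rewrite le_max lexx.
have h2 : r2 <= r by apply: le_trans (ler_norm _) _; rewrite !le_max lexx !orbT.
have h3 : r3 <= r by apply: le_trans (ler_norm _) _; rewrite !le_max lexx !orbT.
have r0 : 0 <= r by rewrite le_max normr_ge0.
clearbody r; exists (3 * C * 2 `^ r), (2 * r); split.
- by rewrite !mulr_gt0// powR_gt0.
- by rewrite mulr_ge0.
move=> a b; pose c := - (a + b).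
have J1 (x : R) : 1 <= J x := japanese_ge1 x; have J0 (x : R) : 0 <= J x := ltW (japanese_gt0 x).
have Jr (x t : R) : t <= r -> J x `^ t <= J x `^ r by move=> tr; rewrite ler_powR.
have X0 (x t : R) : 0 <= J x `^ t := powR_ge0 _ _.
pose X := J a `^ r * J b `^ r * J c `^ r.
have one x y z : J x `^ r * J y `^ r * J z `^ r = X ->
    J x `^ r1 * J y `^ r2 * J z `^ r3 <= X.
  by move=> <-; apply: mul3_le => //; exact: Jr.
have Jc : J c `^ r <= 2 `^ r * (J a `^ r * J b `^ r).
  have Jc : J c <= 2 * (J a * J b).
    rewrite japaneseN; apply: le_trans (japaneseD a b) _.
    by move: (J1 a) (J1 b); move: (J a) (J b) => *; nra.
  rewrite -!powRM ?mulr_ge0//.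
  by apply: ge0_ler_powR; rewrite ?nnegrE ?mulr_ge0.
have sq x : J x `^ (2 * r) = J x `^ r * J x `^ r.
  by rewrite -powRD ?(gt_eqF (japanese_gt0 x)) ?implybT//; congr powR; ring.
have abc : a + b + c = 0 by rewrite /c subrr.
apply: le_trans (nb a b c abc) _.
apply: (@le_trans _ _ (C * (X + X + X))).
  rewrite ler_pM2l//; apply: lerD; first apply: lerD.
  - by apply: one.
  - by apply: one; rewrite mulrC mulrA.
  - by apply: one; rewrite -mulrA mulrC.
have -> : C * (X + X + X) = 3 * C * X by ring.
rewrite !sq [leRHS](_ : _ = 3 * C * (J a `^ r * J b `^ r * (2 `^ r * (J a `^ r * J b `^ r)))); last by ring.
rewrite ler_pM2l ?mulr_gt0// /X.
exact: (ler_wpM2l (mulr_ge0 (X0 a r) (X0 b r)) Jc).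
Qed.

Definition bilinear F G x := I (fun y => n (x - y, y) * (F (x - y) * G y)).

Lemma mea_n_shear : mea (fun z : R * R => n (z.1 - z.2, z.2)).
Proof. exact: (measurableT_comp (mea_n S) (@mphi_shear R)). Qed.

Lemma mea_bilinear F G : mea F -> mea G -> mea (bilinear F G).
Proof.
move=> mF mG; apply: (@mea_iterated R (fun z => n (z.1 - z.2, z.2) * (F (z.1 - z.2) * G z.2))).
have ms := mea_n_shear; apply: meaM; first exact: ms.
apply: meaM; last exact: (mea_comp mG (@mea_snd R)).
by apply: (mea_comp mF); apply: meaB; [exact: mea_fst|exact: mea_snd].
Qed.

Section pairing.
Variables F G : R -> R.
Hypotheses (hF : rapidly_decreasing F) (hG : rapidly_decreasing G).
Let mF : mea F := itg_mea (rapid_itg0 hF).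
Let mG : mea G := itg_mea (rapid_itg0 hG).

Lemma itg_bilinear x : itg mu (fun y => n (x - y, y) * (F (x - y) * G y)).
Proof.
have [C [k [C0 k0 hn]]] := symbol_polynomial.
have h1 := sqi_opp (sqi_shift x (hF k)).
have m1 : mea (fun y : R => n (x - y, y) * (F (x - y) * G y)).
  apply: meaM; first exact: (mea_pair1 x mea_n_shear).
  by apply: meaM => //; apply: (mea_comp mF); apply: meaB; [exact: mea_cst|exact: mea_id].
apply: (itg_le (m := mu) m1 _ (itgZ C (itg_abs (sqi_mul h1 (hG k))))) => y.
rewrite !normrM; apply: le_trans (ler_wpM2r _ (hn _ _)) _; first by rewrite mulr_ge0.
rewrite !(ger0_norm (powR_ge0 _ _)) le_eqVlt; apply/orP; left; apply/eqP; ring.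
Qed.

Lemma bilinear_pairing (phi : R -> R) B : mea phi -> (forall x, `|phi x| <= B) ->
  itg mu2 (fun z => n z * (F z.1 * G z.2) * phi (z.1 + z.2)) /\
  itg mu (fun x => bilinear F G x * phi x) /\
  I2 (fun z => n z * (F z.1 * G z.2) * phi (z.1 + z.2)) = I (fun x => bilinear F G x * phi x).
Proof.
move=> mphi hB; have [C [k [C0 k0 hn]]] := symbol_polynomial.
have mn := mea_n S; have [Pi _] := I2_product (rapid_itg k hF) (rapid_itg k hG).
have i : itg mu2 (fun z => n z * (F z.1 * G z.2) * phi (z.1 + z.2)).
  have m1 : mea (fun z : R * R => n z * (F z.1 * G z.2) * phi (z.1 + z.2)).
    have mp : mea (fun z : R * R => phi (z.1 + z.2)).
      by apply: (mea_comp mphi); apply: meaD; [exact: mea_fst|exact: mea_snd].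
    by apply: meaM => //; apply: meaM => //; apply: meaM; [exact: (mea_comp mF (@mea_fst R))|exact: (mea_comp mG (@mea_snd R))].
  apply: (itg_le (m := mu2) m1 _ (itgZ (C * B) (itg_abs Pi))) => -[a b] /=.
  rewrite !normrM; apply: (@le_trans _ _ (C * (J a `^ k * J b `^ k) * (`|F a| * `|G b|) * B)).
    have FG : 0 <= `|F a| * `|G b| by exact: mulr_ge0.
    apply: ler_pM; [by apply: mulr_ge0|by []| |exact: hB].
    by apply: ler_wpM2r => //; exact: hn.
  rewrite !(ger0_norm (powR_ge0 _ _)) le_eqVlt; apply/orP; left; apply/eqP; ring.
split => //; have [h1 h2] := fubini1 (itg_shear i).
have E x : I (fun y => n (shear (x, y)) * (F (shear (x, y)).1 * G (shear (x, y)).2) *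
    phi ((shear (x, y)).1 + (shear (x, y)).2)) = bilinear F G x * phi x.
  rewrite [RHS]mulrC /bilinear -(IZ _ (itg_bilinear x)).
  by apply: eqI => y; rewrite /shear /= subrK mulrC.
by rewrite -(I2_shear i) h2 (eqI mu E); split => //; exact: eq_itg E h1.
Qed.

Lemma bilinear_opp x : bilinear F G (- x) = bilinear (fun y => F (- y)) (fun y => G (- y)) x.
Proof.
rewrite /bilinear -(I_opp (itg_bilinear (- x))); apply: eqI => y.
rewrite (_ : - x - - y = - (x - y)); last by ring.
by rewrite (sy_ne S).
Qed.

End pairing.

(** Real and imaginary part of the bilinear multiplier applied to ev h + i od h
    in both arguments. *)
Definition spectral_re h x := bilinear (ev h) (ev h) x - bilinear (od h) (od h) x.
Definition spectral_im h x := bilinear (ev h) (od h) x + bilinear (od h) (ev h) x.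

Section profile_equation.
Variables (kappa : R) (h : V).
Hypotheses (hr : rapidly_decreasing h)
  (EL : forall f, Q h f + kappa * mass_form h f = T h h f).
Let mh := mea_profile h.
Let re_ := rapid_ev hr.
Let ro_ := rapid_od hr.

Lemma spectral_re_even x : spectral_re h (- x) = spectral_re h x.
Proof.
rewrite /spectral_re !bilinear_opp//; congr (_ - _); apply: eqI => y; rewrite ?ev_opp ?od_opp//.
by rewrite mulrNN.
Qed.

Lemma spectral_im_odd x : spectral_im h (- x) = - spectral_im h x.
Proof.
rewrite /spectral_im !bilinear_opp// opprD -(IN (itg_bilinear re_ ro_ x)) -(IN (itg_bilinear ro_ re_ x)).
by congr (_ + _); apply: eqI => y; rewrite ?ev_opp ?od_opp ?mulrN ?mulNr ?mulrN.
Qed.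

Lemma mea_spectral : mea (spectral_re h) /\ mea (spectral_im h).
Proof.
have me := mea_ev mh; have mo := mea_od mh.
by split; [apply: meaB|apply: meaD]; apply: mea_bilinear.
Qed.

Lemma spectral_pairing (f : V) B : (forall x, `|f x| <= B) ->
  itg mu (fun x => (spectral_re h x - spectral_im h x) * f x) /\
  T h h f = I (fun x => (spectral_re h x - spectral_im h x) * f x).
Proof.
move=> fB; have mf := mea_profile f.
have B0 : 0 <= B by apply: le_trans (fB 0).
have mev := mea_ev mf; have mod_ := mea_od mf.
have evB x : `|ev f x| <= 2 * B.
  by apply: le_trans (ev_le f x) _; rewrite /envelope; have := fB x; have := fB (- x); lra.
have odB x : `|- od f x| <= 2 * B.
  by rewrite normrN; apply: le_trans (od_le f x) _; rewrite /envelope; have := fB x; have := fB (- x); lra.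
have mno : mea (fun x => - od f x) by exact: meaN.
have [i1 [j1 e1]] := bilinear_pairing re_ re_ mev evB.
have [i2 [j2 e2]] := bilinear_pairing ro_ ro_ mev evB.
have [i3 [j3 e3]] := bilinear_pairing re_ ro_ mno odB.
have [i4 [j4 e4]] := bilinear_pairing ro_ re_ mno odB.
have TE : T h h f = I (fun x => spectral_re h x * ev f x) + I (fun x => spectral_im h x * od f x).
  have -> : I (fun x => spectral_re h x * ev f x) =
     I (fun x => bilinear (ev h) (ev h) x * ev f x) - I (fun x => bilinear (od h) (od h) x * ev f x).
    by rewrite -(IB j1 j2); apply: eqI => x; rewrite /spectral_re mulrBl.
  have -> : I (fun x => spectral_im h x * od f x) =
     - (I (fun x => bilinear (ev h) (od h) x * - od f x) + I (fun x => bilinear (od h) (ev h) x * - od f x)).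
    rewrite -(ID j3 j4) -(IN (itgD j3 j4)); apply: eqI => x; rewrite /spectral_im; ring.
  rewrite -e1 -e2 -e3 -e4 -(IB i1 i2) -(ID i3 i4) -(IB (itgB i1 i2) (itgD i3 i4)).
  apply: eqI => -[a b]; rewrite /cubic_kernel /re3 /= ev_opp od_opp; ring.
have [mr mi] := mea_spectral.
have fNB x : `|f (- x)| <= B by [].
have mfN := mea_flip mf.
have comb (phi : R -> R) : mea phi -> (forall x, `|phi x| <= B) ->
    itg mu (fun x => spectral_re h x * phi x) /\ itg mu (fun x => spectral_im h x * phi x).
  move=> mp pB; have [_ [k1 _]] := bilinear_pairing re_ re_ mp pB.
  have [_ [k2 _]] := bilinear_pairing ro_ ro_ mp pB.
  have [_ [k3 _]] := bilinear_pairing re_ ro_ mp pB.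
  have [_ [k4 _]] := bilinear_pairing ro_ re_ mp pB.
  split; first by apply: eq_itg (itgB k1 k2) => x; rewrite /spectral_re mulrBl.
  by apply: eq_itg (itgD k3 k4) => x; rewrite /spectral_im mulrDl.
have [a1 b1] := comb f mf fB; have [a2 b2] := comb (fun x => f (- x)) mfN fNB.
have o1 : I (fun x => spectral_re h x * f (- x)) = I (fun x => spectral_re h x * f x).
  by rewrite -(I_opp a1); apply: eqI => x; rewrite spectral_re_even.
have o2 : I (fun x => spectral_im h x * f (- x)) = - I (fun x => spectral_im h x * f x).
  by rewrite -(I_opp b1) -(IN (itg_opp b1)); apply: eqI => x; rewrite spectral_im_odd mulNr opprK.
split; first by apply: eq_itg (itgB a1 b1) => x; ring.
have -> : I (fun x => (spectral_re h x - spectral_im h x) * f x) =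
  I (fun x => spectral_re h x * f x) - I (fun x => spectral_im h x * f x).
  by rewrite -(IB a1 b1); apply: eqI => x; ring.
rewrite TE; congr (_ + _).
  have -> : I (fun x => spectral_re h x * ev f x) =
     I (fun x => 2^-1 * (spectral_re h x * f x + spectral_re h x * f (- x))).
    by apply: eqI => x; rewrite /ev; ring.
  by rewrite (IZ _ (itgD a1 a2)) (ID a1 a2) o1; field.
have -> : I (fun x => spectral_im h x * od f x) =
   I (fun x => 2^-1 * (spectral_im h x * f (- x) - spectral_im h x * f x)).
  by apply: eqI => x; rewrite /od; ring.
by rewrite (IZ _ (itgB b2 b1)) (IB b2 b1) o2; field.
Qed.

Lemma mt_polynomial : exists2 c, 0 < c & forall x, 1 + mt x <= c * J x `^ s.
Proof.
have [c1 [c2 [c10 c20 hi lo]]] := sy_m S; have s0 := sy_s S.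
exists (1 + c2); first by rewrite addr_gt0.
move=> x; have J1 : 1 <= J x `^ s.
  by rewrite -[leLHS](powRr0 (J x)) ler_powR ?japanese_ge1// ltW.
have xJ : `|x| `^ s <= J x `^ s.
  by apply: ge0_ler_powR; rewrite ?nnegrE ?(ltW s0) ?(ltW (japanese_gt0 _)) ?japanese_ge_norm.
have [h1|h1] := leP 1 `|x|.
  have /andP[_ h2] := hi x h1; move: h2 J1 xJ; move: (mt x) (`|x| `^ s) (J x `^ s) => *; nra.
have /andP[_ h2] := lo x h1.
have x1 : `|x| `^ s' <= 1.
  have p1 : 1 `^ s' = 1 :> R by rewrite powR1.
  rewrite -[leRHS]p1; apply: ge0_ler_powR; rewrite ?nnegrE ?(ltW h1)//.
  by have := sy_s' S; lra.
move: h2 J1 x1; move: (mt x) (`|x| `^ s') (J x `^ s) => *; nra.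
Qed.

(** The Euler-Lagrange equation holds pointwise: test it with the sign of the
    residual, damped at infinity. *)
Theorem profile_pointwise : {ae mu, forall x, (mt x + kappa) * h x = spectral_re h x - spectral_im h x}.
Proof.
have [mr mi] := mea_spectral; have mmt := mea_mt S.
pose D x := (mt x + kappa) * h x - (spectral_re h x - spectral_im h x).
have mD : mea D.
  apply: meaB; last exact: meaB.
  by apply: meaM => //; apply: meaD => //; exact: mea_cst.
pose k := s / 2 + 1; have k0 : 0 < k by have := sy_s S; rewrite /k; lra.
pose f x := Num.sg (D x) * J x `^ (- k).
have msg : mea (fun x => Num.sg (D x)).
  have -> : (fun x => Num.sg (D x)) = fun x => \1_[set y | 0 < y] (D x) - \1_[set y | y < 0] (D x).
    apply/funext => x.
    have i1 : \1_[set y : R | 0 < y] (D x) = (0 < D x)%R%:R :> R.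
      by rewrite indicE; congr (_%:R); congr nat_of_bool; apply/idP/idP; rewrite inE.
    have i2 : \1_[set y : R | y < 0] (D x) = (D x < 0)%R%:R :> R.
      by rewrite indicE; congr (_%:R); congr nat_of_bool; apply/idP/idP; rewrite inE.
    rewrite i1 i2; case: (ltgtP (D x) 0) => [h1|h1|->]; last by rewrite sgr0 subrr.
      by rewrite ltr0_sg// mulr0n mulr1n sub0r.
    by rewrite gtr0_sg// mulr0n mulr1n subr0.
  apply: meaB; apply: (mea_comp _ mD); apply: mea_indic.
    by rewrite (_ : [set y | _] = `]0, +oo[%classic); [exact: measurable_itv|apply/seteqP; split=> y /=; rewrite in_itv /= andbT].
  by rewrite (_ : [set y | _] = `]-oo, 0[%classic); [exact: measurable_itv|apply/seteqP; split=> y /=; rewrite in_itv].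
have Jk x : 0 < J x `^ (- k) by rewrite powR_gt0 ?japanese_gt0.
have sg1 x : `|Num.sg (D x)| <= 1 by rewrite normr_sg lern1 leq_b1.
have mf : mea f by apply: meaM => //; exact: mea_japanese_powR.
have f1 x : `|f x| <= 1.
  rewrite normrM (gtr0_norm (Jk x)); apply: mulr_ile1 => //; first exact: ltW.
  rewrite powRN invf_le1 ?powR_gt0 ?japanese_gt0// -[leLHS](powRr0 (J x)).
  by rewrite ler_powR ?japanese_ge1// ltW.
have fV : f \in finite_energy mt.
  apply/finite_energyP; split => //; have [c c0 hc] := mt_polynomial.
  have h1 : 1 / 2 < 1 :> R by lra.
  apply: (sqi_le (m := mu) (meaM (mea_sqrt_mt S 1) mf) (sqiZ (Num.sqrt c) (sqi_japanese h1))) => x.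
  rewrite normrM [`|f x|]normrM (gtr0_norm (Jk x)) [leRHS]ger0_norm ?mulr_ge0 ?sqrtr_ge0 ?powR_ge0//.
  rewrite (ger0_norm (sqrtr_ge0 _)).
  have Ws : Num.sqrt (1 + mt x) <= Num.sqrt c * J x `^ (s / 2).
    rewrite -(ler_pXn2r (n:=2))// ?nnegrE ?mulr_ge0 ?sqrtr_ge0 ?powR_ge0// exprMn !sqr_sqrtr ?(tmt_ge0 S) ?(ltW c0)//.
    by rewrite -powR_mulrn ?powR_ge0// -powRrM divfK ?pnatr_eq0.
  apply: (@le_trans _ _ (Num.sqrt c * J x `^ (s / 2) * (1 * J x `^ (- k)))).
    apply: ler_pM => //; rewrite ?sqrtr_ge0// ?mulr_ge0// ?(ltW (Jk x))//.
    by rewrite ler_wpM2r ?(ltW (Jk x)).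
  rewrite mul1r -mulrA -powRD ?(gt_eqF (japanese_gt0 x)) ?implybT//.
  by rewrite (_ : s / 2 + - k = - 1)// /k; ring.
pose fp : V := Profile fV.
have [i3 e3] := @spectral_pairing fp 1 f1.
have i1 := itg_mt S h fp; have i2 := itg_mass S h fp.
have E : I (fun x => D x * f x) = 0.
  have -> : I (fun x => D x * f x) = Q h fp + kappa * mass_form h fp - T h h fp.
    rewrite e3 -(IZ kappa i2) -(ID i1 (itgZ kappa i2)) -(IB (itgD i1 (itgZ kappa i2)) i3).
    by apply: eqI => x; rewrite /D /=; ring.
  by rewrite EL subrr.
have Di : itg mu (fun x => D x * f x).
  by apply: eq_itg (itgB (itgD i1 (itgZ kappa i2)) i3) => x; rewrite /D /=; ring.
have DE x : D x * f x = `|D x| * J x `^ (- k) by rewrite /f mulrA (normrEsg (D x)) (mulrC (Num.sg _)).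
have D0 x : 0 <= D x * f x by rewrite DE mulr_ge0// ltW.
apply: ae_mono (I_eq0_ae (itg_mea Di) D0 Di E) => x /eqP.
by rewrite DE mulf_eq0 (gt_eqF (Jk x)) orbF normr_eq0 subr_eq0 => /eqP.
Qed.

(** The even and odd parts of the pointwise equation. *)
Theorem profile_spectral : {ae mu, forall x, (mt x + kappa) * ev h x = spectral_re h x /\
   (mt x + kappa) * od h x = spectral_im h x}.
Proof.
have a := profile_pointwise; apply: ae_mono (ae_and a (ae_opp a)) => x [].
rewrite (sy_me S) spectral_re_even spectral_im_odd /ev /od => e1 e2.
split.
  transitivity (2^-1 * ((mt x + kappa) * h x + (mt x + kappa) * h (- x))); first by ring.
  by rewrite e1 e2; field.
transitivity (2^-1 * ((mt x + kappa) * h (- x) - (mt x + kappa) * h x)); first by ring.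
by rewrite e1 e2; field.
Qed.

End profile_equation.
End spectral_equation.

(** * The Hartley and the Fourier transform *)

Section lebesgue_norm.
Variable R : realType.
Local Notation mu := (@lebesgue_measure R).
Local Notation "'I' f" := (Rintegral mu [set: _] f) (at level 10, f at level 8).
Local Notation N := (nrm2 mu).

Lemma Lnorm2E (f : R -> R) : sqi mu f -> ('N[mu]_2%:E[EFin \o f] = (N f)%:E)%E.
Proof.
move=> hf; rewrite unlock /=.
have -> : (\int[mu]_x `|(EFin \o f) x| `^ 2)%E = (I (fun x => f x ^+ 2))%:E.
  rewrite (IE hf.2); apply: eq_integral => x _.
  by rewrite /= ?poweR_EFin powR_mulrn// real_normK ?num_real.
rewrite poweR_EFin /nrm2 powR12_sqrt//.
by apply: I_ge0 => x; exact: sqr_ge0.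
Qed.

Lemma sqi_L2 (f : R -> R) : sqi mu f -> L2 f.
Proof.
move=> hf; rewrite /L2; apply/andP; split; rewrite inE /=; first exact: hf.1.
by rewrite /finite_norm (Lnorm2E hf) ltry.
Qed.

Lemma L2_sqi (f : R -> R) : L2 f -> sqi mu f.
Proof.
move=> hf; split; last exact: Lfun2_integrable_sqr hf.
by move/sub_Lfun_mfun: hf; rewrite inE.
Qed.

End lebesgue_norm.

Lemma norm_mul_le (R : realFieldType) (a b : R) : `|a * b| <= a ^+ 2 + b ^+ 2.
Proof.
have h1 := sqr_ge0 (a + b); have h2 := sqr_ge0 (a - b).
rewrite ler_norml; apply/andP; split; move: h1 h2 (sqr_ge0 a) (sqr_ge0 b); rewrite !expr2; lra.
Qed.

Lemma sqr_dist_le (R : realFieldType) (a b c : R) :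
  (a - b) ^+ 2 <= 2 * (a - c) ^+ 2 + 2 * (b - c) ^+ 2.
Proof.
rewrite -subr_ge0 (_ : _ - _ = (a + b - 2 * c) ^+ 2) ?sqr_ge0//.
by ring.
Qed.

Section hartley.
Variable R : realType.
Local Notation mu := (@lebesgue_measure R).
Local Notation mu2 := (leb2 R).
Local Notation "'I' f" := (Rintegral mu [set: _] f) (at level 10, f at level 8).
Local Notation "'I2' f" := (Rintegral mu2 [set: R * R] f) (at level 10, f at level 8).
Local Notation N := (nrm2 mu).
Implicit Types F G u : R -> R.

Definition c0 : R := (Num.sqrt (2 * pi))^-1.

Lemma twopi_gt0 : 0 < 2 * pi :> R. Proof. by rewrite mulr_gt0// pi_gt0. Qed.

Lemma c0_gt0 : 0 < c0. Proof. by rewrite invr_gt0 sqrtr_gt0 twopi_gt0. Qed.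

Lemma c0_sqr : c0 ^+ 2 * (2 * pi) = 1.
Proof. by rewrite exprVn sqr_sqrtr ?(ltW twopi_gt0)// mulVf// gt_eqF// twopi_gt0. Qed.

(** The Hartley transform, normalized to be an isometric involution of L2. *)
Definition hart F x := c0 * (cos_transform F x + sin_transform F x).

Lemma weighted_parts (X h : R -> R) : (forall x, X (- x) = X x) -> sqi mu (fun x => X x * h x) ->
  itg mu (fun x => X x ^+ 2 * (ev h x ^+ 2 + od h x ^+ 2)) /\
  I (fun x => X x ^+ 2 * (ev h x ^+ 2 + od h x ^+ 2)) = I (fun x => (X x * h x) ^+ 2).
Proof.
move=> Xe [_ hi]; have hN := itg_opp hi.
have E x : 2^-1 * ((X x * h x) ^+ 2 + (X (- x) * h (- x)) ^+ 2) =
   X x ^+ 2 * (ev h x ^+ 2 + od h x ^+ 2) by rewrite Xe /ev /od; field.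
split; first by apply: eq_itg (itgZ 2^-1 (itgD hi hN)).
by rewrite -(eqI mu E) (IZ _ (itgD hi hN)) (ID hi hN) (I_opp hi); field.
Qed.

Section transforms.
Variable F : R -> R.
Hypotheses (Fi : itg mu F) (F2 : sqi mu F).
Let mF := itg_mea Fi.

Lemma ctr_even y : cos_transform F (- y) = cos_transform F y.
Proof. by apply: eqI => x; rewrite mulNr cosN. Qed.
Lemma str_odd y : sin_transform F (- y) = - sin_transform F y.
Proof. by rewrite /sin_transform -(IN (itg_str y Fi)); apply: eqI => x; rewrite mulNr sinN mulrN. Qed.

Lemma mea_hart : mea (hart F).
Proof. by apply: meaM; [exact: mea_cst|apply: meaD; [exact: mea_ctr|exact: mea_str]]. Qed.

Lemma hart_bounded x : `|hart F x| <= 2 * c0 * I (fun x => `|F x|).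
Proof.
rewrite normrM (gtr0_norm c0_gt0) mulrAC mulrC ler_pM2r ?c0_gt0//.
apply: le_trans (ler_normD _ _) _; rewrite mulr_natl mulr2n.
by apply: lerD; [exact: ctr_le|exact: str_le].
Qed.

(** The mixed term in the square of the Hartley transform is odd, which leaves
    the Plancherel identity. *)
Lemma hart_sqi : sqi mu (hart F) /\ I (fun x => hart F x ^+ 2) = I (fun x => F x ^+ 2).
Proof.
have [Pi PE] := plancherel Fi F2; have mc := mea_ctr mF; have ms := mea_str mF.
have cs : itg mu (fun y => cos_transform F y * sin_transform F y).
  apply: (itg_le (m := mu) (meaM mc ms) _ Pi) => y.
  exact: norm_mul_le.
have cs0 : I (fun y => cos_transform F y * sin_transform F y) = 0.
  have := I_opp cs; rewrite (eqI mu (g := fun y => - (cos_transform F y * sin_transform F y))); last first.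
    by move=> y; rewrite ctr_even str_odd mulrN.
  by rewrite (IN cs); lra.
have E y : c0 ^+ 2 * ((cos_transform F y ^+ 2 + sin_transform F y ^+ 2) + 2 * (cos_transform F y * sin_transform F y)) = hart F y ^+ 2.
  by rewrite /hart; ring.
have i := itgZ (c0 ^+ 2) (itgD Pi (itgZ 2 cs)).
split; first by split; [exact: mea_hart|exact: eq_itg i].
rewrite -(eqI mu E) (IZ _ (itgD Pi (itgZ 2 cs))) (ID Pi (itgZ 2 cs)) (IZ _ cs) cs0 PE.
by rewrite mulr0 addr0 mulrA c0_sqr mul1r.
Qed.

Lemma cut_bounded u A B : mea u -> (forall x, `|u x| <= B) -> itg mu (cut A u).
Proof.
move=> mu_ uB; have B0 : 0 <= B by apply: le_trans (uB 0).
have i : itg mu (fun x => B * \1_(`[- A, A]%classic) x).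
  by apply: itgZ; exact: integrable_indic_itv.
apply: (itg_le (m := mu) (mea_cut A mu_) _ i) => x.
rewrite cutE indicE mem_setE /= in_itv /= -ler_norml.
by case: ifP => _; rewrite ?mulr1 ?normr0// mulr0.
Qed.

Lemma ctr_ev y : cos_transform (ev F) y = cos_transform F y.
Proof.
have h := itg_ctr y Fi; have hN := itg_opp h.
have E x : 2^-1 * (F x * cos (y * x) + F (- x) * cos (y * - x)) = ev F x * cos (y * x).
  by rewrite mulrN cosN /ev; ring.
by rewrite /cos_transform -(eqI mu E) (IZ _ (itgD h hN)) (ID h hN) (I_opp h); field.
Qed.

Lemma str_od y : sin_transform (od F) y = - sin_transform F y.
Proof.
have h := itg_str y Fi; have hN := itg_opp h.
have E x : - 2^-1 * (F x * sin (y * x) + F (- x) * sin (y * - x)) = od F x * sin (y * x).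
  by rewrite mulrN sinN /od; ring.
by rewrite /sin_transform -(eqI mu E) (IZ _ (itgD h hN)) (ID h hN) (I_opp h); field.
Qed.

Lemma itg_ev_od : itg mu (ev F) /\ itg mu (od F).
Proof.
have hN := itg_opp Fi.
by split; [exact: (itgZ 2^-1 (itgD Fi hN))|exact: (itgZ 2^-1 (itgB hN Fi))].
Qed.

(** Exchanging integrals moves the transforms from v to F. *)
Lemma hart_pairing v : itg mu v ->
  itg mu (fun y => cos_transform v y * ev F y - sin_transform v y * od F y) /\
  I (fun y => cos_transform v y * ev F y - sin_transform v y * od F y) = I (fun x => v x * (cos_transform F x + sin_transform F x)).
Proof.
move=> vi; have mv := itg_mea vi; have [ei oi] := itg_ev_od.
have me := itg_mea ei; have mo := itg_mea oi.
pose k (z : R * R) := v z.2 * (cos (z.1 * z.2) * ev F z.1 - sin (z.1 * z.2) * od F z.1).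
have mk : mea k by rewrite /k; solve_mea.
have [Pi _] := I2_product (itgD (itg_abs ei) (itg_abs oi)) (itg_abs vi).
have ki : itg mu2 k.
  apply: (itg_le (m := mu2) mk _ Pi) => z; rewrite /k normrM mulrC ler_wpM2r//.
  apply: le_trans (ler_normB _ _) _; apply: lerD; rewrite normrM ler_piMl//.
    exact: norm_cos_le1.
  exact: norm_sin_le1.
have [h1 h2] := fubini1 ki; have [h3 h4] := fubini2 ki.
have E1 y : I (fun x => k (y, x)) = cos_transform v y * ev F y - sin_transform v y * od F y.
  rewrite mulrC (mulrC (sin_transform v y)) /cos_transform /sin_transform -(IZ _ (itg_ctr y vi)) -(IZ _ (itg_str y vi)).
  rewrite -(IB (itgZ _ (itg_ctr y vi)) (itgZ _ (itg_str y vi))); apply: eqI => x; rewrite /k /=; ring.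
have E2 x : I (fun y => k (y, x)) = v x * (cos_transform F x + sin_transform F x).
  rewrite -ctr_ev -[sin_transform F x]opprK -str_od /cos_transform /sin_transform.
  rewrite -(IB (itg_ctr x ei) (itg_str x oi)) -(IZ _ (itgB (itg_ctr x ei) (itg_str x oi))).
  by apply: eqI => y; rewrite /k /= (mulrC y x); ring.
split; first by apply: eq_itg h1 => y; rewrite E1.
by rewrite -(eqI mu E1) -h2 h4 (eqI mu E2).
Qed.

End transforms.

Lemma truncated_fourierE u A y : itg mu (cut A u) ->
  complex.Re (truncated_fourier A u y) = c0 * cos_transform (cut A u) y /\
  complex.Im (truncated_fourier A u y) = - c0 * sin_transform (cut A u) y.
Proof.
move=> ui; rewrite /truncated_fourier /cintegral /= !mul0r subr0 addr0 -/c0.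
split; rewrite ?mulNr -?mulrN -?(IN (itg_str y ui)); congr (_ * _); rewrite -[LHS]I_indic;
  apply: eqI => x; rewrite /= ?mulrN ?cosN ?sinN mul0r ?subr0 ?addr0 /cut; ring.
Qed.

Lemma normc_sqr (z w : R[i]) : Normc.normc (z - w) ^+ 2 =
  (complex.Re z - complex.Re w) ^+ 2 + (complex.Im z - complex.Im w) ^+ 2.
Proof. by case: z => a b; case: w => c d /=; rewrite sqr_sqrtr// addr_ge0 ?sqr_ge0. Qed.

Section fourier_characterization.
Variable u : R -> R.
Hypotheses (ui : forall A, itg mu (cut A u)) (u2 : forall A, sqi mu (cut A u)).

Lemma sqi_trig A : sqi mu (cos_transform (cut A u)) /\ sqi mu (sin_transform (cut A u)).
Proof.
have [Pi _] := plancherel (ui A) (u2 A).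
have mc := mea_ctr (itg_mea (ui A)); have ms := mea_str (itg_mea (ui A)).
split; split => //; [apply: (itg_le (m := mu) (meaX 2 mc) _ Pi)|apply: (itg_le (m := mu) (meaX 2 ms) _ Pi)] => y.
  by rewrite ger0_norm ?sqr_ge0// lerDl sqr_ge0.
by rewrite ger0_norm ?sqr_ge0// lerDr sqr_ge0.
Qed.

Definition fourier_error (p q : R -> R) A :=
  I (fun y => (p y - c0 * cos_transform (cut A u) y) ^+ 2 + (q y + c0 * sin_transform (cut A u) y) ^+ 2).

Lemma fourier_errorE (g : R -> R[i]) A :
  sqi mu (fun y => complex.Re (g y)) -> sqi mu (fun y => complex.Im (g y)) ->
  itg mu (fun y => (complex.Re (g y) - c0 * cos_transform (cut A u) y) ^+ 2 + (complex.Im (g y) + c0 * sin_transform (cut A u) y) ^+ 2) /\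
  (\int[mu]_y ((Normc.normc (g y - truncated_fourier A u y)) ^+ 2)%:E =
    (fourier_error (fun y => complex.Re (g y)) (fun y => complex.Im (g y)) A)%:E)%E.
Proof.
move=> hr hi; have [sc ss] := sqi_trig A.
have i := itgD (sqiB hr (sqiZ c0 sc)).2 (sqiD hi (sqiZ c0 ss)).2.
split => //; rewrite /fourier_error (IE i); apply: eq_integral => y _.
by have [e1 e2] := truncated_fourierE y (ui A); rewrite normc_sqr e1 e2 mulNr opprK.
Qed.

(** Both are limits of the same truncated transforms. *)
Lemma fourier_unique g1 g2 : is_fourier u g1 -> is_fourier u g2 ->
  {ae mu, forall y, g1 y = g2 y}.
Proof.
move=> [[/L2_sqi r1 /L2_sqi i1] c1] [[/L2_sqi r2 /L2_sqi i2] c2].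
pose d y := (complex.Re (g1 y) - complex.Re (g2 y)) ^+ 2 + (complex.Im (g1 y) - complex.Im (g2 y)) ^+ 2.
have di : itg mu d := itgD (sqiB r1 r2).2 (sqiB i1 i2).2.
have d0 y : 0 <= d y by rewrite addr_ge0 ?sqr_ge0.
have small (e : R) : 0 < e -> I d <= e.
  move=> e0; have e4 : 0 < e / 4 by lra.
  have ev_ (g : R -> R[i]) : sqi mu (fun y => complex.Re (g y)) -> sqi mu (fun y => complex.Im (g y)) ->
     (\int[mu]_xi ((Normc.normc (g xi - truncated_fourier A u xi)) ^+ 2)%:E)%E @[A --> +oo%R] --> 0%E ->
     \forall A \near +oo%R, fourier_error (fun y => complex.Re (g y)) (fun y => complex.Im (g y)) A <= e / 4.
    move=> hr hi; rewrite (_ : (fun A => _) = fun A => (fourier_error (fun y => complex.Re (g y)) (fun y => complex.Im (g y)) A)%:E); last first.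
      by apply/funext => A; have [_ ->] := fourier_errorE A hr hi.
    move=> /fine_cvg /cvgr0Pnorm_le /(_ _ e4); apply: filterS => A /=.
    by move=> /(le_trans (ler_norm _)).
  have [A [h1 h2]] : exists A, fourier_error (fun y => complex.Re (g1 y)) (fun y => complex.Im (g1 y)) A <= e / 4 /\
      fourier_error (fun y => complex.Re (g2 y)) (fun y => complex.Im (g2 y)) A <= e / 4.
    by have [A hA] := filter_ex (filterI (ev_ g1 r1 i1 c1) (ev_ g2 r2 i2 c2)); exists A.
  have [j1 _] := fourier_errorE A r1 i1; have [j2 _] := fourier_errorE A r2 i2.
  have : I d <= I (fun y => 2 * ((complex.Re (g1 y) - c0 * cos_transform (cut A u) y) ^+ 2 + (complex.Im (g1 y) + c0 * sin_transform (cut A u) y) ^+ 2) +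
     2 * ((complex.Re (g2 y) - c0 * cos_transform (cut A u) y) ^+ 2 + (complex.Im (g2 y) + c0 * sin_transform (cut A u) y) ^+ 2)).
    apply: I_le => //; first exact: itgD (itgZ 2 j1) (itgZ 2 j2).
    move=> y; rewrite /d !mulrDr addrACA; apply: lerD; first exact: sqr_dist_le.
    have := sqr_dist_le (complex.Im (g1 y)) (complex.Im (g2 y)) (- (c0 * sin_transform (cut A u) y)).
    by rewrite !opprK.
  rewrite (ID (itgZ 2 j1) (itgZ 2 j2)) (IZ _ j1) (IZ _ j2).
  move=> /le_trans; apply; rewrite (_ : e = 2 * (e / 4) + 2 * (e / 4)); last by field.
  by apply: lerD; rewrite ler_pM2l.
have Id0 : I d = 0.
  have Id_ge : 0 <= I d by apply: I_ge0.
  apply/eqP; rewrite eq_le Id_ge andbT; apply/ler_addgt0Pr => e e0.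
  by rewrite add0r small.
apply: ae_mono (I_eq0_ae (itg_mea di) d0 di Id0) => y /eqP.
rewrite paddr_eq0 ?sqr_ge0// !sqrf_eq0 !subr_eq0 => /andP[/eqP e1 /eqP e2].
by apply/eqP; rewrite eq_complex e1 e2 !eqxx.
Qed.

End fourier_characterization.

Section hartley_fourier.
Variable F : R -> R.
Hypotheses (Fi : itg mu F) (F2 : sqi mu F).
Let u := hart F.
Let mu_ : mea u. Proof. exact: mea_hart. Qed.
Let u2 : sqi mu u. Proof. by have [] := hart_sqi Fi F2. Qed.
Let uAi A : itg mu (cut A u).
Proof. by apply: cut_bounded => // x; exact: hart_bounded. Qed.
Let uA2 A : sqi mu (cut A u). Proof. exact: sqi_cut. Qed.

Lemma sqi_parts : sqi mu (ev F) /\ sqi mu (od F).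
Proof.
have h : sqi mu (fun x => 1 * F x) by apply: eq_sqi F2 => x; rewrite mul1r.
by split; [apply: eq_sqi (@sqi_ev R (fun=> 1) F (fun=> erefl) h)|apply: eq_sqi (@sqi_od R (fun=> 1) F (fun=> erefl) h)] => x; rewrite mul1r.
Qed.

(** Expand the square: the mixed term pairs the truncation of u with u by
    Parseval, and both remaining terms are given by Plancherel. *)
Lemma hart_fourier_error A :
  fourier_error u (ev F) (od F) A = I (fun x => F x ^+ 2) - I (fun x => cut A u x ^+ 2).
Proof.
have [ei oi] := sqi_parts; have [Pi PE] := plancherel (uAi A) (uA2 A).
have [qi qE] := hart_pairing Fi (uAi A).
have h : sqi mu (fun x => 1 * F x) by apply: eq_sqi F2 => x; rewrite mul1r.
have [wi wE] := @weighted_parts (fun=> 1) F (fun=> erefl) h.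
have E y : 1 ^+ 2 * (ev F y ^+ 2 + od F y ^+ 2) - 2 * c0 * (cos_transform (cut A u) y * ev F y - sin_transform (cut A u) y * od F y)
   + c0 ^+ 2 * (cos_transform (cut A u) y ^+ 2 + sin_transform (cut A u) y ^+ 2) =
   (ev F y - c0 * cos_transform (cut A u) y) ^+ 2 + (od F y + c0 * sin_transform (cut A u) y) ^+ 2 by ring.
rewrite /fourier_error -(eqI mu E) (ID (itgB wi (itgZ _ qi)) (itgZ _ Pi)) (IB wi (itgZ _ qi)) wE (IZ _ qi) (IZ _ Pi) qE PE.
rewrite (mulrA (c0 ^+ 2)) c0_sqr mul1r.
have vi : itg mu (fun x => cut A u x * (cos_transform F x + sin_transform F x)).
  apply: eq_itg (itgZ c0^-1 (uA2 A).2) => x.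
  rewrite !cutE; case: ifP => _; last by rewrite expr0n /= mulr0 mul0r.
  by rewrite /u /hart; field; rewrite gt_eqF ?c0_gt0.
have <- : c0 * I (fun x => cut A u x * (cos_transform F x + sin_transform F x)) = I (fun x => cut A u x ^+ 2).
  rewrite -(IZ _ vi); apply: eqI => x; rewrite !cutE; case: ifP => _; last by rewrite mul0r mulr0 expr0n.
  by rewrite /u /hart; ring.
have -> : I (fun x => (1 * F x) ^+ 2) = I (fun x => F x ^+ 2) by apply: eqI => x; rewrite mul1r.
by ring.
Qed.

Lemma is_fourier_hart : is_fourier u (fun y => complex.Complex (ev F y) (od F y)).
Proof.
have [ei oi] := sqi_parts; split; first by split; exact: sqi_L2.
have [uI uE] := hart_sqi Fi F2.
rewrite (_ : (fun A => _) = fun A => (I (fun x => F x ^+ 2) - I (fun x => cut A u x ^+ 2))%:E); last first.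
  apply/funext => A; rewrite -hart_fourier_error.
  by have [_ ->] := fourier_errorE (u := u) uAi uA2 (g := fun y => complex.Complex (ev F y) (od F y)) A ei oi.
have c : I (fun x => F x ^+ 2) - I (fun x => cut A u x ^+ 2) @[A --> +oo%R] --> (0 : R).
  apply/cvgr0Pnorm_le => e e0.
  have [] := @dct _ _ _ mu (fun k x => cut k%:R u x ^+ 2) (fun x => u x ^+ 2) (fun x => u x ^+ 2).
  - by move=> k; apply: meaX; exact: mea_cut.
  - exact: meaX.
  - exact: uI.2.
  - move=> k x; rewrite ger0_norm ?sqr_ge0// cutE; case: ifP => // _.
    by rewrite expr0n sqr_ge0.
  - by apply: aeW => x; apply: cvg_near_cst; apply: filterS (cut_near u x) => k ->.
  move=> _ /cvgrPdist_le /(_ _ e0)[K _ hK].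
  exists K%:R; split; first exact: num_real.
  move=> A KA; have := hK K (leqnn K) => /=; rewrite uE => h1.
  have mono : I (fun x => cut K%:R u x ^+ 2) <= I (fun x => cut A u x ^+ 2).
    apply: I_le; [exact: (uA2 _).2|exact: (uA2 _).2|move=> x].
    rewrite !cutE; case: (leP `|x| K%:R) => h2; last by rewrite expr0n /=; exact: sqr_ge0.
    by rewrite (le_trans h2 (ltW KA)).
  have top : I (fun x => cut A u x ^+ 2) <= I (fun x => F x ^+ 2).
    rewrite -uE; apply: I_le; [exact: (uA2 _).2|exact: uI.2|move=> x].
    by rewrite cutE; case: ifP => // _; rewrite expr0n sqr_ge0.
  rewrite ger0_norm ?subr_ge0//; apply: le_trans (le_trans (ler_norm _) h1).
  by rewrite lerD2l lerN2.
by apply: (cvg_comp _ EFin c); exact: cvg_id.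
Qed.

Lemma fourier_hart : is_fourier u (fourier u) /\
  {ae mu, forall y, fourier u y = complex.Complex (ev F y) (od F y)}.
Proof.
have h : is_fourier u (fourier u).
  by rewrite /fourier; case: xgetP => [g -> //|/(_ _ is_fourier_hart)].
by split => //; exact: (fourier_unique uAi uA2 h is_fourier_hart).
Qed.

End hartley_fourier.
End hartley.

(** * From profiles to functions *)

Section transfer.
Variables (R : realType) (s s' : R) (m : R -> R) (n : R * R -> R).
Local Notation mt := (fun x => m x - m 0).
Hypothesis S : symbols s s' mt n.
Local Notation mu := (@lebesgue_measure R).
Local Notation "'I' f" := (Rintegral mu [set: _] f) (at level 10, f at level 8).
Local Notation N := (nrm2 mu).
Local Notation V := (profile mt).
Local Notation J := (@japanese R).
Local Notation Q := (@dispersion_form R mt).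
Local Notation T := (@profile_cubic R mt n).

Lemma rapid_mul (c0 a : R) (b h : R -> R) : mea b -> (forall x, `|b x| <= c0 * J x `^ a) ->
  rapidly_decreasing h -> rapidly_decreasing (fun x => b x * h x).
Proof.
move=> mb hb hr t; have mh : mea h := itg_mea (rapid_itg0 hr).
have m1 : mea (fun x => J x `^ t * (b x * h x)).
  by apply: meaM; [exact: mea_japanese_powR|exact: meaM].
apply: (sqi_le (m := mu) m1 (sqiZ c0 (hr (t + a)))) => x.
have -> : c0 * (J x `^ (t + a) * h x) = J x `^ t * (c0 * J x `^ a * h x).
  by rewrite powRD ?(gt_eqF (japanese_gt0 x)) ?implybT//; ring.
rewrite normrM [leRHS]normrM ler_wpM2l// normrM [leRHS]normrM ler_wpM2r//.
exact: le_trans (hb x) (ler_norm _).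
Qed.

Lemma parts_mul (b h : R -> R) x : b (- x) = b x ->
  ev (fun y => b y * h y) x = b x * ev h x /\ od (fun y => b y * h y) x = b x * od h x.
Proof. by rewrite /ev /od => ->; split; ring. Qed.

Lemma fourier_multiplied (c0 a : R) (b h : R -> R) : mea b -> (forall x, `|b x| <= c0 * J x `^ a) ->
  (forall x, b (- x) = b x) -> rapidly_decreasing h ->
  L2 (hart (fun x => b x * h x)) /\ {ae mu, forall x, fourier (hart (fun x => b x * h x)) x =
    complex.Complex (b x * ev h x) (b x * od h x)}.
Proof.
move=> mb hb be hr; have r := rapid_mul mb hb hr.
have [h1 _] := hart_sqi (rapid_itg0 r) (rapid_sqi r); split; first exact: sqi_L2.
have [_ h2] := fourier_hart (rapid_itg0 r) (rapid_sqi r).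
by apply: ae_mono h2 => x ->; have [-> ->] := parts_mul h (be x).
Qed.

Lemma nrm2_mass_form (v : V) : N v = Num.sqrt (mass_form v v).
Proof. by congr Num.sqrt; apply: eqI => x; rewrite expr2. Qed.

Variables (kappa : R) (h : V).
Hypotheses (hr : rapidly_decreasing h)
  (EL : forall f, Q h f + kappa * mass_form h f = T h h f).
Let u := hart h.
Let mh := mea_profile h.

Lemma mt_bounded (k : R) : exists2 c, 0 < c & forall x, `|mt x + k| <= c * J x `^ s.
Proof.
have [c c0 hc] := mt_polynomial S; exists (c * (1 + `|k|)); first by rewrite mulr_gt0// ltr_pwDl.
move=> x; have m0 := sy_m0 S x; have := hc x; rewrite /= => h1; apply: le_trans (ler_normD _ _) _.
rewrite (ger0_norm m0); have := normr_ge0 k; move: h1 m0; rewrite [c * (1 + _)]mulrC -mulrA.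
move: (m x - m 0) (c * _) (`|k|) => y z w *; nra.
Qed.

Lemma mea_mtk (k : R) : mea (fun x => mt x + k).
Proof. by apply: meaD; [exact: (mea_mt S)|exact: mea_cst]. Qed.

Lemma fourier_u : {ae mu, forall x, fourier u x = complex.Complex (ev h x) (od h x)}.
Proof. by have [_] := fourier_hart (rapid_itg0 hr) (rapid_sqi hr). Qed.

Lemma sqi_fourier_u : sqi mu (fun x => complex.Re (fourier u x)) /\ sqi mu (fun x => complex.Im (fourier u x)).
Proof.
have [[[h1 h2] _] _] := fourier_hart (rapid_itg0 hr) (rapid_sqi hr).
by split; exact: L2_sqi.
Qed.

Lemma linear_multiplier_hart : is_linear_multiplier m u (hart (fun x => m x * h x)).
Proof.
have [c c0 hc] := mt_bounded (m 0).
have hm x : `|m x| <= c * J x `^ s by have := hc x; rewrite subrK.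
have mm : mea m by apply: (eq_measurable_fun (fun x => mt x + m 0)) (mea_mtk (m 0)) => x _; rewrite subrK.
have me x : m (- x) = m x by have := sy_me S x; move=> /addIr.
have [h1 h2] := fourier_multiplied mm hm me hr; split => //.
apply: ae_mono (ae_and h2 fourier_u) => x [-> ->].
by apply/eqP; rewrite eq_complex /= !mul0r subr0 addr0 !eqxx.
Qed.

Lemma bilinear_symbol x : {ae mu, forall x, fourier u x = complex.Complex (ev h x) (od h x)} ->
  cintegral setT (fun eta => (n (x - eta, eta))%:C%C * fourier u (x - eta) * fourier u eta) =
  complex.Complex (spectral_re n h x) (spectral_im n h x).
Proof.
move=> hu; have [sr si] := sqi_fourier_u.
have re_ := rapid_ev hr; have ro_ := rapid_od hr.
have m1 : mea (fun y => complex.Re (fourier u y)) := sr.1.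
have m2 : mea (fun y => complex.Im (fourier u y)) := si.1.
have flip (f : R -> R) : mea f -> mea (fun y : R => f (x - y)).
  by move=> mf; apply: (mea_comp mf); apply: meaB; [exact: mea_cst|exact: mea_id].
have m3 := flip _ m1; have m4 := flip _ m2.
have mn1 : mea (fun y : R => n (x - y, y)) := mea_pair1 x (mea_n_shear S).
have me := mea_ev mh; have mo := mea_od mh; have me' := flip _ me; have mo' := flip _ mo.
have ae2 := ae_and hu (ae_sub x hu).
rewrite /cintegral; congr complex.Complex.
  rewrite /spectral_re /bilinear -(IB (itg_bilinear S re_ re_ x) (itg_bilinear S ro_ ro_ x)).
  apply: I_ae.
  - rewrite (_ : (fun y => _) = fun y => n (x - y, y) * (complex.Re (fourier u (x - y)) * complex.Re (fourier u y)
      - complex.Im (fourier u (x - y)) * complex.Im (fourier u y))).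
      by apply: meaM => //; apply: meaB; exact: meaM.
    by apply/funext => y; case: (fourier u y) (fourier u (x - y)) => a b [c d] /=; ring.
  - by apply: meaB; apply: meaM => //; exact: meaM.
  - by apply: ae_mono ae2 => y [-> ->] /=; ring.
rewrite /spectral_im /bilinear -(ID (itg_bilinear S re_ ro_ x) (itg_bilinear S ro_ re_ x)).
apply: I_ae.
- rewrite (_ : (fun y => _) = fun y => n (x - y, y) * (complex.Re (fourier u (x - y)) * complex.Im (fourier u y)
    + complex.Im (fourier u (x - y)) * complex.Re (fourier u y))).
    by apply: meaM => //; apply: meaD; exact: meaM.
  by apply/funext => y; case: (fourier u y) (fourier u (x - y)) => a b [c d] /=; ring.
- by apply: meaD; apply: meaM => //; exact: meaM.
- by apply: ae_mono ae2 => y [-> ->] /=; ring.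
Qed.

(** By the equation for the profile, the bilinear term has transform
    (mt + kappa) (ev h + i od h). *)
Lemma bilinear_multiplier_hart : is_bilinear_multiplier n u u (hart (fun x => (mt x + kappa) * h x)).
Proof.
have [c c0 hc] := mt_bounded kappa.
have me x : mt (- x) + kappa = mt x + kappa by rewrite (sy_me S).
have [h1 h2] := fourier_multiplied (mea_mtk kappa) hc me hr; split => //.
apply: ae_mono (ae_and h2 (profile_spectral S hr EL)) => x [-> [-> ->]].
by rewrite bilinear_symbol//; exact: fourier_u.
Qed.

Lemma hart_lin3 (a b c : R) (F G H : R -> R) x : itg mu F -> itg mu G -> itg mu H ->
  (forall y, a * F y + G y - H y = 0) -> a * hart F x + hart G x - hart H x = 0.
Proof.
move=> iF iG iH E; rewrite /hart.
have cE : a * cos_transform F x + cos_transform G x - cos_transform H x = 0.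
  rewrite /cos_transform -(IZ _ (itg_ctr x iF)) -(ID (itgZ a (itg_ctr x iF)) (itg_ctr x iG)).
  rewrite -(IB (itgD (itgZ a (itg_ctr x iF)) (itg_ctr x iG)) (itg_ctr x iH)).
  rewrite (eqI mu (g := fun=> 0)) ?Rintegral_cst// ?mul0r// => y.
  by rewrite -(mul0r (cos (x * y))) -(E y); ring.
have sE : a * sin_transform F x + sin_transform G x - sin_transform H x = 0.
  rewrite /sin_transform -(IZ _ (itg_str x iF)) -(ID (itgZ a (itg_str x iF)) (itg_str x iG)).
  rewrite -(IB (itgD (itgZ a (itg_str x iF)) (itg_str x iG)) (itg_str x iH)).
  rewrite (eqI mu (g := fun=> 0)) ?Rintegral_cst// ?mul0r// => y.
  by rewrite -(mul0r (sin (x * y))) -(E y); ring.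
transitivity (c0 R * ((a * cos_transform F x + cos_transform G x - cos_transform H x) + (a * sin_transform F x + sin_transform G x - sin_transform H x))); first by ring.
by rewrite cE sE addr0 mulr0.
Qed.

Theorem solitary_wave_hart : solitary_wave m n (m 0 - kappa) u.
Proof.
exists (hart (fun x => m x * h x)), (hart (fun x => (mt x + kappa) * h x)); split.
- exact: linear_multiplier_hart.
- exact: bilinear_multiplier_hart.
apply: aeW => x.
have [c c0 hc] := mt_bounded (m 0); have [c' c'0 hc'] := mt_bounded kappa.
have hm y : `|m y| <= c * J y `^ s by have := hc y; rewrite subrK.
have mm : mea m by apply: (eq_measurable_fun (fun x => mt x + m 0)) (mea_mtk (m 0)) => y _; rewrite subrK.
have i1 := rapid_itg0 hr; have i2 := rapid_itg0 (rapid_mul mm hm hr).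
have i3 := rapid_itg0 (rapid_mul (mea_mtk kappa) hc' hr).
by apply: (hart_lin3 0 0) => // y; ring.
Qed.

Lemma Hnorm_hart t : Hnorm t u = (N (fun x => J x `^ t * h x))%:E.
Proof.
have Je x : J (- x) `^ t = J x `^ t by rewrite japaneseN.
have [wi wE] := weighted_parts Je (hr t); have [sr si] := sqi_fourier_u.
have mJ := @mea_japanese_powR R t.
pose f x := J x `^ t * Normc.normc (fourier u x).
have normcE (z : R[i]) : Normc.normc z = Num.sqrt (complex.Re z ^+ 2 + complex.Im z ^+ 2).
  by case: z.
have mf : mea f.
  apply: meaM => //; rewrite (_ : (fun x => _) = fun x => Num.sqrt (complex.Re (fourier u x) ^+ 2 + complex.Im (fourier u x) ^+ 2)).
    apply: (mea_comp (h := Num.sqrt)); first by apply: continuous_measurable_fun; exact: sqrt_continuous.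
    by apply: meaD; apply: meaX; [exact: sr.1|exact: si.1].
  by apply/funext => x; rewrite normcE.
have fE : {ae mu, forall x, J x `^ t ^+ 2 * (ev h x ^+ 2 + od h x ^+ 2) = f x ^+ 2}.
  apply: ae_mono fourier_u => x e; rewrite /f e [in RHS]exprMn normcE sqr_sqrtr//=.
  by rewrite addr_ge0 ?sqr_ge0.
have f2 : sqi mu f by split => //; exact: (itg_ae (m := mu) (meaX 2 mf) fE wi).
rewrite /Hnorm -[X in Lnorm _ _ X]/(EFin \o f) (Lnorm2E f2); congr (_%:E); rewrite /nrm2 -wE; congr Num.sqrt; apply/esym.
by apply: I_ae fE; [exact: itg_mea wi|exact: meaX].
Qed.

Lemma hart_L2 : L2 u /\ ('N[mu]_2%:E[EFin \o u] = (N h)%:E)%E.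
Proof.
have [h1 h2] := hart_sqi (rapid_itg0 hr) (rapid_sqi hr); split; first exact: sqi_L2.
by rewrite (Lnorm2E h1) /nrm2 h2.
Qed.

Theorem Hinfty_hart : Hinfty u.
Proof. by move=> t; split; [exact: hart_L2.1|rewrite Hnorm_hart ltry]. Qed.

Lemma hart_Linfty : ('N[mu]_+oo[EFin \o u] <=
  (2 * c0 R * (N (fun x => J x `^ (- 1)) * N (fun x => J x `^ 1 * h x)))%:E)%E.
Proof.
set B := 2 * _ * _; have B0 : 0 <= B.
  by rewrite !mulr_ge0 ?nrm2_ge0// ltW// c0_gt0.
rewrite unlock /=; case: ifP => _; last by rewrite lee_fin.
apply/ess_supP; apply: aeW => x /=; rewrite lee_fin.
apply: le_trans (hart_bounded (rapid_itg0 hr) x) _.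
apply: ler_wpM2l; first by rewrite mulr_ge0// ltW// c0_gt0.
have h1 : 1 / 2 < 1 :> R by lra.
have := nrm2_CS (sqi_japanese h1) (hr 1); apply: le_trans; rewrite le_eqVlt; apply/orP; left; apply/eqP.
apply: eqI => y; rewrite mulrA -powRD ?(gt_eqF (japanese_gt0 y)) ?implybT//.
by rewrite addNr powRr0 mul1r.
Qed.

End transfer.

(** * Symbols satisfying the assumptions *)

Section symbols_of_assumptions.
Variables (R : realType) (s s' : R) (m : R -> R) (n : R * R -> R).
Local Notation J := (@japanese R).
Local Notation mt := (fun x => m x - m 0).

(** A cyclic sum is invariant under (a, b) -> (b, - (a + b)), and its three
    terms obey the cyclic permutations of one bound. *)
Lemma symbols_of_cyclic (r1 r2 r3 C : R) (f : R -> R -> R -> R) : assumptionM s s' m ->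
  continuous n -> (forall xi eta, n (xi - eta, eta) = cyc f (- xi) (xi - eta) eta) ->
  (forall a b, n (- a, - b) = n (a, b)) -> 0 < f 0 0 0 -> 0 < C ->
  (forall a b c, a + b + c = 0 -> `|f a b c| <= C * (J a `^ r1 * J b `^ r2 * J c `^ r3)) ->
  [/\ r1 < s / 2, r2 < s / 2 & r3 < s / 2] -> r1 + r2 + r3 < s - 1 / 2 -> symbols s s' mt n.
Proof.
move=> hM cn nf ne f0 C0 fb [h1 h2 h3] hs.
have nE a b : n (a, b) = f (- (a + b)) a b + f a b (- (a + b)) + f b (- (a + b)) a.
  by have := nf (a + b) b; rewrite addrK /cyc.
have [[A1 A10 hA1] [A2 A20 hA2]] := M_high hM; have [[A3 A30 hA3] [A4 A40 hA4]] := M_low hM.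
have mhi x : 1 <= `|x| -> A2^-1 * `|x| `^ s <= m x - m 0.
  by move=> x1; rewrite ler_pdivrMl//; exact: hA2.
have mlo x : `|x| < 1 -> A4^-1 * `|x| `^ s' <= m x - m 0.
  by move=> x1; rewrite ler_pdivrMl//; exact: hA4.
split.
- exact: M_s_gt0 hM.
- exact: M_s'_gt hM.
- move=> x; apply: cvgB; last exact: cvg_cst.
  apply: differentiable_continuous; apply/derivable1_diffP.
  by have [h _] := M_C1 hM; exact: h.
- move=> x; have [x1|x1] := leP 1 `|x|.
    by apply: le_trans (mhi x x1); rewrite mulr_ge0 ?invr_ge0 ?powR_ge0// ltW.
  by apply: le_trans (mlo x x1); rewrite mulr_ge0 ?invr_ge0 ?powR_ge0// ltW.
- by move=> x; rewrite (M_even hM).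
- exists (Num.min A2^-1 A4^-1), (Num.max A1 A3); split.
  + by rewrite lt_min !invr_gt0 A20.
  + by rewrite lt_max A10.
  + move=> x x1; apply/andP; split.
      by apply: le_trans (mhi x x1); rewrite ler_wpM2r ?powR_ge0// ge_min lexx.
    by apply: le_trans (hA1 x x1) _; rewrite ler_wpM2r ?powR_ge0// le_max lexx.
  + move=> x x1; apply/andP; split.
      by apply: le_trans (mlo x x1); rewrite ler_wpM2r ?powR_ge0// ge_min lexx orbT.
    by apply: le_trans (hA3 x x1) _; rewrite ler_wpM2r ?powR_ge0// le_max lexx orbT.
- exact: cn.
- exact: ne.
- move=> a b; rewrite !nE (_ : - (b + - (a + b)) = a); last by ring.
  by ring.
- by rewrite nE addr0 oppr0 !addr_gt0.
- exists r1, r2, r3, C; split; first by split.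
  split => // a b c abc; rewrite nE (_ : - (a + b) = c); last by rewrite -(addr0 (- _)) -abc; ring.
  have k1 := fb a b c abc; have bca : b + c + a = 0 by rewrite addrC addrA.
  have cab : c + a + b = 0 by rewrite -addrA addrC.
  have k2 := fb b c a bca; have k3 := fb c a b cab.
  rewrite !mulrDr; apply: le_trans (lerD (lerD k1 k2) k3).
  apply: le_trans (ler_normD _ _) _; apply: le_trans (lerD (ler_normD _ _) (lexx _)) _.
  by rewrite -addrA addrC.
Qed.

Lemma symbols_N : assumptionM s s' m -> assumptionN s n -> symbols s s' mt n.
Proof.
move=> hM [r1 [r2 [r3 [n1 [n2 [n3 [[_ nf ne] [[f1 f2 f3] [hr [hs _]]]]]]]]]].
have [C1 C10 hC1] := factor_bound f1; have [C2 C20 hC2] := factor_bound f2.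
have [C3 C30 hC3] := factor_bound f3.
have cont (r : R) (g : R -> R) : symbol_factor r g -> continuous g.
  move=> fg x; apply: differentiable_continuous; apply/derivable1_diffP.
  exact: (factor_derivable fg).
have cn : continuous n.
  have -> : n = fun z => n1 (- (z.1 + z.2)) * n2 z.1 * n3 z.2 + n1 z.1 * n2 z.2 * n3 (- (z.1 + z.2)) +
      n1 z.2 * n2 (- (z.1 + z.2)) * n3 z.1.
    by apply/funext => -[a b] /=; have := nf (a + b) b; rewrite addrK /cyc.
  have c1 (g : R -> R) : continuous g -> continuous (fun z : R * R => g z.1).
    by move=> cg z; apply: (cvg_comp (fun z : R * R => z.1) g); [exact: cvg_fst|exact: cg].
  have c2 (g : R -> R) : continuous g -> continuous (fun z : R * R => g z.2).
    by move=> cg z; apply: (cvg_comp (fun z : R * R => z.2) g); [exact: cvg_snd|exact: cg].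
  have c3 (g : R -> R) : continuous g -> continuous (fun z : R * R => g (- (z.1 + z.2))).
    move=> cg z; apply: (cvg_comp (fun z : R * R => - (z.1 + z.2)) g); last exact: cg.
    by apply: cvgN; apply: cvgD; [exact: cvg_fst|exact: cvg_snd].
  have k1 := cont _ _ f1; have k2 := cont _ _ f2; have k3 := cont _ _ f3.
  move=> z; apply: cvgD; first apply: cvgD.
  - by apply: cvgM; first apply: cvgM; [exact: c3|exact: c1|exact: c2].
  - by apply: cvgM; first apply: cvgM; [exact: c1|exact: c2|exact: c3].
  - by apply: cvgM; first apply: cvgM; [exact: c2|exact: c3|exact: c1].
apply: (symbols_of_cyclic hM cn nf ne (r1 := r1) (r2 := r2) (r3 := r3) (C := C1 * C2 * C3)) => //.
- by rewrite !mulr_gt0 ?(factor_gt0 f1) ?(factor_gt0 f2) ?(factor_gt0 f3).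
- by rewrite !mulr_gt0.
move=> a b c _; rewrite !normrM.
have -> : C1 * C2 * C3 * (J a `^ r1 * J b `^ r2 * J c `^ r3) =
  (C1 * J a `^ r1) * (C2 * J b `^ r2) * (C3 * J c `^ r3) by ring.
by apply: mul3_le => //; [exact: hC1|exact: hC2|exact: hC3].
Qed.

Lemma symbols_Nstar : assumptionM s s' m -> assumptionNstar s n -> symbols s s' mt n.
Proof.
move=> hM [r1 [r2 [r3 [f [[cn nf fe] [[_ fb f0] [[h1 h2 h3] [hs _]]]]]]]].
have [C C0 hC] := fb 0 0.
have fE a b c : a + b + c = 0 -> on_plane f (- a, c) = f a b c.
  move=> abc; rewrite /on_plane /= opprK; congr (f _ _ _).
  by rewrite -(addr0 (- a - c)) -abc; ring.
have ne a b : n (- a, - b) = n (a, b).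
  have nE x y : n (x, y) = f (- (x + y)) x y + f x y (- (x + y)) + f y (- (x + y)) x.
    by have := nf (x + y) y; rewrite addrK /cyc.
  have even x y z : x + y + z = 0 -> f (- x) (- y) (- z) = f x y z.
    move=> xyz; rewrite -(fE x y z xyz) -(fE (- x) (- y) (- z)); last by rewrite -!opprD xyz oppr0.
    exact: fe.
  rewrite !nE (_ : - (- a + - b) = - - (a + b)); last by ring.
  by rewrite !even//; ring.
apply: (symbols_of_cyclic hM (cn 0) nf ne f0 C0 (r1 := r1) (r2 := r2) (r3 := r3)) => //.
- move=> a b c abc; have := hC (- a, c) Logic.I; rewrite /= (fE a b c abc).
  rewrite japaneseN (_ : - a - c = b) ?mulrA//.
  by rewrite -(addr0 (- a - c)) -abc; ring.
- by split; lra.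
- by lra.
Qed.

End symbols_of_assumptions.

Theorem theorem1p1 (R : realType) (s s' : R) (m : R -> R) (n : R * R -> R)
    (hM : assumptionM s s' m) (hN : assumptionN s n \/ assumptionNstar s n) :
  let beta := s' / (2 * s' - 1) in
  exists (u : R -> R -> R) (nu : R -> R),
    (forall mu : R, 0 < mu ->
      [/\ Hinfty (u mu),
          solitary_wave m n (nu mu) (u mu),
          ((1 / 2)%:E * 'N[lebesgue_measure]_2%:E[EFin \o u mu] ^+ 2 = mu%:E)%E &
          nu mu < m 0]) /\
    1 / 2 < beta /\
    (forall mu0 : R, 0 < mu0 ->
      [/\ lesssime [set mu | 0 < mu < mu0]
            (fun mu => 'N[lebesgue_measure]_+oo[EFin \o u mu]%E)
            (fun mu => Hnorm (s / 2) (u mu)),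
          simeqe [set mu | 0 < mu < mu0]
            (fun mu => Hnorm (s / 2) (u mu)) (fun mu => (mu `^ (1 / 2))%:E) &
          simeq [set mu | 0 < mu < mu0]
            (fun mu => m 0 - nu mu) (fun mu => mu `^ beta)]).
Proof.
move=> beta; pose mt x := m x - m 0.
have S : symbols s s' mt n by case: hN; [exact: symbols_N|exact: symbols_Nstar].
have /choice[H hH] : forall mu : R, exists p : profile mt * R, 0 < mu -> solitary_profile n (2 * mu) p.2 p.1.
  move=> mu; have [mu_gt0|_] := ltP 0 mu; last by exists (0, 0).
  have M0 : 0 < 2 * mu by rewrite mulr_gt0.
  by have [h [k hk]] := solitary_profile_exists S M0; exists (h, k).
have kap0 mu : 0 < mu -> 0 < (H mu).2.
  by move=> mu_gt0; apply: (kappa_gt0 S _ (hH mu mu_gt0)); rewrite mulr_gt0.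
have EL mu : 0 < mu -> forall f, dispersion_form (H mu).1 f + (H mu).2 * mass_form (H mu).1 f =
    profile_cubic n (H mu).1 (H mu).1 f by move=> mu_gt0; have [] := hH mu mu_gt0.
have mass mu : 0 < mu -> mass_form (H mu).1 (H mu).1 = 2 * mu by move=> mu_gt0; have [] := hH mu mu_gt0.
have rapid mu : 0 < mu -> rapidly_decreasing (H mu).1.
  move=> mu_gt0 t; have [C _ hC] := profile_regularity S t (energy_norm_ge0 (H mu).1).
  by have [] := hC (H mu).1 (H mu).2 (ltW (kap0 mu mu_gt0)) (EL mu mu_gt0) (lexx _).
have nrmE mu : 0 < mu -> nrm2 lebesgue_measure (H mu).1 = Num.sqrt (2 * mu).
  by move=> mu_gt0; rewrite -(mass mu mu_gt0); exact: nrm2_mass_form.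
exists (fun mu => hart (H mu).1), (fun mu => m 0 - (H mu).2); split; last split.
- move=> mu mu_gt0; split.
  + exact: (Hinfty_hart (rapid mu mu_gt0)).
  + exact: (solitary_wave_hart S (rapid mu mu_gt0) (EL mu mu_gt0)).
  + have [_ ->] := hart_L2 (rapid mu mu_gt0); rewrite nrmE// -EFin_expe -EFinM; congr (_%:E).
    by rewrite sqr_sqrtr ?mulr_ge0 ?(ltW mu_gt0)//; field.
  + by rewrite ltrBlDr ltrDl kap0.
- exact: beta_gt S.
move=> mu0 mu0_gt0; have M00 : 0 < 2 * mu0 by rewrite mulr_gt0.
have [C C0 hC] := minimizer_upper_bounds S M00.
have s2 : 0 < 2 * mu0 by [].
have range mu : 0 < mu < mu0 -> [/\ 0 < mu, 0 < 2 * mu & 2 * mu <= 2 * mu0].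
  by move=> /andP[h1 h2]; split => //; [rewrite mulr_gt0|rewrite ler_pM2l// ltW].
have energyE mu : 0 < mu < mu0 -> energy_norm (H mu).1 <= Num.sqrt (1 + C) * Num.sqrt (2 * mu).
  move=> /range[h1 h2 h3]; rewrite -sqrtrM; last by rewrite addr_ge0// ltW.
  apply: le_of_sqr; first exact: sqrtr_ge0.
  rewrite (energy_norm_sqr S) sqr_sqrtr; last by rewrite mulr_ge0 ?addr_ge0// ltW.
  have [hq _] := hC _ _ _ h2 h3 (hH mu h1).
  rewrite /energy_form mass// (_ : (1 + C) * (2 * mu) = 2 * mu + C * (2 * mu)); last by ring.
  by rewrite lerD2l.
have J1 x : 1 <= japanese x `^ (s / 2).
  by rewrite -[leLHS](powRr0 (japanese x)) ler_powR ?japanese_ge1// divr_ge0// ltW// (sy_s S).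
have lower mu : 0 < mu -> Num.sqrt (2 * mu) <= nrm2 lebesgue_measure (fun x => japanese x `^ (s / 2) * (H mu).1 x).
  move=> mu_gt0; rewrite -nrmE//; apply: nrm2_mono; [exact: rapid_sqi (rapid mu mu_gt0)|exact: rapid|move=> x].
  by rewrite normrM ler_peMl// ger0_norm ?powR_ge0.
have half mu : 0 < mu -> mu `^ (1 / 2) = Num.sqrt mu by move=> mu_gt0; rewrite mul1r powR12_sqrt// ltW.
split.
- pose E0 := Num.sqrt (1 + C) * Num.sqrt (2 * mu0).
  have E00 : 0 <= E0 by rewrite mulr_ge0 ?sqrtr_ge0.
  have [C1 C10 hC1] := profile_regularity S 1 E00.
  pose K := 2 * c0 R * nrm2 lebesgue_measure (fun x : R => japanese x `^ (- 1)).
  have K0 : 0 <= K by rewrite !mulr_ge0 ?nrm2_ge0// ltW// c0_gt0.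
  have Q0 : 0 <= C1 * Num.sqrt (1 + C) by rewrite mulr_ge0 ?sqrtr_ge0// ltW.
  exists (K * (C1 * Num.sqrt (1 + C)) + 1); first by rewrite ltr_wpDl//; exact: mulr_ge0.
  move=> mu hmu; have [h1 h2 h3] := range mu hmu; have e1 := energyE mu hmu.
  have eE0 : energy_norm (H mu).1 <= E0.
    by apply: le_trans e1 _; rewrite ler_wpM2l ?sqrtr_ge0// ler_sqrt// ltW.
  have [_ b] := hC1 _ _ (ltW (kap0 mu h1)) (EL mu h1) eE0.
  rewrite (Hnorm_hart (rapid mu h1)) -EFinM; apply: le_trans (hart_Linfty (rapid mu h1)) _.
  rewrite lee_fin mulrA -/K.
  apply: (@le_trans _ _ (K * (C1 * (Num.sqrt (1 + C) * Num.sqrt (2 * mu))))).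
    by apply: ler_wpM2l => //; apply: le_trans b _; rewrite ler_pM2l.
  rewrite (mulrA C1) (mulrA K); apply: ler_pM; [exact: mulr_ge0|exact: sqrtr_ge0| |exact: lower].
  by rewrite lerDl.
- split.
    have [c c0_ hc] := weight_high S.
    exists (Num.sqrt c * (Num.sqrt (1 + C) * Num.sqrt 2)).
      by rewrite !mulr_gt0 ?sqrtr_gt0// addr_gt0.
    move=> mu hmu; have [h1 h2 h3] := range mu hmu; have e1 := energyE mu hmu.
    rewrite (Hnorm_hart (rapid mu h1)) half// -EFinM lee_fin.
    have -> : Num.sqrt c * (Num.sqrt (1 + C) * Num.sqrt 2) * Num.sqrt mu =
      Num.sqrt c * (Num.sqrt (1 + C) * Num.sqrt (2 * mu)) by rewrite (sqrtrM mu)// !mulrA.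
    apply: (@le_trans _ _ (Num.sqrt c * energy_norm (H mu).1)); last by rewrite ler_wpM2l ?sqrtr_ge0.
    have -> : Num.sqrt c * energy_norm (H mu).1 = nrm2 lebesgue_measure
        (fun x => Num.sqrt c * (Num.sqrt (1 + mt x) * (H mu).1 x)).
      by rewrite (nrm2_Z _ (sqi_profile (H mu).1)) (ger0_norm (sqrtr_ge0 c)).
    apply: nrm2_mono; [exact: rapid|exact: sqiZ (sqi_profile _)|move=> x].
    rewrite mulrA normrM [leRHS]normrM ler_wpM2r// !ger0_norm ?mulr_ge0 ?sqrtr_ge0 ?powR_ge0//.
    rewrite -sqrtrM ?(ltW c0_)//; apply: le_of_sqr; first exact: sqrtr_ge0.
    rewrite sqr_sqrtr; last by rewrite mulr_ge0 ?(ltW c0_)// (tmt_ge0 S).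
    by rewrite -powR_mulrn ?powR_ge0// -powRrM divfK ?pnatr_eq0//; exact: hc.
  exists 1 => // mu hmu; have [h1 h2 h3] := range mu hmu.
  rewrite (Hnorm_hart (rapid mu h1)) half// mul1e lee_fin; apply: le_trans (lower mu h1).
  by rewrite ler_sqrt ?mulr_ge0 ?(ltW h1)//; lra.
have [c [C' [c_0 C'0 hk]]] := kappa_bounds S M00.
have b2 : 0 < 2 `^ beta :> R by exact: powR_gt0.
have kE mu : 0 < mu < mu0 -> c * (2 `^ beta * mu `^ beta) <= (H mu).2 <= C' * (2 `^ beta * mu `^ beta).
  move=> /range[h1 h2 h3]; have := hk _ _ _ h2 h3 (hH mu h1).
  by rewrite powRM// ltW.
split.
  exists (C' * 2 `^ beta); first by rewrite mulr_gt0.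
  by move=> mu /kE /andP[_]; rewrite opprB addrC subrK mulrA.
exists (c * 2 `^ beta)^-1; first by rewrite invr_gt0 mulr_gt0.
move=> mu /kE /andP[h _]; rewrite opprB addrC subrK.
by rewrite ler_pdivlMl ?mulr_gt0// -mulrA.
Qed.
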